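(* Let $N\ge 2$ and let $f$ satisfy conditions $(A_1)$–$(A_5)$ below. Then there exists $k_0\in\mathbb N\cup\{0\}$ such that for every integer $k\ge k_0$ there exist at least two solutions $u$ of the radial problem $$u''+\frac{N-1}{r}u'+f(u)=0\ (r>0),\qquad u'(0)=0,\qquad \lim_{r\to\infty}u(r)=0,$$ with initial value $u(0)\in(\beta_*,\gamma_* )$, each having exactly $k$ sign changes in $(0,\infty)$.
   Context: Conditions on $f$, with $F(s)=\int_0^s f(t)\,dt$ and $Q(s)=2NF(s)-(N-2)sf(s)$: $(A_1)$ $f$ is a continuous odd function on $[-\gamma_*,\gamma_*]$ (where $0<\gamma_*\le\infty$, with $[-\infty,\infty]$ meaning $\mathbb R$), $f(0)=0$, and $f$ is locally Lipschitz on $[-\gamma_*,\gamma_*]\setminus\{0\}$. $(A_2)$ There is $\delta>0$ with $F(s)<0$ for $0<|s|<\delta$, and $F(s)<F(\gamma_* )$ for all $s\in(-\gamma_*,\gamma_* )$. $(A_3)$ $F$ has a local maximum at some $\gamma\in(\delta,\gamma_* )$ with $F(\gamma)>0$. $(A_4)$ $f$ has finitely many zeros in $(\delta,\gamma_* )$ and changes sign at each of them. $(A_5)$ Either $\gamma_*<\infty$ and $f(\gamma_* )=0$, or $\gamma_*=\infty$ and, for some $\theta\in(0,1)$, $\lim_{s\to\infty}\inf_{s_1,s_2\in[\theta s,s]}Q(s_2)\bigl(s/f(s_1)\bigr)^{N/2}=\infty$. Notation: let $\gamma_1$ be the first (smallest) local maximum point of $F$ in $(0,\gamma_* )$ with $F(\gamma_1)>0$,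 and inductively $\gamma_i$ the first local maximum point of $F$ after $\gamma_{i-1}$ with $F(\gamma_i)>F(\gamma_{i-1})$, for $i=1,\dots,M$, so that $F(\gamma_M)$ is the largest local maximum value of $F$ in $(0,\gamma_* )$. Let $\beta_*$ be the largest point in $(\gamma_M,\gamma_* )$ with $F(\beta_* )=F(\gamma_M)$. The number of sign changes of $u$ is the number of points where $u$ changes sign. *)

(* Defs.v *)
From Stdlib Require Import Reals List.
From Coquelicot Require Import Coquelicot.
Open Scope R_scope.

(* gs : Rbar encodes gamma_star in (0, +oo]; [-gs, gs] is R when gs = p_infty. *)
Definition in_dom (gs : Rbar) (s : R) : Prop := Rbar_le (Finite (Rabs s)) gs.

Definition Fp (f : R -> R) (s : R) : R := RInt f 0 s.

Definition Qp (N : nat) (f : R -> R) (s : R) : R :=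
  2 * INR N * Fp f s - (INR N - 2) * s * f s.

Definition cond_A1 (gs : Rbar) (f : R -> R) : Prop :=
  Rbar_lt (Finite 0) gs /\
  (forall x, in_dom gs x -> forall eps, 0 < eps -> exists d, 0 < d /\
      forall y, in_dom gs y -> Rabs (y - x) < d -> Rabs (f y - f x) < eps) /\
  (forall s, in_dom gs s -> f (- s) = - f s) /\
  f 0 = 0 /\
  (forall x, in_dom gs x -> x <> 0 -> exists e L, 0 < e /\
      forall y z, in_dom gs y -> in_dom gs z -> Rabs (y - x) < e -> Rabs (z - x) < e ->
        Rabs (f y - f z) <= L * Rabs (y - z)).

Definition cond_A2 (gs : Rbar) (f : R -> R) (delta : R) : Prop :=
  0 < delta /\
  (forall s, 0 < Rabs s < delta -> Fp f s < 0) /\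
  match gs with
  | Finite g => forall s, - g < s < g -> Fp f s < Fp f g
  | p_infty => ex_lim (Fp f) p_infty /\
               forall s, Rbar_lt (Finite (Fp f s)) (Lim (Fp f) p_infty)
  | m_infty => False
  end.

Definition loc_max (gs : Rbar) (G : R -> R) (x : R) : Prop :=
  exists e, 0 < e /\ forall t, in_dom gs t -> Rabs (t - x) < e -> G t <= G x.

Definition cond_A3 (gs : Rbar) (f : R -> R) (delta : R) : Prop :=
  exists g, delta < g /\ Rbar_lt (Finite g) gs /\ loc_max gs (Fp f) g /\ 0 < Fp f g.

Definition changes_sign (g : R -> R) (x : R) : Prop :=
  exists e, 0 < e /\
   (((forall t, x - e < t < x -> 0 < g t) /\ (forall t, x < t < x + e -> g t < 0)) \/
    ((forall t, x - e < t < x -> g t < 0) /\ (forall t, x < t < x + e -> 0 < g t))).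

Definition cond_A4 (gs : Rbar) (f : R -> R) (delta : R) : Prop :=
  (exists l : list R, forall x, delta < x -> Rbar_lt (Finite x) gs -> f x = 0 -> In x l) /\
  (forall x, delta < x -> Rbar_lt (Finite x) gs -> f x = 0 -> changes_sign f x).

Definition cond_A5 (N : nat) (gs : Rbar) (f : R -> R) : Prop :=
  match gs with
  | Finite g => f g = 0
  | p_infty =>
      exists theta, 0 < theta < 1 /\
        forall M, exists S, forall s s1 s2, S <= s ->
          theta * s <= s1 <= s -> theta * s <= s2 <= s ->
          0 < f s1 /\ M < Qp N f s2 * Rpower (s / f s1) (INR N / 2)
  | m_infty => False
  end.

Definition LMpt (gs : Rbar) (f : R -> R) (x : R) : Prop :=
  0 < x /\ Rbar_lt (Finite x) gs /\ loc_max gs (Fp f) x.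

Definition is_gammaM (gs : Rbar) (f : R -> R) (gM : R) : Prop :=
  exists (g : nat -> R) (M : nat), (1 <= M)%nat /\ g M = gM /\
    (LMpt gs f (g 1%nat) /\ 0 < Fp f (g 1%nat) /\
       forall x, LMpt gs f x -> 0 < Fp f x -> g 1%nat <= x) /\
    (forall i, (2 <= i <= M)%nat ->
       LMpt gs f (g i) /\ g (i - 1)%nat < g i /\ Fp f (g (i - 1)%nat) < Fp f (g i) /\
       forall x, LMpt gs f x -> g (i - 1)%nat < x -> Fp f (g (i - 1)%nat) < Fp f x ->
         g i <= x) /\
    (forall x, LMpt gs f x -> g M < x -> Fp f x <= Fp f (g M)).

Definition is_beta (gs : Rbar) (f : R -> R) (gM b : R) : Prop :=
  gM < b /\ Rbar_lt (Finite b) gs /\ Fp f b = Fp f gM /\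
  forall s, gM < s -> Rbar_lt (Finite s) gs -> Fp f s = Fp f gM -> s <= b.

Definition radial_sol (N : nat) (gs : Rbar) (f : R -> R) (u : R -> R) : Prop :=
  (forall r, 0 <= r -> in_dom gs (u r)) /\
  (forall r, 0 < r -> ex_derive u r /\ ex_derive (Derive u) r /\
      Derive (Derive u) r + (INR N - 1) / r * Derive u r + f (u r) = 0) /\
  filterlim (fun h => (u h - u 0) / h) (at_right 0) (locally 0) /\
  is_lim u p_infty 0.

Definition n_sign_changes (u : R -> R) (k : nat) : Prop :=
  exists l : list R, length l = k /\ NoDup l /\
    forall r, (0 < r /\ changes_sign u r) <-> In r l.

(* Main.v *)
Require Import Defs.
From Stdlib Require Import Reals Ranalysis5 Lra Psatz List FinFun ZArith ClassicalEpsilon.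
From Coquelicot Require Import Coquelicot.
From mathcomp Require boot.ssreflect classical.classical_sets classical.filter.
Open Scope R_scope.

(* Shooting from u(0) = al. Let T be the open set of initial values whose solution falls below the barrier F(gamma_1) inside
   |u| < gamma_1. Close to a boundary point of T, and close to gamma_*, solutions linger near a barrier of F and change sign
   arbitrarily often. Hence, if some x0 in T has finitely many sign changes, then for large k the nearest initial values on either
   side of x0 that bound the region where a (k+1)-st sign change is missing give solutions with exactly k sign changes, and an
   analysis of r^2 E, with E = u'^2/2 + F(u), shows that these tend to 0.
   To find x0: solutions starting near beta_* stay above gamma_M, others end up below -gamma_M. The phase points at a fixed time of the
   initial values in between, joined through u < -gamma_M and reflected, form an odd loop. The flow preserves area in the coordinates
   (u, r^n u'), so over a long time the lobe E <= 0 <= u flows back to points outside this loop, while 0, which the lobe contains,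
   has odd winding number. So some solution enters the lobe, after which it never changes sign. *)

(** The obstacle is that $f$ need not be Lipschitz at $0$: a solution that reaches $u=u'=0$ is not
    unique afterwards, and zeros do not pass well to limits. Every solution is therefore stopped at
    its first double zero, uniqueness is proved up to that time only, and sign changes are counted
    by alternating samples. The count can drop in a limit, but by at most one, because $r^2E$
    decreases where $F\le 0$ and crossing a strip where $F<0$ at time $r$ costs a multiple of $r$.
    This is why a value with fewer than $k+1$ changes, approached by values with at least $k+1$, has
    exactly $k$. Winding numbers are replaced by the existence of a closed continuous square root of
    $\Gamma^2-q^2$; this treats $q$ and $-q$ together and needs only an arc $\Gamma$ with opposite
    end points. Area preservation enters by counting lattice points under a rounded symplectic
    scheme, so that planar measure is replaced by injectivity on finite sets. *)

Lemma exists_ultrafilter : exists U : (nat -> Prop) -> Prop,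
  (forall A B : nat -> Prop, U A -> (forall n, A n -> B n) -> U B) /\
  (forall A B : nat -> Prop, U A -> U B -> U (fun n => A n /\ B n)) /\
  ~ U (fun _ => False) /\
  (forall A : nat -> Prop, U A \/ U (fun n => ~ A n)) /\
  (forall N, U (fun n => (N <= n)%nat)).
Proof.
(* The filter of sets containing a tail; an ultrafilter above it satisfies the last clause, so
   ordinary limits are ultralimits. *)
pose (F := fun A : nat -> Prop => exists N, forall n, (N <= n)%nat -> A n).
assert (HF : filter.ProperFilter F).
{ constructor.
  - intros [N HN]. exact (HN N (le_n _)).
  - constructor.
    + exists 0%nat; intros; exact I.
    + intros P Q [N HN] [M HM]. exists (N + M)%nat. intros n Hn; split.
      * apply HN; lia.
      * apply HM; lia.
    + intros P Q HPQ [N HN]. exists N. intros n Hn. apply HPQ, HN, Hn. }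
destruct (filter.ultraFilterLemma HF) as [U [HU HFU]].
pose proof (@filter.ultra_proper _ _ HU) as HP.
exists U. repeat split.
- intros A B HA HAB. exact (filter.filterS (F := U) HAB HA).
- intros A B HA HB. exact (filter.filterI (F := U) HA HB).
- exact (filter.filter_not_empty U).
- intros A. exact (filter.in_ultra_setVsetC A HU).
- intros N. apply HFU. exists N. auto.
Qed.

(** * Ultralimits and calculus *)

Notation LRA := ltac:(lra) (only parsing).
(** [lra] does not use disequalities; this variant splits them into the two strict inequalities. *)
Ltac lrn := first [lra | match goal with H : ?x <> ?y |- _ => destruct (Rdichotomy x y H); clear H; lrn end].

(* Limits along a fixed ultrafilter on nat spare all extractions of subsequences: every bounded sequence has one. *)
Definition Uf := proj1_sig (constructive_indefinite_description _ exists_ultrafilter).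

Lemma Uf_spec :
  (forall A B : nat -> Prop, Uf A -> (forall n, A n -> B n) -> Uf B) /\
  (forall A B : nat -> Prop, Uf A -> Uf B -> Uf (fun n => A n /\ B n)) /\
  ~ Uf (fun _ => False) /\
  (forall A : nat -> Prop, Uf A \/ Uf (fun n => ~ A n)) /\
  (forall N, Uf (fun n => (N <= n)%nat)).
Proof. exact (proj2_sig (constructive_indefinite_description _ exists_ultrafilter)). Qed.

Lemma Uf_mono (A B : nat -> Prop) : Uf A -> (forall n, A n -> B n) -> Uf B.
Proof. apply Uf_spec. Qed.
Lemma Uf_and (A B : nat -> Prop) : Uf A -> Uf B -> Uf (fun n => A n /\ B n).
Proof. apply Uf_spec. Qed.
Lemma Uf_ge N : Uf (fun n => (N <= n)%nat).
Proof. apply Uf_spec. Qed.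
Lemma Uf_em (A : nat -> Prop) : Uf A \/ Uf (fun n => ~ A n).
Proof. apply Uf_spec. Qed.
Lemma Uf_all (A : nat -> Prop) : (forall n, A n) -> Uf A.
Proof. intros. apply (Uf_mono _ _ (Uf_ge 0)). auto. Qed.
(** A large set is nonempty, so a conclusion that does not mention the index may be drawn at a
    single index. *)
Lemma Uf_out (A : nat -> Prop) (P : Prop) : Uf A -> (forall n, A n -> P) -> P.
Proof.
intros HA H. apply NNPP; intros HP.
destruct Uf_spec as (_ & _ & Hf & _). apply Hf.
apply (Uf_mono _ _ HA). intros n Hn. exact (HP (H n Hn)).
Qed.
Lemma Uf_and3 (A B C : nat -> Prop) : Uf A -> Uf B -> Uf C -> Uf (fun n => A n /\ B n /\ C n).
Proof. intros; apply Uf_and; auto; apply Uf_and; auto. Qed.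

Definition ulim (a : nat -> R) (l : R) := forall e, 0 < e -> Uf (fun n => Rabs (a n - l) < e).

Lemma ulim_seq (a : nat -> R) l :
  (forall e, 0 < e -> exists N, forall n, (N <= n)%nat -> Rabs (a n - l) < e) -> ulim a l.
Proof. intros H e He. destruct (H e He) as [N HN]. exact (Uf_mono _ _ (Uf_ge N) HN). Qed.

Lemma ulim_const l : ulim (fun _ => l) l.
Proof. intros e He. apply Uf_all; intros _. rewrite Rminus_diag, Rabs_R0; auto. Qed.

Lemma ulim_inv_INR : ulim (fun n => / (INR n + 1)) 0.
Proof.
apply ulim_seq. intros.
destruct (nfloor_ex (/ e)) as [N HN]. { left; apply Rinv_0_lt_compat; auto. }
exists N. intros n Hn. apply le_INR in Hn. pose proof (pos_INR n).
rewrite Rminus_0_r, Rabs_pos_eq.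
2: left; apply Rinv_0_lt_compat; lra.
rewrite <- (Rinv_inv e). apply Rinv_lt_contravar; [|lra].
apply Rmult_lt_0_compat; [apply Rinv_0_lt_compat; auto|lra].
Qed.

Lemma ulim_ext (a b : nat -> R) l : Uf (fun n => a n = b n) -> ulim a l -> ulim b l.
Proof.
intros H Ha e He. apply (Uf_mono _ _ (Uf_and _ _ H (Ha e He))).
intros n [E h]. rewrite <- E; auto.
Qed.

Lemma ulim_le (a b : nat -> R) l m :
  ulim a l -> ulim b m -> Uf (fun n => a n <= b n) -> l <= m.
Proof.
intros Ha Hb H. apply Rnot_lt_le; intros Hlt.
assert (He : 0 < (l - m) / 2) by lra.
apply (Uf_out _ _ (Uf_and3 _ _ _ H (Ha _ He) (Hb _ He))).
intros n (h1 & h2 & h3). apply Rabs_def2 in h2. apply Rabs_def2 in h3. lra.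
Qed.

Lemma ulim_unique (a : nat -> R) l m : ulim a l -> ulim a m -> l = m.
Proof.
intros. apply Rle_antisym; eapply ulim_le; eauto; apply Uf_all; intros; lra.
Qed.

Lemma ulim_lt (a : nat -> R) l c : ulim a l -> l < c -> Uf (fun n => a n < c).
Proof.
intros Ha Hl. assert (He : 0 < c - l) by lra. apply (Uf_mono _ _ (Ha _ He)).
intros n h. apply Rabs_def2 in h. lra.
Qed.
Lemma ulim_gt (a : nat -> R) l c : ulim a l -> c < l -> Uf (fun n => c < a n).
Proof.
intros Ha Hl. assert (He : 0 < l - c) by lra. apply (Uf_mono _ _ (Ha _ He)).
intros n h. apply Rabs_def2 in h. lra.
Qed.

(** The limit is the supremum of the reals that lie below [a n] for a large set of indices. By the
    dichotomy [Uf_em], either $l+\varepsilon$ is such a real, which is absurd, or [a n] is below it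
    on a large set. *)
Lemma ulim_exists (a : nat -> R) M : Uf (fun n => Rabs (a n) <= M) -> exists l, ulim a l.
Proof.
intros HM.
destruct (completeness (fun x => Uf (fun n => x <= a n))) as [l [Hub Hlub]].
- exists M. intros x Hx. apply (Uf_out _ _ (Uf_and _ _ HM Hx)).
  intros n [h1 h2]. apply Rabs_le_between in h1. lra.
- exists (- M). apply (Uf_mono _ _ HM). intros n h. apply Rabs_le_between in h. lra.
- exists l. intros e He.
  assert (H1 : Uf (fun n => a n < l + e)).
  { destruct (Uf_em (fun n => l + e <= a n)) as [H|H].
    - apply Hub in H. lra.
    - apply (Uf_mono _ _ H). intros; lra. }
  assert (H2 : Uf (fun n => l - e < a n)).
  { destruct (Uf_em (fun n => l - e < a n)) as [H|H]; auto. exfalso.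
    assert (l <= l - e); [|lra]. apply Hlub. intros x Hx.
    apply (Uf_out _ _ (Uf_and _ _ H Hx)). intros n [h1 h2]. lra. }
  apply (Uf_mono _ _ (Uf_and _ _ H1 H2)). intros n [h1 h2]. apply Rabs_def1; lra.
Qed.

Lemma ulim_plus (a b : nat -> R) l m : ulim a l -> ulim b m -> ulim (fun n => a n + b n) (l + m).
Proof.
intros Ha Hb e He. assert (He2 : 0 < e / 2) by lra.
apply (Uf_mono _ _ (Uf_and _ _ (Ha _ He2) (Hb _ He2))). intros n [h1 h2].
apply Rabs_def2 in h1. apply Rabs_def2 in h2. apply Rabs_def1; lra.
Qed.

Lemma continuous_eps (f : R -> R) x : continuous f x ->
  forall e, 0 < e -> exists d, 0 < d /\ forall y, Rabs (y - x) < d -> Rabs (f y - f x) < e.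
Proof.
intros H e He. pose proof (proj1 (filterlim_locally f (f x)) H (mkposreal e He)) as H'.
destruct H' as [d Hd]. exists d. split; [apply cond_pos|]. auto.
Qed.

Lemma eps_continuous (f : R -> R) x :
  (forall e, 0 < e -> exists d, 0 < d /\ forall y, Rabs (y - x) < d -> Rabs (f y - f x) < e) ->
  continuous f x.
Proof.
intros. apply filterlim_locally. intros e.
destruct (H e (cond_pos e)) as (d & Hd & h). exists (mkposreal d Hd). auto.
Qed.

Lemma continuous_cpt (f : R -> R) x : continuous f x -> continuity_pt f x.
Proof. intros. apply continuity_pt_filterlim. exact H. Qed.

Lemma is_derive_cont (f : R -> R) x l : is_derive f x l -> continuous f x.
Proof. intros. apply (ex_derive_continuous f x). exists l. exact H. Qed.

Lemma ex_derive_cont (f : R -> R) x : ex_derive f x -> continuous f x.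
Proof. exact (ex_derive_continuous f x). Qed.

Lemma dval (f : R -> R) (x l l' : R) : is_derive f x l -> l = l' -> is_derive f x l'.
Proof. intros H <-; exact H. Qed.
Lemma dconst (c x : R) : is_derive (fun _ : R => c) x 0.
Proof. exact (is_derive_const c x). Qed.
Lemma did (x : R) : is_derive (fun t : R => t) x 1.
Proof. exact (is_derive_id x). Qed.
Lemma dplus (f g : R -> R) (x a b : R) : is_derive f x a -> is_derive g x b ->
  is_derive (fun t => f t + g t) x (a + b).
Proof. intros; exact (is_derive_plus f g x a b ltac:(auto) ltac:(auto)). Qed.
Lemma dminus (f g : R -> R) (x a b : R) : is_derive f x a -> is_derive g x b ->
  is_derive (fun t => f t - g t) x (a - b).
Proof. intros; exact (is_derive_minus f g x a b ltac:(auto) ltac:(auto)). Qed.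
Lemma dopp (f : R -> R) (x a : R) : is_derive f x a -> is_derive (fun t => - f t) x (- a).
Proof. intros; exact (is_derive_opp f x a ltac:(auto)). Qed.
Lemma dmult (f g : R -> R) (x a b : R) : is_derive f x a -> is_derive g x b ->
  is_derive (fun t => f t * g t) x (a * g x + f x * b).
Proof. intros; exact (is_derive_mult f g x a b ltac:(auto) ltac:(auto) Rmult_comm). Qed.
Lemma dcomp (f g : R -> R) (x a b : R) : is_derive f (g x) a -> is_derive g x b ->
  is_derive (fun t => f (g t)) x (b * a).
Proof. intros; exact (is_derive_comp f g x a b ltac:(auto) ltac:(auto)). Qed.
Lemma dpow (f : R -> R) n (x a : R) : is_derive f x a ->
  is_derive (fun t => f t ^ n) x (INR n * a * f x ^ (pred n)).
Proof. intros; exact (is_derive_pow f n x a ltac:(auto)). Qed.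
Lemma dexp (f : R -> R) (x a : R) : is_derive f x a ->
  is_derive (fun t => exp (f t)) x (a * exp (f x)).
Proof. intros; apply (dcomp exp f x (exp (f x)) a); auto. apply is_derive_exp. Qed.

(** Differentiates by the shape of the expression; combined with [dval], the derivative found is
    then compared with the expected one by algebra. *)
Ltac der :=
  lazymatch goal with
  | |- is_derive (fun t => @?f t + @?g t) ?x _ => refine (dplus f g x _ _ _ _); cbv beta; der
  | |- is_derive (fun t => @?f t - @?g t) ?x _ => refine (dminus f g x _ _ _ _); cbv beta; der
  | |- is_derive (fun t => @?f t * @?g t) ?x _ => refine (dmult f g x _ _ _ _); cbv beta; der
  | |- is_derive (fun t => - @?f t) ?x _ => refine (dopp f x _ _); cbv beta; der
  | |- is_derive (fun t => (@?f t) ^ ?n) ?x _ => refine (dpow f n x _ _); cbv beta; der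
  | |- is_derive (fun t => exp (@?f t)) ?x _ => refine (dexp f x _ _); cbv beta; der
  | |- is_derive (fun t => t) ?x _ => exact (did x)
  | |- is_derive (fun _ => ?c) ?x _ => exact (dconst c x)
  | |- _ => try eassumption
  end.

Lemma ulim_comp (f : R -> R) (a : nat -> R) l :
  continuous f l -> ulim a l -> ulim (fun n => f (a n)) (f l).
Proof.
intros Hf Ha e He. destruct (continuous_eps _ _ Hf e He) as (d & Hd & h).
apply (Uf_mono _ _ (Ha d Hd)). auto.
Qed.

Lemma eps_is_derive (f : R -> R) (x l : R) :
  (forall e, 0 < e -> exists d, 0 < d /\
     forall y, Rabs (y - x) < d -> Rabs (f y - f x - l * (y - x)) <= e * Rabs (y - x)) ->
  is_derive f x l.
Proof.
intros. apply is_derive_Reals. intros e He.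
destruct (H (e/2) LRA) as (d & Hd & h). exists (mkposreal d Hd). intros k Hk0 Hk.
simpl in Hk. specialize (h (x + k)). replace (x + k - x) with k in h by ring.
replace ((f (x + k) - f x) / k - l) with ((f (x + k) - f x - l * k) / k) by (field; auto).
unfold Rdiv. rewrite Rabs_mult, Rabs_inv. apply Rabs_pos_lt in Hk0.
apply Rmult_lt_reg_r with (Rabs k); auto. rewrite Rmult_assoc, Rinv_l by lra. nra.
Qed.

Lemma is_derive_eps (f : R -> R) (x l : R) : is_derive f x l ->
  (forall e, 0 < e -> exists d, 0 < d /\
     forall y, Rabs (y - x) < d -> Rabs (f y - f x - l * (y - x)) <= e * Rabs (y - x)).
Proof.
intros H e He. apply is_derive_Reals in H. destruct (H e He) as [d Hd].
exists d. split; [apply cond_pos|]. intros y Hy.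
destruct (Req_dec y x) as [->|Hn].
{ replace (f x - f x - l * (x - x)) with 0 by ring. rewrite Rabs_R0. apply Rmult_le_pos; [lra|apply Rabs_pos]. }
specialize (Hd (y - x) LRA Hy). replace (x + (y - x)) with y in Hd by ring.
replace (f y - f x - l * (y - x)) with (((f y - f x) / (y - x) - l) * (y - x)) by (field; lra).
rewrite Rabs_mult. apply Rmult_le_compat_r; [apply Rabs_pos|lra].
Qed.

Lemma mvt (h h' : R -> R) a b : a < b ->
  (forall x, a < x < b -> is_derive h x (h' x)) ->
  (forall x, a <= x <= b -> continuous h x) ->
  exists c, a < c < b /\ h b - h a = h' c * (b - a).
Proof.
intros Hab Hd Hc.
assert (pr1 : forall c, a < c < b -> derivable_pt h c).
{ intros c hc. exists (h' c). apply is_derive_Reals, Hd, hc. }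
destruct (MVT h id a b pr1 (fun c _ => derivable_pt_id c) Hab
  (fun c hc => continuous_cpt _ _ (Hc c hc))
  (fun c _ => derivable_continuous_pt _ _ (derivable_pt_id c))) as (c & P & HE).
exists c. split; auto. assert (E1 : derive_pt h c (pr1 c P) = h' c) by (apply derive_pt_eq_0, is_derive_Reals, Hd, P).
rewrite E1 in HE. rewrite derive_pt_id in HE. unfold id in HE. lra.
Qed.

Lemma mono_le (h h' : R -> R) a b : a <= b ->
  (forall x, a < x < b -> is_derive h x (h' x)) ->
  (forall x, a <= x <= b -> continuous h x) ->
  (forall x, a < x < b -> 0 <= h' x) -> h a <= h b.
Proof.
intros Hab Hd Hc Hp. destruct (Req_dec a b) as [->|Hn]; [lra|].
destruct (mvt h h' a b) as (c & hc & E); auto; [lra|]. specialize (Hp c hc). nra.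
Qed.

Lemma mono_lt (h h' : R -> R) a b : a < b ->
  (forall x, a < x < b -> is_derive h x (h' x)) ->
  (forall x, a <= x <= b -> continuous h x) ->
  (forall x, a < x < b -> 0 < h' x) -> h a < h b.
Proof.
intros Hab Hd Hc Hp.
destruct (mvt h h' a b) as (c & hc & E); auto. specialize (Hp c hc). nra.
Qed.

Lemma ivt_up (f : R -> R) a b c : a <= b ->
  (forall x, a <= x <= b -> continuous f x) -> f a <= c <= f b ->
  exists x, a <= x <= b /\ f x = c.
Proof.
intros.
destruct (Req_dec (f a) c) as [E|]; [exists a; lra|].
destruct (Req_dec (f b) c) as [E|]; [exists b; lra|].
destruct (Req_dec a b) as [->|]; [lra|].
destruct (IVT_interv (fun x => f x - c) a b) as [z [Hz1 Hz2]]; try lra.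
- intros. apply continuous_cpt. apply (continuous_minus f (fun _ => c)); auto.
  apply continuous_const.
- exists z; split; lra.
Qed.

Lemma ivt_down (f : R -> R) a b c : a <= b ->
  (forall x, a <= x <= b -> continuous f x) -> f b <= c <= f a ->
  exists x, a <= x <= b /\ f x = c.
Proof.
intros.
destruct (ivt_up (fun x => - f x) a b (- c)) as (x & Hx & E); try lra.
- intros. apply (continuous_opp f); auto.
- exists x; split; lra.
Qed.

Lemma max_attained (f : R -> R) a b : a <= b -> (forall x, a <= x <= b -> continuous f x) ->
  exists x, a <= x <= b /\ forall y, a <= y <= b -> f y <= f x.
Proof.
intros Hab Hc.
destruct (continuity_ab_maj f a b Hab (fun c hc => continuous_cpt _ _ (Hc c hc))) as [x [H1 H2]].
exists x; split; auto.
Qed.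

Lemma bounded_on (f : R -> R) a b : a <= b -> (forall x, a <= x <= b -> continuous f x) ->
  exists B, 0 < B /\ forall x, a <= x <= b -> Rabs (f x) <= B.
Proof.
intros Hab Hc.
destruct (max_attained f a b Hab Hc) as (x & Hx & H1).
destruct (max_attained (fun y => - f y) a b Hab) as (y & Hy & H2).
{ intros. apply (continuous_opp f); auto. }
exists (Rabs (f x) + Rabs (f y) + 1).
pose proof (Rabs_pos (f x)). pose proof (Rabs_pos (f y)). split; [lra|].
intros z Hz. specialize (H1 z Hz). specialize (H2 z Hz).
pose proof (Rle_abs (f x)). pose proof (Rle_abs (- f y)). rewrite Rabs_Ropp in *.
apply Rabs_le; lra.
Qed.

Lemma derive_pos_right (f : R -> R) (x l : R) : is_derive f x l -> 0 < l ->
  exists d, 0 < d /\ (forall y, x < y < x + d -> f x < f y) /\ (forall y, x - d < y < x -> f y < f x).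
Proof.
intros Hl Hp. destruct (is_derive_eps _ _ _ Hl (l/2) LRA) as (d & Hd & h).
exists d. split; auto. split; intros y Hy; specialize (h y).
- rewrite (Rabs_pos_eq (y - x)) in h by lra. specialize (h LRA). apply Rabs_le_between in h. nra.
- rewrite (Rabs_left (y - x)) in h by lra. specialize (h LRA). apply Rabs_le_between in h. nra.
Qed.

Lemma derive_neg_right (f : R -> R) (x l : R) : is_derive f x l -> l < 0 ->
  exists d, 0 < d /\ (forall y, x < y < x + d -> f y < f x) /\ (forall y, x - d < y < x -> f x < f y).
Proof.
intros. destruct (derive_pos_right (fun y => - f y) x (- l)) as (d & Hd & h1 & h2).
- apply (is_derive_opp f); auto.
- lra.
- exists d. split; auto. split; intros y Hy; [specialize (h1 y Hy)|specialize (h2 y Hy)]; lra.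
Qed.

Lemma cont_lt_near (f : R -> R) x c : continuous f x -> f x < c ->
  exists d, 0 < d /\ forall y, Rabs (y - x) < d -> f y < c.
Proof.
intros Hf H. destruct (continuous_eps f x Hf (c - f x) LRA) as (d & Hd & h).
exists d; split; auto. intros y Hy. specialize (h y Hy). apply Rabs_def2 in h. lra.
Qed.
Lemma cont_gt_near (f : R -> R) x c : continuous f x -> c < f x ->
  exists d, 0 < d /\ forall y, Rabs (y - x) < d -> c < f y.
Proof.
intros Hf H. destruct (continuous_eps f x Hf (f x - c) LRA) as (d & Hd & h).
exists d; split; auto. intros y Hy. specialize (h y Hy). apply Rabs_def2 in h. lra.
Qed.

Lemma first_below (f : R -> R) a b c : a <= b ->
  (forall x, a <= x <= b -> continuous f x) -> c < f a -> f b <= c ->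
  exists t, a < t <= b /\ f t = c /\ forall x, a <= x < t -> c < f x.
Proof.
intros Hab Hc Ha Hb.
destruct (completeness (fun t => a <= t <= b /\ forall x, a <= x <= t -> c < f x)) as [t [Hub Hl]].
- exists b. intros x [Hx _]. lra.
- exists a. split; [lra|]. intros. replace x with a by lra. auto.
- assert (a <= t). { apply Hub. split; [lra|]. intros. replace x with a by lra. auto. }
  assert (t <= b). { apply Hl. intros x [Hx _]. lra. }
  assert (Hbel : forall x, a <= x < t -> c < f x).
  { intros. apply Rnot_le_lt; intros Hle.
    assert (t <= x); [|lra]. apply Hl. intros y [Hy1 Hy2]. apply Rnot_lt_le. intros Hlt.
    specialize (Hy2 x LRA). lra. }
  assert (f t = c).
  { destruct (Rtotal_order (f t) c) as [Hlt|[|Hgt]]; auto; exfalso.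
    - destruct (cont_lt_near f t c (Hc t LRA) Hlt) as (d & Hd & h).
      destruct (Req_dec a t) as [E|Hn]; [subst; lra|].
      pose (x := Rmax a (t - d/2)). assert (a <= x < t). { split; [apply Rmax_l|apply Rmax_lub_lt; lra]. }
      assert (t - d/2 <= x) by apply Rmax_r.
      specialize (Hbel x LRA). specialize (h x). rewrite Rabs_left in h by lra. lra.
    - destruct (cont_gt_near f t c (Hc t LRA) Hgt) as (d & Hd & h).
      destruct (Req_dec t b) as [E|Hn]; [subst; lra|].
      pose (x := Rmin b (t + d/2)). assert (t < x <= b). { split; [apply Rmin_glb_lt; lra|apply Rmin_l]. }
      assert (x <= t + d/2) by apply Rmin_r.
      assert (x <= t); [|lra]. apply Hub. split; [lra|]. intros y Hy.
      destruct (Rlt_dec y t); [apply Hbel; lra|]. apply h. rewrite Rabs_pos_eq; lra. }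
  exists t. split; [|split; auto]. split; auto. destruct (Req_dec a t) as [E|]; [subst; lra|lra].
Qed.

Lemma first_above (f : R -> R) a b c : a <= b ->
  (forall x, a <= x <= b -> continuous f x) -> f a < c -> c <= f b ->
  exists t, a < t <= b /\ f t = c /\ forall x, a <= x < t -> f x < c.
Proof.
intros.
destruct (first_below (fun x => - f x) a b (- c)) as (t & Ht & E & h); try lra.
- intros. apply (continuous_opp f); auto.
- exists t. split; auto. split; [lra|]. intros x Hx. specialize (h x Hx). lra.
Qed.

Lemma last_at (f : R -> R) a b c : a <= b ->
  (forall x, a <= x <= b -> continuous f x) -> f a <= c -> c < f b ->
  exists t, a <= t < b /\ f t = c /\ forall x, t < x <= b -> c < f x.
Proof.
intros Hab Hc Ha Hb.
destruct (first_below (fun x => f (- x)) (- b) (- a) c) as (t & Ht & E & h); try lra.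
- intros. apply (continuous_comp (fun y => - y) f).
  + apply ex_derive_cont. auto_derive; auto.
  + apply Hc; lra.
- rewrite Ropp_involutive; auto.
- rewrite Ropp_involutive; auto.
- exists (- t). split; [lra|]. split; auto. intros. specialize (h (- x) LRA).
  rewrite Ropp_involutive in h. auto.
Qed.

Lemma gronwall (D D' : R -> R) K a b : a <= b ->
  (forall x, a < x < b -> is_derive D x (D' x)) ->
  (forall x, a <= x <= b -> continuous D x) ->
  (forall x, a < x < b -> D' x <= K * D x) -> D b <= D a * exp (K * (b - a)).
Proof.
intros Hab Hd Hc Hi.
pose (h := fun x => - (D x * exp (- K * x))).
assert (h a <= h b).
{ apply (mono_le h (fun x => (K * D x - D' x) * exp (- K * x))); auto.
  - intros x Hx. specialize (Hd x Hx). unfold h. eapply dval; [der|]. lra.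
  - intros. apply (continuous_opp (fun y => D y * exp (- K * y))).
    apply (continuous_mult D (fun y => exp (- K * y))); auto.
    apply ex_derive_cont. auto_derive; auto.
  - intros x Hx. specialize (Hi x Hx). apply Rmult_le_pos; [lra|]. left; apply exp_pos. }
unfold h in H.
assert (E : exp (K * (b - a)) = exp (- K * a) / exp (- K * b)).
{ unfold Rdiv. rewrite <- exp_Ropp, <- exp_plus. f_equal; ring. }
rewrite E. pose proof (exp_pos (- K * b)).
apply Rmult_le_reg_r with (exp (- K * b)); auto. unfold Rdiv.
rewrite Rmult_assoc, Rmult_assoc, Rinv_l by lra. lra.
Qed.

Lemma right_point x q d : x < q -> 0 < d -> exists y, x < y <= q /\ y < x + d.
Proof. intros. exists (Rmin q (x + d / 2)). pose proof (Rmin_l q (x + d / 2)). pose proof (Rmin_r q (x + d / 2)). split; [split; [apply Rmin_glb_lt|]|]; lra. Qed.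

Lemma left_point q x d : q < x -> 0 < d -> exists y, q <= y < x /\ x - d < y.
Proof. intros. exists (Rmax q (x - d / 2)). pose proof (Rmax_l q (x - d / 2)). pose proof (Rmax_r q (x - d / 2)). split; [split; [|apply Rmax_lub_lt]|]; lra. Qed.

(** * Picard iteration *)

Lemma ex_RInt_cont (h : R -> R) a b : (forall x : R, continuous h x) -> ex_RInt h a b.
Proof. intros. apply (ex_RInt_continuous h). auto. Qed.

Definition rint (h : R -> R) (a b : R) : R := RInt h a b.

Lemma rint_point (h : R -> R) (a : R) : rint h a a = 0.
Proof. exact (RInt_point a h). Qed.

Lemma drint (h : R -> R) (a r : R) : (forall x : R, continuous h x) -> is_derive (fun x => rint h a x) r (h r).
Proof.
intros. apply (is_derive_RInt h (fun x => RInt h a x) a r); auto.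
exists (mkposreal 1 Rlt_0_1). intros. apply (RInt_correct h), ex_RInt_cont, H.
Qed.

(** Integrating the weight $e^{\lambda|s-r_0|}$ gains a factor $1/\lambda$. With this weight the
    Picard map contracts on the whole line, and no local solutions have to be glued. *)
Lemma primitive_exp_bound (W h : R -> R) (r0 M lam : R) :
  0 <= M -> 0 < lam -> W r0 = 0 -> (forall r : R, is_derive W r (h r)) ->
  (forall s, Rabs (h s) <= M * exp (lam * Rabs (s - r0))) ->
  forall r, Rabs (W r) <= M / lam * exp (lam * Rabs (r - r0)).
Proof.
intros HM Hl H0 HW Hh r.
assert (HM' : 0 <= M / lam) by (apply Rdiv_le_0_compat; auto).
pose (k := fun s t => M / lam * exp (s * lam * (t - r0))).
assert (Hex : forall x s : R, is_derive (k s) x (s * M * exp (s * lam * (x - r0)))).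
{ intros. unfold k. eapply dval; [der|]. cbv beta. field. lra. }
assert (Hk0 : forall s, k s r0 = M / lam).
{ intros. unfold k. replace (s * lam * (r0 - r0)) with 0 by ring. rewrite exp_0. ring. }
(* The sign [s] selects one of the two one-sided bounds on [W]; [k 1] dominates to the right of [r0]
   and [k (-1)] to the left. *)
assert (S : forall s, s = 1 \/ s = -1 -> s * W r <= M / lam * exp (lam * Rabs (r - r0))).
{ intros s Hs.
  assert (HsW : forall x : R, is_derive (fun t => s * W t) x (s * h x)).
  { intros. specialize (HW x). eapply dval; [der|]. lra. }
  destruct (Rle_lt_dec r0 r) as [Hr|Hr].
  - assert (k 1 r0 - s * W r0 <= k 1 r - s * W r).
    { apply (mono_le (fun t => k 1 t - s * W t) (fun x => 1 * M * exp (1 * lam * (x - r0)) - s * h x)); auto.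
      + intros. apply dminus; auto.
      + intros. eapply is_derive_cont. apply dminus; [apply Hex|apply HsW].
      + intros. specialize (Hh x). rewrite (Rabs_pos_eq (x - r0)) in Hh by lra.
        apply Rabs_le_between in Hh. rewrite !Rmult_1_l. nra. }
    rewrite Hk0, H0 in H. rewrite (Rabs_pos_eq (r - r0)) by lra. unfold k in H. rewrite Rmult_1_l in H. lra.
  - assert (s * W r - k (-1) r <= s * W r0 - k (-1) r0).
    { apply (mono_le (fun t => s * W t - k (-1) t) (fun x => s * h x - -1 * M * exp (-1 * lam * (x - r0)))); try lra.
      + intros. apply dminus; auto.
      + intros. eapply is_derive_cont. apply dminus; [apply HsW|apply Hex].
      + intros. specialize (Hh x). rewrite (Rabs_left (x - r0)) in Hh by lra.
        replace (lam * - (x - r0)) with (-1 * lam * (x - r0)) in Hh by ring.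
        apply Rabs_le_between in Hh. nra. }
    rewrite Hk0, H0 in H. rewrite (Rabs_left (r - r0)) by lra. unfold k in H.
    replace (lam * - (r - r0)) with (-1 * lam * (r - r0)) by ring. lra. }
pose proof (S 1 ltac:(auto)). pose proof (S (-1) ltac:(auto)). apply Rabs_le. lra.
Qed.

Lemma Lipschitz_continuous (g : R -> R) (L x : R) :
  (forall x y, Rabs (g x - g y) <= L * Rabs (x - y)) -> continuous g x.
Proof.
intros. apply eps_continuous. intros. pose proof (Rabs_pos L).
exists (e / (Rabs L + 1)). split; [apply Rdiv_lt_0_compat; lra|].
intros. specialize (H y x). pose proof (Rabs_pos (y - x)). pose proof (Rle_abs L).
apply Rle_lt_trans with (1 := H).
apply Rle_lt_trans with ((Rabs L + 1) * Rabs (y - x)); [nra|].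
apply Rlt_le_trans with ((Rabs L + 1) * (e / (Rabs L + 1))).
- nra.
- right; field; lra.
Qed.

Section Picard.
Variables (a g : R -> R) (A L : R).
Hypothesis Ha : forall r : R, continuous a r.
Hypothesis HA : forall r, Rabs (a r) <= A.
Hypothesis HL : forall x y, Rabs (g x - g y) <= L * Rabs (x - y).
Hypothesis HL0 : 0 <= L.
Variables r0 u0 v0 : R.

Let X (u v : R -> R) (s : R) := - a s * v s - g (u s).

Fixpoint picard_it (n : nat) : (R -> R) * (R -> R) :=
  match n with
  | O => (fun _ => u0, fun _ => v0)
  | S m => let u := fst (picard_it m) in let v := snd (picard_it m) in
      (fun r => u0 + rint v r0 r, fun r => v0 + rint (X u v) r0 r)
  end.
Let un n := fst (picard_it n).
Let vn n := snd (picard_it n).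

Lemma X_cont (u v : R -> R) : (forall x : R, continuous u x) -> (forall x : R, continuous v x) ->
  forall x : R, continuous (X u v) x.
Proof.
intros.
apply (continuous_minus (fun s => - a s * v s) (fun s => g (u s))).
- apply (continuous_mult (fun s => - a s) v); auto. apply (continuous_opp a); auto.
- apply (continuous_comp u g); auto. eapply Lipschitz_continuous, HL.
Qed.

Lemma picard_cont n : (forall x : R, continuous (un n) x) /\ (forall x : R, continuous (vn n) x).
Proof.
induction n as [|n [IHu IHv]].
- split; intros x; apply continuous_const.
- split; intros x.
  + apply (continuous_plus (fun _ => u0) (fun r => rint (vn n) r0 r)); [apply continuous_const|].
    eapply is_derive_cont, drint, IHv.
  + apply (continuous_plus (fun _ => v0) (fun r => rint (X (un n) (vn n)) r0 r)); [apply continuous_const|].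
    eapply is_derive_cont, drint. apply X_cont; auto.
Qed.

Lemma X_diff u v u' v' s M : Rabs (u s - u' s) <= M -> Rabs (v s - v' s) <= M ->
  Rabs (X u v s - X u' v' s) <= (A + L) * M.
Proof.
intros h1 h2. unfold X.
replace (- a s * v s - g (u s) - (- a s * v' s - g (u' s)))
  with (- (a s * (v s - v' s)) - (g (u s) - g (u' s))) by ring.
eapply Rle_trans; [apply Rabs_triang|]. rewrite !Rabs_Ropp, Rabs_mult.
specialize (HL (u s) (u' s)). pose proof (HA s). pose proof (Rabs_pos (a s)).
pose proof (Rabs_pos (v s - v' s)). nra.
Qed.

(** With this rate one Picard step halves the weighted distance, since the integrands differ by at
    most $A+L+1$ times it. *)
Let lam := 2 * (A + L + 1).
Let e r := exp (lam * Rabs (r - r0)).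

Lemma A_pos : 0 <= A.
Proof. pose proof (HA 0). pose proof (Rabs_pos (a 0)). lra. Qed.

Lemma e_ge r : 1 <= e r /\ Rabs (r - r0) <= e r.
Proof.
pose proof A_pos. pose proof (Rabs_pos (r - r0)). unfold e.
assert (2 <= lam) by (unfold lam; lra).
destruct (Req_dec (Rabs (r - r0)) 0) as [E|E].
- rewrite E, Rmult_0_r, exp_0. lra.
- pose proof (exp_ineq1 (lam * Rabs (r - r0)) ltac:(nra)). nra.
Qed.

Lemma picard_step (u v u' v' : R -> R) M :
  (forall x : R, continuous u x) -> (forall x : R, continuous v x) ->
  (forall x : R, continuous u' x) -> (forall x : R, continuous v' x) -> 0 <= M ->
  (forall r, Rabs (u r - u' r) <= M * e r /\ Rabs (v r - v' r) <= M * e r) ->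
  forall r, Rabs (rint v r0 r - rint v' r0 r) <= M / 2 * e r /\
            Rabs (rint (X u v) r0 r - rint (X u' v') r0 r) <= M / 2 * e r.
Proof.
intros Hu Hv Hu' Hv' HM H r. pose proof A_pos.
assert (0 < lam) by (unfold lam; lra).
assert (Gen : forall h h' : R -> R, (forall x : R, continuous h x) -> (forall x : R, continuous h' x) ->
  (forall s, Rabs (h s - h' s) <= (A + L + 1) * M * e s) ->
  Rabs (rint h r0 r - rint h' r0 r) <= M / 2 * e r).
{ intros.
  assert (P := primitive_exp_bound (fun x => rint h r0 x - rint h' r0 x) (fun x => h x - h' x) r0
    ((A + L + 1) * M) lam).
   replace (M / 2) with ((A + L + 1) * M / lam) by (unfold lam; field; lra).
   apply P; auto.
  - nra.
  - rewrite !rint_point. lra.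
  - intros. apply dminus; apply drint; auto. }
split; apply Gen; auto.
- intros. destruct (H s) as [_ h]. destruct (e_ge s). eapply Rle_trans; [exact h|].
  apply Rmult_le_compat_r; [lra|]. nra.
- apply X_cont; auto.
- apply X_cont; auto.
- intros. destruct (H s). destruct (e_ge s).
  eapply Rle_trans; [apply (X_diff _ _ _ _ _ (M * e s)); auto|].
   nra.
Qed.

(** Bounds both integrands of the first step, $v_0$ and $X(u_0,v_0)$. *)
Let C := Rabs v0 + A * Rabs v0 + Rabs (g u0) + 1.

Lemma C_pos : 1 <= C.
Proof.
pose proof A_pos. pose proof (Rabs_pos v0). pose proof (Rabs_pos (g u0)).
unfold C. assert (0 <= A * Rabs v0) by nra. lra.
Qed.

Lemma picard_diff n r : Rabs (un (S n) r - un n r) <= C * (/2)^n * e r /\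
  Rabs (vn (S n) r - vn n r) <= C * (/2)^n * e r.
Proof.
pose proof C_pos as HC. pose proof A_pos as HA0.
revert r; induction n as [|n IH]; intros r.
- destruct (e_ge r).
  assert (Gen : forall h : R -> R, (forall x : R, continuous h x) -> (forall s, Rabs (h s) <= C) ->
     Rabs (rint h r0 r) <= C * e r).
  { intros h Hh Hb.
    assert (P := primitive_exp_bound (fun x => rint h r0 x) h r0 C lam).
    assert (2 <= lam) by (unfold lam; lra).
    eapply Rle_trans; [apply P|].
    - lra.
    - lra.
    - exact (rint_point h r0).
    - intros x; apply drint; auto.
    - intros. destruct (e_ge s) as [h1 _]. unfold e in h1. specialize (Hb s). nra.
    - apply Rmult_le_compat_r; [lra|].
      assert (/ lam <= 1). { rewrite <- Rinv_1. apply Rinv_le_contravar; lra. } nra. }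
  cbn [pow]. rewrite Rmult_1_r. change (un 1 r) with (u0 + rint (fun _ => v0) r0 r).
  change (vn 1 r) with (v0 + rint (X (fun _ => u0) (fun _ => v0)) r0 r).
  change (un 0 r) with u0. change (vn 0 r) with v0. split.
  + replace (u0 + rint (fun _ => v0) r0 r - u0) with (rint (fun _ => v0) r0 r) by ring.
    apply Gen. { intros; apply continuous_const. }
    intros. unfold C. pose proof (Rabs_pos v0). pose proof (Rabs_pos (g u0)).
    assert (0 <= A * Rabs v0) by nra. lra.
  + replace (v0 + rint (X (fun _ => u0) (fun _ => v0)) r0 r - v0) with (rint (X (fun _ => u0) (fun _ => v0)) r0 r) by ring.
    apply Gen. { apply X_cont; intros; apply continuous_const. }
    intros. unfold X, C. eapply Rle_trans; [apply Rabs_triang|]. rewrite Rabs_Ropp, Rabs_mult, Rabs_Ropp.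
    pose proof (HA s). pose proof (Rabs_pos v0). nra.
- assert (H := picard_step (un (S n)) (vn (S n)) (un n) (vn n) (C * (/2)^n)).
  destruct (picard_cont (S n)) as [c1 c2]. destruct (picard_cont n) as [c3 c4].
  specialize (H c1 c2 c3 c4).
  assert (Hp : 0 <= C * (/2)^n). { apply Rmult_le_pos; [lra|]. apply pow_le; lra. }
  specialize (H Hp IH r).
  change (un (S (S n)) r) with (u0 + rint (vn (S n)) r0 r).
  change (vn (S (S n)) r) with (v0 + rint (X (un (S n)) (vn (S n))) r0 r).
  change (un (S n) r) with (u0 + rint (vn n) r0 r).
  change (vn (S n) r) with (v0 + rint (X (un n) (vn n)) r0 r).
  replace (C * (/2)^(S n)) with (C * (/2)^n / 2) by (simpl; field).
  destruct H as [H1 H2]. split.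
  + eapply Rle_trans; [|exact H1]. right; f_equal; ring.
  + eapply Rle_trans; [|exact H2]. right; f_equal; ring.
Qed.

(** The factor $1-2^{-k}$ is a partial geometric sum; keeping it makes the induction on [k]
    close. *)
Lemma picard_cauchy n k r : Rabs (un (n + k) r - un n r) <= 2 * C * (/2)^n * (1 - (/2)^k) * e r /\
  Rabs (vn (n + k) r - vn n r) <= 2 * C * (/2)^n * (1 - (/2)^k) * e r.
Proof.
induction k as [|k [IH1 IH2]].
- rewrite Nat.add_0_r, !Rminus_diag, Rabs_R0. lra.
- rewrite Nat.add_succ_r. destruct (picard_diff (n + k) r) as [D1 D2]. rewrite pow_add in D1, D2.
  replace (2 * C * (/2)^n * (1 - (/2)^S k) * e r) with
    (C * ((/2)^n * (/2)^k) * e r + 2 * C * (/2)^n * (1 - (/2)^k) * e r) by (simpl; field).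
  split.
  + replace (un (S (n + k)) r - un n r) with ((un (S (n + k)) r - un (n + k) r) + (un (n + k) r - un n r)) by ring.
    eapply Rle_trans; [apply Rabs_triang|]. lra.
  + replace (vn (S (n + k)) r - vn n r) with ((vn (S (n + k)) r - vn (n + k) r) + (vn (n + k) r - vn n r)) by ring.
    eapply Rle_trans; [apply Rabs_triang|]. lra.
Qed.

Lemma picard_limit (w : nat -> R -> R) :
  (forall n k r, Rabs (w (n + k)%nat r - w n r) <= 2 * C * (/2)^n * (1 - (/2)^k) * e r) ->
  exists l : R -> R, forall n r, Rabs (w n r - l r) <= 2 * C * (/2)^n * e r.
Proof.
intros Hw. pose proof C_pos.
assert (Hw' : forall n k r, Rabs (w (n + k)%nat r - w n r) <= 2 * C * (/2)^n * e r).
{ intros. eapply Rle_trans; [apply Hw|]. destruct (e_ge r).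
  assert (0 < (/2)^n) by (apply pow_lt; lra). assert (0 < (/2)^k) by (apply pow_lt; lra).
  apply Rmult_le_compat_r; [lra|].
  assert (0 <= 2 * C * (/2)^n * (/2)^k) by (apply Rmult_le_pos; [apply Rmult_le_pos|]; lra). lra. }
assert (Hex : forall r, exists l, ulim (fun n => w n r) l).
{ intros. apply (ulim_exists _ (Rabs (w 0%nat r) + 2 * C * e r)). apply Uf_all. intros.
  specialize (Hw' 0%nat n r). simpl in Hw'. rewrite Rmult_1_r in Hw'.
  replace (w n r) with (w 0%nat r + (w n r - w 0%nat r)) by ring.
  eapply Rle_trans; [apply Rabs_triang|]. lra. }
exists (fun r => proj1_sig (constructive_indefinite_description _ (Hex r))). intros.
destruct (constructive_indefinite_description _ (Hex r)) as [l Hl]. simpl.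
apply Rle_plus_epsilon. intros ep Hep.
apply (Uf_out _ _ (Uf_and _ _ (Hl ep Hep) (Uf_ge n))). intros m [h1 h2].
specialize (Hw' n (m - n)%nat r). replace (n + (m - n))%nat with m in Hw' by lia.
rewrite Rabs_minus_sym in Hw'.
replace (w n r - l) with ((w n r - w m r) + (w m r - l)) by ring.
eapply Rle_trans; [apply Rabs_triang|]. lra.
Qed.

Lemma half_pow_small M d : 0 <= M -> 0 < d -> exists n, M * (/2)^n < d.
Proof.
intros. destruct (pow_lt_1_zero (/2) ltac:(rewrite Rabs_pos_eq; lra) (d / (M + 1))) as [N HN].
{ apply Rdiv_lt_0_compat; lra. }
exists N. specialize (HN N (le_n _)). rewrite Rabs_pos_eq in HN by (apply pow_le; lra).
assert (0 < (/2)^N) by (apply pow_lt; lra).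
apply Rle_lt_trans with ((M + 1) * (/2)^N); [nra|].
apply Rlt_le_trans with ((M + 1) * (d / (M + 1))); [apply Rmult_lt_compat_l; lra|].
right; field; lra.
Qed.

Lemma uniform_limit_cont (w : nat -> R -> R) l :
  (forall (n : nat) (x : R), continuous (w n) x) -> (forall n r, Rabs (w n r - l r) <= 2 * C * (/2)^n * e r) ->
  forall x : R, continuous l x.
Proof.
intros Hc Hl x. pose proof C_pos. apply eps_continuous. intros ep Hep.
pose (M := exp (lam * (Rabs (x - r0) + 1))).
assert (0 < M) by apply exp_pos.
destruct (half_pow_small (2 * C * M) (ep / 3)) as [n Hn]; [nra|lra|].
destruct (continuous_eps _ _ (Hc n x) (ep / 3) LRA) as (d & Hd & h).
exists (Rmin d 1). split; [apply Rmin_glb_lt; lra|]. intros y Hy.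
assert (Hy1 : Rabs (y - x) < d) by (eapply Rlt_le_trans; [exact Hy|apply Rmin_l]).
assert (Hy2 : Rabs (y - x) < 1) by (eapply Rlt_le_trans; [exact Hy|apply Rmin_r]).
assert (He : forall z, Rabs (z - x) < 1 -> e z <= M).
{ intros. unfold e, M. pose proof A_pos.
  assert (lam * Rabs (z - r0) <= lam * (Rabs (x - r0) + 1)).
  { apply Rmult_le_compat_l; [unfold lam; lra|].
    replace (z - r0) with ((z - x) + (x - r0)) by ring. eapply Rle_trans; [apply Rabs_triang|]. lra. }
  destruct (Req_dec (lam * Rabs (z - r0)) (lam * (Rabs (x - r0) + 1))) as [->|]; [lra|].
  left; apply exp_increasing; lra. }
assert (0 < (/2)^n) by (apply pow_lt; lra).
pose proof (Hl n y) as Ly. pose proof (Hl n x) as Lx.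
pose proof (He y Hy2). pose proof (He x ltac:(rewrite Rminus_diag, Rabs_R0; lra)).
specialize (h y Hy1).
assert (Ly' : Rabs (w n y - l y) < ep / 3).
{ eapply Rle_lt_trans; [exact Ly|]. eapply Rle_lt_trans; [|exact Hn]. assert (0 < 2 * C * (/2)^n) by nra. nra. }
assert (Lx' : Rabs (w n x - l x) < ep / 3).
{ eapply Rle_lt_trans; [exact Lx|]. eapply Rle_lt_trans; [|exact Hn]. assert (0 < 2 * C * (/2)^n) by nra. nra. }
apply Rabs_def2 in Ly'. apply Rabs_def2 in Lx'. apply Rabs_def2 in h. apply Rabs_def1; lra.
Qed.

Lemma picard : exists u v : R -> R, u r0 = u0 /\ v r0 = v0 /\
  forall r : R, is_derive u r (v r) /\ is_derive v r (- a r * v r - g (u r)).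
Proof.
pose proof C_pos as HC.
destruct (picard_limit un (fun n k r => proj1 (picard_cauchy n k r))) as [u Hu].
destruct (picard_limit vn (fun n k r => proj2 (picard_cauchy n k r))) as [v Hv].
assert (cu := uniform_limit_cont un u (fun n => proj1 (picard_cont n)) Hu).
assert (cv := uniform_limit_cont vn v (fun n => proj2 (picard_cont n)) Hv).
assert (small : forall x y, (forall n r, Rabs (x r - y r) <= 4 * C * (/2)^n * e r) -> forall r, x r = y r).
{ intros. apply Rminus_diag_uniq. apply NNPP. intros Hn. apply Rabs_pos_lt in Hn.
  destruct (half_pow_small (4 * C * e r) (Rabs (x r - y r))) as [n Hnn]; auto.
  { destruct (e_ge r). nra. }
  specialize (H n r). lra. }
assert (St : forall n r, Rabs (rint (vn n) r0 r - rint v r0 r) <= C * (/2)^n * e r /\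
            Rabs (rint (X (un n) (vn n)) r0 r - rint (X u v) r0 r) <= C * (/2)^n * e r).
{ intros. destruct (picard_cont n) as [c1 c2].
  assert (Hp : 0 <= 2 * C * (/2)^n). { apply Rmult_le_pos; [lra|]. apply pow_le; lra. }
  destruct (picard_step (un n) (vn n) u v (2 * C * (/2)^n) c1 c2 cu cv Hp (fun s => conj (Hu n s) (Hv n s)) r).
  lra. }
assert (Eu : forall r, u r = u0 + rint v r0 r).
{ apply small. intros. pose proof (Hu (S n) r) as H1. destruct (St n r).
  change (un (S n) r) with (u0 + rint (vn n) r0 r) in H1.
  assert (H3 : 2 * C * (/2)^(S n) * e r = C * (/2)^n * e r) by (simpl; field).
  rewrite H3 in H1. destruct (e_ge r). assert (0 < (/2)^n) by (apply pow_lt; lra).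
  assert (0 <= C * (/2)^n * e r) by (apply Rmult_le_pos; [apply Rmult_le_pos|]; lra).
  replace (u r - (u0 + rint v r0 r)) with (- (u0 + rint (vn n) r0 r - u r) + (rint (vn n) r0 r - rint v r0 r)) by ring.
  eapply Rle_trans; [apply Rabs_triang|]. rewrite Rabs_Ropp. lra. }
assert (Ev : forall r, v r = v0 + rint (X u v) r0 r).
{ apply small. intros. pose proof (Hv (S n) r) as H1. destruct (St n r).
  change (vn (S n) r) with (v0 + rint (X (un n) (vn n)) r0 r) in H1.
  assert (H3 : 2 * C * (/2)^(S n) * e r = C * (/2)^n * e r) by (simpl; field).
  rewrite H3 in H1. destruct (e_ge r). assert (0 < (/2)^n) by (apply pow_lt; lra).
  assert (0 <= C * (/2)^n * e r) by (apply Rmult_le_pos; [apply Rmult_le_pos|]; lra).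
  replace (v r - (v0 + rint (X u v) r0 r)) with (- (v0 + rint (X (un n) (vn n)) r0 r - v r) + (rint (X (un n) (vn n)) r0 r - rint (X u v) r0 r)) by ring.
  eapply Rle_trans; [apply Rabs_triang|]. rewrite Rabs_Ropp. lra. }
exists u, v. split; [|split].
- rewrite Eu, rint_point. lra.
- rewrite Ev, rint_point. lra.
- intros. split.
  + apply (is_derive_ext (fun r => u0 + rint v r0 r)); [intros; symmetry; apply Eu|].
    eapply dval; [apply dplus; [apply dconst|apply drint; auto]|]. ring.
  + apply (is_derive_ext (fun r => v0 + rint (X u v) r0 r)); [intros; symmetry; apply Ev|].
    eapply dval; [apply dplus; [apply dconst|apply drint; apply X_cont; auto]|]. unfold X; ring.
Qed.
End Picard.

(** * The radial equation *)

Lemma ulim_abs_le (a : nat -> R) l M : ulim a l -> Uf (fun n => Rabs (a n) <= M) -> Rabs l <= M.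
Proof.
intros. apply (ulim_le (fun n => Rabs (a n)) (fun _ => M)); auto.
- apply (ulim_comp Rabs); auto. apply (continuous_Rabs l).
- apply ulim_const.
Qed.

Lemma ulim_opp (a : nat -> R) l : ulim a l -> ulim (fun n => - a n) (- l).
Proof.
intros Ha e He. apply (Uf_mono _ _ (Ha e He)). intros.
replace (- a n - - l) with (- (a n - l)) by ring. rewrite Rabs_Ropp; auto.
Qed.

Lemma ulim_minus (a b : nat -> R) l m : ulim a l -> ulim b m -> ulim (fun n => a n - b n) (l - m).
Proof. intros. apply ulim_plus; auto. apply ulim_opp; auto. Qed.

Lemma ulim_mult (a b : nat -> R) l m : ulim a l -> ulim b m -> ulim (fun n => a n * b n) (l * m).
Proof.
assert (forall x : R, continuous (fun x => x ^ 2 / 4) x) by (intros x; unfold Rdiv; eapply is_derive_cont; der).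
intros. apply (ulim_ext (fun n => (a n + b n) ^ 2 / 4 - (a n - b n) ^ 2 / 4)); [apply Uf_all; intros; field|].
replace (l * m) with ((l + m) ^ 2 / 4 - (l - m) ^ 2 / 4) by field. apply ulim_minus.
- apply (ulim_comp (fun x => x ^ 2 / 4)); auto. apply ulim_plus; auto.
- apply (ulim_comp (fun x => x ^ 2 / 4)); auto. apply ulim_minus; auto.
Qed.

Lemma ulim_scal (a : nat -> R) c l : ulim a l -> ulim (fun n => a n * c) (l * c).
Proof. intros. apply ulim_mult; auto using ulim_const. Qed.

(** Real induction: the supremum of the initial segments on which [P] holds is reached by the
    closing clause, and would be exceeded by the opening clause unless it is [b]. *)
Lemma forward_induction (P : R -> Prop) a b : a <= b -> P a ->
  (forall s, a <= s < b -> (forall t, a <= t <= s -> P t) ->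
     exists h, 0 < h /\ forall t, s <= t < s + h -> t <= b -> P t) ->
  (forall s, a < s <= b -> (forall t, a <= t < s -> P t) -> P s) ->
  forall t, a <= t <= b -> P t.
Proof.
intros Hab Pa Hopen Hcl.
destruct (completeness (fun s => a <= s <= b /\ forall t, a <= t <= s -> P t)) as [s [Hub Hl]].
- exists b. intros x [Hx _]; lra.
- exists a. split; [lra|]. intros. replace t with a by lra. auto.
- assert (a <= s). { apply Hub. split; [lra|]. intros. replace t with a by lra. auto. }
  assert (s <= b) by (apply Hl; intros x [Hx _]; lra).
  assert (Hlt : forall t, a <= t < s -> P t).
  { intros. apply NNPP. intros HP. assert (s <= t); [|lra]. apply Hl.
    intros x [Hx1 Hx2]. apply Rnot_lt_le. intros Hlt. apply HP, Hx2. lra. }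
  assert (P s). { destruct (Req_dec a s) as [<-|]; auto. apply Hcl; auto. lra. }
  assert (Hall : forall t, a <= t <= s -> P t).
  { intros. destruct (Req_dec t s) as [->|]; auto. apply Hlt; lra. }
  destruct (Req_dec s b) as [->|Hn]; auto. exfalso.
  destruct (Hopen s LRA Hall) as (h & Hh & Ho).
  pose (t := Rmin b (s + h/2)). assert (s < t <= b) by (unfold t; split; [apply Rmin_glb_lt; lra|apply Rmin_l]).
  assert (t <= s + h/2) by apply Rmin_r.
  assert (t <= s); [|lra]. apply Hub. split; [lra|]. intros x Hx.
  destruct (Rle_dec x s); [apply Hall; lra|]. apply Ho; lra.
Qed.

(** The set where [P] holds is open and closed in $(a,\infty)$; the part to the left of [r0] is
    covered by real induction in the variable $-r$. *)
Lemma connected_right (P : R -> Prop) a r0 : a < r0 -> P r0 ->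
  (forall r, a < r -> P r -> exists h, 0 < h /\ forall s, Rabs (s - r) < h -> P s) ->
  (forall r, a < r -> (forall h, 0 < h -> exists s, a < s /\ Rabs (s - r) < h /\ P s) -> P r) ->
  forall r, a < r -> P r.
Proof.
intros Har P0 Hop Hcl.
assert (Fw : forall r, r0 <= r -> P r).
{ intros r Hr. apply (forward_induction P r0 r); auto; try lra.
  - intros s Hs Hall. destruct (Hop s LRA (Hall s LRA)) as (h & Hh & H).
    exists h. split; auto. intros. apply H. rewrite Rabs_pos_eq; lra.
  - intros. apply Hcl; [lra|]. intros.
    pose (t := Rmax r0 (s - h/2)). assert (r0 <= t < s) by (unfold t; split; [apply Rmax_l|apply Rmax_lub_lt; lra]).
    assert (s - h/2 <= t) by apply Rmax_r.
    exists t. split; [lra|]. split; [rewrite Rabs_left; lra|]. auto. }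
intros r Hr. destruct (Rle_dec r0 r); [apply Fw; auto|].
assert (G := forward_induction (fun x => P (- x)) (- r0) (- r)).
replace r with (- - r) by ring. apply G; try lra.
- rewrite Ropp_involutive; auto.
- intros s Hs Hall. destruct (Hop (- s) LRA (Hall s LRA)) as (h & Hh & H).
  exists h. split; auto. intros. apply H. rewrite Rabs_left1; lra.
- intros. apply Hcl; [lra|]. intros.
  pose (t := Rmax (- r0) (s - h/2)). assert (- r0 <= t < s) by (unfold t; split; [apply Rmax_l|apply Rmax_lub_lt; lra]).
  assert (s - h/2 <= t) by apply Rmax_r.
  exists (- t). split; [lra|]. split; [rewrite Rabs_pos_eq; lra|]. auto.
Qed.

Lemma gronwall_rev (D D' : R -> R) K a b : a <= b ->
  (forall x, a < x < b -> is_derive D x (D' x)) ->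
  (forall x, a <= x <= b -> continuous D x) ->
  (forall x, a < x < b -> - (K * D x) <= D' x) -> D a <= D b * exp (K * (b - a)).
Proof.
intros Hab Hd Hc Hi.
assert (D a * exp (K * a) <= D b * exp (K * b)).
{ apply (mono_le (fun x => D x * exp (K * x)) (fun x => (K * D x + D' x) * exp (K * x))); auto.
  - intros x Hx. specialize (Hd x Hx). eapply dval; [der|]. lra.
  - intros. apply (continuous_mult D (fun y => exp (K * y))); auto.
    eapply is_derive_cont. der.
  - intros x Hx. specialize (Hi x Hx). apply Rmult_le_pos; [lra|]. left; apply exp_pos. }
assert (E : exp (K * (b - a)) = exp (K * b) * exp (- (K * a))).
{ rewrite <- exp_plus. f_equal; ring. }
rewrite E, exp_Ropp. pose proof (exp_pos (K * a)).
apply Rmult_le_reg_r with (exp (K * a)); auto.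
replace (D b * (exp (K * b) * / exp (K * a)) * exp (K * a)) with (D b * exp (K * b)) by (field; lra). lra.
Qed.

Section ODE.
Variable n : nat.
Hypothesis Hn : (1 <= n)%nat.
(** In the application $n=N-1$, so the damping term is $(n/r)u'$ and the volume weight is $r^n$. *)
Definition nu := INR n.

Lemma nu_ge : 1 <= nu.
Proof. apply (le_INR 1), Hn. Qed.

(** The starting time [e] covers both the singular problem at $0$ and approximate problems started
    at a positive time. *)
Definition ode (g : R -> R) (e : R) (u v : R -> R) : Prop :=
  forall r, e < r -> is_derive u r (v r) /\ is_derive v r (- (nu / r) * v r - g (u r)).

Definition pot (g : R -> R) (x : R) : R := rint g 0 x.
Definition energy (g u v : R -> R) (r : R) : R := v r ^ 2 / 2 + pot g (u r).

Lemma ode_cont g e u v r : ode g e u v -> e < r -> continuous u r /\ continuous v r.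
Proof. intros H Hr. destruct (H r Hr). split; eapply is_derive_cont; eauto. Qed.

Lemma pot_derive g x : (forall y : R, continuous g y) -> is_derive (pot g) x (g x).
Proof. intros. apply (drint g 0 x H). Qed.

Lemma pot_0 g : pot g 0 = 0.
Proof. apply rint_point. Qed.

Lemma pot_even g : (forall y : R, continuous g y) -> (forall x, g (- x) = - g x) -> forall x, pot g (- x) = pot g x.
Proof.
intros Hc Ho x.
assert (Gen : forall y, 0 <= y -> pot g (- y) = pot g y).
{ intros.
  assert (D : forall x : R, is_derive (fun t => pot g (- t) - pot g t) x 0).
  { intros. eapply dval.
    - apply dminus; [apply (dcomp (pot g) (fun t => - t)); [apply pot_derive; auto|der]|apply pot_derive; auto].
    - rewrite Ho. ring. }
  destruct (Req_dec 0 y) as [<-|]; [f_equal; ring|].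
  destruct (mvt (fun t => pot g (- t) - pot g t) (fun _ => 0) 0 y LRA) as (c & _ & E).
  - auto.
  - intros; eapply is_derive_cont, D.
  - rewrite Ropp_0 in E. lra. }
destruct (Rle_dec 0 x); [apply Gen; auto|].
rewrite <- (Ropp_involutive x) at 2. symmetry. apply Gen. lra.
Qed.

Lemma pot_abs g : (forall y : R, continuous g y) -> (forall x, g (- x) = - g x) -> forall x, pot g (Rabs x) = pot g x.
Proof.
intros. unfold Rabs. destruct (Rcase_abs x); auto. apply pot_even; auto.
Qed.

Lemma energy_derive g e u v r : (forall y : R, continuous g y) -> 0 <= e -> ode g e u v -> e < r ->
  is_derive (energy g u v) r (- (nu / r) * v r ^ 2).
Proof.
intros Hg He H Hr. destruct (H r Hr).
assert (hp := pot_derive g (u r) Hg).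
eapply dval.
- apply (dplus (fun t => v t ^ 2 / 2) (fun t => pot g (u t))).
  + unfold Rdiv. der.
  + apply (dcomp (pot g) u); eauto.
- simpl. lra.
Qed.

Lemma energy_cont (g u v : R -> R) (r : R) : (forall y : R, continuous g y) -> continuous u r -> continuous v r ->
  continuous (energy g u v) r.
Proof.
intros Hg Hu Hv.
apply (continuous_plus (fun t => v t ^ 2 / 2) (fun t => pot g (u t))).
- apply (continuous_comp v (fun y => y ^ 2 / 2)); auto. unfold Rdiv. eapply is_derive_cont. der.
- apply (continuous_comp u (pot g)); auto. eapply is_derive_cont, pot_derive, Hg.
Qed.

Lemma energy_decr g e u v r1 r2 : (forall y : R, continuous g y) -> 0 <= e -> ode g e u v -> e <= r1 <= r2 ->
  continuous u r1 -> continuous v r1 -> energy g u v r2 <= energy g u v r1.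
Proof.
intros Hg He H Hr Hu Hv.
assert (forall x, r1 <= x <= r2 -> continuous (energy g u v) x).
{ intros. destruct (Req_dec x r1) as [->|]; [apply energy_cont; auto|].
  destruct (ode_cont g e u v x H LRA). apply energy_cont; auto. }
assert (forall x, r1 <= x <= r2 -> continuous (fun t => - energy g u v t) x).
{ intros. apply (continuous_opp (energy g u v)); auto. }
cut (- energy g u v r1 <= - energy g u v r2); [lra|].
apply (mono_le (fun t => - energy g u v t) (fun x => - (- (nu / x) * v x ^ 2))); try lra; auto.
- intros. apply dopp. apply (energy_derive g e); auto. lra.
- intros. pose proof nu_ge. assert (0 <= nu / x) by (apply Rdiv_le_0_compat; lra).
   nra.
Qed.

Lemma momentum_derive g e u v r : 0 <= e -> ode g e u v -> e < r ->
  is_derive (fun t => t ^ n * v t) r (- (r ^ n * g (u r))).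
Proof.
intros He H Hr. destruct (H r Hr). eapply dval; [der|]. cbv beta. fold nu.
replace (r ^ n) with (r ^ (S (pred n))) by (f_equal; lia). simpl. field. lra.
Qed.

Lemma momentum_cont (v : R -> R) (r : R) : continuous v r -> continuous (fun t : R => t ^ n * v t) r.
Proof.
intros. apply (continuous_mult (fun t : R => t ^ n) v); auto. eapply is_derive_cont. der.
Qed.

(** Integrating $(r^nv)'=-r^ng(u)$ from [e], where $v=0$, gives $r^n|v|\le Br^{n+1}$. Hence
    $v=O(r)$, and the singular term $(n/r)v$ is bounded uniformly in the starting time. *)
Lemma velocity_bound g e u v B r : 0 <= e -> ode g e u v -> continuous v e -> v e = 0 ->
  e <= r -> 0 <= B -> (forall s, e <= s <= r -> Rabs (g (u s)) <= B) -> Rabs (v r) <= B * r.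
Proof.
intros He H Hv H0 Hr HB Hb.
assert (forall x, e <= x <= r -> continuous v x).
{ intros. destruct (Req_dec x e) as [->|]; auto. apply (ode_cont g e u v x H LRA). }
assert (Hd : forall x : R, is_derive (fun t => B * t ^ (S n) / INR (S n)) x (B * x ^ n)).
{ intros. unfold Rdiv. eapply dval; [der|]. cbv beta. simpl pred. field. apply not_0_INR; lia. }
assert (Hp : forall s, s = 1 \/ s = -1 -> s * (r ^ n * v r) <= B * r ^ (S n)).
{ intros.
  assert (M : B * e ^ (S n) / INR (S n) - s * (e ^ n * v e) <= B * r ^ (S n) / INR (S n) - s * (r ^ n * v r)).
  { apply (mono_le (fun t => B * t ^ (S n) / INR (S n) - s * (t ^ n * v t))
      (fun x => B * x ^ n - (0 * (x ^ n * v x) + s * - (x ^ n * g (u x))))); auto.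
    - intros. apply dminus; [apply Hd|]. apply (dmult (fun _ => s) (fun t => t ^ n * v t)); [apply dconst|].
      apply (momentum_derive g e); auto; lra.
    - intros. apply (continuous_minus (fun t => B * t ^ (S n) / INR (S n)) (fun t => s * (t ^ n * v t))).
      + eapply is_derive_cont, Hd.
      + apply (continuous_mult (fun _ => s) (fun t => t ^ n * v t)); [apply continuous_const|].
        apply momentum_cont; auto.
    - intros. specialize (Hb x LRA). apply Rabs_le_between in Hb.
      assert (0 <= x ^ n) by (apply pow_le; lra). nra. }
  rewrite H0 in M.
  assert (1 <= INR (S n)) by (apply (le_INR 1); lia).
  assert (Q : forall y, 0 <= y -> 0 <= B * y ^ S n / INR (S n) <= B * y ^ S n).
  { intros. assert (0 <= B * y ^ S n) by (apply Rmult_le_pos; [auto|apply pow_le; auto]).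
    split; [apply Rdiv_le_0_compat; lra|]. apply Rle_div_l; nra. }
  pose proof (Q e He). pose proof (Q r LRA). lra. }
pose proof (Hp 1 ltac:(auto)) as p1. pose proof (Hp (-1) ltac:(auto)) as p2.
destruct (Req_dec r 0) as [E|Hr0].
- replace r with e in * by lra. rewrite H0, Rabs_R0. nra.
- assert (0 < r ^ n) by (apply pow_lt; lra). simpl in p1, p2.
  apply Rabs_le. nra.
Qed.

Lemma velocity_neg_start g e u v : (forall y : R, continuous g y) -> 0 <= e -> ode g e u v ->
  continuous u e -> continuous v e -> v e = 0 -> 0 < g (u e) ->
  exists h, 0 < h /\ forall r, e < r <= e + h -> v r < 0 /\ u r < u e.
Proof.
intros Hg He H Hu Hv H0 Hp.
assert (Hgu : continuous (fun t => g (u t)) e) by (apply (continuous_comp u g); auto).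
destruct (cont_gt_near _ _ 0 Hgu Hp) as (d & Hd & hd).
assert (Hneg : forall r, e < r < e + d -> v r < 0).
{ intros.
  assert (M : e ^ n * v e > r ^ n * v r).
  { cut (- (e ^ n * v e) < - (r ^ n * v r)); [lra|].
    apply (mono_lt (fun t => - (t ^ n * v t)) (fun x => - - (x ^ n * g (u x)))); try lra.
    - intros. apply dopp. apply (momentum_derive g e); auto; lra.
    - intros. apply (continuous_opp (fun t => t ^ n * v t)). apply momentum_cont.
      destruct (Req_dec x e) as [->|]; auto. apply (ode_cont g e u v x H LRA).
    - intros. rewrite Ropp_involutive. apply Rmult_lt_0_compat; [apply pow_lt; lra|].
      apply hd. rewrite Rabs_pos_eq; lra. }
  rewrite H0 in M. assert (0 < r ^ n) by (apply pow_lt; lra). nra. }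
exists (d/2). split; [lra|]. intros. split; [apply Hneg; lra|].
cut (- u e < - u r); [lra|].
apply (mono_lt (fun t => - u t) (fun x => - v x)); try lra.
- intros. apply dopp. apply (H x LRA).
- intros. apply (continuous_opp u). destruct (Req_dec x e) as [->|]; auto.
  apply (ode_cont g e u v x H LRA).
- intros. specialize (Hneg x LRA). lra.
Qed.

Lemma energy_strict g e u v r : (forall y : R, continuous g y) -> 0 <= e -> ode g e u v ->
  continuous u e -> continuous v e -> v e = 0 -> 0 < g (u e) -> e < r ->
  energy g u v r < energy g u v e.
Proof.
intros Hg He H Hu Hv H0 Hp Hr.
destruct (velocity_neg_start g e u v Hg He H Hu Hv H0 Hp) as (h & Hh & hv).
pose (t := Rmin r (e + h)). assert (e < t <= r) by (unfold t; split; [apply Rmin_glb_lt; lra|apply Rmin_l]).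
assert (t <= e + h) by apply Rmin_r.
assert (energy g u v r <= energy g u v t).
{ destruct (ode_cont g e u v t H LRA). apply (energy_decr g e); auto. lra. }
cut (- energy g u v e < - energy g u v t); [lra|].
apply (mono_lt (fun s => - energy g u v s) (fun x => - (- (nu / x) * v x ^ 2))); try lra.
- intros. apply dopp, (energy_derive g e); auto; lra.
- intros. apply (continuous_opp (energy g u v)).
  destruct (Req_dec x e) as [->|]; [apply energy_cont; auto|].
  destruct (ode_cont g e u v x H LRA). apply energy_cont; auto.
- intros. pose proof nu_ge. assert (0 < nu / x) by (apply Rdiv_lt_0_compat; lra).
  destruct (hv x LRA). assert (0 < v x ^ 2) by nra. nra.
Qed.

(** At a later time with $|u|=u(e)$ the energy would be at least its initial value, against the
    strict loss; so $|u|$ stays on the side to which it first moves. *)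
Lemma amplitude g e u v : (forall y : R, continuous g y) -> (forall x, g (- x) = - g x) ->
  0 <= e -> ode g e u v -> continuous u e -> continuous v e -> v e = 0 -> 0 < u e -> 0 < g (u e) ->
  forall r, e < r -> Rabs (u r) < u e.
Proof.
intros Hg Ho He H Hu Hv H0 Hpos Hp r Hr.
assert (Hne : forall t, e < t -> Rabs (u t) <> u e).
{ intros t Ht E. pose proof (energy_strict g e u v t Hg He H Hu Hv H0 Hp Ht) as S.
  unfold energy in S. rewrite H0 in S. rewrite <- (pot_abs g Hg Ho (u t)), E in S.
  nra. }
apply NNPP. intros Hnl.
destruct (velocity_neg_start g e u v Hg He H Hu Hv H0 Hp) as (h & Hh & hv).
destruct (cont_gt_near u e 0 Hu Hpos) as (d & Hd & hd).
pose (t := Rmin r (e + Rmin (d/2) h)).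
assert (0 < Rmin (d/2) h) by (apply Rmin_glb_lt; lra).
assert (e < t <= r) by (unfold t; split; [apply Rmin_glb_lt; lra|apply Rmin_l]).
assert (t <= e + Rmin (d/2) h) by apply Rmin_r.
assert (Rmin (d/2) h <= d/2) by apply Rmin_l. assert (Rmin (d/2) h <= h) by apply Rmin_r.
destruct (hv t LRA).
assert (0 < u t) by (apply hd; rewrite Rabs_pos_eq; lra).
destruct (ivt_up (fun s => Rabs (u s)) t r (u e)) as (s & Hs & Es); try lra.
- intros. apply (continuous_comp u Rabs); [apply (ode_cont g e u v x H LRA)|apply (continuous_Rabs (u x))].
- rewrite Rabs_pos_eq by lra. lra.
- apply (Hne s LRA); auto.
Qed.
End ODE.

(** * Compactness *)

Lemma choose1 (I A : Type) (P : I -> A -> Prop) : (forall k, exists a, P k a) ->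
  exists a, forall k, P k (a k).
Proof.
intros. exists (fun k => proj1_sig (constructive_indefinite_description _ (H k))).
intros. exact (proj2_sig (constructive_indefinite_description _ (H k))).
Qed.

Lemma choose2 (I A B : Type) (P : I -> A -> B -> Prop) : (forall k, exists a b, P k a b) ->
  exists a b, forall k, P k (a k) (b k).
Proof.
intros. destruct (choose1 _ _ _ H) as [a Ha]. destruct (choose1 _ _ _ Ha). eauto.
Qed.

Lemma mvt_bound (h h' : R -> R) a b K : a <= b ->
  (forall x, a < x < b -> is_derive h x (h' x)) ->
  (forall x, a <= x <= b -> continuous h x) ->
  (forall x, a < x < b -> Rabs (h' x) <= K) -> Rabs (h b - h a) <= K * (b - a).
Proof.
intros Hab Hd Hc HK. destruct (Req_dec a b) as [->|].
- rewrite !Rminus_diag, Rabs_R0. lra.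
- destruct (mvt h h' a b LRA Hd Hc) as (c & hc & E). rewrite E, Rabs_mult, (Rabs_pos_eq (b - a)) by lra.
  specialize (HK c hc). nra.
Qed.

Lemma ode_lip n g e u v K r1 x y : ode n g e u v -> continuous u e -> continuous v e ->
  (forall r, e < r <= r1 -> Rabs (v r) <= K /\ Rabs (nu n / r * v r + g (u r)) <= K) ->
  e <= x -> e <= y -> x <= r1 -> y <= r1 ->
  Rabs (u y - u x) <= K * Rabs (y - x) /\ Rabs (v y - v x) <= K * Rabs (y - x).
Proof.
intros H cu cv HK.
assert (G : forall x y, e <= x -> x <= y -> y <= r1 ->
  Rabs (u y - u x) <= K * (y - x) /\ Rabs (v y - v x) <= K * (y - x)).
{ clear x y. intros.
  assert (C : forall z, x <= z <= y -> continuous u z /\ continuous v z).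
  { intros. destruct (Req_dec z e) as [->|]; auto. apply (ode_cont n g e); auto; lra. }
  split.
  - apply (mvt_bound u v); auto; intros z Hz; [apply H; lra|apply C; auto|apply HK; lra].
  - apply (mvt_bound v (fun r => - (nu n / r) * v r - g (u r))); auto; intros z Hz; [apply H; lra|apply C; auto|].
    replace (- (nu n / z) * v z - g (u z)) with (- (nu n / z * v z + g (u z))) by ring.
    rewrite Rabs_Ropp. apply HK; lra. }
intros. destruct (Rle_lt_dec x y) as [l|l].
- rewrite (Rabs_pos_eq (y - x)) by lra. auto.
- rewrite (Rabs_left (y - x)) by lra. rewrite (Rabs_minus_sym (u y)), (Rabs_minus_sym (v y)).
  replace (- (y - x)) with (x - y) by ring. apply G; lra.
Qed.

Definition xis (c : R) (k : nat) := c * / (INR k + 1).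

Lemma xis_pos c k : 0 < c -> 0 < xis c k <= c.
Proof.
intros. pose proof (pos_INR k). split.
- apply Rmult_lt_0_compat; auto. apply Rinv_0_lt_compat; lra.
- rewrite <- (Rmult_1_r c) at 2. apply Rmult_le_compat_l; [lra|]. rewrite <- Rinv_1. apply Rinv_le_contravar; lra.
Qed.

Lemma xis_lim c : ulim (xis c) 0.
Proof.
apply (ulim_ext (fun k => / (INR k + 1) * c)); [apply Uf_all; intros; unfold xis; ring|].
replace 0 with (0 * c) by ring. apply ulim_scal, ulim_inv_INR.
Qed.

(** An Arzela-Ascoli theorem by ultralimits: the pointwise ultralimit inherits the Lipschitz bounds,
    so convergence also holds along moving points. To the left of [e0] the limit is extended by the
    constant [c0], which makes continuity at [e0] two-sided. *)
Lemma equilipschitz_limit (ws : nat -> R -> R) (e ga : nat -> R) e0 c0 : ulim e e0 -> ulim ga c0 -> (forall k, ws k (e k) = ga k) ->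
  (forall r1, e0 < r1 -> exists K, 0 <= K /\ Uf (fun k => forall x y, e k <= x <= r1 -> e k <= y <= r1 -> Rabs (ws k y - ws k x) <= K * Rabs (y - x))) ->
  exists w, w e0 = c0 /\ continuous w e0 /\ forall x r, e0 < r -> ulim x r -> ulim (fun k => ws k (x k)) (w r).
Proof.
intros He Hg H0 HL.
assert (Est : forall r1, e0 < r1 -> exists K, 0 <= K /\ forall r, e0 < r <= r1 -> Uf (fun k => Rabs (ws k r - ga k) <= K * (r - e k))).
{ intros r1 Hr1. destruct (HL r1 Hr1) as (K & HK & H). exists K. split; auto. intros.
  apply (Uf_mono _ _ (Uf_and _ _ H (ulim_lt _ _ r He LRA))). intros k [h1 h2]. specialize (h1 (e k) r LRA LRA).
  rewrite H0, (Rabs_pos_eq (r - e k)) in h1; lra. }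
destruct (choose1 _ _ (fun r l => (r <= e0 -> l = c0) /\ (e0 < r -> ulim (fun k => ws k r) l))) as [w Hw].
{ intros r. destruct (Rle_lt_dec r e0) as [h|h]; [exists c0; split; lra|]. destruct (Est r h) as (K & HK & H).
  destruct (ulim_exists (fun k => ws k r) (Rabs c0 + 1 + K * (r - e0 + 1))) as [l Hl]; [|exists l; split; [lra|auto]].
  apply (Uf_mono _ _ (Uf_and3 _ _ _ (H r LRA) (Hg 1 Rlt_0_1) (ulim_gt _ _ (e0 - 1) He LRA))). intros k (h1 & h2 & h3).
  assert (K * (r - e k) <= K * (r - e0 + 1)) by nra.
  pose proof (Rle_abs c0). pose proof (Rle_abs (- c0)). rewrite Rabs_Ropp in *. apply Rabs_le_between in h1. apply Rabs_def2 in h2. apply Rabs_le. lra. }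
assert (W0 : w e0 = c0) by (apply Hw; lra). exists w. split; auto. split.
- apply eps_continuous. intros ep Hep. rewrite W0. destruct (Est (e0 + 1) LRA) as (K & HK & H).
  assert (0 < ep / (K + 1)) by (apply Rdiv_lt_0_compat; lra). exists (Rmin 1 (ep / (K + 1))). split; [apply Rmin_glb_lt; lra|]. intros y Hy.
  pose proof (Rmin_l 1 (ep / (K + 1))). pose proof (Rmin_r 1 (ep / (K + 1))).
  destruct (Rle_lt_dec y e0) as [l|l]; [rewrite (proj1 (Hw y) l), Rminus_diag, Rabs_R0; auto|]. rewrite Rabs_pos_eq in Hy by lra.
  apply Rle_lt_trans with (K * (y - e0)).
  + apply (ulim_le (fun k => Rabs (ws k y - ga k)) (fun k => K * (y - e k))); [| |apply H; lra].
    * apply (ulim_comp Rabs); [apply (continuous_Rabs (w y - c0))|apply ulim_minus; auto; apply Hw; auto].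
    * apply (ulim_comp (fun z => K * (y - z)) e e0); auto. eapply is_derive_cont. der.
  + apply Rle_lt_trans with ((K + 1) * (y - e0)); [nra|]. replace ep with ((K + 1) * (ep / (K + 1))) by (field; lra). nra.
- intros x r Hr Hx. destruct (HL (r + 1) LRA) as (K & HK & H).
  assert (ulim (fun k => ws k (x k) - ws k r) 0).
  { intros ep Hep. assert (0 < ep / (K + 1)) by (apply Rdiv_lt_0_compat; lra). pose (m := (e0 + r) / 2).
    apply (Uf_mono _ _ (Uf_and _ _ (Uf_and3 _ _ _ H (Hx _ H1) (ulim_lt _ _ (r + 1) Hx LRA))
      (Uf_and _ _ (ulim_gt _ _ m Hx ltac:(unfold m; lra)) (ulim_lt _ _ m He ltac:(unfold m; lra))))).
    intros k ((h1 & h2 & h3) & h4 & h5). unfold m in *. rewrite Rminus_0_r. eapply Rle_lt_trans; [apply h1; lra|].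
    pose proof (Rabs_pos (x k - r)). apply Rle_lt_trans with ((K + 1) * Rabs (x k - r)); [nra|].
    replace ep with ((K + 1) * (ep / (K + 1))) by (field; lra). nra. }
  apply (ulim_ext (fun k => (ws k (x k) - ws k r) + ws k r)); [apply Uf_all; intros; ring|].
  rewrite <- (Rplus_0_l (w r)). apply ulim_plus; auto. apply Hw; auto.
Qed.

(* A point where [w' k] is far from [q], taken nearly as close to [r] as possible, would converge to [r] unless [w' k] is
   close to [q] on a fixed neighbourhood of [r]; the mean value inequality then passes to the limit. *)
Lemma is_derive_ulim (w w' : nat -> R -> R) (l : R -> R) (r q d0 : R) : 0 < d0 -> (forall y, Rabs (y - r) < d0 -> ulim (fun k => w k y) (l y)) ->
  Uf (fun k => forall x, Rabs (x - r) < d0 -> is_derive (w k) x (w' k x)) ->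
  (forall x, ulim x r -> ulim (fun k => w' k (x k)) q) -> is_derive l r q.
Proof.
intros Hd0 Hl Hd Hq. apply eps_is_derive. intros e He.
pose (far := fun j k x => Rabs (x - r) < xis d0 j /\ e < Rabs (w' k x - q)).
assert (Hj : exists j, Uf (fun k => ~ exists x, far j k x)).
{ apply NNPP. intros HN.
  destruct (choose1 _ _ (fun k x => forall j, (j <= k)%nat -> (exists y, far j k y) -> far j k x)).
  { intros. generalize k at 1. induction k0 as [|m [x IH]].
    - destruct (classic (exists y, far 0%nat k y)) as [[y Hy]|h]; [exists y|exists 0]; intros j Hj; replace j with 0%nat by lia; tauto.
    - destruct (classic (exists y, far (S m) k y)) as [[y [y1 y2]]|h].
      + exists y. intros j Hj _. split; auto. eapply Rlt_le_trans; [exact y1|]. apply Rmult_le_compat_l; [lra|].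
        apply le_INR in Hj. pose proof (pos_INR j). apply Rinv_le_contravar; lra.
      + exists x. intros. destruct (Nat.eq_dec j (S m)) as [->|]; [tauto|]. apply IH; auto. lia. }
  assert (Fx : forall j, Uf (fun k => far j k (x k))).
  { intros. destruct (Uf_em (fun k => exists y, far j k y)) as [h|h]; [|exfalso; apply HN; exists j; auto].
    apply (Uf_mono _ _ (Uf_and _ _ h (Uf_ge j))). intros k [h1 h2]. auto. }
  assert (Lx : ulim x r).
  { intros ep Hep. destruct (Uf_out _ _ (ulim_lt _ _ ep (xis_lim d0) Hep) (fun k hk => ex_intro (fun k => xis d0 k < ep) k hk)) as [j hj].
    apply (Uf_mono _ _ (Fx j)). intros k [h _]. lra. }
  apply (Uf_out _ _ (Uf_and _ _ (Fx 0%nat) (Hq x Lx e He))). intros k [[_ h1] h2]. lra. }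
destruct Hj as [j Hj]. pose proof (xis_pos d0 j Hd0). exists (xis d0 j). split; [lra|]. intros.
assert (B : forall a b, a <= b -> (forall x, a <= x <= b -> Rabs (x - r) < xis d0 j) -> Rabs (l b - l a - q * (b - a)) <= e * (b - a)).
{ intros a b Hab Hin. apply (ulim_le (fun k => Rabs (w k b - w k a - q * (b - a))) (fun _ => e * (b - a))); [|apply ulim_const|].
  - apply (ulim_comp Rabs); [apply (continuous_Rabs (l b - l a - q * (b - a)))|].
    apply ulim_minus; [apply ulim_minus; apply Hl|apply ulim_const]; [specialize (Hin b)|specialize (Hin a)]; lra.
  - apply (Uf_mono _ _ (Uf_and _ _ Hd Hj)). intros k [h1 h2].
    assert (D : forall x, a <= x <= b -> is_derive (fun t => w k t - q * t) x (w' k x - q)).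
    { intros x Hxx. apply dminus; [apply h1; specialize (Hin x Hxx); lra|]. eapply dval; [apply (dmult (fun _ => q) (fun t => t)); [apply dconst|apply did]|ring]. }
    replace (w k b - w k a - q * (b - a)) with (w k b - q * b - (w k a - q * a)) by ring. apply (mvt_bound (fun t => w k t - q * t) (fun x => w' k x - q) a b e Hab).
    + intros. apply D. lra.
    + intros. eapply is_derive_cont. auto.
    + intros. apply Rnot_lt_le. intros h. apply h2. exists x. split; auto. apply Hin. lra. }
destruct (Rle_lt_dec r y) as [c|c].
- rewrite (Rabs_pos_eq (y - r)) in * by lra. apply B; auto. intros. rewrite Rabs_pos_eq; lra.
- rewrite (Rabs_left (y - r)) in * by lra. replace (l y - l r - q * (y - r)) with (- (l r - l y - q * (r - y))) by ring.
  rewrite Rabs_Ropp. eapply Rle_trans; [apply B|right; ring]; [lra|]. intros. rewrite Rabs_left1; lra.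
Qed.

(** The assumed bounds are bounds on $u'$ and $u''$ up to the starting time, the singular term being
    part of $u''$. The equation passes to the limit in both derivatives by [is_derive_ulim]. *)
Lemma compactness n (gs : nat -> R -> R) (g : R -> R) (us vs : nat -> R -> R) (e al be : nat -> R) e0 a0 b0 :
  0 <= e0 -> ulim e e0 -> ulim al a0 -> ulim be b0 ->
  (forall k, us k (e k) = al k) -> (forall k, vs k (e k) = be k) ->
  (forall k, ode n (gs k) (e k) (us k) (vs k)) ->
  (forall k, continuous (us k) (e k)) -> (forall k, continuous (vs k) (e k)) ->
  (forall x : R, continuous g x) ->
  (forall r1, e0 < r1 -> exists K, Uf (fun k => forall r, e k < r <= r1 ->
      Rabs (vs k r) <= K /\ Rabs (nu n / r * vs k r + gs k (us k r)) <= K)) ->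
  (forall c h, 0 < h -> Uf (fun k => forall x, Rabs x <= c -> Rabs (gs k x - g x) <= h)) ->
  exists u v, ode n g e0 u v /\ u e0 = a0 /\ v e0 = b0 /\ continuous u e0 /\ continuous v e0 /\
    forall r, e0 < r -> ulim (fun k => us k r) (u r) /\ ulim (fun k => vs k r) (v r).
Proof.
intros He0 He Ha Hb Hu0 Hv0 Ho Hcu Hcv Hg HK Hgs.
assert (Lip : forall r1, e0 < r1 -> exists K, 0 <= K /\ Uf (fun k => forall x y, e k <= x <= r1 -> e k <= y <= r1 ->
  Rabs (us k y - us k x) <= K * Rabs (y - x) /\ Rabs (vs k y - vs k x) <= K * Rabs (y - x))).
{ intros r1 Hr. destruct (HK r1 Hr) as [K H]. exists K. split.
  - apply (Uf_out _ _ (Uf_and _ _ H (ulim_lt _ _ _ He Hr))). intros k [h1 h2].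
    destruct (h1 r1 LRA). pose proof (Rabs_pos (vs k r1)). lra.
  - apply (Uf_mono _ _ H). intros k hk x y h1 h2. apply (ode_lip n (gs k) (e k) _ _ K r1); auto; lra. }
destruct (equilipschitz_limit us e al e0 a0) as (u & U1 & U2 & U3); auto.
{ intros r1 Hr1. destruct (Lip r1 Hr1) as (K & h1 & h2). exists K. split; auto. apply (Uf_mono _ _ h2). intros k h x y q1 q2. apply h; auto. }
destruct (equilipschitz_limit vs e be e0 b0) as (v & V1 & V2 & V3); auto.
{ intros r1 Hr1. destruct (Lip r1 Hr1) as (K & h1 & h2). exists K. split; auto. apply (Uf_mono _ _ h2). intros k h x y q1 q2. apply h; auto. }
exists u, v. split; [|repeat (split; auto); [apply (U3 (fun _ => r))|apply (V3 (fun _ => r))]; auto using ulim_const].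
intros r Hr. pose (d := (r - e0) / 2).
assert (forall y, Rabs (y - r) < d -> e0 < y) by (intros y Hy; apply Rabs_def2 in Hy; unfold d in Hy; lra).
assert (Hd : Uf (fun k => forall x, Rabs (x - r) < d -> e k < x)).
{ apply (Uf_mono _ _ (ulim_lt _ _ (e0 + d) He ltac:(unfold d; lra))). intros k hk x Hx. apply Rabs_def2 in Hx. unfold d in *. lra. }
split.
- apply (is_derive_ulim us vs u r (v r) d); [unfold d; lra| | |auto].
  + intros. apply (U3 (fun _ => y)); auto using ulim_const.
  + apply (Uf_mono _ _ Hd). intros k h x Hx. apply (Ho k); auto.
- apply (is_derive_ulim vs (fun k x => - (nu n / x) * vs k x - gs k (us k x)) v r (- (nu n / r) * v r - g (u r)) d); [unfold d; lra| | |].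
  + intros. apply (V3 (fun _ => y)); auto using ulim_const.
  + apply (Uf_mono _ _ Hd). intros k h x Hx. apply (Ho k); auto.
  + intros x Hx. pose proof (U3 x r Hr Hx) as Lu. apply ulim_minus.
    * apply (ulim_ext (fun k => vs k (x k) * - (nu n / x k))); [apply Uf_all; intros; ring|]. rewrite Rmult_comm.
      apply ulim_mult; auto. apply (ulim_comp (fun s => - (nu n / s))); auto. apply ex_derive_cont. auto_derive. lra.
    * apply (ulim_ext (fun k => (gs k (us k (x k)) - g (us k (x k))) + g (us k (x k)))); [apply Uf_all; intros; ring|].
      rewrite <- (Rplus_0_l (g (u r))). apply ulim_plus; [|apply (ulim_comp g); auto].
      intros ep Hep. apply (Uf_mono _ _ (Uf_and _ _ (Hgs (Rabs (u r) + 1) (ep / 2) LRA) (Lu 1 Rlt_0_1))). intros k [h1 h2].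
      rewrite Rminus_0_r. apply Rle_lt_trans with (ep / 2); [apply h1|lra].
      pose proof (Rabs_triang (us k (x k) - u r) (u r)). replace (us k (x k) - u r + u r) with (us k (x k)) in * by ring. lra.
Qed.

(** * Regular solutions *)

Definition loc_lip (f : R -> R) (x : R) := exists e L, 0 < e /\
  forall y z, Rabs (y - x) < e -> Rabs (z - x) < e -> Rabs (f y - f z) <= L * Rabs (y - z).

Definition cl (c x : R) := Rmax (- c) (Rmin c x).

Ltac mm :=
  unfold Rmin; repeat match goal with |- context [Rle_dec ?a ?b] => destruct (Rle_dec a b) end;
  unfold Rmax; repeat match goal with |- context [Rle_dec ?a ?b] => destruct (Rle_dec a b) end;
  unfold Rabs; repeat match goal with |- context [Rcase_abs ?a] => destruct (Rcase_abs a) end; try lra.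

Lemma Rmin_lip c x y : Rabs (Rmin c x - Rmin c y) <= Rabs (x - y).
Proof. mm. Qed.
Lemma Rmax_lip c x y : Rabs (Rmax c x - Rmax c y) <= Rabs (x - y).
Proof. mm. Qed.
Lemma cl_lip c x y : Rabs (cl c x - cl c y) <= Rabs (x - y).
Proof. eapply Rle_trans; [apply Rmax_lip|apply Rmin_lip]. Qed.
Lemma cl_id c x : Rabs x <= c -> cl c x = x.
Proof.
intros. apply Rabs_le_between in H. unfold cl. rewrite (Rmin_right c x), Rmax_right by lra. auto.
Qed.
Lemma cl_odd c x : 0 <= c -> cl c (- x) = - cl c x.
Proof.
intros. unfold cl; mm.
Qed.
Lemma cl_bound c x : 0 <= c -> Rabs (cl c x) <= c.
Proof.
intros. apply Rabs_le. split; [apply Rmax_l|]. apply Rmax_lub; [lra|apply Rmin_l].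
Qed.
Lemma cl_ge c x : 0 <= c -> c <= x -> cl c x = c.
Proof. intros. unfold cl. rewrite (Rmin_left c x), Rmax_right by lra. auto. Qed.

(** Otherwise there are pairs with difference quotient above [k] for every [k]. Since $f$ is
    bounded, the two ultralimits of such pairs coincide, and the local Lipschitz constant at that
    point is exceeded. *)
Lemma lip_compact (f : R -> R) a b : a <= b -> (forall x : R, continuous f x) ->
  (forall x, a <= x <= b -> loc_lip f x) ->
  exists L, 0 <= L /\ forall x y, a <= x <= b -> a <= y <= b -> Rabs (f x - f y) <= L * Rabs (x - y).
Proof.
intros Hab Hc Hl. apply NNPP. intros Hn.
assert (forall k : nat, exists x y : R, a <= x <= b /\ a <= y <= b /\ INR k * Rabs (x - y) < Rabs (f x - f y)).
{ intros. apply NNPP. intros Hk. apply Hn. exists (INR k). split; [apply pos_INR|]. intros.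
  apply Rnot_lt_le. intros Hlt. apply Hk. exists x, y. auto. }
destruct (choose2 _ _ _ _ H) as (us & vs & Hp).
assert (Bd : forall x, a <= x <= b -> Rabs x <= Rabs a + Rabs b).
{ intros. unfold Rabs; repeat match goal with |- context [Rcase_abs ?a] => destruct (Rcase_abs a) end; lra. }
destruct (ulim_exists us (Rabs a + Rabs b)) as [x hx].
{ apply Uf_all. intros. apply Bd, Hp. }
destruct (ulim_exists vs (Rabs a + Rabs b)) as [y hy].
{ apply Uf_all. intros. apply Bd, Hp. }
assert (Hx : a <= x <= b).
{ split; [apply (ulim_le (fun _ => a) us)|apply (ulim_le us (fun _ => b))];
  auto using ulim_const; apply Uf_all; intros; apply Hp. }
destruct (bounded_on f a b Hab ltac:(auto)) as (B & HB & hB).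
assert (x = y).
{ apply Rminus_diag_uniq. apply NNPP. intros Hne. apply Rabs_pos_lt in Hne.
  assert (U : ulim (fun k => Rabs (us k - vs k)) (Rabs (x - y))).
  { apply (ulim_comp Rabs); [apply (continuous_Rabs (x - y))|]. apply ulim_minus; auto. }
  destruct (nfloor_ex (2 * B / (Rabs (x - y) / 2))) as [N HN]. { apply Rdiv_le_0_compat; lra. }
  apply (Uf_out _ _ (Uf_and _ _ (ulim_gt _ _ (Rabs (x - y) / 2) U LRA) (Uf_ge (S N)))).
  intros k [h1 h2]. destruct (Hp k) as (q1 & q2 & q3).
  assert (Rabs (f (us k) - f (vs k)) <= 2 * B).
  { eapply Rle_trans; [apply Rabs_triang|]. rewrite Rabs_Ropp. pose proof (hB _ q1). pose proof (hB _ q2). lra. }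
  apply le_INR in h2. rewrite S_INR in h2.
  assert (2 * B <= INR k * (Rabs (x - y) / 2)).
  { apply Rle_div_l; [lra|]. lra. }
  nra. }
subst y. destruct (Hl x Hx) as (e & L & He & HL).
destruct (nfloor_ex (Rabs L)) as [N HN]. { apply Rabs_pos. }
apply (Uf_out _ _ (Uf_and3 _ _ _ (hx e He) (hy e He) (Uf_ge (S N)))).
intros k (h1 & h2 & h3). destruct (Hp k) as (q1 & q2 & q3). specialize (HL _ _ h1 h2).
apply le_INR in h3. rewrite S_INR in h3. pose proof (Rle_abs L). pose proof (Rabs_pos (us k - vs k)). nra.
Qed.

(* [gl] is a Lipschitz approximation of f, linear on [-xi, xi] because f need not be Lipschitz at 0; beyond c both are affine. *)
Definition fc (f : R -> R) (c x : R) := f (cl c x) + (x - cl c x).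
Definition gl (f : R -> R) (c xi x : R) :=
  cl xi x / xi * f (Rmax xi (Rmin c (Rabs x))) + (x - cl c x).
Lemma mid_range xi c x : 0 < xi <= c -> xi <= Rmax xi (Rmin c (Rabs x)) <= c.
Proof. intros. split; [apply Rmax_l|]. apply Rmax_lub; [lra|apply Rmin_l]. Qed.

(** The difference is split by the product rule; only the Lipschitz constant of $f$ on $[\xi,c]$
    enters, and the linear factor has slope $1/\xi$. *)
Lemma gl_lip f c xi : 0 < xi <= c -> (forall x : R, continuous f x) -> (forall x, 0 < x -> loc_lip f x) ->
  exists L, 0 <= L /\ forall x y, Rabs (gl f c xi x - gl f c xi y) <= L * Rabs (x - y).
Proof.
intros Hxi Hc Hl.
destruct (lip_compact f xi c LRA Hc) as (L & HL0 & HL). { intros. apply Hl; lra. }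
destruct (bounded_on f xi c LRA ltac:(auto)) as (B & HB & hB).
exists (B / xi + L + 2). assert (0 <= B / xi) by (apply Rdiv_le_0_compat; lra). split; [lra|]. intros. unfold gl.
set (mx := Rmax xi (Rmin c (Rabs x))). set (my := Rmax xi (Rmin c (Rabs y))).
assert (Rabs (mx - my) <= Rabs (x - y)).
{ assert (G1 : forall a b, Rabs (Rmin c a - Rmin c b) <= Rabs (a - b)) by (intros; mm).
  assert (G2 : forall a b, Rabs (Rmax xi a - Rmax xi b) <= Rabs (a - b)) by (intros; mm).
   eapply Rle_trans; [apply G2|]. eapply Rle_trans; [apply G1|]. apply Rabs_triang_inv2. }
pose proof (mid_range xi c x Hxi) as h1. pose proof (mid_range xi c y Hxi) as h2.
pose proof (HL mx my h1 h2).
replace (cl xi x / xi * f mx + (x - cl c x) - (cl xi y / xi * f my + (y - cl c y))) with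
  ((cl xi x - cl xi y) * (f mx / xi) + cl xi y / xi * (f mx - f my) + ((x - y) - (cl c x - cl c y))) by (field; lra).
pose proof (cl_lip xi x y). pose proof (cl_lip c x y).
eapply Rle_trans; [apply Rabs_triang|].
assert (Rabs (x - y - (cl c x - cl c y)) <= 2 * Rabs (x - y)).
{ eapply Rle_trans; [apply Rabs_triang|]. rewrite Rabs_Ropp. lra. }
assert (Rabs ((cl xi x - cl xi y) * (f mx / xi) + cl xi y / xi * (f mx - f my)) <= Rabs (x - y) * (B / xi) + 1 * (L * Rabs (x - y))).
{ eapply Rle_trans; [apply Rabs_triang|]. rewrite !Rabs_mult. apply Rplus_le_compat.
  - apply Rmult_le_compat; try apply Rabs_pos; auto. unfold Rdiv. rewrite Rabs_mult, Rabs_inv, (Rabs_pos_eq xi) by lra.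
    apply Rmult_le_compat_r; [left; apply Rinv_0_lt_compat; lra|apply hB; auto].
  - apply Rmult_le_compat; try apply Rabs_pos.
    + pose proof (cl_bound xi y LRA). unfold Rdiv. rewrite Rabs_mult, Rabs_inv, (Rabs_pos_eq xi) by lra.
      apply Rle_div_l; lra.
    + nra. }
nra.
Qed.

Lemma gl_odd f c xi x : 0 < xi <= c -> gl f c xi (- x) = - gl f c xi x.
Proof. intros. unfold gl. rewrite !cl_odd, Rabs_Ropp by lra. lra. Qed.

Lemma gl_out f c xi x : 0 < xi <= c -> (forall x, f (- x) = - f x) -> xi <= Rabs x -> gl f c xi x = fc f c x.
Proof.
intros H Ho Hx. unfold gl, fc.
destruct (Rle_lt_dec 0 x) as [l|l].
- rewrite Rabs_pos_eq in * by lra. rewrite (cl_ge xi x) by lra.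
  replace (Rmax xi (Rmin c x)) with (cl c x).
  2: { unfold cl. rewrite Rmax_right, Rmax_right; auto; apply Rmin_glb; lra. }
  field. lra.
- rewrite Rabs_left in * by lra. assert (Hy : exists y, x = - y) by (exists (- x); ring). destruct Hy as [y ->]. rewrite Ropp_involutive in *.
  rewrite (cl_odd xi), (cl_odd c) by lra. rewrite (cl_ge xi y) by lra. rewrite Ho.
  replace (Rmax xi (Rmin c y)) with (cl c y).
  2: { unfold cl. rewrite Rmax_right, Rmax_right; auto; apply Rmin_glb; lra. }
  field. lra.
Qed.

Lemma gl_in f c xi x : 0 < xi <= c -> Rabs x <= xi -> gl f c xi x = x / xi * f xi.
Proof.
intros. unfold gl. rewrite (cl_id xi), (cl_id c) by lra.
rewrite Rmax_left. 2: { eapply Rle_trans; [apply Rmin_r|auto]. } lra.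
Qed.

Lemma fc_id f c x : Rabs x <= c -> fc f c x = f x.
Proof. intros. unfold fc. rewrite cl_id by auto. ring. Qed.

Lemma fc_cont f c (x : R) : (forall x : R, continuous f x) -> continuous (fc f c) x.
Proof.
intros. assert (continuous (cl c) x).
{ apply (Lipschitz_continuous _ 1). intros; rewrite Rmult_1_l; apply cl_lip. }
 apply (continuous_plus (fun x => f (cl c x)) (fun x => x - cl c x)).
- apply (continuous_comp (cl c) f); auto.
- apply (continuous_minus (fun x : R => x) (cl c)); auto. apply continuous_id.
Qed.

(** The two functions agree for $|x|\ge\xi$; for smaller $|x|$ both are small, because $f$ is
    continuous with $f(0)=0$. *)
Lemma gl_approx f c (xi : nat -> R) : (forall k, 0 < xi k <= c) -> ulim xi 0 -> (forall x : R, continuous f x) -> (forall x, f (- x) = - f x) ->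
  forall h, 0 < h -> Uf (fun k => forall x, Rabs (gl f c (xi k) x - fc f c x) <= h).
Proof.
intros Hxi Lxi Hf Ho h Hh.
assert (f 0 = 0). { pose proof (Ho 0). rewrite Ropp_0 in H. lra. }
destruct (continuous_eps f 0 (Hf 0) (h/2) LRA) as (d & Hd & hd).
apply (Uf_mono _ _ (ulim_lt _ _ d Lxi Hd)). intros k hk x.
pose proof (Hxi k). set (x0 := xi k) in *.
destruct (Rle_lt_dec x0 (Rabs x)) as [l|l].
- rewrite gl_out by auto. rewrite Rminus_diag, Rabs_R0. lra.
- rewrite gl_in, fc_id by lra.
  assert (Rabs (f x0) < h/2). { replace (f x0) with (f x0 - f 0) by lra. apply hd. rewrite Rabs_pos_eq; lra. }
  assert (Rabs (f x) < h/2). { replace (f x) with (f x - f 0) by lra. apply hd. rewrite Rminus_0_r. lra. }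
  eapply Rle_trans; [apply Rabs_triang|]. rewrite Rabs_Ropp. rewrite Rabs_mult.
  assert (Rabs (x / x0) <= 1).
  { unfold Rdiv. rewrite Rabs_mult, Rabs_inv, (Rabs_pos_eq x0) by lra. apply Rle_div_l; lra. }
  pose proof (Rabs_pos (f x0)). nra.
Qed.

Lemma gl_bound f c xi B x : 0 < xi <= c -> Rabs x <= c -> (forall y, 0 <= y <= c -> Rabs (f y) <= B) ->
  Rabs (gl f c xi x) <= B.
Proof.
intros H Hx HB. unfold gl. rewrite (cl_id c) by auto. rewrite Rminus_diag, Rplus_0_r, Rabs_mult.
pose proof (mid_range xi c x H). specialize (HB (Rmax xi (Rmin c (Rabs x))) LRA).
pose proof (cl_bound xi x LRA).
assert (Rabs (cl xi x / xi) <= 1).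
{ unfold Rdiv. rewrite Rabs_mult, Rabs_inv, (Rabs_pos_eq xi) by lra. apply Rle_div_l; lra. }
pose proof (Rabs_pos (f (Rmax xi (Rmin c (Rabs x))))). nra.
Qed.

Definition reg (n : nat) (f : R -> R) (al : R) (u v : R -> R) : Prop :=
  u 0 = al /\ v 0 = 0 /\ continuous u 0 /\ continuous v 0 /\ ode n f 0 u v.

Section Exist.
Variable n : nat.
Hypothesis Hn : (1 <= n)%nat.

(** Replacing $n/r$ by $n/\max(r,e)$ makes the coefficient bounded on the whole line, so that
    [picard] applies, and changes nothing for $r\ge e$. *)
Lemma lip_solution (g : R -> R) L e u0 v0 : 0 < e -> 0 <= L ->
  (forall x y, Rabs (g x - g y) <= L * Rabs (x - y)) ->
  exists u v : R -> R, u e = u0 /\ v e = v0 /\ (forall r, continuous u r) /\ (forall r, continuous v r) /\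
    forall r, e <= r -> is_derive u r (v r) /\ is_derive v r (- (nu n / r) * v r - g (u r)).
Proof.
intros.
destruct (picard (fun r => nu n / Rmax r e) g (nu n / e) L) with (r0 := e) (u0 := u0) (v0 := v0) as (u & v & h1 & h2 & h3); auto.
- intros. apply (continuous_mult (fun _ => nu n) (fun r => / Rmax r e)); [apply continuous_const|].
  apply (continuous_comp (fun r => Rmax r e) Rinv).
  + apply (Lipschitz_continuous _ 1). intros. mm.
  + apply (continuous_Rinv (Rmax r e)). pose proof (Rmax_r r e). lra.
- intros. pose proof (Rmax_r r e). pose proof (pos_INR n). unfold nu.
  rewrite Rabs_pos_eq; [|apply Rdiv_le_0_compat; lra].
   apply Rmult_le_compat_l; auto. apply Rinv_le_contravar; lra.
- exists u, v. split; auto. split; auto. split; [|split].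
  + intros. destruct (h3 r) as [a _]. exact (is_derive_cont u r _ a).
  + intros. destruct (h3 r) as [_ a]. exact (is_derive_cont v r _ a).
  + intros. destruct (h3 r) as [a b]. rewrite Rmax_left in b by auto. auto.
Qed.

Lemma reg_bounds f al u v B c r1 : reg n f al u v -> (forall r, 0 <= r -> Rabs (u r) <= c) ->
  (forall y, Rabs y <= c -> Rabs (f y) <= B) ->
  forall r, 0 < r <= r1 -> Rabs (v r) <= B * r1 + (nu n + 1) * B /\ Rabs (nu n / r * v r + f (u r)) <= B * r1 + (nu n + 1) * B.
Proof.
intros (h1 & h2 & h3 & h4 & h5) Hc HB r Hr.
assert (0 <= B). { specialize (HB (u r) (Hc r LRA)). pose proof (Rabs_pos (f (u r))). lra. }
assert (0 <= nu n) by apply pos_INR.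
assert (Rabs (v r) <= B * r).
{ apply (velocity_bound n Hn f 0 u v); auto; try lra. intros. apply HB, Hc; lra. }
assert (0 <= (nu n + 1) * B) by nra.
assert (0 <= B * r1) by nra.
split.
- assert (B * r <= B * r1) by nra. lra.
- eapply Rle_trans; [apply Rabs_triang|]. specialize (HB (u r) (Hc r LRA)).
  assert (Rabs (nu n / r * v r) <= nu n * B); [|lra].
  rewrite Rabs_mult, (Rabs_pos_eq (nu n / r)) by (apply Rdiv_le_0_compat; lra).
  apply Rle_trans with (nu n / r * (B * r)); [apply Rmult_le_compat_l; auto; apply Rdiv_le_0_compat; lra|].
  right; field; lra.
Qed.

Variable f : R -> R.
Hypothesis Hfc : forall x : R, continuous f x.
Hypothesis Hfo : forall x, f (- x) = - f x.
Hypothesis Hfl : forall x, x <> 0 -> loc_lip f x.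

Lemma f_bound c : exists B, 0 < B /\ forall y, Rabs y <= c -> Rabs (f y) <= B.
Proof.
destruct (Rle_lt_dec 0 c) as [h|h].
- destruct (bounded_on f (- c) c LRA ltac:(auto)) as (B & HB & hB). exists B. split; auto.
  intros y Hy. apply hB. apply Rabs_le_between in Hy. lra.
- exists 1. split; [lra|]. intros. pose proof (Rabs_pos y). lra.
Qed.

(** The Lipschitz approximations are started at rest at time $1/(k+1)$. Positivity of [f al] gives
    the amplitude bound [al] for every [k], hence uniform velocity bounds and a limit. *)
Lemma reg_exists al : 0 < al -> 0 < f al ->
  exists u v, reg n f al u v /\ forall r, 0 <= r -> Rabs (u r) <= al.
Proof.
intros Hal Hf.
pose (e := fun k => / (INR k + 1)). pose (gk := fun k => gl f al (xis al k)).
assert (He : forall k, 0 < e k) by (intros k; apply Rinv_0_lt_compat; pose proof (pos_INR k); lra).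
assert (Hxi := fun k => xis_pos al k Hal).
assert (Hex : forall k, exists (u v : R -> R), u (e k) = al /\ v (e k) = 0 /\ (forall r : R, continuous u r) /\ (forall r : R, continuous v r) /\
   ode n (gk k) (e k) u v).
{ intros. destruct (gl_lip f al (xis al k) (Hxi k) Hfc) as (L & HL0 & HL). { intros. apply Hfl; lra. }
  destruct (lip_solution (gk k) L (e k) al 0 (He k) HL0 HL) as (u & v & h1 & h2 & h3 & h4 & h5).
  exists u, v. do 4 (split; auto). intros r Hr. apply h5; lra. }
destruct (choose2 _ _ _ _ Hex) as (us & vs & Hp).
destruct (f_bound al) as (B & HB & hB).
assert (forall k (x : R), continuous (gk k) x).
{ intros. destruct (gl_lip f al (xis al k) (Hxi k) Hfc) as (L & HL0 & HL). { intros. apply Hfl; lra. }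
  apply (Lipschitz_continuous _ L); auto. }
assert (forall k x, gk k (- x) = - gk k x) by (intros; apply gl_odd; auto).
assert (Amp : forall k r, e k <= r -> Rabs (us k r) <= al).
{ intros. destruct (Hp k) as (h1 & h2 & h3 & h4 & h5). destruct (Req_dec r (e k)) as [->|Hne].
  - rewrite h1, Rabs_pos_eq; lra.
  - left. rewrite <- h1. apply (amplitude n Hn (gk k) (e k) _ (vs k)); auto; try lra.
    + specialize (He k); lra.
    + rewrite h1. unfold gk. rewrite gl_out, fc_id; auto; rewrite Rabs_pos_eq; try lra. apply (Hxi k). }
assert (GB : forall k x, Rabs x <= al -> Rabs (gk k x) <= B).
{ intros. apply gl_bound; auto. intros. apply hB. rewrite Rabs_pos_eq; lra. }
destruct (compactness n gk (fc f al) us vs e (fun _ => al) (fun _ => 0) 0 al 0)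
  as (u & v & q1 & q2 & q3 & q4 & q5 & q6); try apply ulim_const; try lra; try (intros k; apply (Hp k)).
- apply ulim_inv_INR.
- intros x; apply fc_cont; auto.
- intros. exists (B * r1 + (nu n + 1) * B). apply Uf_all. intros k r Hr.
  destruct (Hp k) as (h1 & h2 & h3 & h4 & h5). specialize (He k). assert (0 <= nu n) by apply pos_INR.
  assert (Rabs (vs k r) <= B * r).
  { apply (velocity_bound n Hn (gk k) (e k) (us k) (vs k)); auto; try lra. intros. apply GB, Amp; lra. }
  assert (0 <= (nu n + 1) * B) by nra.
  assert (0 <= B * r1) by nra.
  split.
  + assert (B * r <= B * r1) by nra. lra.
  + eapply Rle_trans; [apply Rabs_triang|]. pose proof (GB k (us k r) (Amp k r LRA)).
    assert (Rabs (nu n / r * vs k r) <= nu n * B); [|lra].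
    rewrite Rabs_mult, (Rabs_pos_eq (nu n / r)) by (apply Rdiv_le_0_compat; lra).
    apply Rle_trans with (nu n / r * (B * r)); [apply Rmult_le_compat_l; auto; apply Rdiv_le_0_compat; lra|].
    right; field; lra.
- intros c h Hh. apply (Uf_mono _ _ (gl_approx f al (xis al) Hxi (xis_lim al) Hfc Hfo h Hh)). intros k hk x _. apply hk.
- assert (Bu : forall r, 0 <= r -> Rabs (u r) <= al).
  { intros. destruct (Req_dec r 0) as [->|]; [rewrite q2, Rabs_pos_eq; lra|].
    apply (ulim_abs_le (fun k => us k r)); [apply q6; lra|].
    apply (Uf_mono _ _ (ulim_lt e 0 r ulim_inv_INR LRA)). intros. apply Amp; lra. }
  exists u, v. split; auto. do 4 (split; auto). intros r Hr. destruct (q1 r Hr) as [a b]. split; auto.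
  rewrite fc_id in b by (apply Bu; lra). auto.
Qed.

Lemma cut_derive (w : R -> R) rho (l : R) : w rho = 0 -> is_derive w rho 0 ->
  is_derive (fun r => if Rlt_dec r rho then w r else 0) rho 0.
Proof.
intros H0 Hd. apply eps_is_derive. intros e He. destruct (is_derive_eps _ _ _ Hd e He) as (d & Hdp & h).
exists d. split; auto. intros. rewrite H0 in h.
destruct (Rlt_dec rho rho); [lra|]. destruct (Rlt_dec y rho); auto.
replace (0 - 0 - 0 * (y - rho)) with 0 by ring. rewrite Rabs_R0. apply Rmult_le_pos; [lra|apply Rabs_pos].
Qed.

Definition frozen (u v : R -> R) := forall r s, 0 <= r <= s -> u r = 0 -> v r = 0 -> u s = 0 /\ v s = 0.

Lemma f_0 : f 0 = 0.
Proof. pose proof (Hfo 0). rewrite Ropp_0 in H. lra. Qed.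

(* A regular solution is replaced by zero after its first double zero, where uniqueness may fail. *)
Lemma freeze al u v : 0 < al -> reg n f al u v -> (forall r, 0 <= r -> Rabs (u r) <= al) ->
  exists u' v', reg n f al u' v' /\ (forall r, 0 <= r -> Rabs (u' r) <= al) /\ frozen u' v'.
Proof.
intros Hal (h1 & h2 & h3 & h4 & h5) Hb.
destruct (classic (exists r, 0 <= r /\ u r = 0 /\ v r = 0)) as [(r1 & Hr1 & hu & hv)|Hno].
2: { exists u, v. split; [do 4 (split; auto)|split; auto].
     intros r s Hr a b. exfalso. apply Hno. exists r. lra. }
assert (Cc : forall r, 0 <= r -> continuous u r /\ continuous v r).
{ intros. destruct (Req_dec r 0) as [->|]; auto. apply (ode_cont n f 0 u v r); auto; lra. }
pose (m := fun r => Rabs (u r) + Rabs (v r)).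
destruct (first_below m 0 r1 0) as (rho & Hrho & Em & Hbel); auto.
- intros. destruct (Cc x LRA). apply (continuous_plus (fun r => Rabs (u r)) (fun r => Rabs (v r))).
  + apply (continuous_comp u Rabs); auto. apply (continuous_Rabs (u x)).
  + apply (continuous_comp v Rabs); auto. apply (continuous_Rabs (v x)).
- unfold m. rewrite h1, h2, Rabs_R0, Rabs_pos_eq; lra.
- unfold m. rewrite hu, hv, Rabs_R0. lra.
- assert (Z : u rho = 0 /\ v rho = 0).
  { unfold m in Em. pose proof (Rabs_pos (u rho)). pose proof (Rabs_pos (v rho)).
    split; apply Rabs_eq_0; lra. }
  destruct Z as [Zu Zv].
  pose (u' := fun r => if Rlt_dec r rho then u r else 0). pose (v' := fun r => if Rlt_dec r rho then v r else 0).
  assert (Ebef : forall r, r < rho -> u' r = u r /\ v' r = v r).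
  { intros. unfold u', v'. destruct (Rlt_dec r rho); [auto|lra]. }
  assert (Eaft : forall r, rho <= r -> u' r = 0 /\ v' r = 0).
  { intros. unfold u', v'. destruct (Rlt_dec r rho); [lra|auto]. }
  assert (Cut : forall (w w' : R -> R) (r l : R), (forall s, s < rho -> w' s = w s) -> r < rho -> is_derive w r l -> is_derive w' r l).
  { intros w w' r l E Hr Hd. apply (is_derive_ext_loc w); auto. exists (mkposreal (rho - r) LRA).
    intros y Hy. symmetry. apply E. unfold ball in Hy; simpl in Hy. unfold AbsRing_ball, abs, minus, plus, opp in Hy; simpl in Hy.
    apply Rabs_def2 in Hy. lra. }
  assert (CutA : forall (w' : R -> R) (r : R), (forall s, rho <= s -> w' s = 0) -> rho < r -> is_derive w' r 0).
  { intros w' r E Hr. apply (is_derive_ext_loc (fun _ => 0)); [|apply dconst]. exists (mkposreal (r - rho) LRA).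
    intros y Hy. symmetry. apply E. unfold ball in Hy; simpl in Hy. unfold AbsRing_ball, abs, minus, plus, opp in Hy; simpl in Hy.
    apply Rabs_def2 in Hy. lra. }
  assert (CutC : forall w w' : R -> R, (forall s, s < rho -> w' s = w s) -> continuous w 0 -> continuous w' 0).
  { intros w w' E Hc. apply (continuous_ext_loc _ w); auto. exists (mkposreal rho LRA).
    intros y Hy. symmetry. apply E. unfold ball in Hy; simpl in Hy. unfold AbsRing_ball, abs, minus, plus, opp in Hy; simpl in Hy.
    apply Rabs_def2 in Hy. lra. }
  exists u', v'. split; [|split].
  + split; [|split; [|split; [|split]]].
    * rewrite (proj1 (Ebef 0 LRA)); auto.
    * rewrite (proj2 (Ebef 0 LRA)); auto.
    * apply (CutC u u'); auto. intros; apply Ebef; auto.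
    * apply (CutC v v'); auto. intros; apply Ebef; auto.
    * intros r Hr. destruct (Rtotal_order r rho) as [Hl|[->|Hg]].
      -- destruct (Ebef r Hl) as [-> ->]. destruct (h5 r Hr). split.
         ++ apply (Cut u u'); auto. intros; apply Ebef; auto.
         ++ apply (Cut v v'); auto. intros; apply Ebef; auto.
      -- destruct (Eaft rho LRA) as [-> ->]. destruct (h5 rho Hr) as [d1 d2].
         rewrite Zv in d1. rewrite Zv, Zu, f_0 in d2. split.
         ++ apply (cut_derive u rho 0); auto.
         ++ eapply dval; [apply (cut_derive v rho 0); auto; eapply dval; [exact d2|ring]|]. rewrite f_0. ring.
      -- destruct (Eaft r LRA) as [-> ->]. split.
         ++ apply CutA; auto. intros; apply Eaft; auto.
         ++ eapply dval; [apply CutA; auto; intros; apply Eaft; auto|]. rewrite f_0. ring.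
  + intros. destruct (Rlt_le_dec r rho) as [l|l].
    * rewrite (proj1 (Ebef r l)). auto.
    * rewrite (proj1 (Eaft r l)), Rabs_R0. lra.
  + intros r s Hrs a b. destruct (Rlt_le_dec r rho) as [l|l].
    * destruct (Ebef r l) as [E1 E2]. rewrite E1 in a. rewrite E2 in b. exfalso.
      specialize (Hbel r LRA). unfold m in Hbel. rewrite a, b, Rabs_R0 in Hbel. lra.
    * apply Eaft. lra.
Qed.
End Exist.

(** * Uniqueness up to double zeros *)

(** The assumptions on $f$ alone, once it is extended to an odd continuous function on $\mathbb R$;
    [dl] is $\delta$. *)
Class problem := {
  n : nat;
  Hn : (1 <= n)%nat;
  f : R -> R;
  Hfc : forall x : R, continuous f x;
  Hfo : forall x, f (- x) = - f x;
  Hfl : forall x, x <> 0 -> loc_lip f x;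
  dl : R;
  Hdl : 0 < dl;
  HFneg : forall x, 0 < x < dl -> pot f x < 0 }.

Section Uniq.
Context {P : problem}.

Notation "'ν'" := (nu n).
Notation F := (pot f).

Lemma dF (x : R) : is_derive F x (f x).
Proof. apply pot_derive, Hfc. Qed.
Lemma F_cont (x : R) : continuous F x.
Proof. eapply is_derive_cont, dF. Qed.
Lemma F_0 : F 0 = 0.
Proof. apply pot_0. Qed.
Lemma F_even x : F (- x) = F x.
Proof. apply pot_even; [apply Hfc|apply Hfo]. Qed.
Lemma F_abs x : F (Rabs x) = F x.
Proof. apply pot_abs; [apply Hfc|apply Hfo]. Qed.
Lemma F_lip c B : (forall y, Rabs y <= c -> Rabs (f y) <= B) ->
  forall a b, Rabs a <= c -> Rabs b <= c -> Rabs (F a - F b) <= B * Rabs (a - b).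
Proof.
intros HB. assert (G : forall a b, a <= b -> Rabs a <= c -> Rabs b <= c -> Rabs (F b - F a) <= B * (b - a)).
{ intros a b Hab Ha Hb. apply (mvt_bound F f); auto.
  - intros; apply dF.
  - intros; apply F_cont.
  - intros. apply HB. apply Rabs_le_between in Ha. apply Rabs_le_between in Hb. apply Rabs_le; lra. }
intros. destruct (Rle_lt_dec a b).
- rewrite Rabs_minus_sym, (Rabs_minus_sym a), (Rabs_pos_eq (b - a)) by lra. auto.
- rewrite (Rabs_pos_eq (a - b)) by lra. apply G; lra.
Qed.

Lemma loc_lip_pos x : x <> 0 -> exists e L, 0 < e /\ 0 <= L /\
  forall y z, Rabs (y - x) < e -> Rabs (z - x) < e -> Rabs (f y - f z) <= L * Rabs (y - z).
Proof.
intros Hx. destruct (Hfl x Hx) as (e & L & He & HL). exists e, (Rabs L). split; auto. split; [apply Rabs_pos|].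
intros. eapply Rle_trans; [apply HL; auto|]. apply Rmult_le_compat_r; [apply Rabs_pos|apply Rle_abs].
Qed.

Lemma sq_zero a b : a ^ 2 + b ^ 2 <= 0 -> a = 0 /\ b = 0.
Proof. nra. Qed.

Lemma two_ab a b : - (a ^ 2 + b ^ 2) <= 2 * a * b <= a ^ 2 + b ^ 2.
Proof. pose proof (pow2_ge_0 (a - b)). pose proof (pow2_ge_0 (a + b)). lra. Qed.

Lemma two_abs a b : 2 * (Rabs a * Rabs b) <= a ^ 2 + b ^ 2.
Proof. rewrite <- (pow2_abs a), <- (pow2_abs b). pose proof (pow2_ge_0 (Rabs a - Rabs b)). lra. Qed.

(** Where $u\ne0$ the nonlinearity is Lipschitz, and Gronwall applies to the squared phase distance;
    the damping term has the good sign. *)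
Lemma local_uniq_u e u1 v1 u2 v2 s : 0 <= e -> e <= s -> ode n f e u1 v1 -> ode n f e u2 v2 ->
  continuous u1 s -> continuous v1 s -> continuous u2 s -> continuous v2 s ->
  u1 s = u2 s -> v1 s = v2 s -> u1 s <> 0 ->
  exists h, 0 < h /\ forall t, s <= t < s + h -> u1 t = u2 t /\ v1 t = v2 t.
Proof.
intros He Hs H1 H2 cu1 cv1 cu2 cv2 Eu Ev Hne.
destruct (loc_lip_pos _ Hne) as (d & L & Hd & HL0 & HL).
destruct (continuous_eps u1 s cu1 d Hd) as (d1 & Hd1 & h1).
destruct (continuous_eps u2 s cu2 d Hd) as (d2 & Hd2 & h2).
exists (Rmin d1 d2). split; [apply Rmin_glb_lt; auto|]. intros.
assert (t < s + d1) by (pose proof (Rmin_l d1 d2); lra).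
assert (t < s + d2) by (pose proof (Rmin_r d1 d2); lra).
assert (Hc : forall x, s <= x <= t -> continuous u1 x /\ continuous v1 x /\ continuous u2 x /\ continuous v2 x).
{ intros. destruct (Req_dec x s) as [->|]; auto.
  destruct (ode_cont n f e u1 v1 x H1 LRA). destruct (ode_cont n f e u2 v2 x H2 LRA). auto. }
assert (G : (u1 t - u2 t) ^ 2 + (v1 t - v2 t) ^ 2 <= ((u1 s - u2 s) ^ 2 + (v1 s - v2 s) ^ 2) * exp ((1 + L) * (t - s))).
{ apply (gronwall (fun x => (u1 x - u2 x) ^ 2 + (v1 x - v2 x) ^ 2)
   (fun x => 2 * (u1 x - u2 x) * (v1 x - v2 x) + 2 * (v1 x - v2 x) *
      (- (ν / x) * (v1 x - v2 x) - (f (u1 x) - f (u2 x))))); try lra.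
  - intros. destruct (H1 x LRA). destruct (H2 x LRA).
    eapply dval; [der|]. simpl. ring.
  - intros x Hx. destruct (Hc x Hx) as (c1 & c2 & c3 & c4).
    apply (continuous_plus (fun x => (u1 x - u2 x) ^ 2) (fun x => (v1 x - v2 x) ^ 2)).
    + apply (continuous_comp (fun x => u1 x - u2 x) (fun y => y ^ 2)).
      * apply (continuous_minus u1 u2); auto.
      * eapply is_derive_cont. der.
    + apply (continuous_comp (fun x => v1 x - v2 x) (fun y => y ^ 2)).
      * apply (continuous_minus v1 v2); auto.
      * eapply is_derive_cont. der.
  - intros. pose proof (h1 x ltac:(rewrite Rabs_pos_eq; lra)) as a1.
    pose proof (h2 x ltac:(rewrite Rabs_pos_eq; lra)) as a2. rewrite <- Eu in a2.
    pose proof (HL _ _ a1 a2).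
    set (p := u1 x - u2 x) in *. set (q := v1 x - v2 x) in *. set (w := f (u1 x) - f (u2 x)) in *.
    assert (0 <= ν / x) by (apply Rdiv_le_0_compat; [apply pos_INR|lra]).
    assert (T1 := two_ab p q).
    assert (- (2 * q * w) <= L * (p ^ 2 + q ^ 2)).
    { assert (- (2 * q * w) <= 2 * (Rabs q * Rabs w)).
      { rewrite <- Rabs_mult. pose proof (Rle_abs (- (q * w))). rewrite Rabs_Ropp in *. lra. }
      assert (Rabs q * Rabs w <= Rabs q * (L * Rabs p)) by (apply Rmult_le_compat_l; [apply Rabs_pos|auto]).
      pose proof (two_abs p q). nra. }
     nra. }
rewrite Eu, Ev, !Rminus_diag in G. replace (0 ^ 2 + 0 ^ 2) with 0 in G by ring. rewrite Rmult_0_l in G.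
apply sq_zero in G. lra.
Qed.

(** At a zero of $u$ the function $f$ may fail to be Lipschitz, but $F$ is Lipschitz. So $u$ is
    compared together with the energy instead of $v$: the relations $E'=-(\nu/r)v^2$ and
    $v^2=2(E-F(u))$ involve only $F$. Both velocities stay near $v(s)\ne0$, so the difference of
    their squares controls $v_1-v_2$. *)
Lemma local_uniq_v e u1 v1 u2 v2 s : 0 <= e -> e <= s -> 0 < s -> ode n f e u1 v1 -> ode n f e u2 v2 ->
  continuous u1 s -> continuous v1 s -> continuous u2 s -> continuous v2 s ->
  u1 s = u2 s -> v1 s = v2 s -> v1 s <> 0 ->
  exists h, 0 < h /\ forall t, s <= t < s + h -> u1 t = u2 t /\ v1 t = v2 t.
Proof.
intros He Hs Hs0 H1 H2 cu1 cv1 cu2 cv2 Eu Ev Hne.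
set (w := v1 s) in *. apply Rabs_pos_lt in Hne. set (m := Rabs w) in *.
destruct (continuous_eps v1 s cv1 (m/2) LRA) as (d1 & Hd1 & h1).
destruct (continuous_eps v2 s cv2 (m/2) LRA) as (d2 & Hd2 & h2).
destruct (continuous_eps u1 s cu1 1 Rlt_0_1) as (d3 & Hd3 & h3).
destruct (continuous_eps u2 s cu2 1 Rlt_0_1) as (d4 & Hd4 & h4).
pose (c := Rabs (u1 s) + 1).
destruct (f_bound f Hfc c) as (B & HB & hB). pose proof (F_lip c B hB) as HF.
pose (d := Rmin (Rmin d1 d2) (Rmin d3 d4)).
exists d. split; [unfold d; repeat apply Rmin_glb_lt; auto|]. intros.
assert (d <= d1 /\ d <= d2 /\ d <= d3 /\ d <= d4).
{ unfold d. pose proof (Rmin_l (Rmin d1 d2) (Rmin d3 d4)). pose proof (Rmin_r (Rmin d1 d2) (Rmin d3 d4)).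
  pose proof (Rmin_l d1 d2). pose proof (Rmin_r d1 d2). pose proof (Rmin_l d3 d4). pose proof (Rmin_r d3 d4). lra. }
assert (Hc : forall x, s <= x <= t -> continuous u1 x /\ continuous v1 x /\ continuous u2 x /\ continuous v2 x).
{ intros. destruct (Req_dec x s) as [->|]; auto.
  destruct (ode_cont n f e u1 v1 x H1 LRA). destruct (ode_cont n f e u2 v2 x H2 LRA). auto. }
pose (E1 := energy f u1 v1). pose (E2 := energy f u2 v2).
pose (K := (4 / m + 4 * (ν / s)) * (1 + B)).
assert (G : (u1 t - u2 t) ^ 2 + (E1 t - E2 t) ^ 2 <= ((u1 s - u2 s) ^ 2 + (E1 s - E2 s) ^ 2) * exp (K * (t - s))).
{ apply (gronwall (fun x => (u1 x - u2 x) ^ 2 + (E1 x - E2 x) ^ 2)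
   (fun x => 2 * (u1 x - u2 x) * (v1 x - v2 x) + 2 * (E1 x - E2 x) *
      (- (ν / x) * (v1 x ^ 2 - v2 x ^ 2)))); try lra.
  - intros. destruct (H1 x LRA). destruct (H2 x LRA).
    assert (is_derive E1 x (- (ν / x) * v1 x ^ 2)) by (apply (energy_derive n f e u1 v1 x Hfc He H1); lra).
    assert (is_derive E2 x (- (ν / x) * v2 x ^ 2)) by (apply (energy_derive n f e u2 v2 x Hfc He H2); lra).
    eapply dval; [der|]. simpl. ring.
  - intros x Hx. destruct (Hc x Hx) as (c1 & c2 & c3 & c4).
    apply (continuous_plus (fun x => (u1 x - u2 x) ^ 2) (fun x => (E1 x - E2 x) ^ 2)).
    + apply (continuous_comp (fun x => u1 x - u2 x) (fun y => y ^ 2)).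
      * apply (continuous_minus u1 u2); auto.
      * eapply is_derive_cont. der.
    + apply (continuous_comp (fun x => E1 x - E2 x) (fun y => y ^ 2)).
      * apply (continuous_minus E1 E2); apply energy_cont; auto using Hfc.
      * eapply is_derive_cont. der.
  - intros.
    assert (Rabs (x - s) < d) by (rewrite Rabs_pos_eq; lra).
    pose proof (h1 x LRA) as a1. pose proof (h2 x LRA) as a2.
    pose proof (h3 x LRA). pose proof (h4 x LRA) as a4. rewrite <- Eu in a4. fold w in a1. rewrite <- Ev in a2.
    assert (b1 : Rabs (u1 x) <= c).
    { replace (u1 x) with (u1 s + (u1 x - u1 s)) by ring. eapply Rle_trans; [apply Rabs_triang|]. unfold c; lra. }
    assert (b2 : Rabs (u2 x) <= c).
    { replace (u2 x) with (u1 s + (u2 x - u1 s)) by ring. eapply Rle_trans; [apply Rabs_triang|]. unfold c; lra. }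
    pose proof (HF _ _ b1 b2).
    set (p := u1 x - u2 x) in *. set (q := E1 x - E2 x).
    assert (Eq : v1 x ^ 2 - v2 x ^ 2 = 2 * (q - (F (u1 x) - F (u2 x)))).
    { unfold q, E1, E2, energy. field. }
    set (z := v1 x ^ 2 - v2 x ^ 2) in *.
    assert (Rabs z <= 2 * (Rabs q + B * Rabs p)).
    { rewrite Eq, Rabs_mult, (Rabs_pos_eq 2) by lra. assert (T := Rabs_triang q (- (F (u1 x) - F (u2 x)))).
      rewrite Rabs_Ropp in T. unfold Rminus at 1. lra. }
    assert (m <= Rabs (v1 x + v2 x)).
    { replace (v1 x + v2 x) with (2 * w - (- (v1 x - w) + - (v2 x - w))) by ring.
      eapply Rle_trans; [|apply Rabs_triang_inv]. assert (T := Rabs_triang (- (v1 x - w)) (- (v2 x - w))).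
      rewrite !Rabs_Ropp in T. rewrite Rabs_mult, (Rabs_pos_eq 2) by lra. fold m. lra. }
    assert (Rabs (v1 x - v2 x) <= 2 * (Rabs q + B * Rabs p) / m).
    { apply Rle_div_r; [lra|]. assert (Rabs z = Rabs (v1 x - v2 x) * Rabs (v1 x + v2 x)).
      { rewrite <- Rabs_mult. f_equal. unfold z. ring. }
      pose proof (Rabs_pos (v1 x - v2 x)). nra. }
    set (y := v1 x - v2 x) in *.
    pose proof (two_abs p q). set (D := p ^ 2 + q ^ 2) in *.
    assert (Rabs p * Rabs p <= D) by (unfold D; rewrite <- (pow2_abs p); pose proof (pow2_ge_0 q); simpl; lra).
    assert (Rabs q * Rabs q <= D) by (unfold D; rewrite <- (pow2_abs q); pose proof (pow2_ge_0 p); simpl; lra).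
    pose proof (Rabs_pos p). pose proof (Rabs_pos q).
    assert (2 * p * y <= 4 / m * (1 + B) * D).
    { apply Rle_trans with (2 * (Rabs p * Rabs y)).
      - rewrite <- Rabs_mult. pose proof (Rle_abs (p * y)). lra.
      - apply Rle_trans with (2 * (Rabs p * (2 * (Rabs q + B * Rabs p) / m))).
        + nra.
        + replace (2 * (Rabs p * (2 * (Rabs q + B * Rabs p) / m))) with (4 / m * (Rabs p * Rabs q + B * (Rabs p * Rabs p))) by (field; lra).
          rewrite Rmult_assoc. apply Rmult_le_compat_l; [apply Rdiv_le_0_compat; lra|]. nra. }
    assert (0 <= ν / x <= ν / s).
    { split; [apply Rdiv_le_0_compat; [apply pos_INR|lra]|]. apply Rmult_le_compat_l; [apply pos_INR|].
      apply Rinv_le_contravar; lra. }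
    assert (2 * q * (- (ν / x) * z) <= 4 * (ν / s) * (1 + B) * D).
    { apply Rle_trans with (2 * (ν / x) * (Rabs q * Rabs z)).
      - rewrite <- Rabs_mult. pose proof (Rle_abs (- (q * z))). rewrite Rabs_Ropp in *. nra.
      - assert (Rabs q * Rabs z <= 2 * (1 + B) * D) by nra.
        assert (0 <= Rabs q * Rabs z) by (apply Rmult_le_pos; [auto|apply Rabs_pos]).
        nra. }
    unfold K. nra. }
assert (EE : E1 s = E2 s). { unfold E1, E2, energy. rewrite Eu. fold w. nra. }
rewrite Eu, EE, !Rminus_diag in G. replace (0 ^ 2 + 0 ^ 2) with 0 in G by ring. rewrite Rmult_0_l in G.
apply sq_zero in G. destruct G as [g1 g2]. split; [lra|].
assert (v1 t ^ 2 = v2 t ^ 2).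
{ unfold E1, E2, energy in g2. replace (u1 t) with (u2 t) in g2 by lra. lra. }
assert (Rabs (t - s) < d) by (rewrite Rabs_pos_eq; lra).
pose proof (h1 t LRA) as a1. pose proof (h2 t LRA) as a2. fold w in a1. rewrite <- Ev in a2.
assert (Hz : (v1 t - v2 t) * (v1 t + v2 t) = 0) by lra.
apply Rmult_integral in Hz. destruct Hz as [Hz|Hz]; [lra|]. exfalso.
assert (Hw2 : Rabs (2 * w) < m). { replace (2 * w) with (- (v1 t - w) + - (v2 t - w)) by lra.
 eapply Rle_lt_trans; [apply Rabs_triang|]. rewrite !Rabs_Ropp. lra. }
rewrite Rabs_mult, (Rabs_pos_eq 2) in Hw2 by lra. fold m in Hw2. lra.
Qed.

(** Before a double zero one of the two local arguments applies at every time, and agreement passes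
    to limits. At the singular time $0$ the velocity vanishes, so the first argument is the one that
    applies there. *)
Lemma uniq e T u1 v1 u2 v2 : 0 <= e <= T -> (0 < e \/ v1 e = 0) -> ode n f e u1 v1 -> ode n f e u2 v2 ->
  continuous u1 e -> continuous v1 e -> continuous u2 e -> continuous v2 e -> u1 e = u2 e -> v1 e = v2 e ->
  (forall r, e <= r < T -> u1 r <> 0 \/ v1 r <> 0) ->
  forall r, e <= r <= T -> u1 r = u2 r /\ v1 r = v2 r.
Proof.
intros He He0 H1 H2 cu1 cv1 cu2 cv2 Eu Ev Hal.
assert (Hc : forall x, e <= x -> continuous u1 x /\ continuous v1 x /\ continuous u2 x /\ continuous v2 x).
{ intros. destruct (Req_dec x e) as [->|]; auto.
  destruct (ode_cont n f e u1 v1 x H1 LRA). destruct (ode_cont n f e u2 v2 x H2 LRA). auto. }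
apply (forward_induction (fun r => u1 r = u2 r /\ v1 r = v2 r)); [lra|auto| |].
- intros s Hs Hall. destruct (Hall s LRA). destruct (Hc s LRA) as (c1 & c2 & c3 & c4).
  destruct (Req_dec (u1 s) 0) as [z|z].
  + destruct (Hal s Hs) as [|z']; [tauto|].
    assert (0 < s). { destruct (Req_dec s e) as [->|]; [tauto|lra]. }
    destruct (local_uniq_v e u1 v1 u2 v2 s) as (h & Hh & hh); auto; try lra. exists h. auto.
  + destruct (local_uniq_u e u1 v1 u2 v2 s) as (h & Hh & hh); auto; try lra. exists h. auto.
- intros s Hs Hall. destruct (Hc s LRA) as (c1 & c2 & c3 & c4).
  assert (G : forall w1 w2 : R -> R, continuous w1 s -> continuous w2 s -> (forall t, e <= t < s -> w1 t = w2 t) -> w1 s = w2 s).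
  { intros w1 w2 k1 k2 k3. apply Rminus_diag_uniq. apply NNPP. intros Hne. apply Rabs_pos_lt in Hne.
    destruct (continuous_eps w1 s k1 (Rabs (w1 s - w2 s) / 2) LRA) as (d1 & Hd1 & h1).
    destruct (continuous_eps w2 s k2 (Rabs (w1 s - w2 s) / 2) LRA) as (d2 & Hd2 & h2).
    pose (t := Rmax e (s - Rmin d1 d2 / 2)).
    assert (0 < Rmin d1 d2) by (apply Rmin_glb_lt; auto). pose proof (Rmin_l d1 d2). pose proof (Rmin_r d1 d2).
    assert (e <= t < s) by (unfold t; split; [apply Rmax_l|apply Rmax_lub_lt; lra]).
    assert (s - Rmin d1 d2 / 2 <= t) by apply Rmax_r.
    specialize (h1 t ltac:(rewrite Rabs_left; lra)). specialize (h2 t ltac:(rewrite Rabs_left; lra)).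
    specialize (k3 t LRA). rewrite k3 in h1.
    assert (Rabs (w1 s - w2 s) < Rabs (w1 s - w2 s)); [|lra].
    replace (w1 s - w2 s) with (- (w2 t - w1 s) + (w2 t - w2 s)) at 1 by ring.
    eapply Rle_lt_trans; [apply Rabs_triang|]. rewrite Rabs_Ropp. lra. }
  split; apply G; auto; intros; apply Hall; auto.
Qed.

(** An equilibrium different from $0$ lies where $f$ is Lipschitz; Gronwall in both time directions
    propagates it to all $r>0$. *)
Lemma stationary u v r0 : ode n f 0 u v -> 0 < r0 -> v r0 = 0 -> f (u r0) = 0 -> u r0 <> 0 ->
  forall r, 0 < r -> u r = u r0 /\ v r = 0.
Proof.
intros H Hr0 Hv Hf Hne.
assert (Hc : forall x, 0 < x -> continuous u x /\ continuous v x) by (intros x Hx; apply (ode_cont n f 0 u v x H Hx)).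
set (x0 := u r0) in *.
apply (connected_right (fun r => u r = x0 /\ v r = 0) 0 r0); auto.
- intros r Hr [Eu Ev].
  destruct (loc_lip_pos _ Hne) as (d & L & Hd & HL0 & HL).
  destruct (continuous_eps u r (proj1 (Hc r Hr)) d Hd) as (d1 & Hd1 & h1).
  pose (h := Rmin d1 (r / 2)). assert (h <= d1) by apply Rmin_l. assert (h <= r / 2) by apply Rmin_r.
  exists h. split; [unfold h; apply Rmin_glb_lt; lra|]. intros s Hs.
  pose (D := fun t => (u t - x0) ^ 2 + v t ^ 2).
  pose (D' := fun t => 2 * (u t - x0) * v t + 2 * v t * (- (ν / t) * v t - f (u t))).
  pose (K := 1 + L + 4 * (ν / r)).
  assert (DD : forall t, 0 < t -> is_derive D t (D' t)).
  { intros t Ht. destruct (H t Ht). unfold D, D'. eapply dval; [der|]. simpl. ring. }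
  assert (DC : forall t, 0 < t -> continuous D t) by (intros t Ht; eapply is_derive_cont, DD, Ht).
  assert (DB : forall t, Rabs (t - r) < h -> - (K * D t) <= D' t <= K * D t).
  { intros t Ht. assert (Ht' := Ht). apply Rabs_def2 in Ht'.
    pose proof (h1 t LRA) as a1. rewrite Eu in a1.
    assert (Rabs (f (u t)) <= L * Rabs (u t - x0)).
    { replace (f (u t)) with (f (u t) - f x0) by lra. apply HL; auto. rewrite Rminus_diag, Rabs_R0; auto. }
    unfold D, D'. set (p := u t - x0) in *. set (q := v t). set (w := f (u t)) in *.
    assert (0 <= ν / t <= 2 * (ν / r)).
    { split; [apply Rdiv_le_0_compat; [apply pos_INR|lra]|]. replace (2 * (ν / r)) with (ν / (r / 2)) by (field; lra).
       apply Rmult_le_compat_l; [apply pos_INR|]. apply Rinv_le_contravar; lra. }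
    assert (T1 := two_ab p q).
    assert (T2 : Rabs (2 * q * w) <= L * (p ^ 2 + q ^ 2)).
    { rewrite !Rabs_mult, (Rabs_pos_eq 2) by lra. pose proof (two_abs p q).
      assert (Rabs q * Rabs w <= Rabs q * (L * Rabs p)) by (apply Rmult_le_compat_l; [apply Rabs_pos|auto]). nra. }
    apply Rabs_le_between in T2.
    assert (0 <= 2 * (ν / t) * q ^ 2 <= 4 * (ν / r) * (p ^ 2 + q ^ 2)) by nra.
    unfold K. lra. }
  assert (D0 : D r = 0) by (unfold D; rewrite Eu, Ev; ring).
  assert (Hs' := Hs). apply Rabs_def2 in Hs'.
  assert (Ds : D s <= 0).
  { destruct (Rle_lt_dec r s) as [l|l].
    - assert (G := gronwall D D' K r s l). rewrite D0 in G. rewrite Rmult_0_l in G. apply G.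
      + intros x Hx; apply DD; lra.
      + intros x Hx; apply DC; lra.
      + intros x Hx; apply DB; rewrite Rabs_pos_eq; lra.
    - assert (G := gronwall_rev D D' K s r LRA). rewrite D0 in G. rewrite Rmult_0_l in G. apply G.
      + intros x Hx; apply DD; lra.
      + intros x Hx; apply DC; lra.
      + intros x Hx; apply DB; rewrite Rabs_left; lra. }
   apply sq_zero in Ds. lra.
- intros r Hr Hcl. destruct (Hc r Hr) as [c1 c2].
  split; apply NNPP; intros Hn'.
  + assert (Hp : 0 < Rabs (u r - x0)) by (apply Rabs_pos_lt; lra).
    destruct (continuous_eps u r c1 _ Hp) as (d & Hd & h). destruct (Hcl d Hd) as (s & _ & hs & Es & _).
    specialize (h s hs). rewrite Es, Rabs_minus_sym in h. lra.
  + assert (Hp : 0 < Rabs (v r)) by (apply Rabs_pos_lt; lra).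
    destruct (continuous_eps v r c2 _ Hp) as (d & Hd & h). destruct (Hcl d Hd) as (s & _ & hs & _ & Es).
    specialize (h s hs). rewrite Es in h. unfold Rminus in h. rewrite Rplus_0_l, Rabs_Ropp in h. lra.
Qed.
End Uniq.

(** * The shooting family *)

Section Family.
Context {P : problem}.
Notation F := (pot f).

Definition adm (al : R) := 0 < al /\ 0 < f al.

Lemma fam_ex : exists U V : R -> R -> R, forall al, adm al ->
  reg n f al (U al) (V al) /\ (forall r, 0 <= r -> Rabs (U al r) <= al) /\ frozen (U al) (V al).
Proof.
apply (choose2 _ _ _ (fun al u v => adm al -> reg n f al u v /\ (forall r, 0 <= r -> Rabs (u r) <= al) /\ frozen u v)).
intros al. destruct (classic (adm al)) as [[H1 H2]|H].
- destruct (reg_exists n Hn f Hfc Hfo Hfl al H1 H2) as (u & v & h1 & h2).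
  destruct (freeze n f Hfo al u v H1 h1 h2) as (u' & v' & h). exists u', v'. auto.
- exists (fun _ => 0), (fun _ => 0). tauto.
Qed.

Definition U := proj1_sig (constructive_indefinite_description _ fam_ex).
Definition V := proj1_sig (constructive_indefinite_description _ (proj2_sig (constructive_indefinite_description _ fam_ex))).

Lemma fam al : adm al ->
  reg n f al (U al) (V al) /\ (forall r, 0 <= r -> Rabs (U al r) <= al) /\ frozen (U al) (V al).
Proof. exact (proj2_sig (constructive_indefinite_description _ (proj2_sig (constructive_indefinite_description _ fam_ex))) al). Qed.

Definition orbit_energy al := energy f (U al) (V al).
Notation E := orbit_energy.

Lemma U_0 al : adm al -> U al 0 = al.
Proof. intros. apply (fam al H). Qed.
Lemma V_0 al : adm al -> V al 0 = 0.
Proof. intros. apply (fam al H). Qed.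
Lemma U_ode al : adm al -> ode n f 0 (U al) (V al).
Proof. intros. apply (fam al H). Qed.
Lemma U_cont al r : adm al -> 0 <= r -> continuous (U al) r.
Proof.
intros. destruct (Req_dec r 0) as [->|]; [apply (fam al H)|].
exact (proj1 (ode_cont n f 0 (U al) (V al) r (U_ode al H) LRA)).
Qed.
Lemma V_cont al r : adm al -> 0 <= r -> continuous (V al) r.
Proof.
intros. destruct (Req_dec r 0) as [->|]; [apply (fam al H)|].
exact (proj2 (ode_cont n f 0 (U al) (V al) r (U_ode al H) LRA)).
Qed.
Lemma U_derive al r : adm al -> 0 < r -> is_derive (U al) r (V al r).
Proof. intros H Hr. apply (U_ode al H r Hr). Qed.
Lemma V_derive al r : adm al -> 0 < r -> is_derive (V al) r (- (nu n / r) * V al r - f (U al r)).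
Proof. intros H Hr. apply (U_ode al H r Hr). Qed.
Lemma E_cont al r : adm al -> 0 <= r -> continuous (E al) r.
Proof. intros. apply energy_cont; [apply Hfc|apply U_cont; auto|apply V_cont; auto]. Qed.
Lemma E_derive al r : adm al -> 0 < r -> is_derive (E al) r (- (nu n / r) * V al r ^ 2).
Proof. intros. apply (energy_derive n f 0); auto using Hfc, U_ode; lra. Qed.
Lemma E_decr al r1 r2 : adm al -> 0 <= r1 <= r2 -> E al r2 <= E al r1.
Proof.
intros. apply (energy_decr n Hn f 0); auto using Hfc, U_ode; try lra; [apply U_cont|apply V_cont]; auto; lra.
Qed.
Lemma U_bound al r : adm al -> 0 <= r -> Rabs (U al r) <= al.
Proof. intros. apply (fam al H); auto. Qed.
Lemma U_lt al r : adm al -> 0 < r -> Rabs (U al r) < al.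
Proof.
intros H Hr. rewrite <- (U_0 al H) at 2. pose proof (U_0 al H).
apply (amplitude n Hn f 0 (U al) (V al)); auto using Hfc, Hfo, U_ode, V_0; try lra.
- apply U_cont; auto; lra.
- apply V_cont; auto; lra.
- rewrite H0. apply H.
- rewrite H0. apply H.
Qed.
Lemma U_frozen al r s : adm al -> 0 <= r <= s -> U al r = 0 -> V al r = 0 -> U al s = 0 /\ V al s = 0.
Proof. intros H. apply (fam al H). Qed.
Lemma F_le_E al r : F (U al r) <= E al r.
Proof. unfold E, energy. nra. Qed.
Lemma E_0 al : adm al -> E al 0 = F al.
Proof. intros. unfold E, energy. rewrite U_0, V_0 by auto. lra. Qed.

(** An ultralimit of the solutions solves the limit problem, and [uniq] identifies it with the given
    solution up to a first double zero. Uniform Lipschitz bounds allow the observation times [rk] to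
    move. *)
Lemma cont_dep al a0 u v c rk rho : (forall k, adm (al k)) -> (forall k, al k <= c) -> ulim al a0 ->
  reg n f a0 u v -> 0 <= rho -> ulim rk rho -> (forall k : nat, 0 <= rk k) ->
  (forall r, 0 <= r < rho -> u r <> 0 \/ v r <> 0) ->
  ulim (fun k => U (al k) (rk k)) (u rho) /\ ulim (fun k => V (al k) (rk k)) (v rho).
Proof.
intros Had Hc Ha (R1 & R2 & R3 & R4 & R5) Hrho Hrk Hrk0 Hlive.
destruct (f_bound f Hfc c) as (B & HB & hB).
assert (Kb : forall k r1, forall r, 0 < r <= r1 -> Rabs (V (al k) r) <= B * r1 + (nu n + 1) * B /\
  Rabs (nu n / r * V (al k) r + f (U (al k) r)) <= B * r1 + (nu n + 1) * B).
{ intros. apply (reg_bounds n Hn f (al k) _ _ B c); auto.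
  - apply fam; auto.
  - intros. eapply Rle_trans; [apply U_bound; auto|auto]. }
destruct (compactness n (fun _ => f) f (fun k => U (al k)) (fun k => V (al k)) (fun _ => 0) al (fun _ => 0) 0 a0 0)
  as (u' & v' & q1 & q2 & q3 & q4 & q5 & q6); auto using ulim_const, Hfc; try lra.
- intros k; apply U_0; auto.
- intros k; apply V_0; auto.
- intros k; apply U_ode; auto.
- intros k; apply U_cont; auto; lra.
- intros k; apply V_cont; auto; lra.
- intros. eexists. apply Uf_all. intros k. apply Kb.
- intros. apply Uf_all. intros. rewrite Rminus_diag, Rabs_R0. lra.
- assert (Eq : forall r, 0 <= r <= rho -> u r = u' r /\ v r = v' r).
  { apply (uniq 0 rho u v u' v'); auto; try lra. }
  assert (L : ulim (fun k => U (al k) rho) (u rho) /\ ulim (fun k => V (al k) rho) (v rho)).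
  { destruct (Eq rho LRA) as [-> ->]. destruct (Req_dec rho 0) as [->|]; [|apply q6; lra].
    rewrite q2, q3. split.
    - apply (ulim_ext al); auto. apply Uf_all; intros; symmetry; apply U_0; auto.
    - apply (ulim_ext (fun _ => 0)); [|apply ulim_const]. apply Uf_all; intros; symmetry; apply V_0; auto. }
  destruct L. pose (K := B * (rho + 1) + (nu n + 1) * B).
  assert (0 <= K). { pose proof (pos_INR n). unfold K, nu. assert (0 <= B * (rho + 1)) by nra.
    assert (0 <= (INR n + 1) * B) by nra. lra. }
  assert (Lp : Uf (fun k => Rabs (U (al k) (rk k) - U (al k) rho) <= K * Rabs (rk k - rho) /\
                            Rabs (V (al k) (rk k) - V (al k) rho) <= K * Rabs (rk k - rho))).
  { apply (Uf_mono _ _ (ulim_lt rk rho (rho + 1) Hrk LRA)). intros k hk.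
    apply (ode_lip n f 0 (U (al k)) (V (al k)) K (rho + 1)); auto; try lra.
    - apply U_ode; auto.
    - apply U_cont; auto; lra.
    - apply V_cont; auto; lra.
    - apply Kb. }
  assert (G : forall x : nat -> R, forall (y : nat -> R) l, ulim y l -> Uf (fun k => Rabs (x k - y k) <= K * Rabs (rk k - rho)) -> ulim x l).
  { intros x y l Hy HK e He.
    assert (He2 : 0 < e / 2 / (K + 1)) by (apply Rdiv_lt_0_compat; lra).
    apply (Uf_mono _ _ (Uf_and3 _ _ _ HK (Hy (e/2) LRA) (Hrk _ He2))). intros k (k1 & k2 & k3).
    replace (x k - l) with ((x k - y k) + (y k - l)) by ring. eapply Rle_lt_trans; [apply Rabs_triang|].
    assert (K * Rabs (rk k - rho) <= e / 2); [|lra].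
    apply Rle_trans with ((K + 1) * (e / 2 / (K + 1))); [|right; field; lra].
    nra. }
  split; [apply (G _ (fun k => U (al k) rho))|apply (G _ (fun k => V (al k) rho))]; auto;
    apply (Uf_mono _ _ Lp); tauto.
Qed.

Fixpoint alt (u : R -> R) (s : R) (m : nat) (lo hi : R) : Prop :=
  match m with
  | O => True
  | S m' => exists r, lo < r <= hi /\ 0 < s * u r /\ alt u (- s) m' r hi
  end.

(* A limit of samples with v = 0 can vanish only at a double zero, so these alternations pass to limits. *)
Fixpoint calt (u v : R -> R) (s : R) (m : nat) (lo hi : R) : Prop :=
  match m with
  | O => True
  | S m' => exists r, lo < r <= hi /\ 0 < s * u r /\ (v r = 0 \/ r = hi) /\ calt u v (- s) m' r hi
  end.

Lemma alt_mono u m : forall s lo hi lo' hi', lo' <= lo -> hi <= hi' -> alt u s m lo hi -> alt u s m lo' hi'.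
Proof.
induction m as [|m IH]; intros s lo hi lo' hi' H1 H2; simpl; auto.
intros (r & Hr & Hs & Ha). exists r. split; [lra|]. split; auto. apply (IH _ r hi); auto; lra.
Qed.

Lemma alt_open (us : nat -> R -> R) u m : forall s lo hi,
  (forall r, lo < r <= hi -> ulim (fun k => us k r) (u r)) -> alt u s m lo hi ->
  Uf (fun k => alt (us k) s m lo hi).
Proof.
induction m as [|m IH]; intros s lo hi Hl; simpl; [intros _; apply Uf_all; auto|].
intros (r & Hr & Hs & Ha).
assert (L : ulim (fun k => us k r * s) (u r * s)) by (apply ulim_scal, Hl; auto).
apply (Uf_mono _ _ (Uf_and _ _ (ulim_gt _ _ 0 L LRA) (IH (- s) r hi ltac:(intros; apply Hl; lra) Ha))).
intros k [h1 h2]. exists r. split; auto. split; auto. lra.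
Qed.

(** Each sample is moved to a maximum point of $su$ between the previous and the next sample; this
    point is interior, hence critical, unless it is [hi]. *)
Lemma alt_calt u v m : forall s lo hi, (forall r, lo <= r -> continuous u r) ->
  (forall r, lo < r -> is_derive u r (v r)) -> s * s = 1 -> s * u lo <= 0 -> alt u s m lo hi -> calt u v s m lo hi.
Proof.
induction m as [|m IH]; intros s lo hi Hc Hd Hs2 Hlo; simpl; auto.
intros (r & Hr & Hs & Ha).
(* [top] is the next sample, where $su<0$, or [hi] if there is none. *)
assert (G : exists top, r <= top <= hi /\
   (top = hi /\ m = O \/ s * u top < 0 /\ forall x, x < top -> alt u (- s) m x hi)).
{ destruct m as [|m'].
  - exists hi. split; [lra|]. auto.
  - destruct Ha as (r2 & Hr2 & Hs2' & Ha2). exists r2. split; [lra|]. right. split; [lra|].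
    intros. exists r2. split; [lra|]. auto. }
destruct G as (top & Htop & Hend).
assert (Hcs : forall x, lo <= x -> continuous (fun x => s * u x) x).
{ intros. apply (continuous_mult (fun _ => s) u); [apply continuous_const|auto]. }
destruct (max_attained (fun x => s * u x) lo top LRA) as (t & Ht & Hm).
{ intros. apply Hcs; lra. }
 pose proof (Hm r LRA).
assert (t <> lo) by (intros ->; lra).
assert (Hcrit : t < top -> v t = 0).
{ intros. apply NNPP. intros.
  assert (Ds : is_derive (fun x => s * u x) t (s * v t)).
  { eapply dval; [apply (dmult (fun _ => s) u); [apply dconst|apply Hd; lra]|]. ring. }
  destruct (Rtotal_order (s * v t) 0) as [Hn'|[Hz|Hp]].
  - destruct (derive_neg_right _ _ _ Ds Hn') as (d & Hd0 & _ & h).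
    destruct (left_point lo t d) as (y & ? & ?); try lrn. specialize (h y LRA). specialize (Hm y LRA). lra.
  - nra.
  - destruct (derive_pos_right _ _ _ Ds Hp) as (d & Hd0 & h & _).
    destruct (right_point t top d) as (y & ? & ?); try lrn. specialize (h y LRA). specialize (Hm y LRA). lra. }
exists t. split; [lra|]. split; [lra|].
destruct Hend as [[Et Em]|[Hneg Hnext]].
- rewrite Em. simpl. lra.
- destruct (Req_dec t top) as [->|]; [lra|]. split; [left; apply Hcrit; lra|].
  apply IH; [intros; apply Hc; lra|intros; apply Hd; lra|rewrite <- Hs2; ring|lra|apply Hnext; lra].
Qed.

Lemma calt_lim (us vs : nat -> R -> R) u v hi m : forall s (lo : nat -> R) l,
  (forall rk rho, (forall k : nat, 0 <= rk k) -> ulim rk rho -> 0 <= rho <= hi ->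
     ulim (fun k => us k (rk k)) (u rho) /\ ulim (fun k => vs k (rk k)) (v rho)) ->
  (forall r, 0 <= r <= hi -> u r <> 0 \/ v r <> 0) -> u hi <> 0 ->
  (forall k, 0 <= lo k) -> ulim lo l -> s * u l <= 0 ->
  Uf (fun k => calt (us k) (vs k) s m (lo k) hi) -> alt u s m l hi.
Proof.
induction m as [|m IH]; intros s lo l Hconv Hlive Hhi Hlo0 Hlo Hs; simpl; auto. intros Hc.
assert (Hch : exists rk : nat -> R, forall k, 0 <= rk k /\ (calt (us k) (vs k) s (S m) (lo k) hi ->
   lo k < rk k <= hi /\ 0 < s * us k (rk k) /\ (vs k (rk k) = 0 \/ rk k = hi) /\ calt (us k) (vs k) (- s) m (rk k) hi)).
{ apply (choose1 _ _ (fun (k : nat) r => 0 <= r /\ (calt (us k) (vs k) s (S m) (lo k) hi ->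
   lo k < r <= hi /\ 0 < s * us k r /\ (vs k r = 0 \/ r = hi) /\ calt (us k) (vs k) (- s) m r hi))).
  intros. specialize (Hlo0 k). destruct (classic (calt (us k) (vs k) s (S m) (lo k) hi)) as [H|H].
  - destruct H as (r & h1 & h2). exists r. split; [lra|]. auto.
  - exists 0. split; [lra|]. tauto. }
destruct Hch as [rk Hrk].
assert (Hc' : Uf (fun k => lo k < rk k <= hi /\ 0 < s * us k (rk k) /\ (vs k (rk k) = 0 \/ rk k = hi) /\ calt (us k) (vs k) (- s) m (rk k) hi)).
{ apply (Uf_mono _ _ Hc). intros k hk. apply (Hrk k), hk. }
destruct (ulim_exists rk (Rabs hi)) as [rho Hrho].
{ apply (Uf_mono _ _ Hc'). intros k (h & _). specialize (Hlo0 k). rewrite !Rabs_pos_eq; lra. }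
assert (Hrho0 : 0 <= rho). { apply (ulim_le (fun _ => 0) rk); auto using ulim_const. apply Uf_all; intros; apply Hrk. }
assert (Hrhi : rho <= hi). { apply (ulim_le rk (fun _ => hi)); auto using ulim_const. apply (Uf_mono _ _ Hc'); intros k hk; apply hk. }
assert (Hlr : l <= rho). { apply (ulim_le lo rk); auto. apply (Uf_mono _ _ Hc'); intros k hk; lra. }
destruct (Hconv rk rho ltac:(intros; apply Hrk) Hrho LRA) as [Lu Lv].
assert (Sge : 0 <= s * u rho).
{ apply (ulim_le (fun _ => 0) (fun k => us k (rk k) * s)); auto using ulim_const.
  - rewrite Rmult_comm. apply ulim_scal; auto.
  - apply (Uf_mono _ _ Hc'). intros. lra. }
(* Unless the samples are eventually [hi], their velocities vanish, so $u=0$ in the limit would be a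
   double zero. *)
assert (u rho <> 0).
{ destruct (Uf_em (fun k => rk k = hi)) as [H|H].
  - replace rho with hi; auto. apply (ulim_unique (fun _ => hi)); [apply ulim_const|].
    apply (ulim_ext rk); auto.
  - assert (v rho = 0).
    { apply (ulim_unique (fun k => vs k (rk k))); auto. apply (ulim_ext (fun _ => 0)); [|apply ulim_const].
      apply (Uf_mono _ _ (Uf_and _ _ H Hc')). intros k [k1 (_ & _ & [k2|k2] & _)]; [auto|tauto]. }
    destruct (Hlive rho LRA); auto. }
assert (s <> 0). { intros ->. apply (Uf_out _ _ Hc'). intros k (_ & h & _). lra. }
assert (0 < s * u rho) by nra.
exists rho. split; [|split; auto].
- split; [|lra]. destruct (Req_dec l rho) as [->|]; lra.
- apply (IH (- s) rk); auto; [intros; apply Hrk|lra|]. apply (Uf_mono _ _ Hc'). intros k hk. apply hk.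
Qed.

Lemma alt_lim al a0 u v c hi m : (forall k, adm (al k)) -> (forall k, al k <= c) -> ulim al a0 -> 0 < a0 ->
  reg n f a0 u v -> 0 <= hi -> (forall r, 0 <= r <= hi -> u r <> 0 \/ v r <> 0) -> u hi <> 0 ->
  Uf (fun k => alt (U (al k)) (-1) m 0 hi) -> alt u (-1) m 0 hi.
Proof.
intros Had Hc Ha Ha0 HR Hhi Hlive Hu H.
apply (calt_lim (fun k => U (al k)) (fun k => V (al k)) u v hi m (-1) (fun _ => 0) 0); auto using ulim_const; try (intros; lra).
- intros. apply (cont_dep al a0 u v c); auto; try lra. intros. apply Hlive; lra.
- destruct HR as (-> & _). lra.
- apply (Uf_mono _ _ H). intros k hk. apply alt_calt; auto; try (intros; lra).
  + intros. apply U_cont; auto.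
  + intros. apply U_derive; auto.
  + rewrite U_0 by auto. destruct (Had k). lra.
Qed.

(* Sign alternations replace zeros of the solution: the condition is open in the initial value. *)
Definition W (m : nat) (al : R) := exists hi, alt (U al) (-1) m 0 hi.

Lemma W_pred m al : W (S m) al -> W m al.
Proof.
intros [hi H]. exists hi. revert H. generalize (-1) 0. induction m as [|m IH]; intros s lo; [simpl; auto|].
intros (r & h1 & h2 & h3). exists r. auto.
Qed.

Lemma W_le m m' al : (m <= m')%nat -> W m' al -> W m al.
Proof. induction 1; auto. intros H'. apply IHle, W_pred, H'. Qed.

Lemma min_of_list (l : list R) : l <> nil -> exists z, In z l /\ forall y, In y l -> z <= y.
Proof.
induction l as [|a l IH]; [tauto|]. intros. destruct l as [|b l].
- exists a. split; [left; auto|]. intros y [->|[]]. lra.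
- destruct IH as (z & h1 & h2); [discriminate|]. destruct (Rle_lt_dec a z).
  + exists a. split; [left; auto|]. intros y [->|Hy]; [lra|]. specialize (h2 y Hy). lra.
  + exists z. split; [right; auto|]. intros y [->|Hy]; [lra|]. auto.
Qed.

(** The zeros are simple: a sample of sign [s] lies just before or just after the smallest one,
    depending on the sign of the velocity there, and before all the others. *)
Lemma zeros_alt u v m : forall (l : list R) s lo, length l = m -> NoDup l ->
  (forall r, lo <= r -> continuous u r) -> (forall r, lo < r -> is_derive u r (v r)) ->
  (forall z, In z l -> lo < z /\ u z = 0 /\ v z <> 0) -> s * s = 1 -> s * u lo < 0 ->
  exists hi, alt u s m lo hi.
Proof.
induction m as [|m IH]; intros l s lo Hlen Hnd Hc Hd Hz Hs Hlo; [exists 0; simpl; auto|].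
destruct (min_of_list l) as (z & Hzin & Hmin). { intros ->. discriminate. }
destruct (in_split z l Hzin) as (l1 & l2 & El). subst l.
pose proof (NoDup_remove_1 _ _ _ Hnd). pose proof (NoDup_remove_2 _ _ _ Hnd).
assert (Hin' : forall y, In y (l1 ++ l2) -> In y (l1 ++ z :: l2) /\ z < y).
{ intros y Hy. assert (Hy' : In y (l1 ++ z :: l2)) by (apply in_app_iff in Hy; apply in_app_iff; simpl; tauto).
  split; auto. specialize (Hmin y Hy'). destruct (Req_dec z y) as [->|]; [tauto|lra]. }
destruct (Hz z Hzin) as (Hz1 & Hz2 & Hz3).
assert (G : exists r, lo < r /\ 0 < s * u r /\ forall y, In y (l1 ++ l2) -> r < y).
{ assert (Ds : is_derive (fun x => s * u x) z (s * v z)).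
  { eapply dval; [apply (dmult (fun _ => s) u); [apply dconst|apply Hd; lra]|]. ring. }
  destruct (Rtotal_order (s * v z) 0) as [Hneg|[Hzz|Hp]].
  - destruct (derive_neg_right _ _ _ Ds Hneg) as (d & Hd0 & _ & h). rewrite Hz2 in h.
    pose (y := Rmax ((lo + z) / 2) (z - d / 2)).
    assert ((lo + z) / 2 <= y < z) by (unfold y; split; [apply Rmax_l|apply Rmax_lub_lt; lra]).
    assert (z - d / 2 <= y) by apply Rmax_r. exists y. specialize (h y LRA).
    split; [lra|]. split; [lra|]. intros y' Hy'. destruct (Hin' y' Hy'). lra.
  - nra.
  - destruct (derive_pos_right _ _ _ Ds Hp) as (d & Hd0 & h & _). rewrite Hz2 in h.
    destruct (classic (l1 ++ l2 = nil)) as [E|E].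
    + exists (z + d / 2). specialize (h (z + d / 2) LRA). split; [lra|]. split; [lra|]. rewrite E. simpl. tauto.
    + destruct (min_of_list _ E) as (z' & Hz' & Hmin'). destruct (Hin' z' Hz').
      pose (y := Rmin (z + d / 2) ((z + z') / 2)). assert (z < y <= z + d / 2) by (unfold y; split; [apply Rmin_glb_lt; lra|apply Rmin_l]).
      assert (y <= (z + z') / 2) by apply Rmin_r. exists y. specialize (h y LRA).
      split; [lra|]. split; [lra|]. intros y' Hy'. specialize (Hmin' y' Hy'). lra. }
destruct G as (r & Hr & Hsr & Hrl).
destruct (IH (l1 ++ l2) (- s) r) as [hi Hhi]; auto.
- rewrite length_app in *. simpl in Hlen. lia.
- intros x Hx; apply Hc; lra.
- intros x Hx; apply Hd; lra.
- intros y Hy. destruct (Hin' y Hy) as [h1 h2]. destruct (Hz y h1) as (_ & h3). auto.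
- lra.
- lra.
- exists (Rmax hi r). exists r. split; [split; [auto|apply Rmax_r]|]. split; auto.
  apply (alt_mono u m _ r hi); auto; [lra|apply Rmax_l].
Qed.

Lemma alt_zeros u v m : forall s lo hi, 0 <= lo -> frozen u v -> (forall r, lo <= r -> continuous u r) ->
  s * u lo < 0 -> alt u s m lo hi ->
  exists l, length l = m /\ NoDup l /\ forall z, In z l -> lo < z /\ u z = 0 /\ v z <> 0.
Proof.
induction m as [|m IH]; intros s lo hi Hlo0 Hfr Hc Hlo.
- intros. exists nil. split; auto. split; [constructor|]. simpl; tauto.
- intros (r & Hr & Hs & Ha).
  destruct (IH (- s) r hi) as (l & h1 & h2 & h3); auto; try lra. { intros x Hx; apply Hc; lra. }
  destruct (ivt_up (fun x => s * u x) lo r 0) as (z & Hz & Ez); try lra.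
  { intros. apply (continuous_mult (fun _ => s) u); [apply continuous_const|apply Hc; lra]. }
  assert (s <> 0) by nra.
  assert (Uz : u z = 0). { nra. }
  assert (lo <> z) by (intros ->; lra).
  exists (z :: l). split; [simpl; auto|]. split.
  + constructor; auto. intros Hin. destruct (h3 z Hin). lra.
  + intros y [<-|Hy].
    * split; [lra|]. split; auto. intros Vz. destruct (Hfr z r LRA Uz Vz). nra.
    * destruct (h3 y Hy) as (q1 & q2). lra.
Qed.

Lemma zeros_W l al : adm al -> NoDup l -> (forall z, In z l -> 0 < z /\ U al z = 0 /\ V al z <> 0) -> W (length l) al.
Proof.
intros. apply (zeros_alt (U al) (V al) (length l) l); auto; try lra.
- intros; apply U_cont; auto.
- intros; apply U_derive; auto.
- rewrite U_0 by auto. destruct H. lra.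
Qed.

(** A further simple zero would give [S k] alternations, so the [k] zeros found are all of them. *)
Lemma W_zeros k al : adm al -> W k al -> ~ W (S k) al ->
  exists l, length l = k /\ NoDup l /\ forall z, In z l <-> 0 < z /\ U al z = 0 /\ V al z <> 0.
Proof.
intros H [hi Hk] Hn.
destruct (alt_zeros (U al) (V al) k (-1) 0 hi) as (l & h1 & h2 & h3); auto; try lra.
- apply fam; auto.
- intros; apply U_cont; auto.
- rewrite U_0 by auto. destruct H. lra.
- exists l. split; auto. split; auto. intros r. split; [apply h3|]. intros.
  apply NNPP. intros Hnin. apply Hn. rewrite <- h1. change (S (length l)) with (length (r :: l)).
  apply zeros_W; auto.
  + constructor; auto.
  + intros z [<-|Hz]; [auto|apply h3; auto].
Qed.

(** Sign changes are exactly the simple zeros: continuity excludes them where $u\ne0$, and freezing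
    excludes them at a double zero. *)
Lemma W_sign_changes k al : adm al -> W k al -> ~ W (S k) al -> n_sign_changes (U al) k.
Proof.
intros H Hk Hn. destruct (W_zeros k al H Hk Hn) as (l & h1 & h2 & h3).
exists l. split; auto. split; auto. intros. split.
  + intros [Hr (e & He & Hs)].
    assert (Ur : U al r = 0).
    { apply NNPP. intros. destruct (Rtotal_order (U al r) 0) as [Hl|[Hz|Hg]]; [|tauto|].
      - destruct (cont_lt_near _ r 0 (U_cont al r H LRA) Hl) as (d & Hd & h).
        assert (0 < Rmin d e) by (apply Rmin_glb_lt; auto). pose proof (Rmin_l d e). pose proof (Rmin_r d e).
        pose proof (h (r - Rmin d e / 2) ltac:(rewrite Rabs_left; lra)). pose proof (h (r + Rmin d e / 2) ltac:(rewrite Rabs_pos_eq; lra)).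
        destruct Hs as [[s1 s2]|[s1 s2]]; [specialize (s1 (r - Rmin d e / 2) LRA)|specialize (s2 (r + Rmin d e / 2) LRA)]; lra.
      - destruct (cont_gt_near _ r 0 (U_cont al r H LRA) Hg) as (d & Hd & h).
        assert (0 < Rmin d e) by (apply Rmin_glb_lt; auto). pose proof (Rmin_l d e). pose proof (Rmin_r d e).
        pose proof (h (r - Rmin d e / 2) ltac:(rewrite Rabs_left; lra)). pose proof (h (r + Rmin d e / 2) ltac:(rewrite Rabs_pos_eq; lra)).
        destruct Hs as [[s1 s2]|[s1 s2]]; [specialize (s2 (r + Rmin d e / 2) LRA)|specialize (s1 (r - Rmin d e / 2) LRA)]; lra. }
    assert (V al r <> 0).
    { intros Vr. destruct (U_frozen al r (r + e / 2) H LRA Ur Vr).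
      destruct Hs as [[s1 s2]|[s1 s2]]; specialize (s2 (r + e / 2) LRA); lra. }
    apply h3. lra.
  + intros Hin. destruct (proj1 (h3 r) Hin) as (r1 & r2 & r3). split; auto.
    pose proof (U_derive al r H r1) as D.
    destruct (Rtotal_order (V al r) 0) as [Hl|[Hz|Hg]]; [|tauto|].
    * destruct (derive_neg_right _ _ _ D Hl) as (d & Hd & q1 & q2). rewrite r2 in *. exists d. auto.
    * destruct (derive_pos_right _ _ _ D Hg) as (d & Hd & q1 & q2). rewrite r2 in *. exists d. auto.
Qed.
End Family.

(** * Behaviour at infinity *)

Definition tends (h : R -> R) (l : R) := forall e, 0 < e -> exists R0, forall r, R0 <= r -> Rabs (h r - l) < e.

Lemma tends_comp (g h : R -> R) l : continuous g l -> tends h l -> tends (fun r => g (h r)) (g l).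
Proof.
intros Hg Hh e He. destruct (continuous_eps g l Hg e He) as (d & Hd & hd). destruct (Hh d Hd) as [R0 H0].
exists R0. auto.
Qed.
Lemma tends_plus (g h : R -> R) l m : tends g l -> tends h m -> tends (fun r => g r + h r) (l + m).
Proof.
intros Hg Hh e He. destruct (Hg (e/2) LRA) as [R0 H0]. destruct (Hh (e/2) LRA) as [R1 H1].
exists (Rmax R0 R1). intros. pose proof (Rmax_l R0 R1). pose proof (Rmax_r R0 R1).
specialize (H0 r LRA). specialize (H1 r LRA).
apply Rabs_def2 in H0. apply Rabs_def2 in H1. apply Rabs_def1; lra.
Qed.
Lemma tends_opp (h : R -> R) l : tends h l -> tends (fun r => - h r) (- l).
Proof.
intros Hh e He. destruct (Hh e He) as [R0 H0]. exists R0. intros.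
replace (- h r - - l) with (- (h r - l)) by ring. rewrite Rabs_Ropp. auto.
Qed.
Lemma tends_ext (g h : R -> R) l R0 : (forall r, R0 <= r -> g r = h r) -> tends g l -> tends h l.
Proof.
intros E H e He. destruct (H e He) as [R1 H1]. exists (Rmax R0 R1). intros.
pose proof (Rmax_l R0 R1). pose proof (Rmax_r R0 R1). rewrite <- E by lra. apply H1; lra.
Qed.
Lemma tends_le (g : R -> R) l c R0 : (forall r, R0 <= r -> g r <= c) -> tends g l -> l <= c.
Proof.
intros E H. apply Rnot_lt_le. intros Hlt. destruct (H (l - c) LRA) as [R1 H1].
pose proof (Rmax_l R0 R1). pose proof (Rmax_r R0 R1).
specialize (E (Rmax R0 R1) LRA). specialize (H1 (Rmax R0 R1) LRA). apply Rabs_def2 in H1. lra.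
Qed.
Lemma tends_ge (g : R -> R) l c R0 : (forall r, R0 <= r -> c <= g r) -> tends g l -> c <= l.
Proof.
intros E H. cut (- l <= - c); [lra|]. apply (tends_le (fun r => - g r) _ _ R0).
- intros r Hr. specialize (E r Hr). lra.
- apply tends_opp; auto.
Qed.
Lemma tends_lt (g : R -> R) l c : tends g l -> l < c -> exists R0, forall r, R0 <= r -> g r < c.
Proof.
intros H Hl. destruct (H (c - l) LRA) as [R0 H0]. exists R0. intros r Hr. specialize (H0 r Hr).
apply Rabs_def2 in H0. lra.
Qed.
Lemma tends_gt (g : R -> R) l c : tends g l -> c < l -> exists R0, forall r, R0 <= r -> c < g r.
Proof.
intros H Hl. destruct (H (l - c) LRA) as [R0 H0]. exists R0. intros r Hr. specialize (H0 r Hr).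
apply Rabs_def2 in H0. lra.
Qed.

Lemma decr_tends (h : R -> R) R0 c : (forall r s, R0 <= r <= s -> h s <= h r) -> (forall r, R0 <= r -> c <= h r) ->
  exists l, tends h l /\ forall r, R0 <= r -> l <= h r.
Proof.
intros Hd Hb.
destruct (completeness (fun x => exists r, R0 <= r /\ x = - h r)) as [m [Hub Hl]].
- exists (- c). intros x (r & Hr & ->). specialize (Hb r Hr). lra.
- exists (- h R0), R0. lra.
- assert (G : forall r, R0 <= r -> - m <= h r).
  { intros. assert (- h r <= m); [|lra]. apply Hub. exists r. auto. }
  exists (- m). split; auto. intros e He.
  destruct (classic (exists r, R0 <= r /\ h r < - m + e)) as [(r & Hr & hr)|Hno].
  + exists r. intros s Hs. specialize (Hd r s LRA). specialize (G s LRA). apply Rabs_def1; lra.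
  + exfalso. assert (m <= m - e); [|lra]. apply Hl. intros x (r & Hr & ->).
    apply Rnot_lt_le. intros Hlt. apply Hno. exists r. lra.
Qed.

Lemma deriv_tends_0 (h h' : R -> R) R0 B c : (forall r, R0 <= r -> is_derive h r (h' r)) ->
  (forall r, R0 <= r -> Rabs (h r) <= B) -> tends h' c -> c = 0.
Proof.
intros Hd Hb Ht. apply NNPP. intros Hc. apply Rabs_pos_lt in Hc.
destruct (Ht (Rabs c / 2) LRA) as [R1 H1].
pose (a := Rmax R0 R1). pose proof (Rmax_l R0 R1). pose proof (Rmax_r R0 R1). fold a in H, H0.
pose (T := (2 * B + 1) / (Rabs c / 2)).
assert (0 <= B). { specialize (Hb a LRA). pose proof (Rabs_pos (h a)). lra. }
assert (0 < T) by (apply Rdiv_lt_0_compat; lra).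
destruct (mvt h h' a (a + T) LRA) as (x & Hx & E).
- intros. apply Hd; lra.
- intros. eapply is_derive_cont, Hd; lra.
- specialize (H1 x LRA). pose proof (Hb a LRA). pose proof (Hb (a + T) LRA).
  replace (a + T - a) with T in E by ring.
  assert (A1 : Rabs (h' x * T) <= 2 * B).
  { rewrite <- E. eapply Rle_trans; [apply Rabs_triang|]. rewrite Rabs_Ropp. lra. }
  rewrite Rabs_mult, (Rabs_pos_eq T) in A1 by lra.
  assert (Rabs c / 2 <= Rabs (h' x)).
  { pose proof (Rabs_triang_inv c (c - h' x)). replace (c - (c - h' x)) with (h' x) in * by ring.
    rewrite (Rabs_minus_sym c) in *. lra. }
  assert (Rabs c / 2 * T = 2 * B + 1) by (unfold T; field; lra).
  nra.
Qed.

Section Limits.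
Context {P : problem}.
Notation F := (pot f).
Notation E := orbit_energy.

(** Since $F(U)\le E$ and $E$ decreases, a level of $F$ above the present energy remains a barrier
    for ever. *)
Lemma no_cross al r0 x r : adm al -> 0 <= r0 <= r -> 0 <= x -> E al r0 < F x -> Rabs (U al r) <> x.
Proof.
intros H Hr Hx HE Eq. pose proof (E_decr al r0 r H Hr). pose proof (F_le_E al r).
rewrite <- (F_abs (U al r)), Eq in *. lra.
Qed.

Lemma absU_cont al r : adm al -> 0 <= r -> continuous (fun r => Rabs (U al r)) r.
Proof.
intros. apply (continuous_comp (U al) Rabs); [apply U_cont; auto|apply (continuous_Rabs (U al r))].
Qed.

Lemma trap_out al r0 x r : adm al -> 0 <= r0 <= r -> 0 <= x -> E al r0 < F x -> x < Rabs (U al r0) -> x < Rabs (U al r).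
Proof.
intros. apply Rnot_le_lt. intros Hle.
destruct (ivt_down (fun s => Rabs (U al s)) r0 r x) as (s & Hs & Es); try lra.
- intros. apply absU_cont; auto; lra.
- apply (no_cross al r0 x s); auto; lra.
Qed.

Lemma trap_in al r0 x r : adm al -> 0 <= r0 <= r -> 0 <= x -> E al r0 < F x -> Rabs (U al r0) < x -> Rabs (U al r) < x.
Proof.
intros. apply Rnot_le_lt. intros Hle.
destruct (ivt_up (fun s => Rabs (U al s)) r0 r x) as (s & Hs & Es); try lra.
- intros. apply absU_cont; auto; lra.
- apply (no_cross al r0 x s); auto; lra.
Qed.

Lemma const_sign (u : R -> R) r0 r : r0 <= r -> (forall s, r0 <= s -> continuous u s) ->
  (forall s, r0 <= s <= r -> u s <> 0) -> 0 < u r0 * u r.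
Proof.
intros Hr Hc Hn. destruct (Rlt_le_dec 0 (u r0 * u r)); auto. exfalso.
assert (a := Hn r0 LRA).
destruct (Rlt_le_dec 0 (u r0)) as [l|l].
- destruct (ivt_down u r0 r 0) as (s & Hs & Es); auto; [intros; apply Hc; lra|nra|]. apply (Hn s); auto.
- destruct (ivt_up u r0 r 0) as (s & Hs & Es); auto; [intros; apply Hc; lra|nra|]. apply (Hn s); auto.
Qed.

(** A barrier at [x] separates the solution from $0$, so its sign is settled from time [r] on. *)
Definition trapped (al r : R) := exists x, 0 <= x < Rabs (U al r) /\ E al r < F x.

Lemma trapped_sign al r s : adm al -> 0 <= r <= s -> trapped al r -> 0 < U al r * U al s.
Proof.
intros H Hrs (x & Hx & HE). apply const_sign; [lra|intros; apply U_cont; auto; lra|].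
intros t Ht E0. pose proof (trap_out al r x t H LRA LRA HE LRA) as Q. rewrite E0, Rabs_R0 in Q. lra.
Qed.

Lemma same_sign s a b : 0 < a * b -> 0 < s * b -> 0 < s * a.
Proof.
nra.
Qed.

(** At most one sample lies beyond [R0], and it may be moved to [R0]; so alternations can be tested
    on a compact interval. *)
Lemma alt_cut u m : forall s lo hi R0, lo < R0 -> (forall x, R0 <= x -> 0 < u R0 * u x) ->
  alt u s m lo hi -> alt u s m lo R0.
Proof.
induction m as [|m IH]; intros s lo hi R0 Hlo Hc; simpl; auto.
intros (r & Hr & Hs & Ha). destruct (Rlt_le_dec r R0) as [l|l].
- exists r. split; [lra|]. split; auto. apply (IH _ _ hi); auto.
- assert (m = O) as ->.
  { destruct m as [|m']; auto. destruct Ha as (r2 & Hr2 & Hs2 & _). exfalso.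
    pose proof (same_sign _ _ _ (Hc r l) Hs). pose proof (same_sign _ _ _ (Hc r2 LRA) Hs2). lra. }
  exists R0. split; [lra|]. split; [|simpl; auto].
  apply (same_sign s (u R0) (u r)); auto.
Qed.

Lemma W_after al m R0 : 0 < R0 -> (forall x, R0 <= x -> 0 < U al R0 * U al x) -> W m al -> alt (U al) (-1) m 0 R0.
Proof. intros H1 H2 [hi H]. apply (alt_cut _ _ _ _ hi); auto. Qed.

Lemma live_before al r s : adm al -> 0 <= s <= r -> U al r <> 0 \/ V al r <> 0 -> U al s <> 0 \/ V al s <> 0.
Proof.
intros H Hs Hr. destruct (Req_dec (U al s) 0) as [a|a]; auto. destruct (Req_dec (V al s) 0) as [b|b]; auto.
exfalso. destruct (U_frozen al s r H Hs a b). tauto.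
Qed.

Lemma U_cd al a c r : (forall k : nat, adm (al k)) -> (forall k, al k <= c) -> ulim al a -> adm a -> 0 <= r ->
  U a r <> 0 \/ V a r <> 0 -> ulim (fun k => U (al k) r) (U a r) /\ ulim (fun k => V (al k) r) (V a r).
Proof.
intros.
apply (cont_dep al a (U a) (V a) c (fun _ => r) r); auto using ulim_const.
- apply fam; auto.
- intros. apply (live_before a r); auto; lra.
Qed.

Lemma E_cd al a c r : (forall k : nat, adm (al k)) -> (forall k, al k <= c) -> ulim al a -> adm a -> 0 <= r ->
  U a r <> 0 \/ V a r <> 0 -> ulim (fun k => E (al k) r) (E a r).
Proof.
intros Had Hc Ha Haa Hr Hl. destruct (U_cd al a c r Had Hc Ha Haa Hr Hl).
 apply ulim_plus.
- apply (ulim_comp (fun y => y ^ 2 / 2)); auto. unfold Rdiv. eapply is_derive_cont. der.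
- apply (ulim_comp F); auto. apply F_cont.
Qed.

Lemma W_open m al a c : (forall k : nat, adm (al k)) -> (forall k, al k <= c) -> ulim al a -> adm a ->
  W m a -> Uf (fun k => W m (al k)).
Proof.
intros Had Hc Ha Haa [hi H].
(* The last sample can serve as right end; $u\ne0$ there, so no double zero has occurred before. *)
assert (G : exists hi', alt (U a) (-1) m 0 hi' /\ (m = O \/ U a hi' <> 0)).
{ assert (Gen : forall s lo, alt (U a) s m lo hi -> exists hi', alt (U a) s m lo hi' /\ (m = O \/ U a hi' <> 0)); [|apply Gen, H].
  clear H. induction m as [|m IH]; intros s lo.
  - intros. exists 0. simpl. auto.
  - intros (r & Hr & Hs & Hal). destruct (IH _ _ Hal) as (hi' & h1 & h2).
    exists (match m with O => r | _ => hi' end). destruct m as [|m'].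
    + split; [|right; intros E0; rewrite E0 in Hs; lra]. exists r. split; [lra|]. auto.
    + split; [|right; destruct h2; [discriminate|auto]]. exists r. split; [|split; auto].
      destruct h1 as (r2 & Hr2 & _). lra. }
destruct G as (hi' & h1 & h2). destruct m as [|m]; [apply Uf_all; intros; exists 0; simpl; auto|].
destruct h2 as [h2|h2]; [discriminate|].
apply (Uf_mono _ _ (alt_open (fun k => U (al k)) (U a) (S m) (-1) 0 hi'
  ltac:(intros r Hr; apply (U_cd al a c r); auto; [lra|apply (live_before a hi'); auto; lra]) h1)).
intros. exists hi'. auto.
Qed.

(** Being trapped is open and confines all alternations to $(0,r]$, where they pass to the limit. So
    the count cannot jump up near a trapped solution. *)
Lemma trapped_open al a c r m : (forall k : nat, adm (al k)) -> (forall k, al k <= c) -> ulim al a -> adm a ->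
  0 < r -> trapped a r -> ~ W m a -> Uf (fun k => trapped (al k) r /\ ~ W m (al k)).
Proof.
intros Had Hc Ha Haa Hr (x & Hx & HE) Hn.
assert (U a r <> 0) by (intros E0; rewrite E0, Rabs_R0 in Hx; lra).
destruct (U_cd al a c r Had Hc Ha Haa LRA ltac:(auto)).
pose proof (E_cd al a c r Had Hc Ha Haa LRA ltac:(auto)) as L2.
assert (L3 : ulim (fun k => Rabs (U (al k) r)) (Rabs (U a r))).
{ apply (ulim_comp Rabs); auto. apply (continuous_Rabs (U a r)). }
assert (T : Uf (fun k => trapped (al k) r)).
{ apply (Uf_mono _ _ (Uf_and _ _ (ulim_gt _ _ x L3 LRA) (ulim_lt _ _ _ L2 HE))).
  intros k [k1 k2]. exists x. lra. }
destruct (Uf_em (fun k => W m (al k))) as [HW|HW]; [|apply (Uf_and _ _ T HW)].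
exfalso. apply Hn. exists r.
apply (alt_lim al a (U a) (V a) c r m); auto; try lra.
- apply Haa.
- apply fam; auto.
- intros. apply (live_before a r); auto.
- apply (Uf_mono _ _ (Uf_and _ _ T HW)). intros k [k1 k2]. apply W_after; auto.
  intros s Hs. apply (trapped_sign (al k) r s); auto; lra.
Qed.

Definition live al := forall r, 0 <= r -> U al r <> 0 \/ V al r <> 0.

Lemma max_of_list (l : list R) : exists B, 0 < B /\ forall y, In y l -> y < B.
Proof.
induction l as [|a l (B & HB & h)]; [exists 1; split; [lra|]; simpl; tauto|].
exists (Rmax B (a + 1)). pose proof (Rmax_l B (a + 1)). pose proof (Rmax_r B (a + 1)). split; [lra|].
intros y [<-|Hy]; [lra|]. specialize (h y Hy). lra.
Qed.

Lemma W_exact m al : ~ W m al -> exists k, (k < m)%nat /\ W k al /\ ~ W (S k) al.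
Proof.
induction m as [|m IH]; intros H; [exfalso; apply H; exists 0; simpl; auto|].
destruct (classic (W m al)) as [Hm|Hm]; [exists m; auto|]. destruct (IH Hm) as (k & h1 & h2). exists k. auto.
Qed.

Lemma last_zero m al : adm al -> ~ W m al -> live al -> exists R0, 0 < R0 /\ forall r, R0 <= r -> U al r <> 0.
Proof.
intros H Hm Hl. destruct (W_exact m al Hm) as (k & _ & h1 & h2).
destruct (W_zeros k al H h1 h2) as (l & _ & _ & Hz).
destruct (max_of_list l) as (B & HB & hB). exists B. split; auto. intros r Hr E0.
destruct (Hl r LRA) as [q|q]; [tauto|].
assert (In r l) by (apply Hz; split; [lra|auto]). specialize (hB r H0). lra.
Qed.

(** Otherwise the solution would be constant down to time $0$, although $|U|$ is below its initial
    value at all positive times. *)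
Lemma crit_nonzero al r : adm al -> 0 < r -> V al r = 0 -> f (U al r) = 0 -> U al r = 0.
Proof.
intros H Hr Hv Hf. apply NNPP. intros Hu.
pose proof (stationary (U al) (V al) r (U_ode al H) Hr Hv Hf Hu) as St.
assert (E0 : U al 0 = U al r).
{ apply NNPP. intros Hne. assert (Hp : 0 < Rabs (U al 0 - U al r)) by (apply Rabs_pos_lt; lra).
  destruct (continuous_eps (U al) 0 (U_cont al 0 H LRA) _ Hp) as (d & Hd & h).
  specialize (h (d / 2)). rewrite Rminus_0_r, Rabs_pos_eq in h by lra.
  rewrite (proj1 (St (d / 2) LRA)), Rabs_minus_sym in h. lra. }
rewrite U_0 in E0 by auto. pose proof (U_lt al r H Hr) as Q. rewrite <- E0, Rabs_pos_eq in Q; destruct H; lra.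
Qed.

Lemma f_sign s x : (s = 1 \/ s = -1) -> f (s * x) = s * f x.
Proof.
intros [-> | ->]; [rewrite !Rmult_1_l; auto|]. replace (-1 * x) with (- x) by ring. rewrite Hfo. ring.
Qed.
Lemma F_sign s x : (s = 1 \/ s = -1) -> F (s * x) = F x.
Proof.
intros [-> | ->]; [rewrite Rmult_1_l; auto|]. replace (-1 * x) with (- x) by ring. apply F_even.
Qed.

Lemma sign_after al R0 : adm al -> 0 <= R0 -> (forall r, R0 <= r -> U al r <> 0) ->
  exists s, (s = 1 \/ s = -1) /\ forall r, R0 <= r -> 0 < s * U al r.
Proof.
intros H HR Hn. assert (C := fun r hr => const_sign (U al) R0 r hr ltac:(intros; apply U_cont; auto; lra) ltac:(intros; apply Hn; lra)).
destruct (Rlt_le_dec 0 (U al R0)) as [l|l].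
- exists 1. split; auto. intros r Hr. specialize (C r Hr). nra.
- exists (-1). split; auto. intros r Hr. specialize (C r Hr). nra.
Qed.

Lemma V_bounded al R0 : adm al -> exists K, 0 < K /\ forall r, 0 <= r <= R0 -> Rabs (V al r) <= K.
Proof.
intros. destruct (f_bound f Hfc al) as (B & HB & hB).
pose (K := B * Rabs R0 + (nu n + 1) * B). pose proof (nu_ge n Hn). pose proof (Rabs_pos R0). pose proof (Rle_abs R0).
assert (0 < (nu n + 1) * B) by nra.
assert (0 <= B * Rabs R0) by nra.
exists K. split; [unfold K; lra|]. intros. destruct (Req_dec r 0) as [->|].
- rewrite V_0, Rabs_R0 by auto. unfold K; lra.
- apply (reg_bounds n Hn f al (U al) (V al) B al (Rabs R0)); auto; try (apply fam; auto); lra.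
Qed.

Lemma pos_energy_far al r : 0 < E al r -> V al r = 0 -> dl <= Rabs (U al r).
Proof.
intros HE Hv. apply Rnot_lt_le. intros Hlt.
assert (FE : E al r = F (U al r)) by (unfold E, energy; rewrite Hv; lra).
rewrite <- F_abs in FE. destruct (Req_dec (Rabs (U al r)) 0) as [Z|Z]; [rewrite Z, F_0 in FE; lra|].
pose proof (Rabs_pos (U al r)). assert (Q : 0 < Rabs (U al r) < dl) by lra.
pose proof (HFneg _ Q). lra.
Qed.

(** Between two sign changes there is a turning point of positive energy, hence at distance at least
    $\delta$ from $0$; at speed at most [K] this takes time $\delta/K$. *)
Lemma alt_gap al R0 K : adm al -> 0 < K -> (forall r, 0 <= r <= R0 -> Rabs (V al r) <= K) ->
  forall m s lo, (s = 1 \/ s = -1) -> 0 <= lo -> s * U al lo <= 0 -> alt (U al) s (S m) lo R0 -> INR m * (dl / K) <= R0 - lo.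
Proof.
intros H HK0 HK. induction m as [|m IH]; intros s lo Hs Hlo Hs0 Ha.
- destruct Ha as (r & Hr & _). rewrite Rmult_0_l. lra.
- destruct Ha as (r & Hr & Hsr & r2 & Hr2 & Hsr2 & Ha).
  assert (Cy : forall x, 0 <= x -> continuous (fun x => s * U al x) x).
  { intros. apply (continuous_mult (fun _ => s) (U al)); [apply continuous_const|apply U_cont; auto]. }
  assert (Dy : forall x, 0 < x -> is_derive (fun x => s * U al x) x (s * V al x)).
  { intros. eapply dval; [apply (dmult (fun _ => s) (U al)); [apply dconst|apply U_derive; auto]|]. ring. }
  assert (Hs' : - s = 1 \/ - s = -1) by lra.
  destruct (alt_calt (fun x => s * U al x) (fun x => s * V al x) 2 1 lo r2) as (c & Hc & Hcp & Hcv & r3 & Hr3 & Hr3p & _); try lra.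
  + intros x Hx; apply Cy; lra.
  + intros x Hx; apply Dy; lra.
  + exists r. split; [lra|]. split; [lra|]. exists r2. split; [lra|]. split; [lra|]. simpl; auto.
  +
    assert (Vc : V al c = 0) by nra.
    destruct (ivt_down (fun x => s * U al x) c r2 0) as (z & Hz & Ez); try lra. { intros x Hx; apply Cy; lra. }
    assert (Uz : U al z = 0) by nra.
    assert (0 < E al z).
    { unfold E, energy. rewrite Uz, F_0. destruct (Req_dec (V al z) 0) as [Vz|Vz].
      - destruct (U_frozen al z r2 H LRA Uz Vz). nra.
      - nra. }
    pose proof (E_decr al c z H LRA).
    pose proof (pos_energy_far al c LRA Vc) as Far.
    assert (dl <= s * U al c).
    { destruct Hs; subst s; unfold Rabs in Far; destruct (Rcase_abs (U al c)); lra. }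
    assert (dl / K <= c - lo).
    { apply Rle_div_l; [auto|]. rewrite Rmult_comm.
      assert (M := mvt_bound (fun x => s * U al x) (fun x => s * V al x) lo c K LRA ltac:(intros; apply Dy; lra) ltac:(intros; apply Cy; lra)).
      assert (M2 : forall x, lo < x < c -> Rabs (s * V al x) <= K).
      { intros. rewrite Rabs_mult. replace (Rabs s) with 1; [rewrite Rmult_1_l; apply HK; lra|].
        destruct Hs; subst s; [rewrite Rabs_R1|rewrite Rabs_left]; lra. }
      specialize (M M2). apply Rabs_le_between in M. lra. }
    specialize (IH (- s) c Hs' LRA LRA).
    assert (Ha' : alt (U al) (- s) (S m) c R0) by (exists r2; split; [lra|auto]).
    specialize (IH Ha'). rewrite S_INR. lra.
Qed.

Lemma finite_W al R0 : adm al -> exists m, ~ alt (U al) (-1) m 0 R0.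
Proof.
intros. destruct (V_bounded al R0 H) as (K & HK0 & HK).
assert (Hd : 0 < dl / K) by (apply Rdiv_lt_0_compat; [apply Hdl|auto]).
destruct (nfloor_ex (Rabs R0 / (dl / K))) as [m Hm]. { apply Rdiv_le_0_compat; auto. apply Rabs_pos. }
exists (S (S m)). intros Ha.
pose proof (alt_gap al R0 K H HK0 HK (S m) (-1) 0 ltac:(auto) LRA) as G.
rewrite U_0 in G by auto. specialize (G ltac:(destruct H; lra) Ha). rewrite S_INR in G.
assert (Rabs R0 < (INR m + 1) * (dl / K)) by (apply Rlt_div_l; auto; apply Hm).
pose proof (Rle_abs R0). lra.
Qed.

(** Eventually $y=|U|>0$. Not being trapped means $F(x)\le E$ for all $x<y$. At a critical point
    $E=F(y)$, so $f(y)\ge0$, and equality is excluded by [crit_nonzero]. Hence critical points are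
    strict maxima, there is at most one, and $y$ is eventually monotone. Convergence of $y$ and $E$
    then forces $u'\to0$ and $f(l)=0$. *)
Lemma limit_lemma al m : adm al -> ~ W m al -> live al -> (forall r, 0 < r -> ~ trapped al r) ->
  exists s l R0, (s = 1 \/ s = -1) /\ 0 <= l /\ 0 < R0 /\ (forall r, R0 <= r -> 0 < s * U al r) /\
    tends (fun r => s * U al r) l /\ tends (V al) 0 /\ tends (E al) (F l) /\ f l = 0 /\
    forall x, 0 <= x < l -> F x <= F l.
Proof.
intros H Hm Hl Hnt.
destruct (last_zero m al H Hm Hl) as (R0 & HR0 & Hnz).
destruct (sign_after al R0 H LRA Hnz) as (s & Hs & Hpos).
pose (y := fun r => s * U al r). pose (w := fun r => s * V al r).
assert (Dy : forall r, 0 < r -> is_derive y r (w r)).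
{ intros. unfold y, w. eapply dval; [apply (dmult (fun _ => s) (U al)); [apply dconst|apply U_derive; auto]|]. ring. }
assert (Dw : forall r, 0 < r -> is_derive w r (- (nu n / r) * w r - f (y r))).
{ intros. unfold y, w. eapply dval; [apply (dmult (fun _ => s) (V al)); [apply dconst|apply V_derive; auto]|].
  rewrite f_sign by auto. ring. }
assert (Cw : forall r, 0 < r -> continuous w r) by (intros r Hr; eapply is_derive_cont, Dw, Hr).
assert (Ay : forall r, R0 <= r -> Rabs (U al r) = y r).
{ intros r Hr. specialize (Hpos r Hr). unfold y. destruct Hs; subst s; [rewrite Rabs_pos_eq|rewrite Rabs_left]; lra. }
assert (FU : forall r, F (U al r) = F (y r)) by (intros r; unfold y; rewrite F_sign; auto).
assert (Hun : forall r x, R0 <= r -> 0 <= x < y r -> F x <= E al r).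
{ intros. apply Rnot_lt_le. intros Hlt. apply (Hnt r LRA). exists x. rewrite Ay by auto. auto. }
assert (EE : forall r, E al r = w r ^ 2 / 2 + F (y r)).
{ intros. unfold E, energy. rewrite FU. f_equal. f_equal. unfold w. nra. }
assert (Hcrit : forall r, R0 <= r -> w r = 0 -> 0 < f (y r)).
{ intros r Hr Hw. assert (Hpr := Hpos r Hr). change (0 < y r) in Hpr.
  destruct (Rtotal_order (f (y r)) 0) as [Hlt|[Hz|]]; auto; exfalso.
  - destruct (derive_neg_right F (y r) _ (dF _) Hlt) as (d & Hd & _ & h).
    pose (x := Rmax 0 (y r - d / 2)). assert (0 <= x < y r) by (unfold x; split; [apply Rmax_l|apply Rmax_lub_lt; lra]).
    assert (y r - d / 2 <= x) by apply Rmax_r. specialize (h x LRA). specialize (Hun r x Hr LRA).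
    rewrite EE, Hw in Hun. lra.
  - apply (Hnz r Hr). apply crit_nonzero; auto; try lra.
    + apply Rmult_integral in Hw. lra.
    + unfold y in Hz. rewrite f_sign in Hz by auto. nra. }
(* [t] is the eventual sign of the velocity; after a critical point it is negative for good. *)
assert (Mono : exists R1 t, R0 <= R1 /\ (t = 1 \/ t = -1) /\ forall r, R1 <= r -> 0 < t * w r).
{ destruct (classic (exists r, R0 <= r /\ w r = 0)) as [(r1 & Hr1 & Hw1)|Hno].
  - assert (Neg : forall r, r1 < r -> w r < 0).
    { intros r3 Hr3. apply Rnot_le_lt. intros Hge.
      pose proof (Hcrit r1 Hr1 Hw1).
      destruct (derive_neg_right w r1 _ (Dw r1 LRA)) as (d & Hd & h & _); [rewrite Hw1; lra|]. rewrite Hw1 in h.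
      destruct (right_point r1 r3 d) as (q & ? & ?); try lrn. specialize (h q LRA).
      destruct (first_above w q r3 0) as (r2 & Hr2 & Ew & Hb); try lra. { intros x Hx; apply Cw; lra. }
      pose proof (Hcrit r2 LRA Ew).
      destruct (derive_neg_right w r2 _ (Dw r2 LRA)) as (d' & Hd' & _ & h'); [rewrite Ew; lra|]. rewrite Ew in h'.
      destruct (left_point q r2 d') as (z & ? & ?); try lrn. specialize (h' z LRA). specialize (Hb z LRA). lra. }
    exists (r1 + 1), (-1). split; [lra|]. split; auto. intros. specialize (Neg r LRA). lra.
  - assert (C := fun r hr => const_sign w R0 r hr ltac:(intros; apply Cw; lra) ltac:(intros x Hx E0; apply Hno; exists x; split; [lra|auto])).
    destruct (Rlt_le_dec 0 (w R0)) as [l|l].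
    + exists R0, 1. split; [lra|]. split; auto. intros r Hr. specialize (C r Hr). nra.
    + exists R0, (-1). split; [lra|]. split; auto. intros r Hr. specialize (C r Hr). nra. }
destruct Mono as (R1 & t & HR1 & Ht & Hw).
assert (Ht2 : t * t = 1) by nra.
assert (By : forall r, R0 <= r -> 0 < y r <= al).
{ intros. split; [apply Hpos; auto|]. rewrite <- Ay by auto. apply U_bound; auto; lra. }
destruct (decr_tends (fun r => - (t * y r)) R1 (- al)) as (l0 & Hl0 & _).
{ intros r r' Hr. cut (t * y r <= t * y r'); [lra|].
  apply (mono_le (fun x => t * y x) (fun x => 0 * y x + t * w x)); try lra.
  - intros. apply (dmult (fun _ => t) y); [apply dconst|apply Dy; lra].
  - intros. apply (continuous_mult (fun _ => t) y); [apply continuous_const|]. eapply is_derive_cont, Dy; lra.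
  - intros. specialize (Hw x LRA). lra. }
{ intros. specialize (By r LRA). nra. }
pose (l := - (t * l0)).
assert (Ly : tends y l).
{ apply (tends_ext (fun r => - (t * - (t * y r))) _ _ 0).
  - intros. nra.
  - apply (tends_comp (fun z => - (t * z)) (fun r => - (t * y r)) l0); auto. eapply is_derive_cont. der. }
assert (l_ge : 0 <= l). { apply (tends_ge y l 0 R0); auto. intros. left; apply By; auto. }
assert (LF : tends (fun r => F (y r)) (F l)) by (apply (tends_comp F); auto using F_cont).
destruct (bounded_on F 0 al) as (B & HB & hB). { destruct H; lra. } { intros; apply F_cont. }
destruct (decr_tends (E al) R0 (- B)) as (e & He & _).
{ intros. apply E_decr; auto; lra. }
{ intros r Hr. pose proof (F_le_E al r). rewrite FU in *. specialize (By r Hr). specialize (hB (y r) LRA).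
  apply Rabs_le_between in hB. lra. }
(* Since $E$ and $y$ converge, so does $w^2$; as $y$ is bounded, the limit [q] must be $0$. *)
pose (q := 2 * (e - F l)).
assert (Lq : tends (fun r => w r ^ 2) q).
{ apply (tends_ext (fun r => 2 * (E al r + - F (y r))) _ _ 0).
  - intros. rewrite EE. field.
  - apply (tends_comp (fun z => 2 * z)); [eapply is_derive_cont; der|]. apply tends_plus; auto. apply tends_opp; auto. }
assert (tends (fun r => t * w r) (sqrt q)).
{ apply (tends_ext (fun r => sqrt (w r ^ 2)) _ _ R1).
  - intros r Hr. specialize (Hw r Hr). replace (w r ^ 2) with ((t * w r) ^ 2) by (replace ((t * w r) ^ 2) with (t * t * w r ^ 2) by ring; rewrite Ht2; ring).
    apply sqrt_pow2. lra.
  - apply (tends_comp sqrt); auto. apply continuity_pt_filterlim. apply continuity_pt_sqrt.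
    apply (tends_ge (fun r => w r ^ 2) q 0 0); auto. intros; apply pow2_ge_0. }
assert (Lw' : tends w (t * sqrt q)).
{ apply (tends_ext (fun r => t * (t * w r)) _ _ 0).
  - intros. nra.
  - apply (tends_comp (fun z => t * z)); auto. eapply is_derive_cont. der. }
assert (Z1 : t * sqrt q = 0).
{ apply (deriv_tends_0 y w R0 al); auto.
  - intros. apply Dy; lra.
  - intros r Hr. specialize (By r Hr). rewrite Rabs_pos_eq; lra. }
rewrite Z1 in Lw'.
assert (Q0 : q = 0).
{ apply Rmult_integral in Z1. destruct Z1 as [Z1|Z1]; [destruct Ht; lra|].
  apply sqrt_eq_0 in Z1; auto. apply (tends_ge (fun r => w r ^ 2) q 0 0); auto. intros; apply pow2_ge_0. }
assert (He' : e = F l) by (unfold q in Q0; lra). rewrite He' in He.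
assert (f l = 0).
{ destruct (tends_lt (fun r => w r ^ 2) q 1 Lq LRA) as [R2 H2].
  cut (- f l = 0); [lra|].
  apply (deriv_tends_0 w (fun r => - (nu n / r) * w r - f (y r)) (Rmax R0 R2) 1).
  - intros. apply Dw. pose proof (Rmax_l R0 R2). lra.
  - intros. pose proof (Rmax_r R0 R2). specialize (H2 r LRA). rewrite <- pow2_abs in H2. nra.
  - replace (- f l) with (0 + - f l) by ring. apply tends_plus.
    + intros ep Hep. destruct (Lw' (ep / (nu n + 1))) as [R3 H3].
      { pose proof (nu_ge n Hn). apply Rdiv_lt_0_compat; lra. }
      exists (Rmax R3 1). intros. pose proof (Rmax_l R3 1). pose proof (Rmax_r R3 1). specialize (H3 r LRA).
      rewrite Rminus_0_r in *. rewrite Rabs_mult, Rabs_Ropp.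
      pose proof (nu_ge n Hn).
      rewrite (Rabs_pos_eq (nu n / r)) by (apply Rdiv_le_0_compat; lra).
      assert (nu n / r <= nu n) by (apply Rle_div_l; nra).
      apply Rle_lt_trans with (nu n * Rabs (w r)); [apply Rmult_le_compat_r; auto; apply Rabs_pos|].
      apply Rlt_le_trans with ((nu n + 1) * (ep / (nu n + 1))); [|right; field; lra].
      pose proof (Rabs_pos (w r)). nra.
    + apply tends_opp. apply (tends_comp f); auto using Hfc. }
exists s, l, R0. split; auto. split; auto. split; auto. split; [exact Hpos|]. split; [exact Ly|]. split; [|split; [auto|split; [auto|]]].
- apply (tends_ext (fun r => s * w r) _ _ 0).
  + intros. unfold w. nra.
  + replace 0 with (s * 0) by ring. apply (tends_comp (fun z => s * z)); auto. eapply is_derive_cont. der.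
- intros. destruct (tends_gt y l x Ly LRA) as [R3 H3].
  apply (tends_ge (E al) (F l) (F x) (Rmax R0 R3)); auto. intros.
  pose proof (Rmax_l R0 R3). pose proof (Rmax_r R0 R3). apply (Hun r x LRA). specialize (H3 r LRA). lra.
Qed.
End Limits.

(** * Oscillation in a potential well *)

Section LemmaA.
Context {P : problem}.
Notation F := (pot f).
Notation E := orbit_energy.

Lemma sign_stays_neg (w w' : R -> R) a b : a < b -> (forall r, a <= r <= b -> continuous w r) ->
  (forall r, a <= r <= b -> w r = 0 -> is_derive w r (w' r) /\ w' r < 0) -> w a <= 0 ->
  forall r, a < r <= b -> w r < 0.
Proof.
intros Hab Hc Hcrit Ha r3 Hr3. apply Rnot_le_lt. intros Hge.
assert (Hq : exists q, a <= q < r3 /\ w q < 0).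
{ destruct (Req_dec (w a) 0) as [E|]; [|exists a; lra].
  destruct (Hcrit a LRA E) as [D Hn']. destruct (derive_neg_right _ _ _ D Hn') as (d & Hd & h & _). rewrite E in h.
  pose (q := Rmin ((a + r3) / 2) (a + d / 2)). assert (a < q <= (a + r3) / 2) by (unfold q; split; [apply Rmin_glb_lt; lra|apply Rmin_l]).
  assert (q <= a + d / 2) by apply Rmin_r. exists q. split; [lra|apply h; lra]. }
destruct Hq as (q & Hq & Hwq).
destruct (first_above w q r3 0) as (r2 & Hr2 & Ew & Hb); try lra. { intros x Hx; apply Hc; lra. }
destruct (Hcrit r2 LRA Ew) as [D Hn'].
destruct (derive_neg_right _ _ _ D Hn') as (d' & Hd' & _ & h'). rewrite Ew in h'.
destruct (left_point q r2 d') as (z & ? & ?); try lrn. specialize (h' z LRA). specialize (Hb z LRA). lra.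
Qed.

Lemma up_down (w w' : R -> R) a b : a <= b -> (forall r, a <= r <= b -> continuous w r) ->
  (forall r, a <= r <= b -> w r = 0 -> is_derive w r (w' r) /\ w' r < 0) ->
  exists c, a <= c <= b /\ (forall r, a < r < c -> 0 <= w r) /\ (forall r, c < r <= b -> w r <= 0).
Proof.
intros Hab Hc Hcrit.
destruct (classic (exists r, a <= r <= b /\ w r <= 0)) as [(r & Hr & Hw)|Hno].
- destruct (Rle_lt_dec (w a) 0) as [Ha|Ha].
  + exists a. split; [lra|]. split; [intros; lra|]. intros. left. apply (sign_stays_neg w w' a b); auto; lra.
  + destruct (first_below w a r 0) as (c & Hc' & Ec & Hb); try lra. { intros x Hx; apply Hc; lra. }
    exists c. split; [lra|]. split.
    * intros. left. apply Hb. lra.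
    * intros. left. apply (sign_stays_neg w w' c b); try lra; intros; [apply Hc|apply Hcrit]; lra.
- exists b. split; [lra|]. split; [|intros; lra]. intros. apply Rnot_lt_le. intros Hl. apply Hno. exists r. lra.
Qed.

(** $F(\gamma)$ is a barrier higher than everything inside it, and the layer of height $\eta$ below
    its top contains no critical point of $F$. In this layer a solution turns only at maxima of
    $|u|$. *)
Definition well (ga eta : R) := 0 < ga /\ 0 < eta < F ga /\ (forall s, 0 <= s < ga -> F s < F ga) /\
  (forall s, 0 < s < ga -> F ga - eta <= F s -> 0 < f s).

Lemma well_mono ga eta x z : well ga eta -> 0 < x <= z -> z < ga -> F ga - eta <= F x -> F x <= F z.
Proof.
intros (h1 & h2 & h3 & h4) Hx Hz HF. apply Rnot_lt_le. intros Hlt.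
destruct (max_attained F x z LRA) as (p & Hp & Hm). { intros; apply F_cont. }
assert (F x <= F p) by (apply Hm; lra).
assert (p <> z) by (intros ->; lra).
destruct (derive_pos_right F p _ (dF p)) as (d & Hd & h & _). { apply h4; lra. }
destruct (right_point p z d) as (q & ? & ?); try lrn. specialize (h q LRA). specialize (Hm q LRA). lra.
Qed.

Definition Vm ga := 2 * (F ga + proj1_sig (constructive_indefinite_description _ (f_bound (fun x => F x) F_cont ga))) + 1.

Lemma Vm_bound al r ga : adm al -> 0 <= r -> Rabs (U al r) <= ga -> E al r <= F ga -> Rabs (V al r) <= Vm ga /\ 0 < Vm ga.
Proof.
intros H Hr HU HE. unfold Vm. destruct (constructive_indefinite_description _ _) as [B [HB hB]]. simpl.
pose proof (hB _ HU) as h1. unfold E, energy in HE. apply Rabs_le_between in h1.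
assert (Hsq : V al r ^ 2 <= 2 * (F ga + B)) by lra.
rewrite <- pow2_abs in Hsq.
 nra.
Qed.

(** A half cycle started at time [r0] loses at most [Cl ga / r0]: the loss is $\int(\nu/r)v^2\le(\nu
    V_m/r_0)\int|v|$, and the variation of $u$ is at most $2\gamma$. *)
Definition Cl ga := nu n * Vm ga * (2 * ga).

Lemma signed_y al s : adm al -> (s = 1 \/ s = -1) ->
  (forall r, 0 < r -> is_derive (fun r => s * U al r) r (s * V al r)) /\
  (forall r, 0 < r -> is_derive (fun r => s * V al r) r (- (nu n / r) * (s * V al r) - f (s * U al r))) /\
  (forall r, 0 <= r -> continuous (fun r => s * U al r) r) /\ (forall r, 0 <= r -> continuous (fun r => s * V al r) r) /\
  (forall r, E al r = (s * V al r) ^ 2 / 2 + F (s * U al r)) /\ s * s = 1 /\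
  (forall r, Rabs (s * U al r) = Rabs (U al r)) /\ (forall r, Rabs (s * V al r) = Rabs (V al r)).
Proof.
intros H Hs. assert (s * s = 1) by nra.
assert (Ha : Rabs s = 1) by (destruct Hs; subst s; [apply Rabs_R1|rewrite Rabs_left; lra]).
split; [|split; [|split; [|split; [|split; [|split; [|split]]]]]]; auto.
- intros. eapply dval; [apply (dmult (fun _ => s) (U al)); [apply dconst|apply U_derive; auto]|]. ring.
- intros. eapply dval; [apply (dmult (fun _ => s) (V al)); [apply dconst|apply V_derive; auto]|].
  rewrite f_sign by auto. ring.
- intros. apply (continuous_mult (fun _ => s) (U al)); [apply continuous_const|apply U_cont; auto].
- intros. apply (continuous_mult (fun _ => s) (V al)); [apply continuous_const|apply V_cont; auto].
- intros. unfold E, energy. rewrite F_sign by auto. nra.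
- intros. rewrite Rabs_mult, Ha. ring.
- intros. rewrite Rabs_mult, Ha. ring.
Qed.

(** The dissipation is bounded by $\nu K/r_0$ times the variation of $u$ on an arc that rises until
    [c] and falls afterwards; the integral is avoided by the monotonicity of $E\pm k\,su$. *)
Lemma loss al s r0 r3 K c : adm al -> (s = 1 \/ s = -1) -> 0 < r0 <= r3 -> r0 <= c <= r3 ->
  (forall r, r0 < r < c -> 0 <= s * V al r) -> (forall r, c < r < r3 -> s * V al r <= 0) ->
  (forall r, r0 <= r <= r3 -> Rabs (V al r) <= K) ->
  E al r0 - nu n * K / r0 * ((s * U al c - s * U al r0) + (s * U al c - s * U al r3)) <= E al r3.
Proof.
intros H Hs Hr Hc Hup Hdn HK.
destruct (signed_y al s H Hs) as (Dy & Dw & Cy & Cw & EE & Hs2 & Ay & Aw).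
assert (Hnu := nu_ge n Hn).
set (k := nu n * K / r0).
assert (Q : forall r, r0 <= r <= r3 -> nu n / r * V al r ^ 2 <= k * Rabs (s * V al r)).
{ intros r Hrr. rewrite Aw. rewrite <- pow2_abs. specialize (HK r Hrr). pose proof (Rabs_pos (V al r)).
  assert (nu n / r <= nu n / r0). { apply Rmult_le_compat_l; [lra|]. apply Rinv_le_contravar; lra. }
  assert (0 <= nu n / r) by (apply Rdiv_le_0_compat; lra).
  unfold k. replace (nu n * K / r0 * Rabs (V al r)) with (nu n / r0 * (K * Rabs (V al r))) by (field; lra).
  apply Rmult_le_compat; auto; [apply pow2_ge_0|]. nra. }
assert (E al r0 + k * (s * U al r0) <= E al c + k * (s * U al c)).
{ apply (mono_le (fun r => E al r + k * (s * U al r)) (fun r => - (nu n / r) * V al r ^ 2 + (0 * (s * U al r) + k * (s * V al r)))); try lra.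
  - intros. apply dplus; [apply E_derive; auto; lra|]. apply (dmult (fun _ => k) (fun r => s * U al r)); [apply dconst|apply Dy; lra].
  - intros. apply (continuous_plus (E al) (fun r => k * (s * U al r))); [apply E_cont; auto; lra|].
    apply (continuous_mult (fun _ => k) (fun r => s * U al r)); [apply continuous_const|apply Cy; lra].
  - intros. specialize (Q x LRA). rewrite Rabs_pos_eq in Q by (apply Hup; lra). lra. }
assert (E al c - k * (s * U al c) <= E al r3 - k * (s * U al r3)).
{ apply (mono_le (fun r => E al r - k * (s * U al r)) (fun r => - (nu n / r) * V al r ^ 2 - (0 * (s * U al r) + k * (s * V al r)))); try lra.
  - intros. apply dminus; [apply E_derive; auto; lra|]. apply (dmult (fun _ => k) (fun r => s * U al r)); [apply dconst|apply Dy; lra].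
  - intros. apply (continuous_minus (E al) (fun r => k * (s * U al r))); [apply E_cont; auto; lra|].
    apply (continuous_mult (fun _ => k) (fun r => s * U al r)); [apply continuous_const|apply Cy; lra].
  - intros. specialize (Q x LRA). rewrite Rabs_left1 in Q by (apply Hdn; lra). lra. }
lra.
Qed.

Section W.
Variables ga eta : R.
Hypothesis Hw : well ga eta.

Lemma in_well al r0 r : adm al -> 0 <= r0 <= r -> Rabs (U al r0) < ga -> E al r0 < F ga -> Rabs (U al r) < ga.
Proof. intros. apply (trap_in al r0 ga r); auto. destruct Hw; lra. Qed.

Lemma half_loss al s r0 r2 : adm al -> (s = 1 \/ s = -1) -> 0 < r0 < r2 -> Rabs (U al r0) < ga -> E al r0 < F ga ->
  F ga - eta / 2 <= E al r0 - Cl ga / r0 -> 0 <= s * U al r0 -> (forall r, r0 < r < r2 -> 0 < s * U al r) ->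
  E al r0 - Cl ga / r0 <= E al r2.
Proof.
intros H Hs Hr HU HE Hlev Hy0 Hpos.
assert (Hw' := Hw). destruct Hw' as (w1 & w2 & w3 & w4).
destruct (signed_y al s H Hs) as (Dy & Dw & Cy & Cw & EE & Hs2 & Ay & Aw).
apply Rnot_lt_le. intros Hlt.
(* The arc is cut where the energy has dropped to [L]. Up to there it stays in the layer without
   critical points of $F$, so it rises once and falls once, and [loss] forbids the drop. *)
pose (L := Rmax (E al r2) (F ga - eta)).
assert (E al r2 <= L) by apply Rmax_l. assert (F ga - eta <= L) by apply Rmax_r.
assert (L < E al r0 - Cl ga / r0) by (unfold L; apply Rmax_lub_lt; lra).
assert (Vb : forall r, r0 <= r -> Rabs (V al r) <= Vm ga /\ 0 < Vm ga).
{ intros. apply Vm_bound; auto; try lra.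
  - left. apply (in_well al r0); auto; lra.
  - pose proof (E_decr al r0 r H LRA). lra. }
assert (0 <= Cl ga / r0).
{ pose proof (nu_ge n Hn). destruct (Vb r0 LRA). apply Rdiv_le_0_compat; [|lra].
   apply Rmult_le_pos; [apply Rmult_le_pos; lra|lra]. }
destruct (ivt_down (E al) r0 r2 L LRA) as (r3 & Hr3 & E3); [intros; apply E_cont; auto; lra|lra|].
assert (Hge : forall r, r0 <= r <= r3 -> L <= E al r) by (intros r Hrr; rewrite <- E3; apply E_decr; auto; lra).
assert (Hcr : forall r, r0 <= r <= r3 -> s * V al r = 0 -> is_derive (fun r => s * V al r) r (- (nu n / r) * (s * V al r) - f (s * U al r)) /\
    - (nu n / r) * (s * V al r) - f (s * U al r) < 0).
{ intros r Hrr E0. split; [apply Dw; lra|]. rewrite E0. rewrite Rmult_0_r, Rminus_0_l.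
  assert (FE : F (s * U al r) = E al r) by (rewrite EE, E0; lra).
  specialize (Hge r Hrr).
  assert (0 < f (s * U al r)); [|lra].
  assert (Hy : 0 <= s * U al r).
  { destruct (Req_dec r r0) as [->|]; auto. destruct (Req_dec r r2) as [->|]; [|left; apply Hpos; lra].
    apply Rnot_lt_le. intros Hneg. destruct (cont_lt_near _ r2 0 (Cy r2 LRA) Hneg) as (d & Hd & h).
    pose (q := Rmax ((r0 + r2) / 2) (r2 - d / 2)). assert ((r0 + r2) / 2 <= q < r2) by (unfold q; split; [apply Rmax_l|apply Rmax_lub_lt; lra]).
    assert (r2 - d / 2 <= q) by apply Rmax_r. specialize (h q ltac:(rewrite Rabs_left; lra)). specialize (Hpos q LRA). lra. }
  apply w4; [|lra]. split.
  - destruct Hy as [|Hy]; auto. exfalso. rewrite <- Hy, F_0 in FE. lra.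
  - pose proof (in_well al r0 r H LRA HU HE) as Q. rewrite <- Ay in Q. apply Rabs_def2 in Q. lra. }
destruct (up_down (fun r => s * V al r) _ r0 r3 LRA ltac:(intros; apply Cw; lra) Hcr) as (c & Hc & c1 & c2).
pose proof (loss al s r0 r3 (Vm ga) c H Hs LRA Hc c1 ltac:(intros; apply c2; lra) ltac:(intros; apply Vb; lra)).
assert (B1 : forall r, r0 <= r -> Rabs (s * U al r) < ga) by (intros r Hrr; rewrite Ay; apply (in_well al r0); auto; lra).
assert (Yc := B1 c LRA). assert (Y3 := B1 r3 LRA). apply Rabs_def2 in Yc. apply Rabs_def2 in Y3.
assert (0 <= s * U al r3).
{ destruct (Req_dec r3 r2) as [->|]; [|destruct (Req_dec r3 r0) as [->|]; [auto|left; apply Hpos; lra]].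
  apply Rnot_lt_le. intros Hneg. destruct (cont_lt_near _ r2 0 (Cy r2 LRA) Hneg) as (d & Hd & h).
  pose (q := Rmax ((r0 + r2) / 2) (r2 - d / 2)). assert ((r0 + r2) / 2 <= q < r2) by (unfold q; split; [apply Rmax_l|apply Rmax_lub_lt; lra]).
  assert (r2 - d / 2 <= q) by apply Rmax_r. specialize (h q ltac:(rewrite Rabs_left; lra)). specialize (Hpos q LRA). lra. }
assert (nu n * Vm ga / r0 * (s * U al c - s * U al r0 + (s * U al c - s * U al r3)) <= Cl ga / r0).
{ unfold Cl. replace (nu n * Vm ga * (2 * ga) / r0) with (nu n * Vm ga / r0 * (2 * ga)) by (field; lra).
  apply Rmult_le_compat_l; [|lra]. pose proof (nu_ge n Hn). destruct (Vb r0 LRA). apply Rdiv_le_0_compat; [|lra]. nra. }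
lra.
Qed.

(** If $su$ stayed positive, the energy would remain in the layer, and [limit_lemma] would give a
    limit in it with $f=0$. *)
Lemma half_cycle al s r0 : adm al -> (s = 1 \/ s = -1) -> 0 < r0 -> Rabs (U al r0) < ga -> E al r0 < F ga ->
  F ga - eta / 2 <= E al r0 - Cl ga / r0 -> 0 < s * U al r0 \/ U al r0 = 0 /\ 0 < s * V al r0 ->
  exists r1, r0 < r1 /\ U al r1 = 0 /\ s * V al r1 < 0 /\ (forall r, r0 < r < r1 -> 0 < s * U al r) /\
    E al r0 - Cl ga / r0 <= E al r1.
Proof.
intros H Hs Hr0 HU HE Hlev Hst.
assert (Hw' := Hw). destruct Hw' as (w1 & w2 & w3 & w4).
destruct (signed_y al s H Hs) as (Dy & Dw & Cy & Cw & EE & Hs2 & Ay & Aw).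
assert (s <> 0) by lra.
assert (Hstart : exists q, r0 < q /\ forall r, r0 < r <= q -> 0 < s * U al r).
{ destruct Hst as [Hp|[Hz Hp]].
  - destruct (cont_gt_near _ r0 0 (Cy r0 LRA) Hp) as (d & Hd & h). exists (r0 + d / 2). split; [lra|].
    intros. apply h. rewrite Rabs_pos_eq; lra.
  - destruct (derive_pos_right _ r0 _ (Dy r0 Hr0) Hp) as (d & Hd & h & _). rewrite Hz, Rmult_0_r in h.
    exists (r0 + d / 2). split; [lra|]. intros. apply h. lra. }
destruct Hstart as (q & Hq & hq).
assert (Hy0 : 0 <= s * U al r0) by nra.
destruct (classic (exists r, q < r /\ s * U al r <= 0)) as [(r & Hr & Hneg)|Hno].
- destruct (first_below (fun r => s * U al r) q r 0) as (r1 & Hr1 & E1 & h1); try lra.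
  { intros x Hx; apply Cy; lra. } { apply hq; lra. }
  assert (Hpos : forall x, r0 < x < r1 -> 0 < s * U al x).
  { intros. destruct (Rle_lt_dec x q); [apply hq; lra|apply h1; lra]. }
  pose proof (half_loss al s r0 r1 H Hs LRA HU HE Hlev Hy0 Hpos) as HL.
  exists r1. split; [lra|]. split; [apply Rmult_integral in E1; tauto|]. split; [|split; auto].
  apply Rnot_le_lt. intros Hge.
  assert (s * V al r1 <> 0). { intros E0. rewrite (EE r1), E0, E1, F_0 in HL. lra. }
  destruct (derive_pos_right _ r1 _ (Dy r1 LRA) LRA) as (d & Hd & _ & h). rewrite E1 in h.
  destruct (left_point q r1 d) as (z & ? & ?); try lrn. specialize (h z LRA). specialize (h1 z LRA). lra.
- exfalso.
  assert (Hpos : forall x, r0 < x -> 0 < s * U al x).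
  { intros. destruct (Rle_lt_dec x q); [apply hq; lra|]. apply Rnot_le_lt. intros Hl. apply Hno. exists x. auto. }
  assert (HL : forall r, r0 < r -> F ga - eta / 2 <= E al r).
  { intros. pose proof (half_loss al s r0 r H Hs LRA HU HE Hlev Hy0 ltac:(intros; apply Hpos; lra)). lra. }
  assert (Hin : forall r, r0 <= r -> Rabs (U al r) < ga) by (intros r Hr; apply (in_well al r0); auto; lra).
  assert (Hlive : live al).
  { intros r Hr. apply (live_before al (r + r0 + 1)); auto; [lra|]. left. specialize (Hpos (r + r0 + 1) LRA). nra. }
  assert (Hnt : forall r, 0 < r -> ~ trapped al r).
  { intros r Hr (x & Hx & HEx).
    pose (z := Rmax r (r0 + 1)). assert (r <= z) by apply Rmax_l. assert (r0 + 1 <= z) by apply Rmax_r.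
    pose proof (trap_out al r x z H LRA LRA HEx LRA).
    pose proof (E_decr al r z H LRA). specialize (HL z LRA). specialize (Hin z LRA).
    pose proof (F_le_E al z) as FE. rewrite <- F_abs in FE.
    assert (0 < x). { destruct (Req_dec x 0) as [->|]; [rewrite F_0 in HEx; lra|lra]. }
    assert (T1 : 0 < x <= Rabs (U al z)) by lra. assert (T2 : F ga - eta <= F x) by lra.
    pose proof (well_mono ga eta x (Rabs (U al z)) Hw T1 Hin T2). lra. }
  destruct (finite_W al (r0 + 1) H) as [k Hk].
  assert (HW : ~ W k al).
  { intros HW. apply Hk. apply W_after; auto; [lra|]. intros.
    assert (Q := Rmult_lt_0_compat _ _ (Hpos (r0 + 1) LRA) (Hpos x LRA)).
    nra. }
  destruct (limit_lemma al k H HW Hlive Hnt) as (s' & l & R0 & q1 & q2 & q3 & q4 & q5 & q6 & q7 & q8 & q9).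
  assert (Fl : F ga - eta / 2 <= F l).
  { apply (tends_ge (E al) _ _ (r0 + 1)); auto. intros. apply HL; lra. }
  assert (F l <= E al r0). { apply (tends_le (E al) _ _ r0); auto. intros. apply E_decr; auto; lra. }
  assert (l <= ga).
  { apply (tends_le (fun r => s' * U al r) l ga r0); auto. intros r Hr. specialize (Hin r Hr).
    apply Rabs_def2 in Hin. nra. }
  assert (l < ga) by (destruct (Req_dec l ga) as [->|]; lra).
  assert (0 < l) by (destruct (Req_dec l 0) as [->|]; [rewrite F_0 in Fl|]; lra).
  assert (0 < f l) by (apply w4; [split; apply Rnot_le_lt; intros Hle; lra|lra]). lra.
Qed.

Lemma cycles al m : forall s r0, adm al -> (s = 1 \/ s = -1) -> 0 < r0 -> Rabs (U al r0) < ga -> E al r0 < F ga ->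
  F ga - eta / 2 <= E al r0 - INR m * (Cl ga / r0) -> 0 < s * U al r0 \/ U al r0 = 0 /\ 0 < s * V al r0 ->
  exists hi, alt (U al) s m r0 hi.
Proof.
induction m as [|m IH]; intros s r0 H Hs Hr0 HU HE Hlev Hst; [exists 0; simpl; auto|].
rewrite S_INR in Hlev.
assert (Hw' := Hw). destruct Hw' as (w1 & w2 & w3 & w4).
assert (Vb := Vm_bound al r0 ga H LRA LRA LRA).
assert (0 <= Cl ga).
{ pose proof (nu_ge n Hn). apply Rmult_le_pos; [apply Rmult_le_pos; lra|lra]. }
assert (0 <= Cl ga / r0) by (apply Rdiv_le_0_compat; lra).
assert (Hm := pos_INR m).
assert (0 <= INR m * (Cl ga / r0)) by nra.
destruct (half_cycle al s r0) as (r1 & h1 & h2 & h3 & h4 & h5); auto; try lra.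
assert (Cl ga / r1 <= Cl ga / r0). { apply Rmult_le_compat_l; auto. apply Rinv_le_contravar; lra. }
destruct (IH (- s) r1) as [hi Hhi]; auto; try lra.
- apply (in_well al r0); auto; lra.
- pose proof (E_decr al r0 r1 H LRA). lra.
- nra.
- exists (Rmax hi r1). exists ((r0 + r1) / 2). pose proof (Rmax_l hi r1). pose proof (Rmax_r hi r1).
  split; [lra|]. split; [apply h4; lra|]. apply (alt_mono _ _ _ r1 hi); auto; lra.
Qed.

Lemma start_sign al r0 : adm al -> 0 < r0 -> U al r0 <> 0 \/ V al r0 <> 0 ->
  exists s, (s = 1 \/ s = -1) /\ (0 < s * U al r0 \/ U al r0 = 0 /\ 0 < s * V al r0).
Proof.
intros. destruct (Rtotal_order (U al r0) 0) as [a|[a|a]].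
- exists (-1). lra.
- destruct (Rtotal_order (V al r0) 0) as [c|[c|c]]; [|tauto|].
  + exists (-1). lra.
  + exists 1. lra.
- exists 1. lra.
Qed.

Lemma Cl_large k : exists R0, 0 < R0 /\ forall al r0, adm al -> R0 <= r0 -> Rabs (U al r0) < ga -> E al r0 < F ga ->
  0 <= Cl ga / r0 /\ INR k * (Cl ga / r0) <= eta / 4.
Proof.
assert (Hw' := Hw). destruct Hw' as (w1 & w2 & w3 & w4).
pose (R0 := INR k * Rabs (Cl ga) / (eta / 4) + 1).
pose proof (pos_INR k). pose proof (Rabs_pos (Cl ga)).
assert (0 <= INR k * Rabs (Cl ga)) by nra.
assert (0 <= INR k * Rabs (Cl ga) / (eta / 4)) by (apply Rdiv_le_0_compat; lra).
exists R0. assert (HR0 : 0 < R0) by (unfold R0; lra). split; auto. intros.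
assert (Vb := Vm_bound al r0 ga H3 LRA LRA LRA).
assert (0 <= Cl ga).
{ pose proof (nu_ge n Hn). apply Rmult_le_pos; [apply Rmult_le_pos; lra|lra]. }
split; [apply Rdiv_le_0_compat; lra|].
replace (INR k * (Cl ga / r0)) with (INR k * Cl ga / r0) by (field; lra).
apply Rle_div_l; [lra|]. assert (HA : Rabs (Cl ga) = Cl ga) by (apply Rabs_pos_eq; auto).
apply Rle_trans with (eta / 4 * R0); [|apply Rmult_le_compat_l; lra].
unfold R0. rewrite HA. replace (eta / 4 * (INR k * Cl ga / (eta / 4) + 1)) with (INR k * Cl ga + eta / 4) by (field; lra). lra.
Qed.

(** The loss per half cycle is $O(1/r)$, so a solution that is late and just below the top of a well
    makes any prescribed number of half cycles before it leaves the layer. *)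
Lemma lemmaA k : exists R0 e, 0 < R0 /\ 0 < e /\ forall al r0, adm al -> R0 <= r0 -> Rabs (U al r0) < ga ->
  F ga - e <= E al r0 < F ga -> W k al.
Proof.
assert (Hw' := Hw). destruct Hw' as (w1 & w2 & w3 & w4).
destruct (Cl_large (S k)) as (R0 & HR0 & HC).
exists R0, (eta / 4). split; auto. split; [lra|]. intros al r0 H Hr HU HE.
destruct (HC al r0 H Hr HU LRA).
assert (Hlive : U al r0 <> 0 \/ V al r0 <> 0).
{ destruct (Req_dec (U al r0) 0) as [a|a]; auto. right. intros c. unfold E, energy in HE. rewrite a, c, F_0 in HE. lra. }
destruct (start_sign al r0 H LRA Hlive) as (s & Hs & Hst).
destruct (cycles al (S k) s r0) as [hi Hhi]; auto; try lra.
destruct Hs as [-> | ->].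
- destruct Hhi as (r & Hr' & _ & Ha). exists hi. apply (alt_mono _ _ _ r hi); try lra.
  auto.
- apply W_pred. exists hi. apply (alt_mono _ _ _ r0 hi); try lra. auto.
Qed.

Lemma phase_top al s r1 : adm al -> (s = 1 \/ s = -1) -> 0 < r1 -> Rabs (U al r1) < ga -> E al r1 < F ga ->
  F ga - eta / 2 <= E al r1 - Cl ga / r1 -> U al r1 = 0 -> 0 < s * V al r1 ->
  exists c, r1 < c /\ V al c = 0 /\ 0 < s * U al c /\ F ga - eta / 2 <= E al c.
Proof.
intros H Hs Hr HU HE Hlev Hz Hv.
destruct (half_cycle al s r1 H Hs Hr HU HE Hlev ltac:(auto)) as (r2 & h1 & h2 & h3 & h4 & h5).
destruct (signed_y al s H Hs) as (Dy & Dw & Cy & Cw & EE & Hs2 & Ay & Aw).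
destruct (alt_calt (fun x => s * U al x) (fun x => s * V al x) 1 1 r1 r2) as (c & Hc & Hcp & Hcv & _); try lra.
- intros x Hx; apply Cy; lra.
- intros x Hx; apply Dy; lra.
- nra.
- exists ((r1 + r2) / 2). split; [lra|]. split; [|simpl; auto]. rewrite Rmult_1_l. apply h4. lra.
- assert (c <> r2). { intros ->. nra. }
  exists c. split; [lra|]. split; [|split; [lra|]].
  + nra.
  + pose proof (E_decr al c r2 H LRA). lra.
Qed.

(** Late and near the top, a solution still reaches a negative turning point with almost full
    energy; if the well is higher than $F(\gamma_M)$, [crit_far] places this point below
    $-\gamma_M$. *)
Lemma reachA : exists R0 e, 0 < R0 /\ 0 < e /\ forall al r0, adm al -> R0 <= r0 -> Rabs (U al r0) < ga ->
  F ga - e <= E al r0 < F ga -> exists c, r0 < c /\ V al c = 0 /\ U al c < 0 /\ F ga - eta / 2 <= E al c.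
Proof.
assert (Hw' := Hw). destruct Hw' as (w1 & w2 & w3 & w4).
(* At most two half cycles lead to the start of a negative phase, and the third is that phase. *)
destruct (Cl_large 3) as (R0 & HR0 & HC).
exists R0, (eta / 4). split; auto. split; [lra|]. intros al r0 H Hr HU HE.
destruct (HC al r0 H Hr HU LRA) as [C1 C2]. replace (INR 3) with 3 in C2 by (simpl; ring).
assert (Lv : F ga - eta / 2 <= E al r0 - Cl ga / r0) by lra.
assert (Hlive : U al r0 <> 0 \/ V al r0 <> 0).
{ destruct (Req_dec (U al r0) 0) as [a|a]; auto. right. intros c. unfold E, energy in HE. rewrite a, c, F_0 in HE. lra. }
destruct (start_sign al r0 H LRA Hlive) as (s & Hs & Hst).
assert (Hr0 : 0 < r0) by lra. assert (HEl : E al r0 < F ga) by lra.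
destruct (half_cycle al s r0 H Hs Hr0 HU HEl Lv Hst) as (r1 & a1 & a2 & a3 & a4 & a5).
assert (E1 := E_decr al r0 r1 H LRA).
assert (U1 := in_well al r0 r1 H LRA HU LRA).
assert (Q : forall r, r0 <= r -> Cl ga / r <= Cl ga / r0).
{ intros. apply Rmult_le_compat_l; [|apply Rinv_le_contravar; lra].
  apply Rmult_le_reg_r with (/ r0); [apply Rinv_0_lt_compat; lra|]. lra. }
pose proof (Q r1 LRA).
destruct Hs as [-> | ->].
- destruct (phase_top al (-1) r1) as (c & c1 & c2 & c3 & c4); auto; try lra. exists c. lra.
- destruct (half_cycle al 1 r1) as (r2 & b1 & b2 & b3 & b4 & b5); auto; try lra.
  assert (E2 := E_decr al r1 r2 H LRA).
  assert (U2 := in_well al r1 r2 H LRA U1 LRA). pose proof (Q r2 LRA).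
  destruct (phase_top al (-1) r2) as (c & c1 & c2 & c3 & c4); auto; try lra. exists c. lra.
Qed.
End W.
End LemmaA.

(** * The shape of the potential *)

(* In the notation of the paper gs, g1, gM, b are gamma_*, gamma_1, gamma_M, beta_*; d0 is the last zero of F before gamma_1. *)
Class landscape {P : problem} := {
  gs : Rbar; d0 : R; g1 : R; gM : R; b : R;
  L_order : dl <= d0 /\ d0 < g1 /\ g1 <= gM /\ gM < b;
  L_btop : Rbar_lt (Finite b) gs;
  L_d0 : pot f d0 = 0;
  L_neg : forall x, 0 <= x <= d0 -> pot f x <= 0;
  L_rise : forall x, d0 < x < g1 -> 0 < f x;
  L_g1 : f g1 = 0 /\ 0 < pot f g1 /\ forall x, 0 <= x < g1 -> pot f x < pot f g1;
  L_gM : f gM = 0 /\ forall x, 0 <= x < gM -> pot f x < pot f gM;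
  L_right : exists e, 0 < e /\ forall x, gM < x < gM + e -> pot f x < pot f gM;
  L_b : pot f b = pot f gM /\ forall x, 0 <= x <= b -> pot f x <= pot f gM;
  L_out : forall x, b <= x -> Rbar_lt (Finite x) gs -> 0 < f x;
  L_fin : exists l : list R, forall x, dl < x -> Rbar_lt (Finite x) gs -> f x = 0 -> In x l }.

Section Land.
Context {P : problem} {LL : landscape}.
Notation f := (@f P).
Notation F := (pot f).
Notation E := orbit_energy.
Notation dl := (@dl P).
Notation gs := (@gs P LL).
Notation d0 := (@d0 P LL).
Notation g1 := (@g1 P LL).
Notation gM := (@gM P LL).
Notation b := (@b P LL).
Definition top x := Rbar_lt (Finite x) gs.

Lemma top_lt x y : x <= y -> top y -> top x.
Proof. intros. apply (Rbar_le_lt_trans (Finite x) (Finite y)); auto. Qed.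

Lemma adm_out x : b <= x -> top x -> adm x.
Proof.
intros. pose proof L_order. pose proof Hdl. split; [lra|apply L_out; auto].
Qed.

Lemma int_max (h : R -> R) a c m (l : R) : a < m < c -> is_derive h m l -> (forall y, a <= y <= c -> h y <= h m) -> l = 0.
Proof.
intros Hm Hd Hmax. destruct (Rtotal_order l 0) as [Hl|[|Hg]]; auto; exfalso.
- destruct (derive_neg_right _ _ _ Hd Hl) as (d & Hd0 & _ & h1).
  destruct (left_point a m d) as (y & ? & ?); try lrn. specialize (h1 y LRA). specialize (Hmax y LRA). lra.
- destruct (derive_pos_right _ _ _ Hd Hg) as (d & Hd0 & h1 & _).
  destruct (right_point m c d) as (y & ? & ?); try lrn. specialize (h1 y LRA). specialize (Hmax y LRA). lra.
Qed.

(** $f$ has finitely many zeros in the relevant range and $F<F(\gamma)$ at each, so $\eta$ can be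
    taken below all the gaps. A point of the layer with $f<0$ would force an interior maximum of $F$
    at least as high, which is again a zero of $f$ in the layer. *)
Lemma well_exists ga e0 : 0 < ga -> 0 < e0 -> (forall x, x < ga -> top x) -> 0 < F ga -> (forall s, 0 <= s < ga -> F s < F ga) ->
  exists eta, eta <= e0 /\ well ga eta.
Proof.
intros Hga He0 Htop HF Hlt. destruct L_fin as [l Hl].
assert (G : forall l : list R, exists eta, 0 < eta <= e0 /\ eta < F ga /\ forall z, In z l -> 0 < z < ga -> F z < F ga - eta).
{ clear l Hl. induction l as [|z l (eta & h1 & h2 & h3)].
  - exists (Rmin e0 (F ga / 2)). pose proof (Rmin_l e0 (F ga / 2)). pose proof (Rmin_r e0 (F ga / 2)).
    split; [split; [apply Rmin_glb_lt|]; lra|]. split; [lra|]. simpl; tauto.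
  - destruct (Rlt_le_dec 0 z) as [a|a]; [destruct (Rlt_le_dec z ga) as [c|c]|].
    + pose proof (Hlt z LRA). exists (Rmin eta ((F ga - F z) / 2)).
      pose proof (Rmin_l eta ((F ga - F z) / 2)). pose proof (Rmin_r eta ((F ga - F z) / 2)).
      split; [split; [apply Rmin_glb_lt|]; lra|]. split; [lra|]. intros y [<-|Hy] Hy2; [lra|]. specialize (h3 y Hy Hy2). lra.
    + exists eta. split; auto. split; auto. intros y [<-|Hy] Hy2; [lra|]. auto.
    + exists eta. split; auto. split; auto. intros y [<-|Hy] Hy2; [lra|]. auto. }
destruct (G l) as (eta & h1 & h2 & h3). exists eta. split; [lra|]. split; auto. split; [lra|]. split; auto.
assert (Z : forall z, 0 < z < ga -> F ga - eta <= F z -> f z <> 0).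
{ intros z Hz HFz Hf. assert (In z l).
  { apply Hl; auto; [|apply Htop; lra]. apply Rnot_le_lt. intros Hle. pose proof L_order. assert (Hzz : 0 <= z <= d0) by lra. pose proof (L_neg z Hzz). lra. }
  specialize (h3 z H Hz). lra. }
intros. destruct (Rtotal_order (f s) 0) as [Hn'|[Hz|]]; auto; exfalso; [|apply (Z s); auto].
destruct (max_attained F 0 s LRA) as (m & Hm & Hmax). { intros; apply F_cont. }
assert (Hms : F s <= F m) by (apply Hmax; lra).
assert (m <> 0) by (intros ->; rewrite F_0 in Hms; lra).
assert (m <> s).
{ intros ->. destruct (derive_neg_right F s _ (dF s) Hn') as (d & Hd0 & _ & q).
  destruct (left_point 0 s d) as (y & ? & ?); try lrn. specialize (q y LRA). specialize (Hmax y LRA). lra. }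
apply (Z m); [lra|lra|]. apply (int_max F 0 s m); auto; [lra|apply dF].
Qed.

Lemma first_dead al r : adm al -> 0 <= r -> U al r = 0 -> V al r = 0 ->
  exists rho, 0 < rho <= r /\ U al rho = 0 /\ V al rho = 0 /\ forall s, 0 <= s < rho -> U al s <> 0 \/ V al s <> 0.
Proof.
intros H Hr Hu Hv. pose (m := fun r => Rabs (U al r) + Rabs (V al r)).
destruct (first_below m 0 r 0) as (rho & Hrho & Em & Hb); auto.
- intros. apply (continuous_plus (fun r => Rabs (U al r)) (fun r => Rabs (V al r))); [apply absU_cont; auto; lra|].
  apply (continuous_comp (V al) Rabs); [apply V_cont; auto; lra|apply (continuous_Rabs (V al x))].
- unfold m. rewrite U_0, V_0, Rabs_R0 by auto. destruct H. rewrite Rabs_pos_eq; lra.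
- unfold m. rewrite Hu, Hv, Rabs_R0. lra.
- unfold m in *. pose proof (Rabs_pos (U al rho)). pose proof (Rabs_pos (V al rho)).
  exists rho. split; auto. split; [apply Rabs_eq_0; lra|]. split; [apply Rabs_eq_0; lra|]. intros.
  specialize (Hb s LRA). destruct (Req_dec (U al s) 0) as [a|a]; auto. right. intros c. rewrite a, c, Rabs_R0 in Hb. lra.
Qed.

Lemma U_cd' al a c r : (forall k : nat, adm (al k)) -> (forall k, al k <= c) -> ulim al a -> adm a -> 0 <= r ->
  (forall s, 0 <= s < r -> U a s <> 0 \/ V a s <> 0) ->
  ulim (fun k => U (al k) r) (U a r) /\ ulim (fun k => V (al k) r) (V a r) /\ ulim (fun k => E (al k) r) (E a r).
Proof.
intros.
destruct (cont_dep al a (U a) (V a) c (fun _ => r) r) as [L1 L2]; auto using ulim_const; [apply fam; auto|].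
split; auto. split; auto. apply ulim_plus.
- apply (ulim_comp (fun y => y ^ 2 / 2)); auto. unfold Rdiv. eapply is_derive_cont. der.
- apply (ulim_comp F); auto. apply F_cont.
Qed.

(* T collects the initial values whose solution falls into the innermost well |u| < g1. *)
Definition inT al r := Rabs (U al r) < g1 /\ E al r < F g1.
Definition T al := exists r, 0 <= r /\ inT al r.

Lemma inT_persist al r s : adm al -> 0 <= r <= s -> inT al r -> inT al s.
Proof.
intros H Hr [h1 h2]. pose proof L_order. pose proof Hdl. split.
- apply (trap_in al r g1 s); auto. lra.
- pose proof (E_decr al r s H Hr). lra.
Qed.

Lemma dead_T al r : 0 <= r -> U al r = 0 -> V al r = 0 -> inT al r.
Proof.
intros Hr Hu Hv. pose proof L_order. pose proof Hdl. pose proof L_g1 as (_ & hp & _). unfold inT, E, energy.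
rewrite Hu, Hv, Rabs_R0, F_0. lra.
Qed.

Lemma T_open al a c : (forall k : nat, adm (al k)) -> (forall k, al k <= c) -> ulim al a -> adm a -> T a ->
  Uf (fun k => T (al k)).
Proof.
intros Had Hc Ha Haa (r & Hr & HT).
assert (G : exists r, 0 <= r /\ inT a r /\ forall s, 0 <= s < r -> U a s <> 0 \/ V a s <> 0).
{ destruct (classic (U a r = 0 /\ V a r = 0)) as [[hu hv]|Hn].
  - destruct (first_dead a r Haa Hr hu hv) as (rho & q1 & q2 & q3 & q4). exists rho.
    split; [lra|]. split; auto. apply dead_T; lra.
  - exists r. split; auto. split; auto. intros. apply (live_before a r); [auto|lra|apply not_and_or in Hn; tauto]. }
clear r Hr HT. destruct G as (r & Hr & [HT1 HT2] & Hl).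
destruct (U_cd' al a c r Had Hc Ha Haa Hr Hl) as (L1 & _ & L3).
assert (L1' : ulim (fun k => Rabs (U (al k) r)) (Rabs (U a r))).
{ apply (ulim_comp Rabs); auto. apply (continuous_Rabs (U a r)). }
apply (Uf_mono _ _ (Uf_and _ _ (ulim_lt _ _ _ L1' HT1) (ulim_lt _ _ _ L3 HT2))). intros k [k1 k2].
exists r. split; auto. split; auto.
Qed.

Lemma first_level Phi l : 0 < l -> F l = Phi -> 0 < Phi -> (forall x, 0 <= x < l -> F x <= Phi) ->
  exists ga, 0 < ga <= l /\ F ga = Phi /\ forall x, 0 <= x < ga -> F x < Phi.
Proof.
intros.
destruct (first_above F 0 l Phi) as (t & Ht & Et & Hb); try lra.
- intros; apply F_cont.
- rewrite F_0; auto.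
- exists t. auto.
Qed.

(** Suppose the limit [a], outside [T], had fewer than [m] sign changes. It is not frozen, being
    outside [T], and not trapped, since its neighbours reach the inner well; so it converges to some
    [l] with $F(l)\ge F(\gamma_1)$, and its energy tends to $F(l)$ from above. The neighbours follow
    it for a long time before their energy falls below $F(\gamma_1)$. On the way they are, late,
    just below the top of a well of height $F(l)$, where [lemmaA] makes them oscillate. *)
Lemma end_lemma al a c m : (forall k : nat, adm (al k)) -> (forall k, al k <= c) -> ulim al a -> adm a -> top a -> ~ T a ->
  (forall k, T (al k)) -> Uf (fun k => W m (al k)).
Proof.
intros Had Hc Ha Haa Htop HnT HT. pose proof L_order as Lo. pose proof Hdl as Hdl'. pose proof L_g1 as (Lg1 & Lg2 & Lg3).
destruct (Uf_em (fun k => W m (al k))) as [|HnW]; auto.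
assert (HWa : ~ W m a).
{ intros HW. pose proof (W_open m al a c Had Hc Ha Haa HW) as Q. apply (Uf_out _ _ (Uf_and _ _ HnW Q)). tauto. }
assert (Hlive : live a).
{ intros r Hr. destruct (classic (U a r = 0 /\ V a r = 0)) as [[hu hv]|Hna]; [|apply not_and_or in Hna; tauto].
  exfalso. apply HnT. exists r. split; auto. apply dead_T; auto. }
assert (Hnt : forall r, 0 < r -> ~ trapped a r).
{ intros r Hr (x & Hx & HE).
  (* A barrier inside [g1] may be replaced by [g1]; a neighbour trapped outside it can never enter
     $|u|<\gamma_1$. *)
  assert (G : exists x, g1 <= x < Rabs (U a r) /\ E a r < F x).
  { destruct (Rle_lt_dec g1 x) as [l|l]; [exists x; split; [lra|auto]|]. pose proof (Lg3 x LRA).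
    exists g1. split; [|lra]. split; [lra|]. apply Rnot_le_lt. intros Hle.
    assert (Rabs (U a r) <> g1) by (apply (no_cross a r); auto; lra).
    apply HnT. exists r. split; [lra|]. split; lra. }
  clear x Hx HE. destruct G as (x & Hx & HE).
  destruct (U_cd' al a c r Had Hc Ha Haa LRA ltac:(intros; apply Hlive; lra)) as (L1 & _ & L3).
  assert (L1' : ulim (fun k => Rabs (U (al k) r)) (Rabs (U a r))).
  { apply (ulim_comp Rabs); auto. apply (continuous_Rabs (U a r)). }
  apply (Uf_out _ _ (Uf_and _ _ (ulim_gt _ _ x L1' LRA) (ulim_lt _ _ _ L3 HE))). intros k [k1 k2].
  destruct (HT k) as (t & Ht & HTk). pose (z := Rmax r t). pose proof (Rmax_l r t). pose proof (Rmax_r r t). fold z in H, H0.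
  destruct (inT_persist (al k) t z (Had k) LRA HTk).
  pose proof (trap_out (al k) r x z (Had k) LRA LRA k2 k1). lra. }
destruct (limit_lemma a m Haa HWa Hlive Hnt) as (s & l & R0 & q1 & q2 & q3 & q4 & q5 & q6 & q7 & q8 & q9).
assert (Hlg : g1 <= l).
{ apply Rnot_lt_le. intros Hlt. pose proof (Lg3 l LRA).
  destruct (tends_lt _ _ g1 q5 Hlt) as [R1 h1]. destruct (tends_lt _ _ (F g1) q7 LRA) as [R2 h2].
  pose (z := Rmax R0 (Rmax R1 R2)). pose proof (Rmax_l R0 (Rmax R1 R2)). pose proof (Rmax_r R0 (Rmax R1 R2)).
  pose proof (Rmax_l R1 R2). pose proof (Rmax_r R1 R2). fold z in H0, H1.
  apply HnT. exists z. split; [lra|]. split; [|apply h2; lra].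
  specialize (q4 z LRA). specialize (h1 z LRA).
  destruct q1; subst s; [rewrite Rabs_pos_eq|rewrite Rabs_left]; lra. }
assert (HPhi : F g1 <= F l). { destruct (Req_dec l g1) as [->|]; [lra|]. apply q9; lra. }
destruct (first_level (F l) l LRA eq_refl LRA q9) as (ga & Hga & Ega & Bga).
assert (g1 <= ga). { apply Rnot_lt_le. intros Hlt. pose proof (Lg3 ga LRA). lra. }
assert (Htl : top l).
{ apply (top_lt _ a); auto. apply (tends_le (fun r => s * U a r) l a 1); auto. intros.
  pose proof (U_bound a r Haa LRA) as Q. apply Rabs_le_between in Q. nra. }
destruct (well_exists ga 1) as (eta & _ & Hw); try lra.
{ intros. apply (top_lt _ l); auto; lra. } { intros. rewrite Ega. auto. }
destruct (lemmaA ga eta Hw m) as (R1 & e & HR1 & He & HA).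
assert (Efar : F l <= E a R1).
{ apply (tends_le (E a) (F l) (E a R1) R1); auto. intros. apply E_decr; auto; lra. }
destruct (U_cd' al a c R1 Had Hc Ha Haa LRA ltac:(intros; apply Hlive; lra)) as (_ & _ & L3).
apply (Uf_mono _ _ (ulim_gt _ _ (F l - e) L3 LRA)). intros k hk.
destruct (HT k) as (t & Ht & HTk). pose (z := Rmax R1 t). pose proof (Rmax_l R1 t). pose proof (Rmax_r R1 t). fold z in H0, H1.
destruct (inT_persist (al k) t z (Had k) LRA HTk).
destruct (Rle_lt_dec (F l - e) (E (al k) z)) as [hz|hz].
- apply (HA (al k) z); auto; lra.
- destruct (ivt_down (E (al k)) R1 z (F l - e)) as (w & Hw1 & Ew); try lra.
  { intros. apply E_cont; auto; lra. }
  apply (HA (al k) w); auto; try lra. apply Rnot_le_lt. intros Hle.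
  assert (Rabs (U (al k) w) <> ga) by (apply (no_cross (al k) w); auto; lra).
  assert (ga < Rabs (U (al k) z)) by (apply (trap_out (al k) w ga z); auto; lra). lra.
Qed.

(** At positive times the energy is strictly below $F(b)=F(\gamma_M)$, so $|U|$ cannot come down
    through $\gamma_M$. *)
Lemma b_not_T : ~ T b.
Proof.
pose proof L_order. pose proof Hdl. destruct L_b as [Lb1 Lb2].
assert (Hb : adm b) by (apply adm_out; [lra|apply L_btop]).
intros (r & Hr & HT).
assert (forall t, 0 < t -> E b t < F gM).
{ intros. rewrite <- Lb1, <- (E_0 b Hb). apply (energy_strict n Hn f 0); auto using Hfc, U_ode, V_0; try lra.
  - apply U_cont; auto; lra.
  - apply V_cont; auto; lra.
  - rewrite U_0 by auto. apply Hb. }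
destruct (inT_persist b r (r + 1) Hb LRA HT).
destruct (ivt_down (fun t => Rabs (U b t)) 0 (r + 1) gM) as (t & Ht & Et); try lra.
- intros. apply absU_cont; auto; lra.
- rewrite U_0 by auto. rewrite (Rabs_pos_eq b); lra.
- assert (t <> 0). { intros ->. rewrite U_0, Rabs_pos_eq in Et by (auto; lra). lra. }
  assert (0 < t) by lrn. apply (no_cross b t gM t Hb); auto; lra.
Qed.

(** What the condition at $\gamma_*$ has to provide: many sign changes near $\gamma_*$, which close
    the interval of initial values from above, and one solution that gets below $-\gamma_M$, which
    is needed for the odd loop. *)
Definition far_oscillation := (forall m, exists A0, b <= A0 /\ top A0 /\ forall al, A0 < al -> top al -> W m al) /\
  exists al r, b < al /\ top al /\ 0 < r /\ U al r < - gM.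

Lemma crit_far ga eta al c : F gM < F ga - eta / 2 -> V al c = 0 -> U al c < 0 -> F ga - eta / 2 <= E al c -> U al c < - gM.
Proof.
intros H1 Hv Hu HE. pose proof L_order. destruct L_b as [_ Lb].
assert (FE : E al c = F (U al c)) by (unfold E, energy; rewrite Hv; lra).
rewrite <- F_abs, Rabs_left in FE by auto.
apply Rnot_le_lt. intros Hle. assert (Hr : 0 <= - U al c <= b) by lra. pose proof (Lb _ Hr). lra.
Qed.

Lemma F_incr_out x y : b <= x < y -> top y -> F x < F y.
Proof.
intros. apply (mono_lt F f x y); try lra.
- intros; apply dF.
- intros; apply F_cont.
- intros. apply L_out; [lra|]. apply (top_lt _ y); auto; lra.
Qed.

(** $\gamma_*$ is an equilibrium and the top of a well. By continuous dependence on the constant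
    solution, solutions that start near it still have almost full energy at any fixed time. *)
Lemma far_finite g : gs = Finite g -> f g = 0 -> far_oscillation.
Proof.
intros Hgs Hg. pose proof L_order as Lo. pose proof Hdl as Hdl'. destruct L_b as [Lb1 Lb2]. destruct L_gM as [Lm1 Lm2].
assert (Htop : forall x, top x <-> x < g) by (intros x; unfold top; rewrite Hgs; simpl; tauto).
assert (Hbg : b < g) by (apply Htop; apply L_btop).
assert (Finc : forall x, b <= x < g -> F x < F g).
{ intros. apply (mono_lt F f x g); try lra.
  - intros; apply dF.
  - intros; apply F_cont.
  - intros. apply L_out; [lra|]. apply Htop. lra. }
assert (Fmax : forall x, 0 <= x < g -> F x < F g).
{ intros. destruct (Rle_lt_dec b x); [apply Finc; lra|]. pose proof (Lb2 x LRA). pose proof (Finc b LRA). lra. }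
assert (HFg : F gM < F g) by (apply Fmax; lra).
assert (0 < F gM). { destruct L_g1 as (_ & hp & _). destruct (Req_dec g1 gM) as [<-|]; [auto|]. pose proof (Lm2 g1 LRA). lra. }
destruct (well_exists g (F g - F gM)) as (eta & Heta & Hw); try lra; auto.
{ intros. apply Htop; auto. }
assert (reg n f g (fun _ => g) (fun _ => 0)).
{ split; auto. split; auto. split; [apply continuous_const|]. split; [apply continuous_const|].
  intros. split; [apply dconst|]. eapply dval; [apply dconst|]. lra. }
assert (Near : forall R0 e (Q : R -> Prop), 0 < R0 -> 0 < e ->
   (forall al r0, adm al -> R0 <= r0 -> Rabs (U al r0) < g -> F g - e <= E al r0 < F g -> Q al) ->
   exists A0, b <= A0 /\ A0 < g /\ forall al, A0 < al -> al < g -> Q al).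
{ intros R0 e Q HR0 He HQ. apply NNPP. intros Hno.
  pose (A := fun k => g - (g - b) * / (INR k + 1)).
  assert (HA : forall k, b <= A k < g).
  { intros. unfold A. pose proof (pos_INR k). assert (0 < / (INR k + 1)) by (apply Rinv_0_lt_compat; lra).
    assert (/ (INR k + 1) <= 1). { rewrite <- Rinv_1. apply Rinv_le_contravar; lra. } nra. }
  destruct (choose1 _ _ (fun k al => A k < al < g /\ ~ Q al)) as [al Hal].
  { intros. apply NNPP. intros Hn'. apply Hno. exists (A k). split; [apply HA|]. split; [apply HA|].
    intros. apply NNPP. intros h3. apply Hn'. exists al. auto. }
  assert (Had : forall k, adm (al k)).
  { intros. apply adm_out; [|apply Htop]; destruct (Hal k); pose proof (HA k); lra. }
  assert (ulim al g).
  { assert (LA : ulim (fun k => (g - b) * / (INR k + 1)) 0).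
    { replace 0 with (0 * (g - b)) by ring. apply (ulim_ext (fun k => / (INR k + 1) * (g - b))); [apply Uf_all; intros; ring|].
      apply ulim_scal, ulim_inv_INR. }
    intros ep Hep. apply (Uf_mono _ _ (ulim_lt _ _ ep LA Hep)). intros k hk. destruct (Hal k) as [h _]. unfold A in h.
    rewrite Rabs_left; lra. }
  destruct (cont_dep al g (fun _ => g) (fun _ => 0) g (fun _ => R0) R0) as [L1 L2]; auto using ulim_const; try lra.
  { intros. left. apply Hal. } { intros; lra. } { intros. lra. }
  assert (L3 : ulim (fun k => E (al k) R0) (F g)).
  { replace (F g) with (0 ^ 2 / 2 + F g) by lra. apply ulim_plus.
    - apply (ulim_comp (fun y => y ^ 2 / 2)); auto. unfold Rdiv. eapply is_derive_cont. der.
    - apply (ulim_comp F); auto. apply F_cont. }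
  apply (Uf_out _ _ (ulim_gt _ _ (F g - e) L3 LRA)). intros k hk. destruct (Hal k) as [h1 h2]. apply h2.
  apply (HQ (al k) R0); auto; try lra.
  - pose proof (U_bound (al k) R0 (Had k) LRA). lra.
  - split; [lra|]. pose proof (E_decr (al k) 0 R0 (Had k) LRA). rewrite E_0 in * by auto.
    pose proof (HA k). pose proof (Finc (al k) LRA). lra. }
split.
- intros. destruct (lemmaA g eta Hw m) as (R0 & e & HR0 & He & HA).
  destruct (Near R0 e (W m) HR0 He HA) as (A0 & h1 & h2 & h3). exists A0. split; auto. split; [apply Htop; auto|].
  intros. apply h3; auto. apply Htop; auto.
- destruct (reachA g eta Hw) as (R0 & e & HR0 & He & HA).
  destruct (Near R0 e (fun al => exists r, 0 < r /\ U al r < - gM) HR0 He) as (A0 & h1 & h2 & h3).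
  { intros al r0 H1 H2 H3 H4. destruct (HA al r0 H1 H2 H3 H4) as (c & c1 & c2 & c3 & c4).
    exists c. split; [lra|]. apply (crit_far g eta); auto. lra. }
  destruct (h3 ((A0 + g) / 2) LRA LRA) as (r & Hr & HU). exists ((A0 + g) / 2), r.
  split; [lra|]. split; [apply Htop; lra|]. auto.
Qed.
End Land.

(** * Far oscillation for an unbounded domain *)

Section Infinite.
Context {P : problem} {LL : landscape}.
Notation n := (@n P).
Notation f := (@f P).
Notation F := (pot f).
Notation U := (@U P).
Notation V := (@V P).
Notation E := (@orbit_energy P).
Notation gs := (@gs P LL).
Notation gM := (@gM P LL).
Notation b := (@b P LL).

Definition Qf s := 2 * (nu n + 1) * F s - (nu n - 1) * s * f s.
(** The Pohozaev functional, combined so that the terms in $v^2$ and $uv$ cancel in its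
    derivative. *)
Definition Poh al r := 2 * (r ^ S n * E al r) + (nu n - 1) * (r ^ n * (U al r * V al r)).

Lemma Poh_derive al r : adm al -> 0 < r -> is_derive (Poh al) r (r ^ n * Qf (U al r)).
Proof.
intros H Hr. pose proof (E_derive al r H Hr). pose proof (U_derive al r H Hr). pose proof (V_derive al r H Hr).
unfold Poh. eapply dval; [der|]. unfold Qf, E, energy.
rewrite S_INR. fold (nu n).
assert (Hp : r ^ n = r * r ^ pred n) by (change (r * r ^ pred n) with (r ^ S (pred n)); f_equal; pose proof Hn; lia).
simpl. rewrite Hp. field. lra.
Qed.

Lemma Poh_cont al r : adm al -> 0 <= r -> continuous (Poh al) r.
Proof.
intros.
apply (continuous_plus (fun r => 2 * (r ^ S n * E al r)) (fun r => (nu n - 1) * (r ^ n * (U al r * V al r)))).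
- apply (continuous_mult (fun _ => 2) (fun r => r ^ S n * E al r)); [apply continuous_const|].
  apply (continuous_mult (fun r => r ^ S n) (E al)); [eapply is_derive_cont; der|apply E_cont; auto].
- apply (continuous_mult (fun _ => nu n - 1) (fun r => r ^ n * (U al r * V al r))); [apply continuous_const|].
  apply (continuous_mult (fun r => r ^ n) (fun r => U al r * V al r)); [eapply is_derive_cont; der|].
  apply (continuous_mult (U al) (V al)); [apply U_cont|apply V_cont]; auto.
Qed.

Lemma le_of_sq x c : 0 <= x -> x ^ 2 <= c -> x <= c + 1.
Proof. nra. Qed.

Lemma Poh_0 al : Poh al 0 = 0.
Proof. unfold Poh. pose proof Hn. destruct n as [|m]; [lia|]. simpl. ring. Qed.

Lemma Poh_ge al r1 r2 q : adm al -> 0 <= r1 <= r2 -> (forall r, r1 < r < r2 -> q <= Qf (U al r)) ->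
  Poh al r1 + q * (r2 ^ S n - r1 ^ S n) / (nu n + 1) <= Poh al r2.
Proof.
intros H Hr Hq. assert (Hnu := nu_ge n Hn).
assert (Poh al r1 - q * r1 ^ S n / (nu n + 1) <= Poh al r2 - q * r2 ^ S n / (nu n + 1)).
{ apply (mono_le (fun r => Poh al r - q * r ^ S n / (nu n + 1)) (fun r => r ^ n * Qf (U al r) - q * r ^ n)); try lra.
  - intros. apply dminus; [apply Poh_derive; auto; lra|]. unfold Rdiv. eapply dval; [der|].
    rewrite S_INR. fold (nu n). simpl pred. field. lra.
  - intros. apply (continuous_minus (Poh al) (fun r => q * r ^ S n / (nu n + 1))); [apply Poh_cont; auto; lra|].
    unfold Rdiv. eapply is_derive_cont. der.
  - intros x Hx. specialize (Hq x Hx). assert (0 <= x ^ n) by (apply pow_le; lra). nra. }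
lra.
Qed.

(** Comparison with the parabola $\alpha-Br^2/(2N)$, which is the radial solution for a constant
    force $B$. With $s=-1$ a lower bound on the force gives the reverse estimate. *)
Lemma decay_bound s al r0 B : (s = 1 \/ s = -1) -> adm al -> 0 < r0 -> (forall r, 0 < r < r0 -> s * f (U al r) <= s * B) ->
  s * (al - B * r0 ^ 2 / (2 * (nu n + 1))) <= s * U al r0.
Proof.
intros Hs H Hr HB. assert (Hnu := nu_ge n Hn).
assert (ds : forall (g : R -> R) (x l : R), is_derive g x l -> is_derive (fun t => s * g t) x (s * l)).
{ intros. apply (dval _ _ (0 * g x + s * l)); [apply (dmult (fun _ => s) g); [apply dconst|auto]|ring]. }
assert (cs : forall (g : R -> R) (x : R), continuous g x -> continuous (fun t => s * g t) x).
{ intros. apply (continuous_mult (fun _ => s) g); auto. apply continuous_const. }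
assert (Hv : forall r, 0 < r < r0 -> s * - (B * r / (nu n + 1)) <= s * V al r).
{ intros.
  assert (M : s * (B * 0 ^ S n / (nu n + 1) + 0 ^ n * V al 0) <= s * (B * r ^ S n / (nu n + 1) + r ^ n * V al r)).
  { apply (mono_le (fun r => s * (B * r ^ S n / (nu n + 1) + r ^ n * V al r)) (fun r => s * (B * r ^ n + - (r ^ n * f (U al r))))); try lra.
    - intros. apply ds. apply dplus; [|apply (momentum_derive n Hn f 0 (U al) (V al)); auto using U_ode; lra].
      unfold Rdiv. eapply dval; [der|]. rewrite S_INR. fold (nu n). simpl pred. field. lra.
    - intros. apply cs. apply (continuous_plus (fun r => B * r ^ S n / (nu n + 1)) (fun r => r ^ n * V al r)).
      + unfold Rdiv. eapply is_derive_cont. der.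
      + apply momentum_cont. apply V_cont; auto; lra.
    - intros. specialize (HB x LRA). assert (0 <= x ^ n) by (apply pow_le; lra).
      nra. }
  rewrite V_0 in M by auto. simpl in M. rewrite Rmult_0_l, !Rmult_0_r in M.
  assert (0 < r ^ n) by (apply pow_lt; lra).
  nra. }
assert (M : s * (U al 0 + B * 0 ^ 2 / (2 * (nu n + 1))) <= s * (U al r0 + B * r0 ^ 2 / (2 * (nu n + 1)))).
{ apply (mono_le (fun r => s * (U al r + B * r ^ 2 / (2 * (nu n + 1)))) (fun r => s * (V al r + B * r / (nu n + 1)))); try lra.
  - intros. apply ds. apply dplus; [apply U_derive; auto; lra|]. unfold Rdiv. eapply dval; [der|]. simpl. field. lra.
  - intros. apply cs. apply (continuous_plus (U al) (fun r => B * r ^ 2 / (2 * (nu n + 1)))); [apply U_cont; auto; lra|].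
    unfold Rdiv. eapply is_derive_cont. der.
  - intros. specialize (Hv x LRA). lra. }
rewrite U_0 in M by auto. lra.
Qed.

Definition growth := exists theta, 0 < theta < 1 /\
  forall M, exists S0, forall s s1 s2, S0 <= s -> theta * s <= s1 <= s -> theta * s <= s2 <= s ->
    0 < f s1 /\ M < Qf s2 * Rpower (s / f s1) ((nu n + 1) / 2).

Hypothesis Hgs : gs = p_infty.
Hypothesis Hgrowth : growth.

Lemma all_top x : top x.
Proof. unfold top. rewrite Hgs. exact I. Qed.

Lemma Qf_cont (x : R) : continuous Qf x.
Proof.
 apply (continuous_minus (fun s => 2 * (nu n + 1) * F s) (fun s => (nu n - 1) * s * f s)).
- apply (continuous_mult (fun _ => 2 * (nu n + 1)) F); [apply continuous_const|apply F_cont].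
- apply (continuous_mult (fun s => (nu n - 1) * s) f); [eapply is_derive_cont; der|apply Hfc].
Qed.

Lemma Qf_even x : Qf (- x) = Qf x.
Proof. unfold Qf. rewrite F_even, Hfo. ring. Qed.

Lemma Qf_lower : exists Q0, 0 < Q0 /\ forall x, - Q0 <= Qf x.
Proof.
destruct Hgrowth as (th & Hth & HM). destruct (HM 0) as [S0 HS].
destruct (bounded_on Qf 0 (Rabs S0 + 1)) as (B & HB & hB). { pose proof (Rabs_pos S0); lra. } { intros; apply Qf_cont. }
exists B. split; auto.
assert (G : forall x, 0 <= x -> - B <= Qf x).
{ intros. destruct (Rle_lt_dec x (Rabs S0 + 1)) as [l|l].
  - specialize (hB x LRA). apply Rabs_le_between in hB. lra.
  - pose proof (Rle_abs S0). destruct (HS x x x LRA ltac:(nra) ltac:(nra)).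
    assert (0 < Rpower (x / f x) ((nu n + 1) / 2)) by apply exp_pos.
     nra. }
intros. destruct (Rle_lt_dec 0 x); [apply G; auto|]. rewrite <- Qf_even. apply G. lra.
Qed.

Lemma Rpower_half x m : 0 < x -> Rpower (x ^ 2) (INR m / 2) = x ^ m.
Proof.
intros. rewrite <- (Rpower_pow 2) by auto. rewrite Rpower_mult. rewrite <- Rpower_pow by auto. f_equal. simpl. field.
Qed.

(** While $u$ falls from $\alpha$ to $\theta\alpha$, at time $r_t$, the Pohozaev functional grows by
    at least $\min Q\cdot r_t^N/N$, and comparison gives $r_t^2\ge2N(1-\theta)\alpha/\max f$. The
    growth condition makes the product as large as desired. Until [R0] the functional then loses
    only a bounded amount, while low energy at [R0] would bound it there. If $u$ does not fall that
    far before [R0], the energy is high anyway. *)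
Lemma high_energy R0 e0 : 0 < R0 -> 0 < e0 -> exists A0, b <= A0 /\ forall al, A0 < al -> F (b + e0) <= E al R0.
Proof.
intros HR0 He0. destruct Hgrowth as (th & Hth & HM). destruct Qf_lower as (Q0 & HQ0 & hQ0).
pose proof L_order as Lo. pose proof Hdl as Hdl'. assert (Hnu := nu_ge n Hn).
set (b0 := b + e0). assert (Hb0 : b < b0) by (unfold b0; lra).
destruct (f_bound (fun x => F x) F_cont b0) as (B & HB & hB).
pose (Vb := 2 * (Rabs (F b0) + B) + 1).
(* Bounds the functional at [R0] for an energy below [F b0], plus its possible decrease before
   [R0]. *)
pose (C2 := 2 * (R0 ^ S n * Rabs (F b0)) + (nu n - 1) * (R0 ^ n * (b0 * Vb)) + Q0 * R0 ^ S n / (nu n + 1)).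
(* The constant in $r_t^N\ge c\,(\alpha/f(s_1))^{N/2}$. *)
pose (c := Rpower (2 * (nu n + 1) * (1 - th)) ((nu n + 1) / 2)).
assert (Hc : 0 < c) by apply exp_pos.
destruct (HM ((Rabs C2 + 1) * (nu n + 1) / c)) as [S0 HS].
exists (Rmax (Rmax b S0) (b0 / th)). split.
{ eapply Rle_trans; [|apply Rmax_l]. apply Rmax_l. }
intros al Hal.
assert (al_b : b < al /\ S0 < al /\ b0 < th * al).
{ pose proof (Rmax_l (Rmax b S0) (b0 / th)). pose proof (Rmax_r (Rmax b S0) (b0 / th)). pose proof (Rmax_l b S0). pose proof (Rmax_r b S0).
  split; [lra|]. split; [lra|]. assert (b0 / th < al) by lra. apply Rlt_div_l in H3; lra. }
assert (adm al) by (apply adm_out; [lra|apply all_top]).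
assert (Fin : forall x, b0 <= x -> F b0 <= F x).
{ intros. destruct (Req_dec x b0) as [->|]; [lra|]. left. apply F_incr_out; [split; [lra|lrn]|apply all_top]. }
destruct (classic (exists r, 0 <= r <= R0 /\ U al r <= th * al)) as [(r & Hr & HU)|Hno].
2: { assert (th * al < U al R0) by (apply Rnot_le_lt; intros Hle; apply Hno; exists R0; lra).
     pose proof (F_le_E al R0). assert (HUb : b0 <= U al R0) by lra. pose proof (Fin _ HUb). lra. }
destruct (first_below (U al) 0 r (th * al)) as (rt & Hrt & Et & Hb); try lra.
{ intros. apply U_cont; auto; lra. } { rewrite U_0 by auto. nra. }
assert (Range : forall x, 0 < x < rt -> th * al <= U al x <= al).
{ intros. split; [left; apply Hb; lra|]. pose proof (U_bound al x H LRA) as Q. apply Rabs_le_between in Q. lra. }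
destruct (max_attained f (th * al) al) as (s1 & Hs1 & hs1). { nra. } { intros; apply Hfc. }
destruct (max_attained (fun x => - Qf x) (th * al) al) as (s2 & Hs2 & hs2). { nra. } { intros. apply (continuous_opp Qf). apply Qf_cont. }
destruct (HS al s1 s2 LRA Hs1 Hs2) as [Hf1 HQ].
pose proof (decay_bound 1 al rt (f s1) ltac:(auto) H LRA ltac:(intros x Hx; rewrite !Rmult_1_l; apply hs1, Range, Hx)) as Dk. rewrite Et, !Rmult_1_l in Dk.
assert (2 * (nu n + 1) * (1 - th) * (al / f s1) <= rt ^ 2).
{ apply Rmult_le_reg_r with (f s1 / (2 * (nu n + 1))); [apply Rdiv_lt_0_compat; lra|].
  replace (2 * (nu n + 1) * (1 - th) * (al / f s1) * (f s1 / (2 * (nu n + 1)))) with ((1 - th) * al) by (field; lra).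
  lra. }
assert (0 < al / f s1) by (apply Rdiv_lt_0_compat; lra).
assert (0 < 2 * (nu n + 1) * (1 - th)) by nra.
assert (c * Rpower (al / f s1) ((nu n + 1) / 2) <= rt ^ S n).
{ unfold c. rewrite Rpower_mult_distr by auto. rewrite <- (Rpower_half rt (S n)) by lra.
  rewrite S_INR. fold (nu n). apply Rle_Rpower_l; [lra|]. nra. }
assert (0 < Rpower (al / f s1) ((nu n + 1) / 2)) by apply exp_pos.
assert (0 <= (Rabs C2 + 1) * (nu n + 1) / c).
{ pose proof (Rabs_pos C2). apply Rdiv_le_0_compat; [apply Rmult_le_pos; lra|auto]. }
assert (Rabs C2 + 1 <= Poh al rt).
{ pose proof (Poh_ge al 0 rt (Qf s2) H LRA) as G. rewrite Poh_0 in G.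
  assert (Gq : forall r, 0 < r < rt -> Qf s2 <= Qf (U al r)).
  { intros x Hx. pose proof (hs2 (U al x) (Range x Hx)). lra. }
  specialize (G Gq). simpl (0 ^ S n) in G. rewrite Rmult_0_l, Rminus_0_r in G.
  assert (Qf s2 * (c * Rpower (al / f s1) ((nu n + 1) / 2)) <= Qf s2 * rt ^ S n) by nra.
  assert ((Rabs C2 + 1) * (nu n + 1) < Qf s2 * (c * Rpower (al / f s1) ((nu n + 1) / 2))).
  { apply Rmult_lt_compat_r with (r := c) in HQ; auto.
    replace ((Rabs C2 + 1) * (nu n + 1) / c * c) with ((Rabs C2 + 1) * (nu n + 1)) in HQ by (field; lra). lra. }
  assert (Rabs C2 + 1 <= Qf s2 * rt ^ S n / (nu n + 1)) by (apply Rle_div_r; lra). lra. }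
apply Rnot_lt_le. intros HE.
assert (Rabs (U al R0) < b0).
{ apply Rnot_le_lt. intros Hle. pose proof (Fin _ Hle) as Q. rewrite F_abs in Q. pose proof (F_le_E al R0). lra. }
pose proof (hB (U al R0) LRA) as HFb. apply Rabs_le_between in HFb.
pose proof (Rle_abs (F b0)).
assert (Rabs (V al R0) <= Vb).
{ unfold E, energy in HE. assert (Hsq : V al R0 ^ 2 <= 2 * (Rabs (F b0) + B)) by lra.
  rewrite <- pow2_abs in Hsq. apply le_of_sq; auto. apply Rabs_pos. }
pose proof (Poh_ge al rt R0 (- Q0) H LRA ltac:(intros; apply hQ0)).
assert (0 <= R0 ^ S n) by (apply pow_le; lra). assert (0 <= R0 ^ n) by (apply pow_le; lra).
assert (0 <= rt ^ S n) by nra.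
assert (- (Q0 * R0 ^ S n / (nu n + 1)) <= - Q0 * (R0 ^ S n - rt ^ S n) / (nu n + 1)).
{ replace (- Q0 * (R0 ^ S n - rt ^ S n) / (nu n + 1)) with (- (Q0 * R0 ^ S n / (nu n + 1)) + Q0 * rt ^ S n / (nu n + 1)) by (field; lra).
  assert (0 <= Q0 * rt ^ S n / (nu n + 1)) by (apply Rdiv_le_0_compat; [apply Rmult_le_pos; lra|lra]). lra. }
assert (Poh al R0 <= 2 * (R0 ^ S n * Rabs (F b0)) + (nu n - 1) * (R0 ^ n * (b0 * Vb))).
{ apply Rplus_le_compat.
  - nra.
  - apply Rmult_le_compat_l; [lra|]. apply Rmult_le_compat_l; auto.
    eapply Rle_trans; [apply Rle_abs|]. rewrite Rabs_mult. apply Rmult_le_compat; try apply Rabs_pos; lra. }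
pose proof (Rle_abs C2). unfold C2 in *. lra.
Qed.

(** The point $b+1$ bounds a well. If the energy never falls below its top, a bounded number of sign
    changes would give a limit beyond [b] with $f=0$. If it does fall, it passes late through a thin
    layer below the top, and the lemmas on wells apply. *)
Lemma far_infinite : far_oscillation.
Proof.
pose proof L_order as Lo. pose proof Hdl as Hdl'. destruct L_b as [Lb1 Lb2]. destruct L_gM as [Lm1 Lm2].
set (b0 := b + 1).
assert (Fin : forall x y, b <= x < y -> F x < F y) by (intros x y Hx; apply F_incr_out; auto; apply all_top).
assert (Fmax : forall x, 0 <= x < b0 -> F x < F b0).
{ intros. unfold b0 in *. destruct (Rle_lt_dec b x) as [l|l]; [apply Fin; lra|].
  pose proof (Lb2 x LRA). pose proof (Fin b (b + 1) LRA). lra. }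
assert (HFg : F gM < F b0) by (apply Fmax; unfold b0; lra).
assert (HgM : 0 < F gM).
{ destruct L_g1 as (_ & hp & _). destruct (Req_dec (@g1 P LL) gM) as [<-|Hne]; [auto|]. assert (Q : 0 <= @g1 P LL < gM) by lrn.
  pose proof (Lm2 _ Q). lra. }
destruct (well_exists b0 (F b0 - F gM)) as (eta & Heta & Hw); try lra; auto.
{ unfold b0; lra. } { intros. apply all_top. }
assert (Far : forall x, F b0 <= F x -> b0 <= Rabs x).
{ intros. apply Rnot_lt_le. intros Hlt. pose proof (Fmax (Rabs x) ltac:(split; [apply Rabs_pos|auto])). rewrite F_abs in *. lra. }
assert (Always : forall al m, b < al -> (forall r, 0 <= r -> F b0 <= E al r) -> W m al).
{ intros al m Hal HE. apply NNPP. intros HW. assert (adm al) by (apply adm_out; [lra|apply all_top]).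
  assert (Hlive : live al).
  { intros r Hr. destruct (Req_dec (U al r) 0) as [a|a]; auto. right. intros c. specialize (HE r Hr).
    unfold E, energy in HE. rewrite a, c, F_0 in HE. lra. }
  assert (Hnt : forall r, 0 < r -> ~ trapped al r).
  { intros r Hr (x & Hx & HEx). specialize (HE r LRA). pose proof (F_le_E al r) as Q. rewrite <- F_abs in Q.
    destruct (Rlt_le_dec x b0) as [l|l]; [pose proof (Fmax x LRA); lra|].
    pose proof (Fin x (Rabs (U al r)) ltac:(unfold b0 in *; lra)). lra. }
  destruct (limit_lemma al m H HW Hlive Hnt) as (s & l & R0 & q1 & q2 & q3 & q4 & q5 & q6 & q7 & q8 & q9).
  assert (Fl : F b0 <= F l) by (apply (tends_ge (E al) _ _ 0); auto).
  pose proof (Far l Fl) as Q. rewrite Rabs_pos_eq in Q by auto.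
  assert (Hbl : b <= l) by (unfold b0 in Q; lra). pose proof (L_out l Hbl (all_top l)). lra. }
assert (Drop : forall al R0 e, b < al -> 0 < R0 -> 0 < e -> F b0 <= E al R0 ->
   (forall r, 0 <= r -> F b0 <= E al r) \/ exists r0, R0 <= r0 /\ Rabs (U al r0) < b0 /\ F b0 - e <= E al r0 < F b0).
{ intros al R0 e Hal HR0 He HE. assert (adm al) by (apply adm_out; [lra|apply all_top]).
  destruct (classic (exists r, R0 <= r /\ E al r < F b0)) as [(r & Hr & Hlt)|Hno].
  - right.
    assert (G : exists r0, R0 <= r0 /\ F b0 - e <= E al r0 < F b0).
    { destruct (Rle_lt_dec (F b0 - e) (E al r)) as [l|l]; [exists r; auto|].
      destruct (ivt_down (E al) R0 r (F b0 - e)) as (w & Hw1 & Ew); try lra. { intros. apply E_cont; auto; lra. }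
      exists w. lra. }
    destruct G as (r0 & h1 & h2). exists r0. split; auto. split; auto.
    apply Rnot_le_lt. intros Hle. pose proof (F_le_E al r0) as Q. rewrite <- F_abs in Q.
    destruct (Req_dec (Rabs (U al r0)) b0) as [Eq|Hne]; [rewrite Eq in Q; lra|].
    pose proof (Fin b0 (Rabs (U al r0)) ltac:(unfold b0 in *; lrn)). lra.
  - left. intros. destruct (Rle_lt_dec R0 r) as [l|l].
    + apply Rnot_lt_le. intros Hlt. apply Hno. exists r. auto.
    + pose proof (E_decr al r R0 H LRA). lra. }
split.
- intros. destruct (lemmaA b0 eta Hw m) as (R0 & e & HR0 & He & HA).
  destruct (high_energy R0 1 HR0 Rlt_0_1) as (A0 & h1 & h2). exists A0. split; auto. split; [apply all_top|].
  intros al Hal _. specialize (h2 al Hal).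
  destruct (Drop al R0 e LRA HR0 He h2) as [HE|(r0 & q1 & q2 & q3)]; [apply Always; auto; lra|].
  apply (HA al r0); auto. apply adm_out; [lra|apply all_top].
- destruct (reachA b0 eta Hw) as (R0 & e & HR0 & He & HA).
  destruct (high_energy R0 1 HR0 Rlt_0_1) as (A0 & h1 & h2). specialize (h2 (A0 + 1) LRA).
  assert (adm (A0 + 1)) by (apply adm_out; [lra|apply all_top]).
  exists (A0 + 1).
  destruct (Drop (A0 + 1) R0 e LRA HR0 He h2) as [HE|(r0 & q1 & q2 & q3)].
  + destruct (Always (A0 + 1) 2%nat LRA HE) as [hi Ha].
    apply (alt_calt _ (V (A0 + 1))) in Ha; try lra.
    * destruct Ha as (c & Hc & Hcp & Hcv & r2 & Hr2 & _).
      assert (Vc : V (A0 + 1) c = 0) by lra.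
      exists c. split; [lra|]. split; [apply all_top|]. split; [lra|]. specialize (HE c LRA).
      unfold E, energy in HE. rewrite Vc in HE.
      assert (Q : F b0 <= F (U (A0 + 1) c)) by lra. pose proof (Far _ Q) as Q2. rewrite Rabs_left in Q2 by lra. unfold b0 in Q2. lra.
    * intros. apply U_cont; auto.
    * intros. apply U_derive; auto.
    * rewrite U_0 by auto. lra.
  + destruct (HA (A0 + 1) r0 H q1 q2 q3) as (c & c1 & c2 & c3 & c4). exists c. split; [lra|]. split; [apply all_top|]. split; [lra|].
    apply (crit_far b0 eta); auto. lra.
Qed.
End Infinite.

(** * Decaying solutions *)

Lemma passage_up (h : R -> R) x y c1 c2 : x <= y -> c1 < c2 -> (forall r, x <= r <= y -> continuous h r) ->
  h x <= c1 -> c2 <= h y -> exists t2 t1, x <= t2 < t1 /\ t1 <= y /\ h t2 = c1 /\ h t1 = c2 /\ forall r, t2 <= r <= t1 -> c1 <= h r <= c2.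
Proof.
intros Hxy Hc Hcont Hx Hy.
destruct (first_above h x y c2) as (t1 & Ht1 & E1 & B1); auto; try lra.
destruct (last_at h x t1 c1) as (t2 & Ht2 & E2 & B2); try lra. { intros r Hr; apply Hcont; lra. }
exists t2, t1. split; [lra|]. split; [lra|]. split; auto. split; auto. intros. split.
- destruct (Req_dec r t2) as [->|]; [lra|]. left; apply B2; lra.
- destruct (Req_dec r t1) as [->|]; [lra|]. left; apply B1; lra.
Qed.

Lemma passage_down (h : R -> R) x y c1 c2 : x <= y -> c1 < c2 -> (forall r, x <= r <= y -> continuous h r) ->
  c2 <= h x -> h y <= c1 -> exists t2 t1, x <= t2 < t1 /\ t1 <= y /\ h t2 = c2 /\ h t1 = c1 /\ forall r, t2 <= r <= t1 -> c1 <= h r <= c2.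
Proof.
intros.
destruct (passage_up (fun r => - h r) x y (- c2) (- c1)) as (t2 & t1 & h1 & h2 & h3 & h4 & h5); try lra.
{ intros. apply (continuous_opp h); auto. }
exists t2, t1. split; auto. split; auto. split; [lra|]. split; [lra|]. intros r Hr. specialize (h5 r Hr). lra.
Qed.

Section Death.
Context {P : problem} {LL : landscape}.
Notation n := (@n P).
Notation f := (@f P).
Notation F := (pot f).
Notation U := (@U P).
Notation V := (@V P).
Notation E := (@orbit_energy P).
Notation dl := (@dl P).
Notation g1 := (@g1 P LL).

(** With the weight $r^2$ the velocity term of the derivative is $-(\nu-1)rv^2\le0$, so this
    quantity decreases wherever $F(u)\le0$. *)
Definition scaled_energy al r := r ^ 2 * E al r.
Notation D := scaled_energy.

Lemma D_derive al r : adm al -> 0 < r -> is_derive (D al) r (2 * r * F (U al r) - (nu n - 1) * r * V al r ^ 2).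
Proof.
intros H Hr. pose proof (E_derive al r H Hr). unfold D. eapply dval; [der|]. unfold E, energy. simpl. field. lra.
Qed.

Lemma D_cont al r : adm al -> 0 <= r -> continuous (D al) r.
Proof.
intros. apply (continuous_mult (fun r => r ^ 2) (E al)); [eapply is_derive_cont; der|apply E_cont; auto].
Qed.

Lemma D_drop al p q c : adm al -> 0 < p <= q -> 0 <= c -> (forall r, p < r < q -> F (U al r) <= - c) ->
  D al q <= D al p - 2 * c * p * (q - p).
Proof.
intros H Hpq Hc HF. pose proof (nu_ge n Hn).
assert (- D al p - 2 * c * p * p <= - D al q - 2 * c * p * q).
{ apply (mono_le (fun r => - D al r - 2 * c * p * r) (fun r => - (2 * r * F (U al r) - (nu n - 1) * r * V al r ^ 2) - 2 * c * p)); try lra.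
  - intros. apply dminus; [apply dopp, D_derive; auto; lra|]. apply (dval _ _ (0 * x + 2 * c * p * 1)); [|ring]. apply (dmult (fun _ => 2 * c * p) (fun r => r)); [apply dconst|apply did].
  - intros. apply (continuous_minus (fun r => - D al r) (fun r => 2 * c * p * r)).
    + apply (continuous_opp (D al)). apply D_cont; auto; lra.
    + eapply is_derive_cont. der.
  - intros x Hx. specialize (HF x Hx). pose proof (pow2_ge_0 (V al x)).
    assert (0 <= (nu n - 1) * x * V al x ^ 2) by (apply Rmult_le_pos; [apply Rmult_le_pos; lra|auto]).
    assert (2 * x * F (U al x) <= 2 * x * - c) by nra.
    assert (c * p <= c * x) by nra. lra. }
lra.
Qed.

Lemma D_decr al p q : adm al -> 0 < p <= q -> (forall r, p < r < q -> F (U al r) <= 0) -> D al q <= D al p.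
Proof. intros H Hpq HF. pose proof (D_drop al p q 0 H Hpq LRA ltac:(intros r Hr; specialize (HF r Hr); lra)). lra. Qed.

(** On the strip $c_1\le|u|\le c_2$ the potential is bounded above by a negative constant. Crossing
    it takes a time bounded below, during which $r^2E$ falls at a rate proportional to $r$. *)
Lemma crossing_cost c1 c2 Ec : 0 < c1 < c2 -> c2 < dl -> exists k, 0 < k /\ forall al p q, adm al -> 0 < p <= q ->
  E al p <= Ec -> (forall r, p <= r <= q -> F (U al r) <= 0) ->
  (exists x y, p <= x <= y /\ y <= q /\ (Rabs (U al x) <= c1 /\ c2 <= Rabs (U al y) \/ c2 <= Rabs (U al x) /\ Rabs (U al y) <= c1)) ->
  D al q <= D al p - k * p.
Proof.
intros Hc Hc2.
destruct (max_attained F c1 c2 LRA) as (m & Hm & hm). { intros; apply F_cont. }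
assert (HFm : F m < 0) by (apply HFneg; lra).
destruct (f_bound (fun x => F x) F_cont c2) as (B & HB & hB).
pose (K := 2 * (Rabs Ec + B) + 1). pose proof (Rabs_pos Ec) as HEc0.
exists (2 * (- F m) * ((c2 - c1) / K)).
assert (HK : 0 < K) by (unfold K; lra).
split. { apply Rmult_lt_0_compat; [lra|]. apply Rdiv_lt_0_compat; lra. }
intros al p q H Hpq HE HF (x & y & Hxy & Hyq & Hcase).
assert (Cc : forall r, x <= r <= y -> continuous (fun r => Rabs (U al r)) r) by (intros; apply absU_cont; auto; lra).
assert (G : exists t2 t1, x <= t2 < t1 /\ t1 <= y /\ Rabs (Rabs (U al t1) - Rabs (U al t2)) = c2 - c1 /\
   forall r, t2 <= r <= t1 -> c1 <= Rabs (U al r) <= c2).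
{ destruct Hcase as [[a1 a2]|[a1 a2]].
  - destruct (passage_up _ x y c1 c2 LRA LRA Cc a1 a2) as (t2 & t1 & h1 & h2 & h3 & h4 & h5).
    exists t2, t1. split; auto. split; auto. split; auto. rewrite h3, h4, Rabs_pos_eq; lra.
  - destruct (passage_down _ x y c1 c2 LRA LRA Cc a1 a2) as (t2 & t1 & h1 & h2 & h3 & h4 & h5).
    exists t2, t1. split; auto. split; auto. split; auto. rewrite h3, h4, Rabs_left; lra. }
destruct G as (t2 & t1 & h1 & h2 & h3 & h4).
assert (VB : forall r, t2 <= r <= t1 -> Rabs (V al r) <= K).
{ intros r Hr. pose proof (E_decr al p r H LRA). pose proof (hB (U al r) (proj2 (h4 r Hr))) as Q2.
  apply Rabs_le_between in Q2. pose proof (Rle_abs Ec). apply le_of_sq; [apply Rabs_pos|]. rewrite pow2_abs.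
  assert (E al r = V al r ^ 2 / 2 + F (U al r)) by auto. lra. }
assert ((c2 - c1) / K <= t1 - t2).
{ apply Rle_div_l; auto. rewrite <- h3.
  eapply Rle_trans; [apply Rabs_triang_inv2|]. rewrite Rmult_comm.
  apply (mvt_bound (U al) (V al)); try lra.
  - intros z Hz; apply U_derive; auto; lra.
  - intros z Hz; apply U_cont; auto; lra.
  - intros z Hz; apply VB; lra. }
assert (D al t2 <= D al p) by (apply D_decr; auto; [lra|intros; apply HF; lra]).
assert (D al q <= D al t1) by (apply D_decr; auto; [lra|intros; apply HF; lra]).
assert (D al t1 <= D al t2 - 2 * (- F m) * t2 * (t1 - t2)).
{ apply D_drop; auto; try lra. intros. rewrite <- F_abs. rewrite Ropp_involutive. apply hm. apply h4. lra. }
assert (2 * (- F m) * ((c2 - c1) / K) * p <= 2 * (- F m) * t2 * (t1 - t2)); [|lra].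
replace (2 * (- F m) * ((c2 - c1) / K) * p) with (2 * (- F m) * (p * ((c2 - c1) / K))) by ring.
rewrite (Rmult_assoc (2 * - F m)). apply Rmult_le_compat_l; [lra|].
nra.
Qed.

(** After [R0] the sign changes at most once, so all but one of the alternations can be realized up
    to [R0]. *)
Lemma alt_cut2 u s0 R0 m : 0 < s0 * u R0 -> (forall x y, R0 <= x < y -> s0 * u x < 0 -> 0 < s0 * u y -> False) ->
  (s0 = 1 \/ s0 = -1) ->
  forall s lo hi, (s = 1 \/ s = -1) -> lo < R0 -> alt u s (S m) lo hi -> alt u s m lo R0.
Proof.
intros H0 Hno Hs0. induction m as [|m IH]; intros s lo hi Hs Hlo Ha; [simpl; auto|].
destruct Ha as (r & Hr & Hsr & Ha).
assert (- s = 1 \/ - s = -1) by lra.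
destruct (Rlt_le_dec r R0) as [l|l].
- exists r. split; [lra|]. split; auto. apply (IH (- s) r hi); auto.
- destruct Ha as (r2 & Hr2 & Hsr2 & Ha).
  destruct (Req_dec s s0) as [->|Hne].
  + destruct m as [|m']; [exists R0; split; [lra|]; split; [auto|simpl; auto]|].
    exfalso. destruct Ha as (r3 & Hr3 & Hsr3 & _). apply (Hno r2 r3); lra.
  + exfalso. assert (s = - s0) by lra. subst s. apply (Hno r r2); lra.
Qed.

Lemma E_pos_zero al z y : adm al -> 0 < z <= y -> U al z = 0 -> U al y <> 0 -> 0 < E al z.
Proof.
intros H Hz Uz Uy. assert (EV : E al z = V al z ^ 2 / 2 + F (U al z)) by auto. rewrite EV, Uz, F_0.
destruct (Req_dec (V al z) 0) as [Vz|Vz].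
- destruct (U_frozen al z y H LRA Uz Vz). tauto.
- assert (0 < V al z ^ 2) by nra. lra.
Qed.

(** To return to its sign the solution must turn at a point of positive energy, hence beyond [c2].
    The way from [c1] to [c2] costs more of $r^2E$ than is left at [R0], so the energy would be
    negative there. *)
Lemma one_change al c1 c2 Ec k R0 s : 0 < c1 < c2 -> c2 < dl -> 0 < k ->
  (forall al p q, adm al -> 0 < p <= q -> E al p <= Ec -> (forall r, p <= r <= q -> F (U al r) <= 0) ->
  (exists x y, p <= x <= y /\ y <= q /\ (Rabs (U al x) <= c1 /\ c2 <= Rabs (U al y) \/ c2 <= Rabs (U al x) /\ Rabs (U al y) <= c1)) ->
  D al q <= D al p - k * p) ->
  adm al -> 0 < R0 -> E al R0 <= Ec -> (s = 1 \/ s = -1) -> 0 < s * U al R0 < c1 -> D al R0 < k * R0 ->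
  forall x y, R0 <= x < y -> s * U al x < 0 -> 0 < s * U al y -> False.
Proof.
intros Hc Hc2 Hk Hcost H HR HE Hs Hu HD x y Hxy Hx Hy.
destruct (signed_y al s H Hs) as (Dy & Dw & Cy & Cw & EE & Hs2 & Ay & Aw).
assert (x <> R0) by (intros ->; lra).
destruct (alt_calt (fun x => (- s) * U al x) (fun x => (- s) * V al x) 2 1 R0 y) as (c & Hcc & Hcp & Hcv & r3 & Hr3 & Hr3p & _); try lra.
- intros. apply (continuous_mult (fun _ => - s) (U al)); [apply continuous_const|apply U_cont; auto; lra].
- intros. eapply dval; [apply (dmult (fun _ => - s) (U al)); [apply dconst|apply U_derive; auto; lra]|]. ring.
- exists x. split; [lrn|]. split; [lra|]. exists y. split; [lra|]. split; [lra|]. simpl; auto.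
-
  assert (Vc : V al c = 0).
  { nra. }
  destruct (ivt_up (fun x => s * U al x) c y 0) as (z & Hz & Ez); try lra. { intros r Hr; apply Cy; lra. }
  assert (Uz : U al z = 0) by nra.
  assert (Uy : U al y <> 0) by nra.
  pose proof (E_pos_zero al z y H LRA Uz Uy).
  pose proof (E_decr al c z H LRA).
  assert (Ecp : 0 < E al c) by lra. pose proof (pos_energy_far al c Ecp Vc).
  assert (Rabs (U al R0) <= c1) by (rewrite <- Ay, Rabs_pos_eq; lra).
  destruct (first_above (fun r => Rabs (U al r)) R0 c c2) as (q & Hq & Eq & Bq); try lra.
  { intros. apply absU_cont; auto; lra. }
  assert (HF : forall r, R0 <= r <= q -> F (U al r) <= 0).
  { intros. rewrite <- F_abs. destruct (Req_dec (Rabs (U al r)) 0) as [Z|Z]; [rewrite Z, F_0; lra|].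
    left. apply HFneg. pose proof (Rabs_pos (U al r)). split; [lrn|].
    destruct (Req_dec r q) as [->|]; [lra|]. pose proof (Bq r ltac:(lrn)). lra. }
  pose proof (Hcost al R0 q H LRA HE HF) as Q.
  assert (Q' : D al q <= D al R0 - k * R0).
  { apply Q. exists R0, q. lra. }
  pose proof (E_decr al q z H LRA). unfold D in Q', HD.
  nra.
Qed.

(** At most one sign change is lost in the limit: at some [R0] the limit solution is small and
    nonzero with $r^2E<kr$, the neighbours inherit this, and [one_change] allows them one change
    afterwards. Such an [R0] exists for a decaying solution because $r^2E$ is eventually bounded
    above, and just before a double zero because $E$ vanishes at it. *)
Lemma death al a c j : (forall k : nat, adm (al k)) -> (forall k, al k <= c) -> ulim al a -> adm a -> ~ W (S j) a ->
  T a -> (live a -> tends (U a) 0 /\ exists R0, 0 < R0 /\ forall r, R0 <= r -> U a r <> 0) -> Uf (fun k => ~ W (S (S j)) (al k)).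
Proof.
intros Had Hc Ha Haa HW (rT & HrT & HT) Hlv.
pose proof Hdl as Hdl'. pose (c1 := dl / 3). pose (c2 := 2 * dl / 3).
destruct (crossing_cost c1 c2 (F g1)) as (k & Hk & Hcost); [unfold c1, c2; lra|unfold c2; lra|].
assert (G : exists R0, 0 < R0 /\ U a R0 <> 0 /\ Rabs (U a R0) < c1 /\ D a R0 < k * R0 /\ E a R0 < F g1).
{ destruct (classic (live a)) as [Hl|Hl].
  - destruct (Hlv Hl) as (Ht & Rz & HRz & Hz).
    destruct (Ht c1 ltac:(unfold c1; lra)) as [R1 H1].
    pose (R2 := Rmax (Rmax Rz R1) rT). pose proof (Rmax_l (Rmax Rz R1) rT) as m1. pose proof (Rmax_r (Rmax Rz R1) rT) as m2.
    pose proof (Rmax_l Rz R1). pose proof (Rmax_r Rz R1). fold R2 in m1, m2.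
    pose (R3 := Rmax R2 (Rabs (D a R2) / k + 1)). pose proof (Rmax_l R2 (Rabs (D a R2) / k + 1)) as m5. pose proof (Rmax_r R2 (Rabs (D a R2) / k + 1)) as m6. fold R3 in m5, m6.
    exists R3. split; [lra|]. split; [apply Hz; lra|].
    assert (Hsm : forall r, R2 <= r -> Rabs (U a r) < c1) by (intros r Hr; specialize (H1 r LRA); rewrite Rminus_0_r in H1; auto).
    split; [apply Hsm; lra|]. split.
    + assert (D a R3 <= D a R2).
      { apply D_decr; auto; [lra|]. intros. specialize (Hsm r LRA). rewrite <- F_abs.
        destruct (Req_dec (Rabs (U a r)) 0) as [Z|Z]; [rewrite Z, F_0; lra|]. left. apply HFneg. pose proof (Rabs_pos (U a r)).
        split; [lrn|]. unfold c1 in Hsm. lra. }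
      pose proof (Rle_abs (D a R2)).
      assert (Rabs (D a R2) / k * k = Rabs (D a R2)) by (field; lra). nra.
    + apply (inT_persist a rT R3); auto; lra.
  - apply not_all_ex_not in Hl. destruct Hl as [r Hr]. apply imply_to_and in Hr. destruct Hr as [Hr Hd].
    apply not_or_and in Hd. destruct Hd as [d1 d2]. apply NNPP in d1. apply NNPP in d2.
    destruct (first_dead a r Haa Hr d1 d2) as (rho & q1 & q2 & q3 & q4).
    assert (Er : E a rho = 0). { assert (EV : E a rho = V a rho ^ 2 / 2 + F (U a rho)) by auto. rewrite EV, q2, q3, F_0. lra. }
    pose proof L_g1 as (_ & Lg & _).
    destruct (cont_lt_near (fun r => Rabs (U a r)) rho c1) as (e1 & He1 & h1); [apply absU_cont; auto; lra|rewrite q2, Rabs_R0; unfold c1; lra|].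
    destruct (cont_lt_near (fun r => D a r - k * r) rho 0) as (e2 & He2 & h2).
    { apply (continuous_minus (D a) (fun r => k * r)); [apply D_cont; auto; lra|eapply is_derive_cont; der]. }
    { unfold D. nra. }
    destruct (cont_lt_near (E a) rho (F g1)) as (e3 & He3 & h3); [apply E_cont; auto; lra|lra|].
    pose (e := Rmin (Rmin e1 e2) (Rmin e3 rho)).
    assert (He : 0 < e) by (unfold e; repeat apply Rmin_glb_lt; lra).
    assert (ee : e <= e1 /\ e <= e2 /\ e <= e3 /\ e <= rho).
    { unfold e. pose proof (Rmin_l (Rmin e1 e2) (Rmin e3 rho)). pose proof (Rmin_r (Rmin e1 e2) (Rmin e3 rho)).
      pose proof (Rmin_l e1 e2). pose proof (Rmin_r e1 e2). pose proof (Rmin_l e3 rho). pose proof (Rmin_r e3 rho). lra. }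
    assert (Hex : exists R0, rho - e < R0 < rho /\ U a R0 <> 0).
    { apply NNPP. intros Hno.
      assert (Z : forall r, rho - e < r < rho -> U a r = 0) by (intros x Hx; apply NNPP; intros Hne; apply Hno; exists x; auto).
      destruct (mvt (U a) (V a) (rho - 2 * e / 3) (rho - e / 3)) as (w & Hw & Ew); try lra.
      { intros. apply U_derive; auto; lra. } { intros. apply U_cont; auto; lra. }
      rewrite !Z in Ew by lra. assert (V a w = 0). { nra. }
      destruct (q4 w LRA); [apply H0; apply Z; lra|tauto]. }
    destruct Hex as (R0 & hR & hU). exists R0.
    assert (Rabs (R0 - rho) < e) by (rewrite Rabs_left; lra).
    split; [lra|]. split; auto. split; [apply h1; lra|]. split; [specialize (h2 R0 LRA); lra|apply h3; lra]. }
destruct G as (R0 & HR0 & HU0 & HU1 & HD & HE).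
assert (Hl : forall s, 0 <= s <= R0 -> U a s <> 0 \/ V a s <> 0) by (intros s Hs; apply (live_before a R0); auto).
destruct (U_cd' al a c R0 Had Hc Ha Haa LRA ltac:(intros; apply Hl; lra)) as (L1 & _ & L3).
assert (Hs : exists s, (s = 1 \/ s = -1) /\ 0 < s * U a R0).
{ destruct (Rdichotomy _ _ HU0); [exists (-1)|exists 1]; split; lra. }
destruct Hs as (s & Hs & Hsp).
assert (L1' : ulim (fun k => U (al k) R0 * s) (U a R0 * s)) by (apply ulim_scal; auto).
assert (LD : ulim (fun k => E (al k) R0 * R0 ^ 2) (E a R0 * R0 ^ 2)) by (apply ulim_scal; auto).
assert (Hsc : U a R0 * s < c1).
{ apply Rabs_def2 in HU1. nra. }
destruct (Uf_em (fun k => W (S (S j)) (al k))) as [HWk|]; auto. exfalso. apply HW. exists R0.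
apply (alt_lim al a (U a) (V a) c R0 (S j)); auto; try lra.
- apply Haa.
- apply fam; auto.
- unfold D in HD.
  apply (Uf_mono _ _ (Uf_and _ _ HWk (Uf_and _ _ (Uf_and3 _ _ _ (ulim_gt _ _ 0 L1' LRA) (ulim_lt _ _ _ L1' Hsc) (ulim_lt _ _ _ L3 HE))
     (ulim_lt _ _ (k * R0) LD LRA)))).
  intros i [[hi Hi] [(i1 & i2 & i3) i4]].
  apply (alt_cut2 (U (al i)) s R0 (S j)) with (hi := hi); auto; try lra.
  apply (one_change (al i) c1 c2 (F g1) k R0 s); auto; unfold D, c1, c2 in *; try lra.
Qed.
End Death.

(** * Positive limits are impossible *)

(** Turns a statement on null sequences into one on a one-sided neighbourhood, by choosing a null
    sequence of counterexamples. *)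
Lemma near_seq (Q : R -> Prop) e0 : 0 < e0 ->
  (forall t : nat -> R, (forall k, 0 < t k < e0) -> ulim t 0 -> Uf (fun k => Q (t k))) ->
  exists e1, 0 < e1 <= e0 /\ forall t, 0 < t < e1 -> Q t.
Proof.
intros He H. apply NNPP. intros Hno.
assert (Hx : forall k, 0 < e0 * / (INR k + 1) <= e0) by (intros k; apply xis_pos; auto).
destruct (choose1 _ _ (fun (k : nat) t => 0 < t < e0 * / (INR k + 1) /\ ~ Q t)) as [t Ht].
{ intros. apply NNPP. intros Hn'. apply Hno. exists (e0 * / (INR k + 1)). split; [apply Hx|].
  intros. apply NNPP. intros HQ. apply Hn'. exists t. auto. }
assert (Lt : ulim t 0).
{ intros e Hep. apply (Uf_mono _ _ (ulim_lt _ _ e (xis_lim e0) Hep)). intros k hk. unfold xis in hk.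
  destruct (Ht k). rewrite Rminus_0_r, Rabs_pos_eq; lra. }
apply (Uf_out _ _ (H t ltac:(intros k; destruct (Ht k); specialize (Hx k); lra) Lt)). intros k. apply Ht.
Qed.

Lemma seq_cont (h : R -> R) e0 x : 0 < x < e0 ->
  (forall t : nat -> R, (forall k, 0 < t k < e0) -> ulim t x -> ulim (fun k => h (t k)) (h x)) -> continuous h x.
Proof.
intros Hx H. apply eps_continuous. intros e He. apply NNPP. intros Hno.
pose (m := Rmin x (e0 - x)). assert (0 < m) by (unfold m; apply Rmin_glb_lt; lra).
assert (m <= x) by apply Rmin_l. assert (m <= e0 - x) by apply Rmin_r.
assert (Hxi : forall k, 0 < m * / (INR k + 1) <= m) by (intros k; apply xis_pos; auto).
destruct (choose1 _ _ (fun (k : nat) t => Rabs (t - x) < m * / (INR k + 1) /\ ~ Rabs (h t - h x) < e)) as [t Ht].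
{ intros. apply NNPP. intros Hn'. apply Hno. exists (m * / (INR k + 1)). split; [apply Hxi|].
  intros. apply NNPP. intros HQ. apply Hn'. exists y. auto. }
assert (Lt : ulim t x).
{ intros e' Hep. apply (Uf_mono _ _ (ulim_lt _ _ e' (xis_lim m) Hep)). intros k hk. unfold xis in hk. destruct (Ht k). lra. }
apply (Uf_out _ _ (H t ltac:(intros k; destruct (Ht k) as [q _]; specialize (Hxi k); apply Rabs_def2 in q; lra) Lt e He)).
intros k. apply Ht.
Qed.

Section L0.
Context {P : problem} {LL : landscape}.
Notation n := (@n P).
Notation f := (@f P).
Notation F := (pot f).
Notation U := (@U P).
Notation V := (@V P).
Notation E := (@orbit_energy P).
Notation D := (@scaled_energy P).
Notation dl := (@dl P).
Notation d0 := (@d0 P LL).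
Notation g1 := (@g1 P LL).

Lemma alt_cut3 u s0 R0 m : 0 < s0 * u R0 -> (forall x, R0 <= x -> 0 <= s0 * u x) -> (s0 = 1 \/ s0 = -1) ->
  forall s lo hi, (s = 1 \/ s = -1) -> lo < R0 -> alt u s m lo hi -> alt u s m lo R0.
Proof.
intros H0 Hno Hs0. induction m as [|m IH]; intros s lo hi Hs Hlo Ha; [simpl; auto|].
destruct Ha as (r & Hr & Hsr & Ha).
assert (- s = 1 \/ - s = -1) by lra.
destruct (Rlt_le_dec r R0) as [l|l].
- exists r. split; [lra|]. split; auto. apply (IH (- s) r hi); auto.
- assert (s = s0). { pose proof (Hno r l). nra. } subst s.
  exists R0. split; [lra|]. split; auto. destruct m as [|m']; [simpl; auto|].
  destruct Ha as (r2 & Hr2 & Hsr2 & _). pose proof (Hno r2 LRA). lra.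
Qed.

(** Let $q=G(y)$ and $m=g(y)>2Cq^2$. By the Lipschitz bound $g\ge m/2$ on an interval of length
    $m/(2L)$ to the left of [y], so $G$ gains $m^2/(4L)$ there, and this is at most $Cq^2$. Hence
    $g\le C_1G$ near $0$, and Gronwall forces $G=0$. *)
Lemma no_flat_start (G g : R -> R) eta L C q0 : 0 < eta -> 0 < L -> 0 < C -> 0 < q0 ->
  (forall x : R, is_derive G x (g x)) -> (forall x : R, continuous G x) ->
  (forall x y, 0 <= x <= eta -> 0 <= y <= eta -> Rabs (g x - g y) <= L * Rabs (x - y)) ->
  G 0 = 0 -> (forall x, 0 < x < eta -> 0 < g x) ->
  (forall q, 0 < q < q0 -> exists x, 0 <= x < eta /\ q - C * q ^ 2 <= G x <= q /\ g x <= C * q ^ 2) -> False.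
Proof.
intros Heta HL HC Hq0 HG HGc Hlip HG0 Hg Hq.
assert (Mono : forall x y, 0 <= x < y -> y <= eta -> G x < G y).
{ intros. apply (mono_lt G g); try lra; auto. intros. apply Hg; lra. }
assert (Hex : exists Y, 0 < Y < eta /\ G Y < q0).
{ destruct (cont_lt_near G 0 q0 (HGc 0) LRA) as (d & Hd & h).
  pose (Y := Rmin (d / 2) (eta / 2)). assert (Y <= d / 2) by apply Rmin_l. assert (Y <= eta / 2) by apply Rmin_r.
  assert (0 < Y) by (unfold Y; apply Rmin_glb_lt; lra). exists Y. split; [lra|]. apply h. rewrite Rminus_0_r, Rabs_pos_eq; lra. }
destruct Hex as (Y & HY & HGY).
(* The first term covers the case $m\le2Cq^2$, the second the case $m^2\le4LCq^2$. *)
pose (C1 := 2 * C * q0 + (4 * L * C + 1)).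
assert (Key : forall y, 0 < y < Y -> g y <= C1 * G y).
{ intros. set (q := G y). assert (Hqp : 0 < q < q0).
  { unfold q. pose proof (Mono 0 y LRA LRA). pose proof (Mono y Y LRA LRA). lra. }
  destruct (Hq q Hqp) as (x & Hx & HGx & Hgx).
  assert (x <= y). { apply Rnot_lt_le. intros Hlt. pose proof (Mono y x LRA LRA). unfold q in HGx. lra. }
  set (m := g y).
  assert (C * q ^ 2 <= C * q0 * q). { nra. }
  unfold C1. rewrite Rmult_plus_distr_r.
  assert (0 <= (4 * L * C + 1) * q) by nra.
  destruct (Rle_lt_dec m (2 * C * q ^ 2)) as [l|l]; [lra|].
  assert (m / (2 * L) <= y - x).
  { pose proof (Hlip y x LRA LRA) as Q. rewrite (Rabs_pos_eq (y - x)) in Q by lra. apply Rabs_le_between in Q.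
    apply Rle_div_l; [lra|]. fold m in Q. nra. }
  pose (w := y - m / (2 * L)). assert (x <= w < y). { unfold w. assert (0 < m / (2 * L)) by (apply Rdiv_lt_0_compat; lra). lra. }
  assert (m ^ 2 / (4 * L) <= G y - G w).
  { assert (G w - m / 2 * w <= G y - m / 2 * y).
    { apply (mono_le (fun z => G z - m / 2 * z) (fun z => g z - (0 * z + m / 2 * 1))); try lra.
      - intros. apply dminus; auto. apply (dmult (fun _ => m / 2) (fun z => z)); [apply dconst|apply did].
      - intros. apply (continuous_minus G (fun z => m / 2 * z)); auto. eapply is_derive_cont. der.
      - intros z Hz. pose proof (Hlip y z LRA LRA) as Q. rewrite (Rabs_pos_eq (y - z)) in Q by lra. apply Rabs_le_between in Q. fold m in Q.
        assert (L * (y - z) <= m / 2); [|lra]. apply Rle_trans with (L * (m / (2 * L))).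
        + apply Rmult_le_compat_l; [lra|]. unfold w in Hz. lra.
        + right. field. lra. }
    replace (m ^ 2 / (4 * L)) with (m / 2 * (m / (2 * L))) by (field; lra).
    assert (m / 2 * w = m / 2 * y - m / 2 * (m / (2 * L))) by (unfold w; ring). lra. }
  assert (G x <= G w). { destruct (Req_dec x w) as [<-|]; [lra|]. left. apply Mono; lra. }
  assert (m ^ 2 <= 4 * L * C * q ^ 2).
  { assert (m ^ 2 / (4 * L) <= C * q ^ 2) by (unfold q in *; lra). assert (Q2 : m ^ 2 / (4 * L) * (4 * L) <= C * q ^ 2 * (4 * L)) by nra.
    replace (m ^ 2 / (4 * L) * (4 * L)) with (m ^ 2) in Q2 by (field; lra). lra. }
  apply Rnot_lt_le. intros.
   set (B := 4 * L * C) in *.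
  nra. }
assert (Gr := gronwall G g C1 0 (Y / 2) LRA ltac:(intros; auto) ltac:(intros; auto) ltac:(intros x Hx; apply Key; lra)).
rewrite HG0, Rmult_0_l in Gr. pose proof (Mono 0 (Y / 2) LRA LRA). lra.
Qed.

(** * A positive limit approached by solutions with more sign changes *)

Section Plateau.
Variables (a s sg e0 l R0 : R) (k : nat).
Hypothesis Haa : adm a.
Hypothesis HTa : T a.
Hypothesis Hlive : live a.
Hypothesis HWa : ~ W (S k) a.
Hypothesis Hs : s = 1 \/ s = -1.
Hypothesis Hl : 0 < l <= d0.
Hypothesis Hlim : tends (fun r => s * U a r) l.
Hypothesis HE0 : tends (E a) 0.
Hypothesis Hsg : sg = 1 \/ sg = -1.
Hypothesis He0 : 0 < e0.
Hypothesis Hnb : forall t, 0 < t < e0 -> adm (a + sg * t) /\ W (S k) (a + sg * t).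

Let sa t := a + sg * t.

Lemma al_seq (t : nat -> R) x : ulim t x -> ulim (fun k => sa (t k)) (sa x).
Proof.
intros. apply ulim_plus; [apply ulim_const|]. apply (ulim_ext (fun k => t k * sg)); [apply Uf_all; intros; ring|].
rewrite (Rmult_comm sg). apply ulim_scal; auto.
Qed.

Lemma al_0 : sa 0 = a.
Proof. unfold sa. ring. Qed.

Lemma al_bound t : 0 < t < e0 -> sa t <= a + e0.
Proof. intros. unfold sa. nra. Qed.

(** The strip from [c1] to [c2] lies below both $\delta$ and the limit [l]: $F<0$ on it, and the
    solution of [a] eventually stays above it. *)
Let c2 := Rmin dl l / 2.
Let c1 := c2 / 2.

Lemma c_order : 0 < c1 < c2 /\ c2 < dl /\ c2 < l.
Proof.
assert (0 < Rmin dl l) by (apply Rmin_glb_lt; [apply Hdl|lra]).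
pose proof (Rmin_l dl l). pose proof (Rmin_r dl l). unfold c1, c2. lra.
Qed.

Lemma E_lim (t : nat -> R) x (rk : nat -> R) rho : (forall k, 0 < t k < e0) -> ulim t x -> 0 <= x < e0 -> (forall k, 0 <= rk k) -> ulim rk rho -> 0 <= rho ->
  (forall r, 0 <= r < rho -> U (sa x) r <> 0 \/ V (sa x) r <> 0) ->
  ulim (fun k => U (sa (t k)) (rk k)) (U (sa x) rho) /\ ulim (fun k => V (sa (t k)) (rk k)) (V (sa x) rho) /\
  ulim (fun k => E (sa (t k)) (rk k)) (E (sa x) rho).
Proof.
intros.
assert (adm (sa x)).
{ destruct (Req_dec x 0) as [->|]; [rewrite al_0; auto|]. apply Hnb. lrn. }
destruct (cont_dep (fun k => sa (t k)) (sa x) (U (sa x)) (V (sa x)) (a + e0) rk rho) as [L1 L2]; auto.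
- intros. apply Hnb; auto.
- intros. apply al_bound; auto.
- apply al_seq; auto.
- apply fam; auto.
- split; auto. split; auto. apply ulim_plus.
  + apply (ulim_comp (fun y => y ^ 2 / 2)); auto. unfold Rdiv. eapply is_derive_cont. der.
  + apply (ulim_comp F); auto. apply F_cont.
Qed.

Lemma start_time : exists R1, 0 < R1 /\ inT a R1 /\ forall r, R1 <= r -> c2 < s * U a r.
Proof.
destruct c_order as (h1 & h2 & h3). destruct (tends_gt _ _ c2 Hlim h3) as [R2 HR2].
destruct HTa as (rT & HrT & HT).
pose (R1 := Rmax (Rmax R2 rT) 1). pose proof (Rmax_l (Rmax R2 rT) 1) as m1. pose proof (Rmax_r (Rmax R2 rT) 1) as m2.
pose proof (Rmax_l R2 rT). pose proof (Rmax_r R2 rT). fold R1 in m1, m2.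
exists R1. split; [lra|]. split; [apply (inT_persist a rT); auto; lra|]. intros. apply HR2. lra.
Qed.

Section Fixed.
Variable R1 : R.
Hypothesis HR1 : 0 < R1.
Hypothesis HTR1 : inT a R1.
Hypothesis Hc2R1 : forall r, R1 <= r -> c2 < s * U a r.
Let C := D a R1 + 1.

(** A neighbour of [a] that follows it above the strip until [T0] and later reaches $0$ with
    positive energy, as its additional sign change requires. *)
Definition good T0 al := adm al /\ (forall r, R1 <= r <= T0 -> c2 < s * U al r) /\ D al R1 <= C /\ inT al R1 /\
  exists z, R1 < z /\ U al z = 0 /\ 0 < E al z /\ forall r, R1 <= r < z -> 0 < s * U al r.

Lemma near_good T0 : R1 <= T0 -> exists e1, 0 < e1 <= e0 /\ forall t, 0 < t < e1 -> good T0 (sa t).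
Proof.
intros. destruct c_order as (h1 & h2 & h3). apply near_seq; auto. intros t Ht Lt.
assert (Lv : forall rho r, 0 <= r < rho -> U (sa 0) r <> 0 \/ V (sa 0) r <> 0) by (intros rho r Hr; rewrite al_0; apply Hlive; lra).
assert (forall k, adm (sa (t k))) by (intros i; apply Hnb; auto).
assert (Lim := fun rk rho => E_lim t 0 rk rho Ht Lt LRA).
destruct (Lim (fun _ => R1) R1 ltac:(intros; lra) (ulim_const R1) LRA (Lv R1)) as (L1 & _ & L3). rewrite al_0 in L1, L3.
assert (L1' : ulim (fun k => Rabs (U (sa (t k)) R1)) (Rabs (U a R1))).
{ apply (ulim_comp Rabs); auto. apply (continuous_Rabs (U a R1)). }
assert (L4 : ulim (fun k => E (sa (t k)) R1 * R1 ^ 2) (E a R1 * R1 ^ 2)) by (apply ulim_scal; auto).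
assert (A1 : Uf (fun k => forall r, R1 <= r <= T0 -> c2 < s * U (sa (t k)) r)).
{ destruct (Uf_em (fun k => forall r, R1 <= r <= T0 -> c2 < s * U (sa (t k)) r)) as [|HN]; auto. exfalso.
  destruct (choose1 _ _ (fun (k : nat) r => R1 <= r <= T0 /\ (~ (forall r, R1 <= r <= T0 -> c2 < s * U (sa (t k)) r) -> s * U (sa (t k)) r <= c2))) as [rk Hrk].
  { intros i. destruct (classic (forall r, R1 <= r <= T0 -> c2 < s * U (sa (t i)) r)) as [Q|Q].
    - exists R1. split; [lra|]. tauto.
    - apply not_all_ex_not in Q. destruct Q as [r Q]. apply imply_to_and in Q. exists r. lra. }
  destruct (ulim_exists rk T0) as [rho Hrho]. { apply Uf_all. intros i. destruct (Hrk i). rewrite Rabs_pos_eq; lra. }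
  assert (R1 <= rho) by (apply (ulim_le (fun _ => R1) rk); auto using ulim_const; apply Uf_all; intros i; apply Hrk).
  destruct (Lim rk rho ltac:(intros i; destruct (Hrk i); lra) Hrho LRA (Lv rho)) as (L & _ & _). rewrite al_0 in L.
  assert (s * U a rho <= c2); [|pose proof (Hc2R1 rho LRA); lra].
  apply (ulim_le (fun k => U (sa (t k)) (rk k) * s) (fun _ => c2)); auto using ulim_const.
  - rewrite Rmult_comm. apply ulim_scal; auto.
  - apply (Uf_mono _ _ HN). intros i hi. destruct (Hrk i) as [_ q]. specialize (q hi). lra. }
(* Up to [R1] the neighbours have fewer than $k+1$ sign changes, like [a], so [W (S k)] forces one
   after [R1]. *)
assert (A2 : Uf (fun i => ~ alt (U (sa (t i))) (-1) (S k) 0 R1)).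
{ destruct (Uf_em (fun i => alt (U (sa (t i))) (-1) (S k) 0 R1)) as [HN|]; auto. exfalso. apply HWa. exists R1.
  apply (alt_lim (fun i => sa (t i)) a (U a) (V a) (a + e0) R1 (S k)); auto; try lra.
  - intros. apply al_bound; auto.
  - rewrite <- al_0. apply al_seq; auto.
  - apply Haa.
  - apply fam; auto.
  - intros. apply Hlive; lra.
  - intros. pose proof (Hc2R1 R1 LRA). nra. }
destruct HTR1 as [T1 T2].
apply (Uf_mono _ _ (Uf_and _ _ (Uf_and _ _ A1 A2) (Uf_and3 _ _ _ (ulim_lt _ _ _ L1' T1) (ulim_lt _ _ _ L3 T2) (ulim_lt _ _ (R1 ^ 2 * E a R1 + 1) L4 LRA)))).
intros i [[i1 i2] (i3 & i4 & i5)]. destruct (Hnb (t i) (Ht i)) as [b1 b2].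
split; [exact b1|]. split; [exact i1|]. split; [unfold C, D; fold (sa (t i)); lra|]. split; [split; assumption|].
assert (0 < s * U (sa (t i)) R1) by (specialize (i1 R1 LRA); lra).
assert (Hx : exists x, R1 < x /\ s * U (sa (t i)) x < 0).
{ apply NNPP. intros Hno. apply i2. destruct b2 as [hi b2]. apply (alt_cut3 _ s) with (hi := hi); auto.
  intros. apply Rnot_lt_le. intros Hlt. apply Hno. exists x. split; auto. destruct (Req_dec x R1) as [->|]; [lra|lrn]. }
destruct Hx as (x & Hx & Hxn).
destruct (signed_y (sa (t i)) s b1 Hs) as (Dy & Dw & Cy & Cw & EE & Hs2 & Ay & Aw).
destruct (first_below (fun r => s * U (sa (t i)) r) R1 x 0) as (z & Hz & Ez & Bz); try lra. { intros r Hr; apply Cy; lra. }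
exists z. split; [lra|].
assert (U (sa (t i)) z = 0) by nra.
split; auto. split; [|auto].
apply (E_pos_zero _ z x); auto; try lra. nra.
Qed.

Definition inward al t := R1 < t /\ s * U al t = d0 /\ s * V al t < 0 /\ 0 < E al t /\ forall r, R1 <= r <= t -> 0 < s * U al r.

(** At an interior minimum of $su$ the energy equals $F\le0$, although it is still positive
    later. *)
Lemma no_low_min al p q m : adm al -> 0 < p <= m -> m <= q -> 0 < E al q -> 0 < s * U al m < d0 ->
  d0 <= s * U al p -> d0 <= s * U al q -> (forall r, p <= r <= q -> 0 < s * U al r) -> False.
Proof.
intros H Hpm Hmq HEq Hm Hp Hq Hpos.
destruct (signed_y al s H Hs) as (Dy & Dw & Cy & Cw & EE & Hs2 & Ay & Aw).
destruct (max_attained (fun r => - (s * U al r)) p q) as (x & Hx & hx); [lra|intros r Hr; apply (continuous_opp (fun r => s * U al r)); apply Cy; lra|].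
pose proof (hx m LRA).
assert (x <> p) by (intros ->; lra). assert (x <> q) by (intros ->; lra).
assert (- (s * V al x) = 0).
{ apply (int_max (fun r => - (s * U al r)) p q x); auto; [split; lrn|]. apply dopp, Dy. lra. }
pose proof (EE x) as Ex. replace (s * V al x) with 0 in Ex by lra.
pose proof (E_decr al x q H LRA). pose proof (Hpos x LRA).
assert (F (s * U al x) <= 0) by (apply L_neg; lra). lra.
Qed.

Lemma inward_unique al t t' : adm al -> inward al t -> inward al t' -> t = t'.
Proof.
assert (G : forall t t', adm al -> inward al t -> inward al t' -> t < t' -> False).
{ clear t t'. intros t t' H (i1 & i2 & i3 & i4 & i5) (j1 & j2 & j3 & j4 & j5) Hlt.
  destruct (signed_y al s H Hs) as (Dy & Dw & Cy & Cw & EE & Hs2 & Ay & Aw).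
  destruct (derive_neg_right _ t _ (Dy t LRA) i3) as (d & Hd & h & _). rewrite i2 in h.
  destruct (right_point t t' d) as (m & ? & ?); try lrn. specialize (h m LRA).
  apply (no_low_min al t t' m); auto; try lra.
  - split; [apply j5; lra|auto].
  - intros. apply j5; lra. }
intros. destruct (Rtotal_order t t') as [q|[q|q]]; auto; exfalso; [apply (G t t')|apply (G t' t)]; auto.
Qed.

Variable kp : R.
Hypothesis Hkp : 0 < kp.
Hypothesis Hcost : forall al p q, adm al -> 0 < p <= q ->
  E al p <= F g1 -> (forall r, p <= r <= q -> F (U al r) <= 0) ->
  (exists x y, p <= x <= y /\ y <= q /\ (Rabs (U al x) <= c1 /\ c2 <= Rabs (U al y) \/ c2 <= Rabs (U al x) /\ Rabs (U al y) <= c1)) ->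
  D al q <= D al p - kp * p.

(** The solution has spent the second half of its time on the plateau above $d_0$, and its energy is
    still at least of order $1/t$. *)
Definition stuck al t := inward al t /\ 2 * R1 <= t /\ kp < t * E al t /\ forall r, t / 2 <= r <= t -> d0 <= s * U al r.

Lemma F_dip al r : 0 <= s * U al r <= d0 -> F (U al r) <= 0.
Proof. intros. rewrite <- (F_sign s) by auto. apply L_neg. auto. Qed.

(** At the zero $r^2E$ is positive, while crossing the strip after time $p$ costs a multiple of $p$.
    The value of $r^2E$ at [R1] cannot pay for a late crossing, so the solution must have risen
    above $d_0$, and its last descent through $d_0$ is late. *)
Lemma good_stuck T1 : exists T0, R1 <= T0 /\ forall al, good T0 al -> exists t, T1 < t /\ stuck al t.
Proof.
destruct c_order as (h1 & h2 & h3).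
 pose proof (Rle_abs C) as C1.
(* Beyond [T2] one has $k_pt>4|C|$, which excludes a stay below $d_0$ within $[t/2,t]$. *)
pose (T2 := Rmax (Rmax T1 (2 * R1)) (4 * Rabs C / kp) + 1).
assert (HT2 : T1 < T2 /\ 2 * R1 < T2 /\ 4 * Rabs C / kp < T2).
{ unfold T2. pose proof (Rmax_l (Rmax T1 (2 * R1)) (4 * Rabs C / kp)). pose proof (Rmax_r (Rmax T1 (2 * R1)) (4 * Rabs C / kp)).
  pose proof (Rmax_l T1 (2 * R1)). pose proof (Rmax_r T1 (2 * R1)). lra. }
(* Neither the bound [C] on $r^2E$ at [R1] nor the energy available at times up to [T2] pays for a
   crossing that starts at [T0]. *)
pose (T0 := Rmax T2 (Rmax (Rabs C / kp) (T2 ^ 2 * F g1 / kp)) + 1).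
assert (HT0 : T2 < T0 /\ Rabs C / kp < T0 /\ T2 ^ 2 * F g1 / kp < T0).
{ unfold T0. pose proof (Rmax_l T2 (Rmax (Rabs C / kp) (T2 ^ 2 * F g1 / kp))). pose proof (Rmax_r T2 (Rmax (Rabs C / kp) (T2 ^ 2 * F g1 / kp))).
   pose proof (Rmax_r (Rabs C / kp) (T2 ^ 2 * F g1 / kp)). lra. }
assert (HT0' : Rabs C < kp * T0 /\ T2 ^ 2 * F g1 < kp * T0).
{ destruct HT0 as (q1 & q2 & q3). apply Rlt_div_l in q2; auto. apply Rlt_div_l in q3; auto. lra. }
exists T0. split; [lra|]. intros al' (H & b1 & b2 & [b3 b3'] & z & z1 & z2 & z3 & z4).
destruct (signed_y al' s H Hs) as (Dy & Dw & Cy & Cw & EE & Hs2 & Ay & Aw).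
assert (T0 < z). { apply Rnot_le_lt. intros Hle. pose proof (b1 z LRA). nra. }
assert (EM : forall r, R1 <= r -> E al' r <= F g1) by (intros r Hr; pose proof (E_decr al' R1 r H LRA); lra).
assert (Dz : 0 < D al' z). { apply Rmult_lt_0_compat; auto. nra. }
assert (Posz : forall r, R1 <= r <= z -> 0 <= s * U al' r).
{ intros. destruct (Req_dec r z) as [->|]; [rewrite z2; lra|]. left; apply z4. lrn. }
assert (Cr : forall p, R1 <= p -> p <= z -> c2 <= s * U al' p -> (forall r, p <= r <= z -> s * U al' r <= d0) -> D al' z <= D al' p - kp * p).
{ intros p Hp Hpz Hc Hd. apply Hcost; auto; try lra.
  - intros. apply F_dip. split; [apply Posz; lra|apply Hd; lra].
  - exists p, z. split; [lra|]. split; [lra|]. right. split.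
    + rewrite <- Ay. rewrite Rabs_pos_eq; lra.
    + rewrite z2, Rabs_R0. lra. }
assert (Hup : exists x, R1 <= x < z /\ d0 < s * U al' x).
{ apply NNPP. intros Hno.
  assert (Hd : forall r, R1 <= r <= z -> s * U al' r <= d0).
  { intros. apply Rnot_lt_le. intros Hlt. apply Hno. exists r. split; auto. split; [lra|].
    destruct (Req_dec r z) as [->|]; [rewrite z2 in Hlt; lra|lrn]. }
  pose proof (Cr T0 LRA LRA ltac:(left; apply b1; lra) ltac:(intros; apply Hd; lra)).
  assert (D al' T0 <= D al' R1).
  { apply D_decr; auto; [lra|]. intros. apply F_dip. split; [apply Posz; lra|apply Hd; lra]. }
  lra. }
destruct Hup as (x & Hx & Hxd).
destruct (last_at (fun r => - (s * U al' r)) x z (- d0)) as (t & Ht & Et & Bt); try lra.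
{ intros. apply (continuous_opp (fun r => s * U al' r)). apply Cy; lra. }
{ nra. }
assert (Et' : s * U al' t = d0) by lra.
assert (Bt' : forall r, t <= r <= z -> s * U al' r <= d0).
{ intros. destruct (Req_dec r t) as [->|]; [lra|]. specialize (Bt r ltac:(lrn)). lra. }
assert (x <> t) by (intros ->; lra).
pose proof (Cr t LRA LRA LRA Bt') as Ct.
assert (0 < E al' t) by (pose proof (E_decr al' t z H LRA); lra).
assert (kp < t * E al' t).
{ unfold D in Ct. unfold D in Dz. nra. }
assert (s * V al' t < 0).
{ pose proof (EE t) as Q. rewrite Et', L_d0 in Q.
  destruct (Rtotal_order (s * V al' t) 0) as [|[E1|E1]]; auto; exfalso.
  - nra.
  - destruct (derive_pos_right _ t _ (Dy t LRA) E1) as (d & Hd & h & _). rewrite Et' in h.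
    destruct (right_point t z d) as (m & ? & ?); try lrn. specialize (h m LRA). specialize (Bt' m LRA). lra. }
assert (inward al' t).
{ split; [lra|]. split; auto. split; auto. split; auto. intros. apply z4; lra. }
assert (T2 < t).
{ apply Rnot_le_lt. intros Hle.
  pose proof (Cr T0 LRA LRA ltac:(left; apply b1; lra) ltac:(intros; apply Bt'; lra)).
  assert (D al' T0 <= D al' t).
  { apply D_decr; auto; [lra|]. intros. apply F_dip. split; [apply Posz; lra|apply Bt'; lra]. }
  assert (D al' t <= T2 ^ 2 * F g1).
  { apply Rmult_le_compat; [apply pow2_ge_0|lra| |apply EM; lra]. nra. }
  lra. }
exists t. split; [lra|]. split; auto. split; [lra|]. split; auto.
intros. apply Rnot_lt_le. intros Hlt.
assert (Hd : forall w, R1 <= w <= r -> s * U al' w <= d0).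
{ intros. apply Rnot_lt_le. intros Hwd.
  apply (no_low_min al' w t r); auto; try lra; [split; [apply z4; lra|auto]|]. intros; apply z4; lra. }
assert (Dr : D al' r <= C).
{ eapply Rle_trans; [|exact b2]. apply D_decr; auto; [lra|]. intros. apply F_dip. split; [apply Posz; lra|apply Hd; lra]. }
pose proof (E_decr al' r t H LRA).
assert (t ^ 2 * E al' t <= 4 * Rabs C).
{ unfold D in Dr. apply Rle_trans with (4 * (r ^ 2 * E al' r)); [|lra].
  replace (4 * (r ^ 2 * E al' r)) with ((2 * r) ^ 2 * E al' r) by ring.
  apply Rmult_le_compat; [apply pow2_ge_0|lra| |lra]. nra. }
assert (4 * Rabs C < kp * t). { destruct HT2 as (_ & _ & q3). apply Rlt_div_l in q3; auto. assert (kp * T2 < kp * t) by nra. lra. }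
assert (kp * t < t * E al' t * t) by nra. lra.
Qed.
Lemma f_ge_plateau x : d0 <= x < g1 -> 0 <= f x.
Proof.
intros. destruct (Req_dec x d0) as [->|]; [|left; apply L_rise; lrn].
apply Rnot_lt_le. intros Hlt. destruct (cont_lt_near f d0 0 (Hfc d0) Hlt) as (d & Hd & h).
pose (z := Rmin (d0 + d / 2) ((d0 + g1) / 2)).
assert (d0 < z <= d0 + d / 2) by (unfold z; split; [apply Rmin_glb_lt; lra|apply Rmin_l]).
assert (z <= (d0 + g1) / 2) by apply Rmin_r.
pose proof (h z ltac:(rewrite Rabs_pos_eq; lra)). assert (0 < f z) by (apply L_rise; lra). lra.
Qed.

(* While the solution lingers above d0 it is almost stationary, so the force is tiny at the level q of its energy. *)
Lemma stuck_plateau : exists C', 0 < C' /\ forall al t, adm al -> inT al R1 -> stuck al t ->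
  0 < E al (5 / 8 * t) /\ exists x, 0 <= x < g1 - d0 /\
    E al (5 / 8 * t) - C' * E al (5 / 8 * t) ^ 2 <= F (d0 + x) <= E al (5 / 8 * t) /\ f (d0 + x) <= C' * E al (5 / 8 * t) ^ 2.
Proof.
pose proof L_order as Lo. pose proof (nu_ge n Hn) as Hnu.
(* From a speed $8\gamma_1/t$, which is a distance at most $\gamma_1$ over a time $t/8$; the factor
   $2^n$ comes from $t^n\le2^nr^n$ for $r\ge t/2$. *)
pose (K1 := 2 ^ n * (8 * g1)).
assert (HK1 : 0 < K1) by (unfold K1; apply Rmult_lt_0_compat; [apply pow_lt|]; lra).
pose (C0 := 16 * K1 + (nu n + 1) * K1 ^ 2).
assert (HK2 : 0 < K1 ^ 2) by nra.
assert (HC0 : 0 < C0) by (unfold C0; assert (0 < (nu n + 1) * K1 ^ 2) by (apply Rmult_lt_0_compat; lra); lra).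
exists (C0 / kp ^ 2). assert (Hk2 : 0 < kp ^ 2) by nra. split; [apply Rdiv_lt_0_compat; auto|].
intros al t H HT ((i1 & i2 & i3 & i4 & i5) & j1 & j2 & j3).
destruct (signed_y al s H Hs) as (Dy & Dw & Cy & Cw & EE & Hs2 & Ay & Aw).
assert (0 < t) by lra.
set (q := E al (5 / 8 * t)).
assert (kp < t * q). { pose proof (E_decr al (5 / 8 * t) t H LRA). unfold q.
  nra. }
assert (0 < q) by nra.
assert (C0 / t ^ 2 <= C0 / kp ^ 2 * q ^ 2).
{ replace (C0 / kp ^ 2 * q ^ 2) with (C0 * (q / kp) ^ 2) by (field; lra).
  replace (C0 / t ^ 2) with (C0 * (/ t) ^ 2) by (field; lra).
  apply Rmult_le_compat_l; [lra|]. apply pow_incr. split; [left; apply Rinv_0_lt_compat; auto|].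
  apply Rmult_le_reg_l with (t * kp); [apply Rmult_lt_0_compat; auto|].
  replace (t * kp * / t) with kp by (field; lra). replace (t * kp * (q / kp)) with (t * q) by (field; lra). lra. }
assert (Yb : forall r, t / 2 <= r <= t -> d0 <= s * U al r < g1).
{ intros. split; [apply j3; auto|]. destruct (inT_persist al R1 r H LRA HT) as [Q _].
  rewrite <- Ay in Q. apply Rabs_def2 in Q. lra. }
pose (m := fun r => r ^ n * (s * V al r)).
assert (Dm : forall r, 0 < r -> is_derive m r (- (r ^ n * f (s * U al r)))).
{ intros. apply (is_derive_ext (fun r => s * (r ^ n * V al r))); [intros z; change (s * (z ^ n * V al z) = z ^ n * (s * V al z)); ring|].
  eapply dval; [apply (dmult (fun _ => s) (fun r => r ^ n * V al r)); [apply dconst|apply (momentum_derive n Hn f 0 (U al)); auto using U_ode; lra]|].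
  rewrite f_sign by auto. ring. }
assert (Mm : forall r r', t / 2 <= r <= r' -> r' <= t -> m r' <= m r).
{ intros. cut (- m r <= - m r'); [lra|].
  apply (mono_le (fun r => - m r) (fun r => - - (r ^ n * f (s * U al r)))); try lra.
  - intros. apply dopp, Dm. lra.
  - intros. apply (continuous_opp m). eapply is_derive_cont, Dm. lra.
  - intros. rewrite Ropp_involutive. apply Rmult_le_pos; [apply pow_le; lra|]. apply f_ge_plateau, Yb. lra. }
(* Each window of length $t/8$ contains a time of small momentum; as the momentum is monotone on the
   plateau, it is small between two such times. *)
assert (Slow : forall p p', t / 2 <= p -> p' <= t -> p' - p = t / 8 -> exists x, p < x < p' /\ Rabs (m x) <= t ^ n * (8 * g1 / t)).
{ intros p p' Hp Hp' Hpp.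
  destruct (mvt (fun r => s * U al r) (fun r => s * V al r) p p') as (x & Hx & Ex); try lra.
  { intros. apply Dy; lra. } { intros. apply Cy; lra. }
  exists x. split; auto. unfold m. rewrite Rabs_mult, (Rabs_pos_eq (x ^ n)) by (apply pow_le; lra).
  apply Rmult_le_compat; [apply pow_le; lra|apply Rabs_pos|apply pow_incr; lra|].
  apply Rle_div_r; [lra|]. pose proof (Yb p LRA). pose proof (Yb p' LRA). rewrite Hpp in Ex.
  assert (Q : Rabs (s * V al x * (t / 8)) <= g1) by (rewrite <- Ex; apply Rabs_le; lra).
  rewrite Rabs_mult, (Rabs_pos_eq (t / 8)) in Q by lra. lra. }
destruct (Slow (t / 2) (5 / 8 * t) LRA LRA ltac:(field)) as (t1 & Ht1 & m1).
destruct (Slow (6 / 8 * t) (7 / 8 * t) LRA LRA ltac:(field)) as (t2 & Ht2 & m2).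
set (M := t ^ n * (8 * g1 / t)) in *.
assert (Mb : forall r, t1 <= r <= t2 -> Rabs (m r) <= M).
{ intros. pose proof (Mm t1 r LRA LRA). pose proof (Mm r t2 LRA LRA).
  apply Rabs_le_between in m1. apply Rabs_le_between in m2. apply Rabs_le. lra. }
assert (Half : forall r, t / 2 <= r -> t ^ n <= 2 ^ n * r ^ n).
{ intros. rewrite <- Rpow_mult_distr. apply pow_incr. lra. }
assert (Cancel : forall r z K, t1 <= r <= t2 -> r ^ n * z <= t ^ n * K -> 0 <= K -> z <= 2 ^ n * K).
{ intros r z K Hr Hz HK. assert (0 < r ^ n) by (apply pow_lt; lra).
  apply Rmult_le_reg_l with (r ^ n); auto. eapply Rle_trans; [exact Hz|].
  replace (r ^ n * (2 ^ n * K)) with (2 ^ n * r ^ n * K) by ring. apply Rmult_le_compat_r; auto. apply Half. lra. }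
assert (0 <= 8 * g1 / t) by (apply Rdiv_le_0_compat; lra).
assert (Vb : forall r, t1 <= r <= t2 -> Rabs (V al r) <= K1 / t).
{ intros r Hr. replace (K1 / t) with (2 ^ n * (8 * g1 / t)) by (unfold K1; field; lra).
  apply (Cancel r); auto. specialize (Mb r Hr). unfold m in Mb. rewrite Rabs_mult, Aw, (Rabs_pos_eq (r ^ n)) in Mb by (apply pow_le; lra). auto. }
(* The momentum changes by at most $2M$ over a time $t/8$, so the force is $O(t^{-2})$ at some [x];
   the inequality $k_p<tq$ turns this into $O(q^2)$. *)
destruct (mvt m (fun r => - (r ^ n * f (s * U al r))) (5 / 8 * t) (6 / 8 * t)) as (x & Hx & Ex); try lra.
{ intros. apply Dm; lra. } { intros. eapply is_derive_cont, Dm; lra. }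
pose proof (Yb x LRA).
assert (f (s * U al x) <= 16 * K1 / t ^ 2).
{ replace (16 * K1 / t ^ 2) with (2 ^ n * (16 / t * (8 * g1 / t))) by (unfold K1; field; lra).
  assert (0 <= 16 / t) by nra.
  apply (Cancel x); [lra| |apply Rmult_le_pos; auto].
  pose proof (Mb (5 / 8 * t) LRA) as b1. pose proof (Mb (6 / 8 * t) LRA) as b2.
  apply Rabs_le_between in b1. apply Rabs_le_between in b2.
  assert (Q : x ^ n * f (s * U al x) * (t / 8) <= 2 * M) by lra.
  apply Rmult_le_reg_r with (t / 8); [lra|]. eapply Rle_trans; [exact Q|]. right. unfold M. field. lra. }
assert ((s * V al x) ^ 2 <= K1 ^ 2 / t ^ 2).
{ replace (K1 ^ 2 / t ^ 2) with ((K1 / t) ^ 2) by (field; lra). rewrite <- pow2_abs, Aw. apply pow_incr. split; [apply Rabs_pos|apply Vb; lra]. }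
assert (q - E al x <= nu n * (K1 ^ 2 / t ^ 2)).
{ assert (B := mvt_bound (E al) (fun r => - (nu n / r) * V al r ^ 2) (5 / 8 * t) x (2 * nu n / t * (K1 ^ 2 / t ^ 2)) LRA).
  assert (B' : Rabs (E al x - E al (5 / 8 * t)) <= 2 * nu n / t * (K1 ^ 2 / t ^ 2) * (x - 5 / 8 * t)).
  { apply B.
    - intros. apply E_derive; auto; lra.
    - intros. apply E_cont; auto; lra.
    - intros. rewrite Rabs_mult, Rabs_Ropp. apply Rmult_le_compat; try apply Rabs_pos.
      + rewrite Rabs_pos_eq by (apply Rdiv_le_0_compat; lra). replace (2 * nu n / t) with (nu n / (t / 2)) by (field; lra).
         apply Rmult_le_compat_l; [lra|]. apply Rinv_le_contravar; lra.
      + rewrite <- RPow_abs. replace (K1 ^ 2 / t ^ 2) with ((K1 / t) ^ 2) by (field; lra). apply pow_incr. split; [apply Rabs_pos|apply Vb; lra]. }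
  apply Rabs_le_between in B'. fold q in B'.
  assert (2 * nu n / t * (K1 ^ 2 / t ^ 2) * (x - 5 / 8 * t) <= 2 * nu n / t * (K1 ^ 2 / t ^ 2) * (t / 8)) by nra.
  replace (2 * nu n / t * (K1 ^ 2 / t ^ 2) * (t / 8)) with (nu n * (K1 ^ 2 / t ^ 2) / 4) in * by (field; lra).
   lra. }
split; auto. exists (s * U al x - d0). replace (d0 + (s * U al x - d0)) with (s * U al x) by ring.
split; [lra|].
pose proof (EE x). pose proof (E_decr al (5 / 8 * t) x H LRA) as Ed. fold q in Ed.
pose proof (pow2_ge_0 (s * V al x)).
assert (C0 / t ^ 2 = 16 * K1 / t ^ 2 + (nu n * (K1 ^ 2 / t ^ 2) + K1 ^ 2 / t ^ 2)) by (unfold C0; field; lra).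
assert (0 <= 16 * K1 / t ^ 2) by nra.
lra.
Qed.

(** The passage through $d_0$ is transversal and has positive energy, so neighbouring solutions pass
    inwards at a nearby time; by [inward_unique] this is their only passage. *)
Lemma inward_cont e1 (rd : R -> R) : 0 < e1 <= e0 -> (forall t, 0 < t < e1 -> adm (sa t) /\ inward (sa t) (rd t)) ->
  forall (t : nat -> R) x, 0 < x < e1 -> (forall k, 0 < t k < e1) -> ulim t x -> ulim (fun k => rd (t k)) (rd x).
Proof.
intros He Hrd t x Hx Ht Lt e Hep.
destruct (Hrd x Hx) as [Hax (i1 & i2 & i3 & i4 & i5)]. set (r0 := rd x) in *.
destruct (signed_y (sa x) s Hax Hs) as (Dy & Dw & Cy & Cw & EE & Hs2 & Ay & Aw).
destruct (derive_neg_right _ r0 _ (Dy r0 LRA) i3) as (d & Hd & h1 & h2). rewrite i2 in h1, h2.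
destruct (cont_gt_near _ r0 0 (Cy r0 LRA) ltac:(cbv beta; lra)) as (d' & Hd' & h3).
destruct (cont_gt_near _ r0 0 (E_cont (sa x) r0 Hax LRA) i4) as (d'' & Hd'' & h4).
pose (h := Rmin (Rmin (d / 2) (d' / 2)) (Rmin (d'' / 2) (Rmin (e / 2) ((r0 - R1) / 2)))).
assert (0 < h) by (unfold h; repeat apply Rmin_glb_lt; lra).
assert (h <= d / 2 /\ h <= d' / 2 /\ h <= d'' / 2 /\ h <= e / 2 /\ h <= (r0 - R1) / 2).
{ unfold h. pose proof (Rmin_l (Rmin (d / 2) (d' / 2)) (Rmin (d'' / 2) (Rmin (e / 2) ((r0 - R1) / 2)))).
  pose proof (Rmin_r (Rmin (d / 2) (d' / 2)) (Rmin (d'' / 2) (Rmin (e / 2) ((r0 - R1) / 2)))).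
  pose proof (Rmin_l (d / 2) (d' / 2)). pose proof (Rmin_r (d / 2) (d' / 2)).
  pose proof (Rmin_l (d'' / 2) (Rmin (e / 2) ((r0 - R1) / 2))). pose proof (Rmin_r (d'' / 2) (Rmin (e / 2) ((r0 - R1) / 2))).
  pose proof (Rmin_l (e / 2) ((r0 - R1) / 2)). pose proof (Rmin_r (e / 2) ((r0 - R1) / 2)). lra. }
assert (Pos : forall r, R1 <= r <= r0 + h -> 0 < s * U (sa x) r).
{ intros. destruct (Rle_lt_dec r r0); [apply i5; lra|]. apply h3. rewrite Rabs_pos_eq; lra. }
assert (Lv : forall r, 0 <= r <= r0 + h -> U (sa x) r <> 0 \/ V (sa x) r <> 0).
{ intros. apply (live_before (sa x) (r0 + h)); [auto|lra|]. left. intros. pose proof (Pos (r0 + h) LRA). nra. }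
assert (Ht' : forall k, 0 < t k < e0) by (intros i; specialize (Ht i); lra).
assert (Lim := fun rk rho => E_lim t x rk rho Ht' Lt LRA).
destruct (Lim (fun _ => r0 - h) (r0 - h) ltac:(intros; lra) (ulim_const _) LRA ltac:(intros; apply Lv; lra)) as (L1 & _ & _).
destruct (Lim (fun _ => r0 + h) (r0 + h) ltac:(intros; lra) (ulim_const _) LRA ltac:(intros; apply Lv; lra)) as (L2 & _ & L3).
apply (ulim_scal _ s) in L1. apply (ulim_scal _ s) in L2.
assert (A1 : Uf (fun k => forall r, R1 <= r <= r0 + h -> 0 < s * U (sa (t k)) r)).
{ destruct (Uf_em (fun k => forall r, R1 <= r <= r0 + h -> 0 < s * U (sa (t k)) r)) as [|HN]; auto. exfalso.
  destruct (choose1 _ _ (fun (k : nat) r => R1 <= r <= r0 + h /\ (~ (forall r, R1 <= r <= r0 + h -> 0 < s * U (sa (t k)) r) -> s * U (sa (t k)) r <= 0))) as [rk Hrk].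
  { intros i. destruct (classic (forall r, R1 <= r <= r0 + h -> 0 < s * U (sa (t i)) r)) as [Q|Q].
    - exists R1. split; [lra|]. tauto.
    - apply not_all_ex_not in Q. destruct Q as [r Q]. apply imply_to_and in Q. exists r. lra. }
  destruct (ulim_exists rk (r0 + h)) as [rho Hrho]. { apply Uf_all. intros i. destruct (Hrk i). rewrite Rabs_pos_eq; lra. }
  assert (R1 <= rho) by (apply (ulim_le (fun _ => R1) rk); auto using ulim_const; apply Uf_all; intros i; apply Hrk).
  assert (rho <= r0 + h) by (apply (ulim_le rk (fun _ => r0 + h)); auto using ulim_const; apply Uf_all; intros i; apply Hrk).
  destruct (Lim rk rho ltac:(intros i; destruct (Hrk i); lra) Hrho LRA ltac:(intros; apply Lv; lra)) as (L & _ & _).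
  assert (s * U (sa x) rho <= 0); [|pose proof (Pos rho LRA); lra].
  apply (ulim_le (fun k => U (sa (t k)) (rk k) * s) (fun _ => 0)); auto using ulim_const.
  - rewrite Rmult_comm. apply ulim_scal; auto.
  - apply (Uf_mono _ _ HN). intros i hi. destruct (Hrk i) as [_ q]. specialize (q hi). lra. }
assert (B1 : d0 < U (sa x) (r0 - h) * s) by (pose proof (h2 (r0 - h) LRA); lra).
assert (B2 : U (sa x) (r0 + h) * s < d0) by (pose proof (h1 (r0 + h) LRA); lra).
assert (B3 : 0 < E (sa x) (r0 + h)) by (apply h4; rewrite Rabs_pos_eq; lra).
apply (Uf_mono _ _ (Uf_and _ _ A1 (Uf_and3 _ _ _ (ulim_gt _ _ _ L1 B1) (ulim_lt _ _ _ L2 B2) (ulim_gt _ _ _ L3 B3)))).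
intros i [k0 (k1 & k2 & k3)]. destruct (Hrd (t i) (Ht i)) as [Ha Hin].
destruct (signed_y (sa (t i)) s Ha Hs) as (Dy' & Dw' & Cy' & Cw' & EE' & _ & _ & _).
destruct (last_at (fun r => - (s * U (sa (t i)) r)) (r0 - h) (r0 + h) (- d0)) as (w & Hw & Ew & Bw); try lra.
{ intros. apply (continuous_opp (fun r => s * U (sa (t i)) r)). apply Cy'; lra. }
assert (0 < E (sa (t i)) w) by (pose proof (E_decr (sa (t i)) w (r0 + h) Ha LRA); lra).
assert (Ew' : s * U (sa (t i)) w = d0) by lra.
assert (Hinw : inward (sa (t i)) w).
{ split; [lra|]. split; auto. split; [|split; auto; intros r Hr; apply k0; lra].
  pose proof (EE' w) as Q. rewrite Ew', L_d0 in Q.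
  destruct (Rtotal_order (s * V (sa (t i)) w) 0) as [|[E1|E1]]; auto; exfalso.
  - nra.
  - destruct (derive_pos_right _ w _ (Dy' w LRA) E1) as (dd & Hdd & g & _). rewrite Ew' in g.
    pose (m := Rmin (r0 + h) (w + dd / 2)). assert (w < m <= r0 + h) by (unfold m; split; [apply Rmin_glb_lt; lra|apply Rmin_l]).
    assert (m <= w + dd / 2) by apply Rmin_r. specialize (g m LRA). specialize (Bw m LRA). lra. }
rewrite (inward_unique (sa (t i)) _ _ Ha Hin Hinw). apply Rabs_def1; lra.
Qed.

(** The energy at $5/8$ of the passage time depends continuously on the initial value and takes
    arbitrarily small values, hence all small values [q]. So near every small level [q] of $F$ just
    above $d_0$ there is a point with $f=O(q^2)$, which [no_flat_start] excludes. *)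
Lemma plateau_contradiction : False.
Proof.
pose proof L_order.
destruct (good_stuck 1) as (T0 & HT0 & HGS). destruct (near_good T0 HT0) as (e1 & He1 & HG).
destruct (choose1 _ _ (fun t r => 0 < t < e1 -> stuck (sa t) r)) as [rd Hrd].
{ intros t. destruct (classic (0 < t < e1)) as [Q|Q]; [|exists 0; tauto].
  destruct (HGS _ (HG t Q)) as (r & _ & Hr). exists r. auto. }
assert (Hin : forall t, 0 < t < e1 -> adm (sa t) /\ inward (sa t) (rd t)).
{ intros t Ht. split; [apply Hnb; lra|]. apply (Hrd t Ht). }
pose (Q := fun t => E (sa t) (5 / 8 * rd t)).
assert (CQ : forall x, 0 < x < e1 -> continuous Q x).
{ intros x Hx. apply (seq_cont Q e1 x Hx). intros t Ht Lt.
  pose proof (inward_cont e1 rd He1 Hin t x Hx Ht Lt).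
  destruct (Hin x Hx) as [ax (b1 & b2 & b3 & b4 & b5)].
  apply (E_lim t x (fun k => 5 / 8 * rd (t k)) (5 / 8 * rd x)); auto; try lra.
  - intros i. specialize (Ht i). lra.
  - intros i. destruct (Hin (t i) (Ht i)) as [_ (c1' & _)]. lra.
  - apply (ulim_ext (fun k => rd (t k) * (5 / 8))); [apply Uf_all; intros; ring|]. rewrite Rmult_comm. apply ulim_scal; auto.
  - intros. apply (live_before (sa x) (rd x)); [auto|lra|]. nra. }
assert (Small : forall q, 0 < q -> exists t, 0 < t < e1 / 2 /\ Q t < q).
{ intros q Hq. destruct (HE0 q Hq) as [T1 HT1].
  pose (T2 := Rmax T1 R1). pose proof (Rmax_l T1 R1) as m1. pose proof (Rmax_r T1 R1) as m2. fold T2 in m1, m2.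
  destruct (good_stuck (8 / 5 * T2)) as (T3 & HT3 & HGS3). destruct (near_good T3 HT3) as (e2 & He2 & HG2).
  destruct (near_seq (fun t => E (sa t) T2 < q) e0 He0) as (e3 & He3 & HG3).
  { intros t Ht Lt. destruct (E_lim t 0 (fun _ => T2) T2 Ht Lt LRA ltac:(intros; lra) (ulim_const _) LRA) as (_ & _ & L3).
    - intros. rewrite al_0. apply Hlive; lra.
    - rewrite al_0 in L3. apply (ulim_lt _ _ _ L3). specialize (HT1 T2 m1). rewrite Rminus_0_r in HT1. pose proof (Rle_abs (E a T2)). lra. }
  pose (t := Rmin (Rmin e1 e2) e3 / 3).
  assert (0 < Rmin (Rmin e1 e2) e3) by (repeat apply Rmin_glb_lt; lra).
  pose proof (Rmin_l (Rmin e1 e2) e3). pose proof (Rmin_r (Rmin e1 e2) e3). pose proof (Rmin_l e1 e2). pose proof (Rmin_r e1 e2).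
  exists t. assert (0 < t < e1 / 2 /\ t < e2 /\ t < e3) by (unfold t; lra). split; [lra|].
  destruct (HGS3 _ (HG2 t LRA)) as (r & Hr & Hst).
  destruct (Hin t LRA) as [at' Hi].
  assert (r = rd t) by (apply (inward_unique (sa t)); auto; apply Hst). subst r.
  unfold Q. pose proof (E_decr (sa t) T2 (5 / 8 * rd t) at' LRA). pose proof (HG3 t LRA). lra. }
destruct stuck_plateau as (C' & HC' & HP).
destruct (lip_compact f d0 g1 LRA Hfc) as (L & HL0 & HL). { intros. apply Hfl. lra. }
assert (Hhalf : 0 < e1 / 2 < e1) by lra.
assert (HGI : forall t, 0 < t < e1 -> adm (sa t) /\ inT (sa t) R1).
{ intros t Ht. destruct (HG t Ht) as (g1' & _ & _ & g2' & _). auto. }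
apply (no_flat_start (fun x => F (d0 + x)) (fun x => f (d0 + x)) (g1 - d0) (L + 1) C' (Q (e1 / 2))); try lra.
- destruct (HGI _ Hhalf) as [q1 q2]. destruct (HP (sa (e1 / 2)) (rd (e1 / 2)) q1 q2 (Hrd _ Hhalf)) as [z _]. exact z.
- intros. eapply dval; [apply (dcomp F (fun x => d0 + x)); [apply dF|der]|]. ring.
- intros. eapply is_derive_cont. apply (dcomp F (fun x => d0 + x)); [apply dF|der].
- intros. eapply Rle_trans; [apply HL; lra|]. replace (d0 + x - (d0 + y)) with (x - y) by ring.
  apply Rmult_le_compat_r; [apply Rabs_pos|lra].
- rewrite Rplus_0_r. apply L_d0.
- intros. apply L_rise. lra.
- intros. destruct (Small q LRA) as (t & Ht & Hqt).
  destruct (ivt_up Q t (e1 / 2) q) as (w & Hw & Ew); try lra. { intros. apply CQ; lra. }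
  assert (Hw' : 0 < w < e1) by lra. destruct (HGI w Hw') as [q1 q2].
  destruct (HP (sa w) (rd w) q1 q2 (Hrd w Hw')) as [_ (x & x1 & x2 & x3)]. fold (Q w) in x2, x3. rewrite Ew in x2, x3.
  exists x. lra.
Qed.
End Fixed.

(** In the application $F(l)=f(l)=0$, and such a limit is compatible with the energy of the solution
    itself; the contradiction comes from its neighbours. *)
Lemma no_positive_limit : False.
Proof.
destruct start_time as (R1 & h1 & h2 & h3). destruct c_order as (o1 & o2 & o3).
destruct (crossing_cost c1 c2 (F g1)) as (kp & Hk & Hcost); try lra.
apply (plateau_contradiction R1 h1 h2 h3 kp Hk Hcost).
Qed.
End Plateau.
End L0.

(** * Two bound states around a shooting value *)

Section Bound.
Context {P : problem} {LL : landscape}.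
Notation f := (@f P).
Notation F := (pot f).
Notation U := (@U P).
Notation E := (@orbit_energy P).
Notation d0 := (@d0 P LL).
Notation g1 := (@g1 P LL).
Notation b := (@b P LL).

(** [a] has at most [k] sign changes and its neighbours on one side at least $k+1$; by [death] only
    one is lost, so [a] has exactly [k]. It is not trapped, since the count would then be stable, so
    it converges unless it is frozen. In [T] the limit is below $\gamma_1$, there is no zero of $f$
    between $d_0$ and $\gamma_1$, and [no_positive_limit] excludes $(0,d_0]$. *)
Lemma bound_state a sg e0 k : adm a -> T a -> ~ W (S k) a -> (sg = 1 \/ sg = -1) -> 0 < e0 ->
  (forall t, 0 < t < e0 -> adm (a + sg * t) /\ W (S k) (a + sg * t)) -> W k a /\ tends (U a) 0.
Proof.
intros Haa HT HW Hsg He0 Hnb. pose proof L_order. pose proof Hdl.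
pose (t := fun k => e0 / 2 * / (INR k + 1)).
assert (Ht : forall k, 0 < t k < e0). { intros i. pose proof (xis_pos (e0 / 2) i LRA) as Q. unfold xis in Q. unfold t. lra. }
pose (al := fun k => a + sg * t k).
assert (Lal : ulim al a).
{ apply (ulim_ext (fun k => a + t k * sg)); [apply Uf_all; intros; unfold al; ring|].
  assert (L : ulim (fun k => a + t k * sg) (a + 0 * sg)).
  { apply (ulim_plus (fun _ => a) (fun k => t k * sg)); [apply ulim_const|]. apply ulim_scal. apply (xis_lim (e0 / 2)). }
  rewrite Rmult_0_l, Rplus_0_r in L. exact L. }
assert (Hc : forall k, al k <= a + e0). { intros i. specialize (Ht i). unfold al. nra. }
assert (Had : forall k, adm (al k)) by (intros i; apply Hnb; auto).
assert (HWk : forall i, W (S k) (al i)) by (intros i; apply Hnb; auto).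
assert (Tl : live a -> tends (U a) 0 /\ exists R0, 0 < R0 /\ forall r, R0 <= r -> U a r <> 0).
{ intros Hl.
  assert (Hnt : forall r, 0 < r -> ~ trapped a r).
  { intros r Hr Htr. apply (Uf_out _ _ (trapped_open al a (a + e0) r (S k) Had Hc Lal Haa Hr Htr HW)). intros i [_ h]. auto. }
  destruct (limit_lemma a (S k) Haa HW Hl Hnt) as (s & l & R0 & q1 & q2 & q3 & q4 & q5 & q6 & q7 & q8 & q9).
  assert (forall r, R0 <= r -> U a r <> 0) by (intros r Hr E0; specialize (q4 r Hr); rewrite E0 in q4; lra).
  destruct (Req_dec l 0) as [->|Hl0].
  - split; [|exists R0; auto]. apply (tends_ext (fun r => s * (s * U a r)) _ _ 0).
    + intros. nra.
    + replace 0 with (s * 0) by ring. apply (tends_comp (fun z => s * z)); auto. eapply is_derive_cont. der.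
  - exfalso. destruct HT as (rT & HrT & HT).
    assert (l < g1).
    { apply Rnot_le_lt. intros Hle.
      assert (F l <= E a rT). { apply (tends_le (E a) _ _ rT); auto. intros. apply E_decr; auto. }
      destruct HT. assert (F g1 <= F l). { destruct (Req_dec l g1) as [->|]; [lra|]. apply q9. lrn. } lra. }
    assert (l <= d0). { apply Rnot_lt_le. intros Hlt. assert (0 < f l) by (apply L_rise; lra). lra. }
    assert (Fl : F l = 0). { assert (F l <= 0) by (apply L_neg; lra). assert (F 0 <= F l) by (apply q9; lrn). rewrite F_0 in *. lra. }
    rewrite Fl in q7.
    apply (no_positive_limit a s sg e0 l k); auto; try (split; lrn).
    exists rT. auto. }
destruct (W_exact (S k) a HW) as (j & Hj & Wj & HWj).
assert ((k <= j)%nat).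
{ destruct (Nat.le_gt_cases k j); auto. exfalso.
  apply (Uf_out _ _ (death al a (a + e0) j Had Hc Lal Haa HWj HT Tl)). intros i h. apply h.
  apply (W_le (S (S j)) (S k)); [lia|apply HWk]. }
split.
- apply (W_le k j); auto.
- destruct (classic (live a)) as [Hl|Hl]; [apply Tl, Hl|].
   apply not_all_ex_not in Hl. destruct Hl as [r Hr]. apply imply_to_and in Hr. destruct Hr as [Hr Hd].
  apply not_or_and in Hd. destruct Hd as [d1 d2]. apply NNPP in d1. apply NNPP in d2.
  intros. exists r. intros x Hx. rewrite (proj1 (U_frozen a r x Haa LRA d1 d2)), Rminus_diag, Rabs_R0. auto.
Qed.

(** Provides the supremum with a sequence of the set converging to it, because openness and
    closedness are stated for sequences. *)
Lemma sup_seq (Q : R -> Prop) lo hi : (exists x, lo <= x <= hi /\ Q x) ->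
  exists s al, lo <= s <= hi /\ (forall x, s < x <= hi -> ~ Q x) /\ ulim al s /\ forall k : nat, lo <= al k <= s /\ Q (al k).
Proof.
intros [x0 [Hx0 HQ]]. destruct (completeness (fun x => lo <= x <= hi /\ Q x)) as [s [ub lub]].
{ exists hi. intros x [hx _]. lra. } { exists x0. auto. }
destruct (choose1 _ _ (fun (k : nat) x => s - 1 * / (INR k + 1) < x /\ lo <= x <= hi /\ Q x)) as [al Hal].
{ intros. pose proof (xis_pos 1 k Rlt_0_1) as h. unfold xis in h. apply NNPP. intros HN.
  assert (s <= s - 1 * / (INR k + 1)); [|lra]. apply lub. intros x Hx. apply Rnot_lt_le. intros Hlt. apply HN. exists x. auto. }
assert (B : forall k, lo <= al k <= s) by (intros k; destruct (Hal k) as (_ & h1 & h2); split; [lra|apply ub; auto]).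
exists s, al. split; [split; [specialize (B 0%nat); lra|apply lub; intros x [h _]; lra]|]. split; [|split].
- intros x Hx h. destruct (B 0%nat). assert (x <= s); [|lra]. apply ub. split; [lra|auto].
- intros e He. apply (Uf_mono _ _ (ulim_lt _ _ e (xis_lim 1) He)). intros k hk. unfold xis in hk.
  destruct (Hal k). specialize (B k). rewrite Rabs_left1; lra.
- intros. split; auto. apply Hal.
Qed.

Lemma inf_seq (Q : R -> Prop) lo hi : (exists x, lo <= x <= hi /\ Q x) ->
  exists s al, lo <= s <= hi /\ (forall x, lo <= x < s -> ~ Q x) /\ ulim al s /\ forall k : nat, s <= al k <= hi /\ Q (al k).
Proof.
intros (x & Hx & HQ). destruct (sup_seq (fun x => Q (- x)) (- hi) (- lo)) as (s & al & h1 & h2 & h3 & h4).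
{ exists (- x). rewrite Ropp_involutive. split; auto. lra. }
exists (- s), (fun k => - al k). split; [lra|]. split; [|split; [apply ulim_opp; auto|]].
- intros y Hy h. apply (h2 (- y)); [lra|]. rewrite Ropp_involutive. auto.
- intros. destruct (h4 k). split; auto. lra.
Qed.

Lemma two_solutions k x0 : b < x0 -> top x0 -> T x0 -> ~ W k x0 ->
  (exists A0, b <= A0 /\ top A0 /\ forall al, A0 < al -> top al -> W (S k) al) ->
  exists a1 a2, b < a1 /\ a1 < x0 /\ x0 < a2 /\ top a2 /\
    (forall a, a = a1 \/ a = a2 -> adm a /\ W k a /\ ~ W (S k) a /\ tends (U a) 0).
Proof.
intros Hb0 Ht0 HT0 HW0 (A0 & hA0 & htA0 & HA0).
assert (HWS : ~ W (S k) x0) by (intros HW; apply HW0, W_pred, HW).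
assert (Adm : forall x hi, top hi -> b <= x <= hi -> adm x) by (intros x hi h1 h2; apply adm_out; [|apply (top_lt _ hi)]; auto; lra).
(* By [T_open], [W_open] and [end_lemma], three sets are closed: the complement of [T], the set
   without $k+1$ sign changes, and its part inside [T]. *)
assert (Cl : forall al s hi, top hi -> ulim al s -> (forall i : nat, b <= al i <= hi) -> b <= s <= hi -> ((forall i, ~ T (al i)) -> ~ T s) /\
  ((forall i, ~ W (S k) (al i)) -> ~ W (S k) s /\ ((forall i, T (al i)) -> T s))).
{ intros al s hi Hhi Ls Hal Hs. assert (Had : forall i, adm (al i)) by (intros i; apply (Adm _ hi); auto).
  assert (Hc : forall i, al i <= hi) by apply Hal. pose proof (Adm s hi Hhi Hs) as Has. assert (ts : top s) by (apply (top_lt _ hi); auto; lra).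
  split; [|split].
  - intros HnT HT. apply (Uf_out _ _ (T_open al s hi Had Hc Ls Has HT)). auto.
  - intros HW. apply (Uf_out _ _ (W_open (S k) al s hi Had Hc Ls Has HW)). auto.
  - intros HT. apply NNPP. intros HnT. apply (Uf_out _ _ (end_lemma al s hi (S k) Had Hc Ls Has ts HnT HT)). auto. }
assert (Low : exists a1 e, b < a1 <= x0 /\ T a1 /\ ~ W (S k) a1 /\ 0 < e /\ forall t, 0 < t < e -> adm (a1 + -1 * t) /\ W (S k) (a1 + -1 * t)).
{ destruct (sup_seq (fun x => ~ T x) b x0) as (lo & al & h1 & h2 & h3 & h4); [exists b; split; [lra|apply b_not_T]|].
  assert (~ T lo) by (apply (Cl al lo x0); auto; intros i; destruct (h4 i); auto; lra).
  assert (lo <> x0) by (intros ->; auto).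
  destruct (inf_seq (fun x => lo < x /\ ~ W (S k) x) lo x0) as (a1 & al' & q1 & q2 & q3 & q4); [exists x0; split; [lra|split; [lrn|auto]]|].
  destruct (Cl al' a1 x0) as [_ Z]; auto; [intros i; destruct (q4 i); lra|lra|]. destruct Z as [HWa HTa]; [intros i; apply q4|].
  assert (T a1). { apply HTa. intros. apply NNPP. intros. destruct (q4 i) as [z1 [z2 _]]. apply (h2 (al' i)); auto. lra. }
  assert (lo <> a1) by (intros <-; auto).
  exists a1, (a1 - lo). split; [lrn|]. split; auto. split; auto. split; [lrn|]. intros. split; [apply (Adm _ x0); auto; lra|].
  apply NNPP. intros h. apply (q2 (a1 + -1 * t)); [lra|]. split; [lra|auto]. }
assert (Up : exists a2 e, x0 <= a2 /\ top a2 /\ T a2 /\ ~ W (S k) a2 /\ 0 < e /\ forall t, 0 < t < e -> adm (a2 + 1 * t) /\ W (S k) (a2 + 1 * t)).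
{ assert (Hx : exists hi, x0 < hi /\ top hi /\ (forall x, x0 <= x < hi -> T x) /\ (T hi -> W (S k) hi)).
  { assert (x0 <= A0) by (apply Rnot_lt_le; intros Hlt; apply HWS, HA0; auto).
    assert (Hm : exists m, A0 < m /\ top m).
    { unfold top in *. destruct gs as [g| |]; simpl in *; [exists ((A0 + g) / 2); lra|exists (A0 + 1); split; [lra|exact I]|tauto]. }
    destruct Hm as (m & hm & tm).
    destruct (classic (exists x, x0 <= x <= m /\ ~ T x)) as [Hx|HN].
    - destruct (inf_seq (fun x => ~ T x) x0 m Hx) as (hi & al & h1 & h2 & h3 & h4).
      assert (~ T hi) by (apply (Cl al hi m); auto; [intros i; destruct (h4 i); lra|lra|intros i; apply h4]).
      exists hi. assert (x0 <> hi) by (intros <-; auto). split; [lrn|]. split; [apply (top_lt _ m); auto; lra|]. split; [|tauto].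
      intros. apply NNPP. auto.
    - exists m. split; [lra|]. split; auto. split; [|intros _; apply HA0; auto].
      intros. apply NNPP. intros h. apply HN. exists x. split; auto. lra. }
  destruct Hx as (hi & Hhi & thi & Tb & HThi).
  destruct (sup_seq (fun x => x < hi /\ ~ W (S k) x) x0 hi) as (a2 & al' & q1 & q2 & q3 & q4); [exists x0; split; [lra|split; [lra|auto]]|].
  destruct (Cl al' a2 hi) as [_ Z]; auto; [intros i; destruct (q4 i); lra|lra|]. destruct Z as [HWa HTa]; [intros i; apply q4|].
  assert (T a2) by (apply HTa; intros i; apply Tb; destruct (q4 i) as [z1 [z2 _]]; lra).
  assert (a2 <> hi) by (intros ->; auto).
  exists a2, (hi - a2). split; [lra|]. split; [apply (top_lt _ hi); auto; lra|]. split; auto. split; auto. split; [lrn|].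
  intros. split; [apply (Adm _ hi); auto; lra|]. apply NNPP. intros h. apply (q2 (a2 + 1 * t)); [lra|]. split; [lra|auto]. }
destruct Low as (a1 & e1 & l1 & l2 & l3 & l4 & l5). destruct Up as (a2 & e2 & u1 & u2 & u3 & u4 & u5 & u6).
assert (adm a1) by (apply (Adm _ x0); auto; lra).
assert (adm a2) by (apply (Adm _ a2); auto; lra).
destruct (bound_state a1 (-1) e1 k) as [w1 t1]; auto.
destruct (bound_state a2 1 e2 k) as [w2 t2]; auto.
assert (a1 <> x0) by (intros ->; auto). assert (a2 <> x0) by (intros ->; auto).
exists a1, a2. split; [lra|]. split; [lrn|]. split; [lrn|]. split; auto. intros a [-> | ->]; auto.
Qed.
End Bound.

(** * Solutions trapped on either side *)

Section Trapping.
Context {P : problem} {LL : landscape}.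
Notation n := (@n P).
Notation f := (@f P).
Notation F := (pot f).
Notation U := (@U P).
Notation V := (@V P).
Notation E := (@orbit_energy P).
Notation D := (@scaled_energy P).
Notation gM := (@gM P LL).
Notation b := (@b P LL).

Lemma b_right r : 0 < r -> gM < U b r /\ E b r < F gM.
Proof.
intros. pose proof L_order. destruct L_b as [Lb1 Lb2].
assert (Hb : adm b) by (apply adm_out; [lra|apply L_btop]).
assert (Es : forall t, 0 < t -> E b t < F gM).
{ intros. rewrite <- Lb1, <- (E_0 b Hb). apply (energy_strict n Hn f 0); auto using Hfc, U_ode, V_0; try lra.
  - apply U_cont; auto; lra.
  - apply V_cont; auto; lra.
  - rewrite U_0 by auto. apply Hb. }
split; auto. apply Rnot_le_lt. intros Hle.
destruct (ivt_down (U b) 0 r gM) as (t & Ht & Et); try lra.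
- intros. apply U_cont; auto; lra.
- rewrite U_0 by auto. lra.
- assert (t <> 0). { intros ->. rewrite U_0 in Et by auto. lra. }
  pose proof (Es t ltac:(lrn)). pose proof (F_le_E b t). rewrite Et in *. lra.
Qed.

(** $f$ has a positive minimum on $[b,\alpha]$, so the comparison parabola drives the solution below
    [b]. *)
Lemma falls_below_b al : adm al -> b <= al -> top al -> exists S, 0 < S /\ U al S < b.
Proof.
intros H Hb Ht. pose proof L_order. pose proof Hdl. pose proof (nu_ge n Hn).
destruct (max_attained (fun x => - f x) b al Hb) as (x0 & Hx0 & Hm).
{ intros. apply (continuous_opp f). apply Hfc. }
assert (Hp : 0 < f x0). { apply L_out; [lra|]. apply (top_lt _ al); auto; lra. }
pose (r := 2 * (nu n + 1) * al / f x0 + 1).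
assert (2 * (nu n + 1) * al < f x0 * r).
{ unfold r. replace (f x0 * (2 * (nu n + 1) * al / f x0 + 1)) with (2 * (nu n + 1) * al + f x0) by (field; apply Rgt_not_eq; exact Hp). lra. }
assert (1 <= r). { unfold r. assert (0 <= 2 * (nu n + 1) * al / f x0) by (apply Rdiv_le_0_compat; nra). lra. }
apply NNPP. intros HN.
assert (Hge : forall s, 0 < s -> b <= U al s). { intros. apply Rnot_lt_le. intros Hlt. apply HN. exists s. auto. }
assert (Hr0 : 0 < r) by lra. assert (HH : -1 = 1 \/ -1 = -1) by lra.
pose proof (decay_bound (-1) al r (f x0) HH H Hr0) as Q.
assert (-1 * (al - f x0 * r ^ 2 / (2 * (nu n + 1))) <= -1 * U al r).
{ apply Q. intros s Hs. assert (b <= U al s <= al).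
  { split; [apply Hge; lra|]. pose proof (U_bound al s H LRA) as h. apply Rabs_le_between in h. lra. }
  specialize (Hm (U al s) LRA). lra. }
specialize (Hge r LRA).
assert (al <= f x0 * r ^ 2 / (2 * (nu n + 1))).
{ apply Rle_div_r; [lra|]. simpl. rewrite Rmult_1_r. assert (f x0 * r * 1 <= f x0 * r * r) by (apply Rmult_le_compat_l; [apply Rmult_le_pos; lra|lra]). lra. }
lra.
Qed.

(** The decay of $r^2E$ again, with the energy measured from $F(\gamma_M)$ instead of $0$. *)
Lemma excess_drop al p q c : adm al -> 0 < p <= q -> 0 <= c -> (forall r, p < r < q -> F (U al r) <= F gM - c) ->
  q ^ 2 * (E al q - F gM) <= p ^ 2 * (E al p - F gM) - 2 * c * p * (q - p).
Proof.
intros H Hpq Hc HF. pose proof (nu_ge n Hn).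
assert (M : - (D al p - F gM * p ^ 2) - 2 * c * p * p <= - (D al q - F gM * q ^ 2) - 2 * c * p * q).
{ apply (mono_le (fun r => - (D al r - F gM * r ^ 2) - 2 * c * p * r) (fun r => - ((2 * r * F (U al r) - (nu n - 1) * r * V al r ^ 2) - F gM * (2 * r)) - 2 * c * p)); try lra.
  - intros. apply dminus; [apply dopp, dminus; [apply D_derive; auto; lra|eapply dval; [der|cbv beta; simpl; ring]]|apply (dval _ _ (0 * x + 2 * c * p * 1)); [apply (dmult (fun _ => 2 * c * p) (fun r => r)); [apply dconst|apply did]|ring]].
  - intros. apply (continuous_minus (fun r => - (D al r - F gM * r ^ 2)) (fun r => 2 * c * p * r)); [|eapply is_derive_cont; der].
    apply (continuous_opp (fun r => D al r - F gM * r ^ 2)). apply (continuous_minus (D al) (fun r => F gM * r ^ 2)); [apply D_cont; auto; lra|eapply is_derive_cont; der].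
  - intros x Hx. specialize (HF x Hx). pose proof (pow2_ge_0 (V al x)).
    assert (0 <= (nu n - 1) * x * V al x ^ 2) by (apply Rmult_le_pos; [apply Rmult_le_pos; lra|auto]).
    nra. }
unfold scaled_energy in M. lra.
Qed.

(* Along a solution that descends from [b] to [-gM] the excess r^2 (E - F gM) is nonincreasing, hence bounded;
   the strip to the left of [-gM] then costs an amount of it proportional to r. *)
Lemma late_crossing_traps A1 S : b < A1 -> top A1 -> 0 < S -> exists R0, forall al rho, b < al <= A1 -> U al S < b -> R0 < rho ->
  U al rho = - gM -> (forall r, 0 <= r < rho -> - gM < U al r) -> exists r, 0 < r /\ U al r < - gM /\ E al r < F gM.
Proof.
intros HA1 Ht HS. pose proof L_order as Lo. pose proof Hdl as Hdl'. destruct L_b as [Lb1 Lb2]. destruct L_gM as [Lm1 Lm2].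
destruct L_right as (e0 & He0 & Hright). pose (e := Rmin e0 (b - gM)). assert (He : 0 < e) by (unfold e; apply Rmin_glb_lt; lra).
assert (Hee : e <= e0) by apply Rmin_l. assert (Heb : e <= b - gM) by apply Rmin_r.
pose (x1 := gM + e / 3). pose (x2 := gM + 2 * e / 3).
destruct (max_attained F x1 x2 ltac:(unfold x1, x2; lra) ltac:(intros; apply F_cont)) as (xm & Hxm & Hmax).
pose (kap := F gM - F xm). assert (Hkap : 0 < kap). { unfold kap. pose proof (Hright xm). unfold x1, x2 in *. lra. }
destruct (bounded_on F 0 A1 LRA ltac:(intros; apply F_cont)) as (B & HB & hB).
pose (K := 4 * B + 1).
pose (C := S ^ 2 * (2 * B)).
(* [C] bounds the excess at time [S]; crossing a strip of width $e/3$ at speed at most [K] costs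
   $2\kappa r\,e/(3K)$, which exceeds [C] after this time. *)
exists (C * (3 * K) / (2 * kap * e) + S).
intros al rho Hal HUS Hrho Urho Hpos.
assert (Hta : top al) by (apply (top_lt _ A1); auto; lra).
assert (adm al) by (apply adm_out; auto; lra).
assert (0 <= C) by (unfold C; pose proof (pow2_ge_0 S); nra).
assert (S < rho). { assert (0 <= C * (3 * K) / (2 * kap * e)) by (apply Rdiv_le_0_compat; unfold K; nra). lra. }
assert (C * (3 * K) < rho * (2 * kap * e)).
{ assert (Hq : C * (3 * K) / (2 * kap * e) < rho) by lra. apply Rlt_div_l in Hq; nra. }
apply NNPP. intros HN.
assert (HEge : forall r, 0 < r -> U al r < - gM -> F gM <= E al r).
{ intros. apply Rnot_lt_le. intros Hlt. apply HN. exists r. auto. }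
assert (Hub : forall r, 0 <= r -> Rabs (F (U al r)) <= B).
{ intros r Hr. rewrite <- F_abs. apply hB. pose proof (U_bound al r H Hr). pose proof (Rabs_pos (U al r)). lra. }
assert (V al rho <> 0).
{ intros E0. pose proof (crit_nonzero al rho H LRA E0) as Q. rewrite Urho, Hfo, Lm1 in Q. lra. }
assert (F gM < E al rho).
{ unfold orbit_energy, energy. rewrite Urho, F_even. nra. }
(* Until [rho] the energy exceeds $F(\gamma_M)$, the maximum of $F$ on $[-b,b]$, so a turning point
   must lie outside this interval. *)
assert (Hcrit : forall r, 0 < r <= rho -> V al r = 0 -> b < Rabs (U al r)).
{ intros r Hr Hv. apply Rnot_le_lt. intros Hle. pose proof (E_decr al r rho H LRA).
  assert (HE : E al r = F (U al r)) by (unfold orbit_energy, energy; rewrite Hv; lra). rewrite <- F_abs in HE.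
  pose proof (Lb2 (Rabs (U al r)) ltac:(split; [apply Rabs_pos|auto])). lra. }
assert (Hlow : forall s, S <= s <= rho -> U al s < b).
{ intros. apply Rnot_le_lt. intros Hle.
  destruct (max_attained (fun r => - U al r) 0 s LRA) as (m & Hm & Hmm).
  { intros. apply (continuous_opp (U al)). apply U_cont; auto; lra. }
  pose proof (Hmm S LRA) as hS.
  assert (m <> 0). { intros ->. rewrite U_0 in hS by auto. lra. }
  assert (m <> s). { intros ->. lra. }
  assert (- V al m = 0).
  { apply (int_max (fun r => - U al r) 0 s m); [lrn| |exact Hmm]. apply dopp, U_derive; auto. lrn. }
  pose proof (Hcrit m ltac:(lrn) LRA).
  assert (- gM <= U al m). { left. apply Hpos. lrn. }
  assert (Rabs (U al m) <= b) by (apply Rabs_le; lra). lra. }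
assert (rho ^ 2 * (E al rho - F gM) <= C).
{ eapply Rle_trans; [apply (excess_drop al S rho 0); auto; try lra|].
  - intros. rewrite <- F_abs. rewrite Rminus_0_r. apply Lb2. split; [apply Rabs_pos|]. apply Rabs_le.
    pose proof (Hlow r LRA). pose proof (Hpos r LRA). lra.
  - unfold C. pose proof (E_decr al 0 S H LRA) as Q. rewrite E_0 in Q by auto.
    pose proof (hB al LRA) as q1. pose proof (hB gM LRA) as q2. apply Rabs_le_between in q1. apply Rabs_le_between in q2.
     nra. }
assert (Vneg : V al rho < 0).
{ apply Rnot_le_lt. intros Hle. destruct (derive_pos_right (U al) rho (V al rho) (U_derive al rho H LRA) ltac:(lrn)) as (d & Hd & _ & h).
  pose (y := Rmax (rho / 2) (rho - d / 2)). assert (rho / 2 <= y < rho) by (unfold y; split; [apply Rmax_l|apply Rmax_lub_lt; lra]).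
  assert (rho - d / 2 <= y) by apply Rmax_r. specialize (h y LRA). pose proof (Hpos y LRA). lra. }
destruct (derive_neg_right (U al) rho (V al rho) (U_derive al rho H LRA) Vneg) as (d & Hd & hd & _).
(* Beyond $-\gamma_M$ the assumed failure of trapping gives $E\ge F(\gamma_M)$, while
   $F<F(\gamma_M)$ there; so there is no turning point before $-x_2$. *)
assert (Hmon : forall r, rho <= r -> (forall s, rho <= s <= r -> - x2 < U al s) -> V al r < 0).
{ intros r Hr Hst. destruct (Req_dec r rho) as [->|Hne]; auto. apply Rnot_le_lt. intros Hle.
  destruct (max_attained (fun r => - U al r) rho r LRA) as (m & Hm & Hmm).
  { intros. apply (continuous_opp (U al)). apply U_cont; auto; lra. }
  destruct (right_point rho r d) as (y & ? & ?); try lrn. pose proof (hd y LRA). pose proof (Hmm y LRA).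
  assert (m <> rho) by (intros ->; lra).
  assert (Vm0 : V al m = 0).
  { destruct (Req_dec m r) as [->|Hmr].
    - apply Rle_antisym; auto. apply Rnot_lt_le. intros Hlt.
      destruct (derive_pos_right (U al) r (V al r) (U_derive al r H LRA) Hlt) as (d' & Hd' & _ & h).
      destruct (left_point rho r d') as (z & ? & ?); try lrn. specialize (h z LRA). pose proof (Hmm z LRA). lra.
    - assert (- V al m = 0); [|lra]. apply (int_max (fun r => - U al r) rho r m); [lrn| |exact Hmm]. apply dopp, U_derive; auto. lrn. }
  pose proof (Hst m LRA). pose proof (HEge m ltac:(lrn) LRA).
  assert (E al m = F (U al m)) by (unfold orbit_energy, energy; rewrite Vm0; lra).
  pose proof (Hright (- U al m) ltac:(unfold x2 in *; lra)) as Q2. rewrite F_even in Q2. lra. }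
assert (Hreach : exists q, rho < q /\ U al q <= - x2).
{ apply NNPP. intros HNq.
  assert (Hst : forall s, rho <= s -> - x2 < U al s).
  { intros. destruct (Req_dec s rho) as [->|]; [unfold x2; lra|]. apply Rnot_le_lt. intros Hle. apply HNq. exists s. lra. }
  assert (Hdec : forall r s, rho <= r < s -> U al s < U al r).
  { intros. cut (- U al r < - U al s); [lra|]. apply (mono_lt (fun x => - U al x) (fun x => - V al x)); try lra.
    - intros. apply dopp, U_derive; auto; lra.
    - intros. apply (continuous_opp (U al)). apply U_cont; auto; lra.
    - intros. pose proof (Hmon x LRA ltac:(intros; apply Hst; lra)). lra. }
  set (r' := rho + 1). pose proof (Hdec rho r' ltac:(unfold r'; lra)).
  destruct (max_attained F (- U al r') x2 ltac:(pose proof (Hst r' ltac:(unfold r'; lra)); lra) ltac:(intros; apply F_cont)) as (z & Hz & Hzm).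
  pose (ka := F gM - F z). assert (0 < ka). { unfold ka. pose proof (Hright z). unfold x2 in *. lra. }
  assert (Hv : forall r, r' < r -> V al r <= - Rmin 1 ka).
  { intros. pose proof (Hdec r' r ltac:(unfold r' in *; lra)). pose proof (Hst r ltac:(unfold r' in *; lra)).
    pose proof (HEge r ltac:(unfold r' in *; lra) LRA) as Q. pose proof (Hzm (- U al r) LRA) as Q2. rewrite F_even in Q2.
    pose proof (Hmon r ltac:(unfold r' in *; lra) ltac:(intros; apply Hst; lra)).
    unfold orbit_energy, energy in Q.
    assert (ka <= V al r ^ 2 / 2) by (unfold ka; lra). pose proof (Rmin_l 1 ka). pose proof (Rmin_r 1 ka).
     nra. }
  set (v0 := Rmin 1 ka) in *. assert (0 < v0) by (unfold v0; apply Rmin_glb_lt; lra).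
  pose (T := x2 / v0). assert (0 < T) by (apply Rdiv_lt_0_compat; unfold x2; lra).
  destruct (mvt (U al) (V al) r' (r' + T)) as (c & Hc & Ec); try lra.
  { intros. apply U_derive; auto; unfold r' in *; lra. } { intros. apply U_cont; auto; unfold r' in *; lra. }
  pose proof (Hv c LRA). pose proof (Hst (r' + T) ltac:(unfold r' in *; lra)).
  assert (v0 * T = x2) by (unfold T; field; lra). nra. }
destruct Hreach as (q0 & Hq0 & Uq0).
destruct (first_below (U al) rho q0 (- x2)) as (q & Hq & Uq & Hqb); try (unfold x2 in *; lra).
{ intros. apply U_cont; auto; lra. }
destruct (ivt_down (U al) rho q (- x1)) as (p & Hp & Up); try (unfold x1, x2 in *; lra).
{ intros. apply U_cont; auto; lra. }
assert (Hdec : forall r s, rho <= r <= s -> s <= q -> U al s <= U al r).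
{ intros. cut (- U al r <= - U al s); [lra|]. apply (mono_le (fun x => - U al x) (fun x => - V al x)); try lra.
  - intros. apply dopp, U_derive; auto; lra.
  - intros. apply (continuous_opp (U al)). apply U_cont; auto; lra.
  - intros. pose proof (Hmon x LRA ltac:(intros; apply Hqb; lra)). lra. }
assert (p <= q) by lra.
assert (p ^ 2 * (E al p - F gM) <= C).
{ eapply Rle_trans; [apply (excess_drop al rho p 0); auto; try lra|lra].
  intros. rewrite <- F_abs, Rminus_0_r. apply Lb2. split; [apply Rabs_pos|]. apply Rabs_le.
  pose proof (Hdec rho r LRA LRA). pose proof (Hdec r p LRA LRA). unfold x1 in *. lra. }
assert (q ^ 2 * (E al q - F gM) <= C - 2 * kap * p * (q - p)).
{ eapply Rle_trans; [apply (excess_drop al p q kap); auto; try lra|lra].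
  intros. rewrite <- F_even.
  pose proof (Hdec p r LRA LRA). pose proof (Hdec r q LRA LRA).
  pose proof (Hmax (- U al r) LRA). unfold kap. lra. }
assert (0 <= E al q - F gM). { pose proof (HEge q LRA ltac:(unfold x2 in *; lra)). lra. }
assert (e / 3 <= K * (q - p)).
{ replace (e / 3) with (Rabs (U al q - U al p)); [|rewrite Uq, Up, Rabs_left; unfold x1, x2; lra].
  apply (mvt_bound (U al) (V al)); auto.
  - intros. apply U_derive; auto; lra.
  - intros. apply U_cont; auto; lra.
  - intros. pose proof (E_decr al 0 x H LRA) as Q. rewrite E_0 in Q by auto.
    pose proof (hB al LRA) as q1. apply Rabs_le_between in q1. pose proof (Hub x LRA) as q2. apply Rabs_le_between in q2.
    assert (V al x ^ 2 <= 4 * B). { unfold orbit_energy, energy in Q. lra. }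
     apply le_of_sq; [apply Rabs_pos|]. rewrite pow2_abs. auto. }
assert (0 <= q ^ 2 * (E al q - F gM)) by nra.
assert (2 * kap * rho * (e / 3) <= 2 * kap * rho * (K * (q - p))) by (apply Rmult_le_compat_l; nra).
assert (K * (2 * kap * rho * (q - p)) <= K * C) by (apply Rmult_le_compat_l; unfold K; nra).
nra.
Qed.

(** On the right a value slightly above [b] serves, because the solution of [b] is trapped there
    with strict inequalities. On the left, take the supremum of the values whose solutions never
    fall below $-\gamma_M$. Its own solution does not even touch $-\gamma_M$, so for slightly larger
    values the crossing happens arbitrarily late and [late_crossing_traps] applies. *)
Lemma trapped_pair : far_oscillation -> (forall al r, b < al -> top al -> 0 <= r -> U al r <> 0 \/ V al r <> 0) ->
  exists a1 a2 r0, b < a1 < a2 /\ top a2 /\ 0 < r0 /\ gM < U a1 r0 /\ E a1 r0 < F gM /\ U a2 r0 < - gM /\ E a2 r0 < F gM.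
Proof.
intros (_ & A1 & r1 & HA1 & HtA & Hr1 & HU1) Hlive.
pose proof L_order. pose proof Hdl. destruct L_gM as [Lm1 Lm2].
assert (Adm : forall x, b <= x -> top x -> adm x) by (intros; apply adm_out; auto).
assert (Live : forall al r, b <= al -> top al -> 0 <= r -> U al r <> 0 \/ V al r <> 0).
{ intros. destruct (Req_dec b al) as [<-|]; [|apply Hlive; auto; lrn]. left.
  destruct (Req_dec r 0) as [->|]; [rewrite U_0 by auto; lra|]. pose proof (b_right r ltac:(lrn)). lra. }
assert (b <= b <= A1 /\ forall r, 0 <= r -> - gM <= U b r).
{ split; [lra|]. intros. destruct (Req_dec r 0) as [->|]; [rewrite U_0 by (apply Adm; [lra|apply L_btop]); lra|].
  pose proof (b_right r ltac:(lrn)). lra. }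
destruct (sup_seq (fun x => forall r, 0 <= r -> - gM <= U x r) b A1) as (a1 & al & Ha1 & lub & L1 & L2); [exists b; tauto|].
assert (ta1 : top a1) by (apply (top_lt _ A1); auto; lra).
assert (Haa : adm a1) by (apply Adm; auto; lra).
assert (Stay : forall r, 0 <= r -> - gM <= U a1 r).
{ intros. apply (ulim_le (fun _ => - gM) (fun k => U (al k) r)); [apply ulim_const| |apply Uf_all; intros k; apply L2; auto].
  apply (U_cd al a1 A1); auto; try (apply Live; auto; lra); intros k; destruct (L2 k); [apply Adm; [|apply (top_lt _ A1); auto]|]; lra. }
clear al L1 L2.
(* A contact would be a turning point at the equilibrium $-\gamma_M$, which [crit_nonzero]
   excludes. *)
assert (Strict : forall r, 0 <= r -> - gM < U a1 r).
{ intros r Hr. destruct (Req_dec (U a1 r) (- gM)) as [Er|]; [|specialize (Stay r Hr); lrn]. exfalso.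
  assert (r <> 0). { intros ->. rewrite U_0 in Er by auto. lra. }
  assert (- V a1 r = 0).
  { apply (int_max (fun t => - U a1 t) 0 (r + 1) r); [lrn| |].
    - apply dopp, U_derive; auto; lrn.
    - intros. specialize (Stay y LRA). lra. }
  pose proof (crit_nonzero a1 r Haa ltac:(lrn) LRA) as Q. rewrite Er, Hfo, Lm1 in Q. lra. }
assert (a1 < A1). { destruct (Req_dec a1 A1) as [E1|]; [|lrn]. rewrite E1 in Strict. specialize (Strict r1 LRA). lra. }
destruct (falls_below_b a1 Haa LRA ta1) as (S & HS & US).
destruct (late_crossing_traps A1 S HA1 HtA HS) as (R0 & HR0).
destruct (near_seq (fun t => exists r, 0 < r /\ U (a1 + t) r < - gM /\ E (a1 + t) r < F gM) (A1 - a1)) as (e1 & He1 & Hn1); [lra| |].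
{ intros t Ht Lt. pose (al := fun k => a1 + t k).
  assert (Lal : ulim al a1).
  { assert (L : ulim (fun k => a1 + t k) (a1 + 0)) by (apply (ulim_plus (fun _ => a1) t); auto; apply ulim_const).
    rewrite Rplus_0_r in L. exact L. }
  assert (Hal : forall k, b < al k <= A1 /\ a1 < al k) by (intros k; specialize (Ht k); unfold al; lra).
  assert (forall k, top (al k)) by (intros k; specialize (Hal k); apply (top_lt _ A1); auto; lra).
  assert (Had : forall k, adm (al k)) by (intros k; apply Adm; auto; specialize (Hal k); lra).
  assert (Hc : forall k, al k <= A1) by (intros k; specialize (Hal k); lra).
  destruct (choose1 _ _ (fun k rho => 0 < rho /\ U (al k) rho = - gM /\ forall r, 0 <= r < rho -> - gM < U (al k) r)) as [rho Hrho].
  { intros. assert (Hx : exists r, 0 <= r /\ U (al k) r < - gM).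
    { apply NNPP. intros HN. apply (lub (al k)); [specialize (Hal k); lra|].
      intros. apply Rnot_lt_le. intros Hu. apply HN. exists r. auto. }
    destruct Hx as (r & Hr & Hu). destruct (first_below (U (al k)) 0 r (- gM)) as (q & Hq & Uq & Hq2); try lra.
    - intros. apply U_cont; auto; lra.
    - rewrite U_0 by auto. specialize (Hal k). lra.
    - exists q. split; [lra|]. auto. }
  (* Bounded crossing times would have a limit, at which the solution of [a1] equals $-\gamma_M$. *)
  assert (Hlate : Uf (fun k => R0 < rho k)).
  { destruct (Uf_em (fun k => R0 < rho k)) as [|Hn0]; auto. exfalso.
    destruct (ulim_exists rho (Rabs R0)) as [l Hl].
    { apply (Uf_mono _ _ Hn0). intros k hk. destruct (Hrho k) as (h & _). apply Rnot_lt_le in hk. rewrite Rabs_pos_eq by lra. pose proof (Rle_abs R0). lra. }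
    assert (Hl0 : 0 <= l). { apply (ulim_le (fun _ => 0) rho); auto using ulim_const. apply Uf_all. intros. left. apply Hrho. }
    destruct (cont_dep al a1 (U a1) (V a1) A1 rho l) as [L1 _]; auto.
    - apply fam; auto.
    - intros. left. apply Hrho.
    - intros. apply Live; auto; lra.
    - assert (U a1 l = - gM); [|specialize (Strict l Hl0); lra].
      apply (ulim_unique (fun k => U (al k) (rho k))); auto. apply (ulim_ext (fun _ => - gM)); [|apply ulim_const].
      apply Uf_all. intros. symmetry. apply Hrho. }
  destruct (U_cd al a1 A1 S Had Hc Lal Haa LRA ltac:(apply Live; auto; lra)) as [LS _].
  apply (Uf_mono _ _ (Uf_and _ _ Hlate (ulim_lt _ _ b LS US))). intros k [h1 h2].
  destruct (Hrho k) as (q1 & q2 & q3). apply (HR0 (al k) (rho k)); auto. specialize (Hal k). lra. }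
pose (a2 := a1 + e1 / 2). destruct (Hn1 (e1 / 2) LRA) as (r0 & Hr0 & q1 & q2).
assert (top a2) by (apply (top_lt _ A1); auto; unfold a2; lra).
destruct (near_seq (fun t => gM < U (b + t) r0 /\ E (b + t) r0 < F gM) (A1 - b)) as (e2 & He2 & Hn2); [lra| |].
{ intros t Ht Lt. pose (al := fun k => b + t k).
  assert (Lal : ulim al b).
  { assert (L : ulim (fun k => b + t k) (b + 0)) by (apply (ulim_plus (fun _ => b) t); auto; apply ulim_const).
    rewrite Rplus_0_r in L. exact L. }
  assert (Had : forall k, adm (al k)) by (intros k; specialize (Ht k); apply Adm; [|apply (top_lt _ A1); auto]; unfold al; lra).
  assert (Hc : forall k, al k <= A1) by (intros k; specialize (Ht k); unfold al; lra).
  assert (Hb : adm b) by (apply Adm; [lra|apply L_btop]).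
  assert (Lb : U b r0 <> 0 \/ V b r0 <> 0) by (apply Live; [lra|apply L_btop|lra]).
  destruct (b_right r0 Hr0) as [z1 z2].
  destruct (U_cd al b A1 r0 Had Hc Lal Hb LRA Lb) as [L1 _].
  pose proof (E_cd al b A1 r0 Had Hc Lal Hb LRA Lb) as L2.
  apply (Uf_and _ _ (ulim_gt _ _ gM L1 z1) (ulim_lt _ _ _ L2 z2)). }
pose (t := Rmin (e2 / 2) (e1 / 4)). assert (0 < t) by (unfold t; apply Rmin_glb_lt; lra).
assert (t <= e2 / 2) by apply Rmin_l. assert (t <= e1 / 4) by apply Rmin_r.
destruct (Hn2 t LRA).
exists (b + t), a2, r0. unfold a2 in *. repeat split; auto; lra.
Qed.
End Trapping.

(** * Square roots of planar loops *)

Ltac cnt :=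
  lazymatch goal with
  | |- continuous (fun t => @?f t + @?g t) ?x => apply (continuous_plus f g x); cbv beta; cnt
  | |- continuous (fun t => @?f t - @?g t) ?x => apply (continuous_minus f g x); cbv beta; cnt
  | |- continuous (fun t => @?f t * @?g t) ?x => apply (continuous_mult f g x); cbv beta; cnt
  | |- continuous (fun t => - @?f t) ?x => apply (continuous_opp f x); cbv beta; cnt
  | |- continuous (fun t => (@?f t) ^ 2) ?x => apply (continuous_ext (fun t => f t * f t)); [intro; simpl; ring|]; apply (continuous_mult f f x); cbv beta; cnt
  | |- continuous (fun t => t) ?x => apply continuous_id
  | |- continuous (fun _ => ?c) ?x => apply continuous_const
  | |- _ => try (solve [auto])
  end.

Section Root.
Variables s0 s1 : R.
Hypothesis Hs : s0 < s1.

(* A closed continuous square root of the planar loop hx + i hy on [s0, s1]. *)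
Definition root (hx hy : R -> R) := exists X Y : R -> R, (forall s : R, continuous X s) /\ (forall s : R, continuous Y s) /\
  (forall s, X s ^ 2 - Y s ^ 2 = hx s /\ 2 * X s * Y s = hy s) /\ X s1 = X s0 /\ Y s1 = Y s0.

Lemma principal_sqrt a b : 0 < a -> exists c d, c = sqrt ((sqrt (a ^ 2 + b ^ 2) + a) / 2) /\ d = b * / (2 * c) /\
  0 < c /\ c ^ 2 - d ^ 2 = a /\ 2 * c * d = b.
Proof.
intros. set (m := sqrt (a ^ 2 + b ^ 2)). assert (0 <= m) by apply sqrt_pos.
assert (m ^ 2 = a ^ 2 + b ^ 2) by (apply pow2_sqrt; nra).
set (c := sqrt ((m + a) / 2)). assert (0 < c) by (apply sqrt_lt_R0; lra).
assert (Hc2 : c ^ 2 = (m + a) / 2) by (apply pow2_sqrt; lra).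
exists c, (b * / (2 * c)). repeat split; auto.
- replace ((b * / (2 * c)) ^ 2) with (b ^ 2 / (4 * c ^ 2)) by (field; lra). rewrite Hc2.
  replace (b ^ 2) with ((m - a) * (m + a)) by (ring_simplify; lra). field. lra.
- field. lra.
Qed.

(* The quotient of the two loops stays in the right half plane, where the principal square root is continuous. *)
Lemma root_step (hx hy kx ky : R -> R) : (forall s : R, continuous hx s) -> (forall s : R, continuous hy s) ->
  (forall s : R, continuous kx s) -> (forall s : R, continuous ky s) -> (forall s, 0 < hx s * kx s + hy s * ky s) ->
  hx s1 = hx s0 -> hy s1 = hy s0 -> kx s1 = kx s0 -> ky s1 = ky s0 -> root hx hy -> root kx ky.
Proof.
intros Chx Chy Ckx Cky Hd e1 e2 e3 e4 (X & Y & CX & CY & Hr & eX & eY).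
assert (HN : forall s, 0 < hx s ^ 2 + hy s ^ 2).
{ intros. specialize (Hd s). destruct (Req_dec (hx s) 0) as [e|e].
  - rewrite e in *. nra.
  - nra. }
pose (a := fun s => (hx s * kx s + hy s * ky s) * / (hx s ^ 2 + hy s ^ 2)).
pose (b := fun s => (hx s * ky s - hy s * kx s) * / (hx s ^ 2 + hy s ^ 2)).
pose (c := fun s => sqrt ((sqrt (a s ^ 2 + b s ^ 2) + a s) * / 2)).
pose (d := fun s => b s * / (2 * c s)).
assert (Ha : forall s, 0 < a s) by (intros s; apply Rmult_lt_0_compat; [apply Hd|apply Rinv_0_lt_compat, HN]).
assert (HP : forall s, 0 < c s /\ c s ^ 2 - d s ^ 2 = a s /\ 2 * c s * d s = b s).
{ intros. destruct (principal_sqrt (a s) (b s) (Ha s)) as (c' & d' & -> & -> & h). exact h. }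
assert (forall s : R, continuous (fun s => / (hx s ^ 2 + hy s ^ 2)) s).
{ intros. apply (continuous_comp (fun s => hx s ^ 2 + hy s ^ 2) Rinv); [cnt|]. apply (continuous_Rinv (hx s ^ 2 + hy s ^ 2)). specialize (HN s). lra. }
assert (forall s : R, continuous a s) by (intros s; unfold a; cnt).
assert (forall s : R, continuous b s) by (intros s; unfold b; cnt).
assert (forall s : R, continuous c s).
{ intros. apply (continuous_comp (fun s => (sqrt (a s ^ 2 + b s ^ 2) + a s) * / 2) sqrt); [|apply continuous_sqrt].
  cnt. apply (continuous_comp (fun s => a s ^ 2 + b s ^ 2) sqrt); [cnt|apply continuous_sqrt]. }
assert (forall s : R, continuous d s).
{ intros. unfold d. cnt. apply (continuous_comp (fun s => 2 * c s) Rinv); [cnt|]. apply (continuous_Rinv (2 * c s)). destruct (HP s). lra. }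
exists (fun s => X s * c s - Y s * d s), (fun s => X s * d s + Y s * c s).
assert (ea : a s1 = a s0) by (unfold a; rewrite e1, e2, e3, e4; reflexivity).
assert (eb : b s1 = b s0) by (unfold b; rewrite e1, e2, e3, e4; reflexivity).
assert (ec : c s1 = c s0) by (unfold c; rewrite ea, eb; reflexivity).
assert (ed : d s1 = d s0) by (unfold d; rewrite eb, ec; reflexivity).
split; [intros s; cnt|]. split; [intros s; cnt|]. split; [|rewrite eX, eY, ec, ed; auto].
intros. destruct (HP s) as (_ & h1 & h2). destruct (Hr s). specialize (HN s).
assert (hx s * a s - hy s * b s = kx s) by (unfold a, b; field; lra).
assert (hx s * b s + hy s * a s = ky s) by (unfold a, b; field; lra).
nra.
Qed.

(** A root $X+iY$ of $(u+iv)^2$ is $\pm(u+iv)$, so $Xu+Yv$ never vanishes; but it takes opposite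
    values at the ends of an odd arc with a closed root. *)
Lemma odd_no_root (u v : R -> R) : (forall s : R, continuous u s) -> (forall s : R, continuous v s) ->
  (forall s, ~ (u s = 0 /\ v s = 0)) -> u s1 = - u s0 -> v s1 = - v s0 ->
  ~ root (fun s => u s ^ 2 - v s ^ 2) (fun s => 2 * u s * v s).
Proof.
intros Cu Cv Hne eu ev (X & Y & CX & CY & Hr & eX & eY).
pose (p := fun s => X s * u s + Y s * v s).
assert (forall s : R, continuous p s) by (intros s; unfold p; cnt).
assert (Hp : forall s, p s <> 0).
{ intros s Hz. destruct (Hr s) as [r1 r2]. unfold p in Hz. apply (Hne s).
  assert (Hq3 : 2 * ((X s * u s + Y s * v s) ^ 2 - (X s * v s - Y s * u s) ^ 2) = (X s ^ 2 - Y s ^ 2) * (2 * (u s ^ 2 - v s ^ 2)) + (2 * X s * Y s) * (2 * (2 * u s * v s))) by ring.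
  rewrite r1, r2 in Hq3.
   set (B := u s ^ 2 + v s ^ 2) in *.
  assert (Hq4 : (u s ^ 2 - v s ^ 2) * (2 * (u s ^ 2 - v s ^ 2)) + 2 * u s * v s * (2 * (2 * u s * v s)) = 2 * B ^ 2) by (unfold B; ring).
  rewrite Hq4, Hz in Hq3. assert (B = 0) by nra.
  unfold B in *. nra. }
assert (p s1 = - p s0) by (unfold p; rewrite eX, eY, eu, ev; ring).
destruct (Rtotal_order (p s0) 0) as [h|[h|h]]; [|apply (Hp s0 h)|].
- destruct (ivt_up p s0 s1 0) as (x & _ & Ex); auto; try lra. apply (Hp x Ex).
- destruct (ivt_down p s0 s1 0) as (x & _ & Ex); auto; try lra. apply (Hp x Ex).
Qed.

(** If $|\Gamma|<|q|$, then $\Gamma^2-q^2$ stays in the half plane around $-q^2$, which has the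
    constant root $iq$. *)
Lemma far_root (u v : R -> R) a b : (forall s : R, continuous u s) -> (forall s : R, continuous v s) ->
  u s1 = - u s0 -> v s1 = - v s0 -> (forall s, u s ^ 2 + v s ^ 2 < a ^ 2 + b ^ 2) ->
  root (fun s => u s ^ 2 - v s ^ 2 - (a ^ 2 - b ^ 2)) (fun s => 2 * u s * v s - 2 * a * b).
Proof.
intros Cu Cv eu ev Hf.
apply (root_step (fun _ => - (a ^ 2 - b ^ 2)) (fun _ => - (2 * a * b))); try (intros s; cnt).
- specialize (Hf s).
  assert ((u s ^ 2 + v s ^ 2) * (a ^ 2 + b ^ 2) < (a ^ 2 + b ^ 2) * (a ^ 2 + b ^ 2)) by nra.
  assert (0 <= 2 * (u s * b - v s * a) ^ 2) by (pose proof (pow2_ge_0 (u s * b - v s * a)); lra).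
  lra.
- lra.
- lra.
- nra.
- nra.
- exists (fun _ => - b), (fun _ => a). repeat split; try (intros s; apply continuous_const); ring.
Qed.

Definition clip s := Rmax s0 (Rmin s1 s).

Lemma clip_range s : s0 <= clip s <= s1.
Proof. split; [apply Rmax_l|]. apply Rmax_lub; [lra|apply Rmin_l]. Qed.

(** As long as $\Gamma\ne\pm q$, the closed loop $\Gamma^2-q^2$ keeps a positive distance from $0$
    at each time, by compactness. So [root_step] carries a root over a short time in both
    directions, and real induction covers $[t_0,t_1]$. Invariance under [clip] reduces the loop
    parameter to $[s_0,s_1]$. *)
Lemma root_homotopy (u v : R -> R -> R) (a b : R -> R) t0 t1 C M : t0 <= t1 -> 0 <= C -> 0 <= M ->
  (forall t, t0 <= t <= t1 -> forall s : R, continuous (fun s => u s t) s /\ continuous (fun s => v s t) s) ->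
  (forall s t, u (clip s) t = u s t /\ v (clip s) t = v s t) ->
  (forall s t t', t0 <= t <= t1 -> t0 <= t' <= t1 -> Rabs (u s t' - u s t) <= C * Rabs (t' - t) /\ Rabs (v s t' - v s t) <= C * Rabs (t' - t) /\
     Rabs (a t' - a t) <= C * Rabs (t' - t) /\ Rabs (b t' - b t) <= C * Rabs (t' - t)) ->
  (forall s t, t0 <= t <= t1 -> Rabs (u s t) <= M /\ Rabs (v s t) <= M /\ Rabs (a t) <= M /\ Rabs (b t) <= M) ->
  (forall s t, t0 <= t <= t1 -> ~ (u s t = a t /\ v s t = b t) /\ ~ (u s t = - a t /\ v s t = - b t)) ->
  (forall t, t0 <= t <= t1 -> u s1 t = - u s0 t /\ v s1 t = - v s0 t) ->
  (root (fun s => u s t0 ^ 2 - v s t0 ^ 2 - (a t0 ^ 2 - b t0 ^ 2)) (fun s => 2 * u s t0 * v s t0 - 2 * a t0 * b t0) <->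
   root (fun s => u s t1 ^ 2 - v s t1 ^ 2 - (a t1 ^ 2 - b t1 ^ 2)) (fun s => 2 * u s t1 * v s t1 - 2 * a t1 * b t1)).
Proof.
intros Ht HC HM Hc Hcl Hlip Hb Hne Hcd.
pose (hx := fun t s => u s t ^ 2 - v s t ^ 2 - (a t ^ 2 - b t ^ 2)).
pose (hy := fun t s => 2 * u s t * v s t - 2 * a t * b t).
change (root (hx t0) (hy t0) <-> root (hx t1) (hy t1)).
assert (forall t, t0 <= t <= t1 -> forall s : R, continuous (hx t) s).
{ intros t Hrt s. destruct (Hc t Hrt s). unfold hx. cnt. }
assert (forall t, t0 <= t <= t1 -> forall s : R, continuous (hy t) s).
{ intros t Hrt s. destruct (Hc t Hrt s). unfold hy. cnt. }
assert (ehx : forall t, t0 <= t <= t1 -> hx t s1 = hx t s0 /\ hy t s1 = hy t s0).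
{ intros t Hrt. destruct (Hcd t Hrt). unfold hx, hy. nra. }
assert (Hloc : forall t, t0 <= t <= t1 -> exists h, 0 < h /\ forall t', t0 <= t' <= t1 -> Rabs (t' - t) < h ->
   (root (hx t) (hy t) <-> root (hx t') (hy t'))).
{ intros t Hrt.
  destruct (max_attained (fun s => - (hx t s ^ 2 + hy t s ^ 2)) s0 s1 LRA) as (sm & Hsm & Hmax).
  { intros. cnt. }
  pose (m := hx t sm ^ 2 + hy t sm ^ 2).
  assert (0 < m).
  { pose proof (pow2_ge_0 (hx t sm)). pose proof (pow2_ge_0 (hy t sm)). apply Rnot_le_lt. intros Hle. unfold m in Hle.
    assert (z : ((u sm t - a t) ^ 2 + (v sm t - b t) ^ 2) * ((u sm t + a t) ^ 2 + (v sm t + b t) ^ 2) = 0).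
    { replace (((u sm t - a t) ^ 2 + (v sm t - b t) ^ 2) * ((u sm t + a t) ^ 2 + (v sm t + b t) ^ 2)) with (hx t sm ^ 2 + hy t sm ^ 2) by (unfold hx, hy; ring). lra. }
    assert (sq : forall x y, x ^ 2 + y ^ 2 = 0 -> x = 0 /\ y = 0) by (intros x y h; split; nra).
    destruct (Hne sm t Hrt) as [n1 n2]. apply Rmult_integral in z. destruct z as [z|z]; apply sq in z; [apply n1|apply n2]; lra. }
  assert (Hmall : forall s, m <= hx t s ^ 2 + hy t s ^ 2).
  { intros. specialize (Hmax (clip s) (clip_range s)). destruct (Hcl s t).
    unfold m. unfold hx, hy in *. nra. }
  (* [hx] and [hy] are at most $4M^2$ and change by at most $8MC|t'-t|$, so the scalar product
     changes by at most $64M^3C|t'-t|$. *)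
  pose (K := 64 * M ^ 3 * C + 1). assert (0 < K). { unfold K. assert (0 <= M ^ 3) by nra. assert (0 <= M ^ 3 * C) by nra. lra. }
  exists (m / K). split; [apply Rdiv_lt_0_compat; auto|]. intros t' Hrt' Hd.
  assert (Hdot : forall s, 0 < hx t s * hx t' s + hy t s * hy t' s).
  { intros. destruct (Hlip s t t' Hrt Hrt') as (l1 & l2 & l3 & l4). destruct (Hb s t Hrt) as (b1 & b2 & b3 & b4). destruct (Hb s t' Hrt') as (b5 & b6 & b7 & b8).
    set (dt := Rabs (t' - t)) in *. assert (0 <= dt) by apply Rabs_pos.
    assert (prod : forall x y x' y', Rabs x <= M -> Rabs y' <= M -> Rabs (x' - x) <= C * dt -> Rabs (y' - y) <= C * dt -> Rabs (x' * y' - x * y) <= 2 * M * C * dt).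
    { intros. replace (x' * y' - x * y) with ((x' - x) * y' + x * (y' - y)) by ring.
      eapply Rle_trans; [apply Rabs_triang|]. rewrite !Rabs_mult.
      assert (Rabs (x' - x) * Rabs y' <= C * dt * M) by (apply Rmult_le_compat; auto using Rabs_pos).
      assert (Rabs x * Rabs (y' - y) <= M * (C * dt)) by (apply Rmult_le_compat; auto using Rabs_pos). lra. }
    assert (bd : forall x y, Rabs x <= M -> Rabs y <= M -> Rabs (x * y) <= M * M).
    { intros. rewrite Rabs_mult. apply Rmult_le_compat; auto using Rabs_pos. }
    pose proof (prod _ _ _ _ b1 b5 l1 l1) as p1. pose proof (prod _ _ _ _ b2 b6 l2 l2) as p2.
    pose proof (prod _ _ _ _ b3 b7 l3 l3) as p3. pose proof (prod _ _ _ _ b4 b8 l4 l4) as p4.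
    pose proof (prod _ _ _ _ b1 b6 l1 l2) as p5. pose proof (prod _ _ _ _ b3 b8 l3 l4) as p6.
    pose proof (bd _ _ b1 b1) as d1. pose proof (bd _ _ b2 b2) as d2. pose proof (bd _ _ b3 b3) as d3.
    pose proof (bd _ _ b4 b4) as d4. pose proof (bd _ _ b1 b2) as d5. pose proof (bd _ _ b3 b4) as d6.
    apply Rabs_le_between in p1, p2, p3, p4, p5, p6, d1, d2, d3, d4, d5, d6.
    assert (Rabs (hx t' s - hx t s) <= 8 * M * C * dt) by (unfold hx; apply Rabs_le; lra).
    assert (Rabs (hy t' s - hy t s) <= 8 * M * C * dt) by (unfold hy; apply Rabs_le; lra).
    assert (Rabs (hx t s) <= 4 * (M * M)) by (unfold hx; apply Rabs_le; lra).
    assert (Rabs (hy t s) <= 4 * (M * M)) by (unfold hy; apply Rabs_le; lra).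
    assert (T1 : Rabs (hx t s * (hx t' s - hx t s)) <= 4 * (M * M) * (8 * M * C * dt)) by (rewrite Rabs_mult; apply Rmult_le_compat; auto using Rabs_pos).
    assert (T2 : Rabs (hy t s * (hy t' s - hy t s)) <= 4 * (M * M) * (8 * M * C * dt)) by (rewrite Rabs_mult; apply Rmult_le_compat; auto using Rabs_pos).
    apply Rabs_le_between in T1, T2. specialize (Hmall s).
    assert (KD : K * dt < m). { apply Rlt_div_r in Hd; auto. lra. }
    unfold K in KD. lra. }
  destruct (ehx t Hrt). destruct (ehx t' Hrt'). split.
  - apply root_step; auto.
  - apply root_step; auto. intros. specialize (Hdot s). lra. }
apply (forward_induction (fun t => root (hx t0) (hy t0) <-> root (hx t) (hy t)) t0 t1 Ht); try tauto; try lra.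
- intros s Hrs Hall. destruct (Hloc s LRA) as (h & Hh & hh). exists h. split; auto. intros.
  rewrite (Hall s LRA). apply hh; [lra|]. rewrite Rabs_pos_eq; lra.
- intros s Hrs Hall. destruct (Hloc s LRA) as (h & Hh & hh).
  destruct (left_point t0 s h) as (t & ? & ?); try lrn. rewrite (Hall t) by lra. symmetry. apply hh; [lra|]. rewrite Rabs_left; lra.
Qed.
End Root.

(** * Area and lattice counting *)

Lemma NoDup_product (A B : Type) (l : list A) (l' : list B) : NoDup l -> NoDup l' -> NoDup (list_prod l l').
Proof.
intros. induction H as [|x l Hx Hl IH]; simpl; [constructor|].
apply NoDup_app; auto.
- apply Injective_map_NoDup; auto. intros. congruence.
- intros [y z] h1 h2. apply in_map_iff in h1. destruct h1 as (w & e & _). apply in_prod_iff in h2. destruct h2. injection e as -> _. auto.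
Qed.

Lemma integers_between a b : a <= b -> exists l : list Z, NoDup l /\ (forall z, In z l <-> a <= IZR z <= b) /\
  b - a - 1 <= INR (length l) <= b - a + 1.
Proof.
intros Hab. set (lo := (- Int_part (- a))%Z). set (hi := Int_part b).
destruct (base_Int_part (- a)) as [a1 a2]. destruct (base_Int_part b) as [b1 b2].
assert (La : a <= IZR lo < a + 1) by (unfold lo; rewrite opp_IZR; lra). fold hi in b1, b2.
assert ((0 <= hi - lo + 1)%Z).
{ assert (H : (-1 < hi - lo + 1)%Z); [|lia]. apply lt_IZR. rewrite plus_IZR, minus_IZR. lra. }
exists (map (fun k => (lo + Z.of_nat k)%Z) (seq 0 (Z.to_nat (hi - lo + 1)))). split; [|split].
- apply Injective_map_NoDup; [intros x y e; lia|apply seq_NoDup].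
- intros. rewrite in_map_iff. split.
  + intros (k & <- & Hk). apply in_seq in Hk. assert (H1 : (lo <= lo + Z.of_nat k <= hi)%Z) by lia.
    destruct H1 as [H1 H2]. apply IZR_le in H1, H2. lra.
  + intros [H1 H2]. exists (Z.to_nat (z - lo)).
    assert (lo <= z)%Z. { assert (lo - 1 < z)%Z; [|lia]. apply lt_IZR. rewrite minus_IZR. lra. }
    assert (z <= hi)%Z. { assert (z < hi + 1)%Z; [|lia]. apply lt_IZR. rewrite plus_IZR. lra. }
    split; [lia|]. apply in_seq. lia.
- rewrite length_map, length_seq, INR_IZR_INZ, Z2Nat.id by auto. rewrite plus_IZR, minus_IZR. lra.
Qed.

Section Lattice.
Variables (al be PA PB g : R -> R) (r0 r1 G L M c1 c2 y0 a b : R).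
Hypothesis Hr : r0 < r1.
Hypothesis HG : 0 < G.
Hypothesis HL0 : 0 <= L.
Hypothesis HM : 0 <= M.
Hypothesis Ha : 0 <= a.
Hypothesis Hb : 0 <= b.
Hypothesis HA : forall s, r0 <= s <= r1 -> is_derive PA s (al s) /\ 0 <= al s <= G.
Hypothesis HB : forall s, r0 <= s <= r1 -> is_derive PB s (be s) /\ 0 <= be s <= G.
Hypothesis HL : forall x y, Rabs (g x - g y) <= L * Rabs (x - y).
Hypothesis Hg0 : g 0 = 0.
Hypothesis Hc : c1 < c2.
Hypothesis Hy0 : 0 < y0.
(** With $p=r^nu'$ the radial equation has this form for $r^{-n}$ and $r^n$ in place of [al] and
    [be]. The flow is prescribed at its end [r1], since it is followed backwards. *)
Definition hamiltonian_flow u p x y := u r1 = x /\ p r1 = y /\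
  (forall s, r0 <= s <= r1 -> is_derive u s (al s * p s) /\ is_derive p s (- (be s * g (u s))) /\ Rabs (u s) <= M /\ Rabs (p s) <= M).
Hypothesis Hsol : forall x y, c1 <= x <= c2 -> 0 <= y <= y0 -> exists u p, hamiltonian_flow u p x y /\ Rabs (u r0) <= a /\ Rabs (p r0) <= b.

Section Scheme.
Variable m : nat.
Hypothesis Hm : (0 < m)%nat.
Let h := (r1 - r0) / INR m.
(** With mesh $h^2$ rounding costs $h^2$ per step, the order of the local error of the scheme, and
    the total error remains $O(h)$. *)
Let eta := h ^ 2.
Let rk (k : nat) := r1 - INR k * h.
Let tau k := PA (rk k) - PA (rk (S k)).
Let sig k := PB (rk k) - PB (rk (S k)).

(* A backward symplectic Euler step rounded to the lattice: each half step is a shear, so the rounded map stays injective. *)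
Definition lattice_step k (z : Z * Z) : Z * Z :=
  let i := (fst z - up (tau k * IZR (snd z)))%Z in (i, (snd z + up (sig k * g (IZR i * eta) / eta))%Z).
Fixpoint lattice_run k z := match k with O => z | S j => lattice_step j (lattice_run j z) end.

Lemma lattice_step_inj k : Injective (lattice_step k).
Proof.
intros [i j] [i' j'] e.
injection e as e1 e2. rewrite e1 in e2. assert (j = j') by lia. subst j'. f_equal. lia.
Qed.

Lemma lattice_run_inj k : Injective (lattice_run k).
Proof. induction k as [|k IH]; intros x y e; simpl in e; auto. apply IH, (lattice_step_inj k), e. Qed.

Let Q := G * (1 + L).
Let C1 := G * G * L * M.
Hypothesis HQh : Q * h <= 1.

Lemma INR_m : 0 < INR m. Proof. apply (lt_INR 0), Hm. Qed.
Lemma h_pos : 0 < h. Proof. pose proof INR_m. apply Rdiv_lt_0_compat; lra. Qed.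

Lemma rk_range k : (k <= m)%nat -> r0 <= rk k <= r1.
Proof.
intros Hk. pose proof INR_m. apply le_INR in Hk. pose proof (pos_INR k). unfold rk.
assert (INR m * h = r1 - r0) by (unfold h; field; lra). nra.
Qed.

Lemma up_err x : Rabs (IZR (up x) - x) <= 1.
Proof. destruct (archimed x). apply Rabs_le. lra. Qed.

(** The local errors come from freezing one variable during a half step and from rounding, and are
    $O(h^2)$; a step amplifies the accumulated error by at most $1+2Qh\le e^{2Qh}$. *)
Lemma scheme_error u p i j : hamiltonian_flow u p (IZR i * eta) (IZR j * eta) -> forall k, (k <= m)%nat ->
  Rabs (IZR (fst (lattice_run k (i, j))) * eta - u (rk k)) + Rabs (IZR (snd (lattice_run k (i, j))) * eta - p (rk k))
  <= 3 * (1 + C1) * h * (INR k * h) * exp (2 * Q * (INR k * h)).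
Proof.
intros (H1 & H2 & Hs). pose proof h_pos.
assert (0 <= C1) by (unfold C1; repeat apply Rmult_le_pos; lra).
assert (0 < Q) by (unfold Q; apply Rmult_lt_0_compat; lra).
assert (0 < eta) by (unfold eta; apply pow_lt; auto).
assert (Cu : forall s, r0 <= s <= r1 -> continuous u s /\ continuous p s).
{ intros s h'. destruct (Hs s h') as (d1 & d2 & _). split; eapply is_derive_cont; eauto. }
assert (gb : forall x, Rabs (g x) <= L * Rabs x). { intros. pose proof (HL x 0) as z. rewrite Hg0, !Rminus_0_r in z. auto. }
induction k as [|k IH]; intros Hk.
- simpl. replace (rk 0) with r1 by (unfold rk; simpl; ring). rewrite H1, H2, !Rminus_diag, Rabs_R0. lra.
- specialize (IH ltac:(lia)). simpl lattice_run. set (z := lattice_run k (i, j)) in *. destruct z as [i0 j0]. simpl fst in *. simpl snd in *.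
  pose proof (rk_range k ltac:(lia)). pose proof (rk_range (S k) Hk).
  set (r := rk k) in *. set (r' := rk (S k)) in *.
  assert (Er : r - r' = h). { unfold r, r', rk. rewrite S_INR. ring. }
  assert (r' <= r) by lra.
  assert (Bu : forall s t, r' <= s <= t -> t <= r -> Rabs (u t - u s) <= G * M * (t - s) /\ Rabs (p t - p s) <= G * L * M * (t - s)).
  { intros. split.
    - apply (mvt_bound u (fun s => al s * p s)); try lra.
      + intros. apply Hs. lra.
      + intros. apply Cu. lra.
      + intros. destruct (HA x LRA). destruct (Hs x LRA) as (_ & _ & _ & q2).
        rewrite Rabs_mult, (Rabs_pos_eq (al x)) by lra. nra.
    - apply (mvt_bound p (fun s => - (be s * g (u s)))); try lra.
      + intros. apply Hs. lra.
      + intros. apply Cu. lra.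
      + intros. destruct (HB x LRA). destruct (Hs x LRA) as (_ & _ & q2 & _).
        rewrite Rabs_Ropp, Rabs_mult, (Rabs_pos_eq (be x)), Rmult_assoc by lra. apply Rmult_le_compat; auto using Rabs_pos; try lra.
        eapply Rle_trans; [apply gb|]. nra. }
  assert (T1 : Rabs (u r' - u r + tau k * p r) <= C1 * h ^ 2).
  { replace (u r' - u r + tau k * p r) with (- ((u r - PA r * p r) - (u r' - PA r' * p r))) by (unfold tau; fold r r'; ring). rewrite Rabs_Ropp.
    eapply Rle_trans; [apply (mvt_bound (fun s => u s - PA s * p r) (fun s => al s * p s - al s * p r) r' r (C1 * h)); auto|].
    - intros. apply dminus; [apply Hs; lra|]. apply (dval _ _ (al x * p r + PA x * 0)); [|ring].
      apply (dmult PA (fun _ => p r)); [apply HA; lra|apply dconst].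
    - intros. apply (continuous_minus u (fun s => PA s * p r)); [apply Cu; lra|].
      apply (continuous_mult PA (fun _ => p r)); [|apply continuous_const]. eapply is_derive_cont. apply HA. lra.
    - intros. destruct (HA x LRA). destruct (Bu x r LRA LRA) as [_ q2].
      replace (al x * p x - al x * p r) with (- (al x * (p r - p x))) by ring. rewrite Rabs_Ropp, Rabs_mult, (Rabs_pos_eq (al x)) by lra.
      replace (C1 * h) with (G * (G * L * M * h)) by (unfold C1; ring). apply Rmult_le_compat; auto using Rabs_pos; try lra.
      eapply Rle_trans; [exact q2|]. apply Rmult_le_compat_l; [repeat apply Rmult_le_pos; lra|lra].
    - nra. }
  assert (T2 : Rabs (p r' - p r - sig k * g (u r')) <= C1 * h ^ 2).
  { replace (p r' - p r - sig k * g (u r')) with (- ((p r + PB r * g (u r')) - (p r' + PB r' * g (u r')))) by (unfold sig; fold r r'; ring). rewrite Rabs_Ropp.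
    eapply Rle_trans; [apply (mvt_bound (fun s => p s + PB s * g (u r')) (fun s => - (be s * g (u s)) + be s * g (u r')) r' r (C1 * h)); auto|].
    - intros. apply dplus; [apply Hs; lra|]. apply (dval _ _ (be x * g (u r') + PB x * 0)); [|ring].
      apply (dmult PB (fun _ => g (u r'))); [apply HB; lra|apply dconst].
    - intros. apply (continuous_plus p (fun s => PB s * g (u r'))); [apply Cu; lra|].
      apply (continuous_mult PB (fun _ => g (u r'))); [|apply continuous_const]. eapply is_derive_cont. apply HB. lra.
    - intros. destruct (HB x LRA). destruct (Bu r' x LRA LRA) as [q2 _].
      replace (- (be x * g (u x)) + be x * g (u r')) with (- (be x * (g (u x) - g (u r')))) by ring. rewrite Rabs_Ropp, Rabs_mult, (Rabs_pos_eq (be x)) by lra.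
      replace (C1 * h) with (G * (L * (G * M * h))) by (unfold C1; ring). apply Rmult_le_compat; auto using Rabs_pos; try lra.
      eapply Rle_trans; [apply HL|]. apply Rmult_le_compat_l; auto. eapply Rle_trans; [exact q2|]. apply Rmult_le_compat_l; [apply Rmult_le_pos; lra|lra].
    - nra. }
  assert (incr : forall PX x', (forall s, r0 <= s <= r1 -> is_derive PX s (x' s) /\ 0 <= x' s <= G) -> 0 <= PX r - PX r' <= G * h).
  { intros PX x' HX. split.
    - cut (PX r' <= PX r); [lra|]. apply (mono_le PX x'); auto.
      + intros. apply HX. lra. + intros. eapply is_derive_cont. apply HX. lra. + intros. apply HX. lra.
    - rewrite <- Er. eapply Rle_trans; [apply Rle_abs|]. apply (mvt_bound PX x'); auto.
      + intros. apply HX. lra. + intros. eapply is_derive_cont. apply HX. lra.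
      + intros s h1. destruct (HX s LRA). rewrite Rabs_pos_eq; lra. }
  assert (0 <= tau k <= G * h) by (apply (incr PA al); auto).
  assert (0 <= sig k <= G * h) by (apply (incr PB be); auto).
  set (i1 := (i0 - up (tau k * IZR j0))%Z).
  set (j1 := (j0 + up (sig k * g (IZR i1 * eta) / eta))%Z).
  set (eu := Rabs (IZR i0 * eta - u r)) in *. set (ep := Rabs (IZR j0 * eta - p r)) in *.
  set (eu' := Rabs (IZR i1 * eta - u r')). set (ep' := Rabs (IZR j1 * eta - p r')).
  assert (0 <= eu) by apply Rabs_pos. assert (0 <= ep) by apply Rabs_pos.
  assert (G * h <= Q * h). { apply Rmult_le_compat_r; [lra|]. unfold Q. nra. }
  assert (G * h * L <= Q * h). { replace (G * h * L) with (G * L * h) by ring. apply Rmult_le_compat_r; [lra|]. unfold Q. nra. }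
  assert (eu' <= eu + Q * h * ep + (1 + C1) * h ^ 2).
  { unfold eu', i1. rewrite minus_IZR.
    replace ((IZR i0 - IZR (up (tau k * IZR j0))) * eta - u r') with
      ((IZR i0 * eta - u r) - tau k * (IZR j0 * eta - p r) - (IZR (up (tau k * IZR j0)) - tau k * IZR j0) * eta - (u r' - u r + tau k * p r)) by ring.
    assert (X1 : Rabs ((IZR (up (tau k * IZR j0)) - tau k * IZR j0) * eta) <= 1 * h ^ 2).
    { rewrite Rabs_mult, (Rabs_pos_eq eta) by lra. apply Rmult_le_compat_r; [apply pow2_ge_0|apply up_err]. }
    assert (X2 : Rabs (tau k * (IZR j0 * eta - p r)) <= Q * h * ep).
    { rewrite Rabs_mult, Rabs_pos_eq by lra. apply Rmult_le_compat_r; auto. lra. }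
    assert (X3 : Rabs (IZR i0 * eta - u r) <= eu) by apply Rle_refl.
    apply Rabs_le_between in X1, X2, X3, T1. apply Rabs_le. lra. }
  assert (ep' <= ep + Q * h * eu' + (1 + C1) * h ^ 2).
  { unfold ep', j1. rewrite plus_IZR. set (w := sig k * g (IZR i1 * eta)).
    replace ((IZR j0 + IZR (up (w / eta))) * eta - p r') with
      ((IZR j0 * eta - p r) + sig k * (g (IZR i1 * eta) - g (u r')) + (IZR (up (w / eta)) - w / eta) * eta - (p r' - p r - sig k * g (u r'))) by (unfold w; field; lra).
    assert (X1 : Rabs ((IZR (up (w / eta)) - w / eta) * eta) <= 1 * h ^ 2).
    { rewrite Rabs_mult, (Rabs_pos_eq eta) by lra. apply Rmult_le_compat_r; [apply pow2_ge_0|apply up_err]. }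
    assert (X2 : Rabs (sig k * (g (IZR i1 * eta) - g (u r'))) <= Q * h * eu').
    { rewrite Rabs_mult, Rabs_pos_eq by lra. eapply Rle_trans; [apply Rmult_le_compat_l; [lra|apply HL]|]. rewrite <- Rmult_assoc.
      apply Rmult_le_compat_r; [apply Rabs_pos|]. nra. }
    assert (X3 : Rabs (IZR j0 * eta - p r) <= ep) by apply Rle_refl.
    apply Rabs_le_between in X1, X2, X3, T2. apply Rabs_le. lra. }
  set (q := Q * h) in *.
  assert (S3 : eu' + ep' <= (1 + 2 * q) * (eu + ep) + 3 * (1 + C1) * h ^ 2).
  { assert (0 <= (1 + C1) * h ^ 2) by nra.
    assert (q * (q * ep) <= q * ep) by (apply Rmult_le_compat_l; nra).
     nra. }
  eapply Rle_trans; [exact S3|]. rewrite S_INR.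
  replace (2 * Q * ((INR k + 1) * h)) with (2 * q + 2 * Q * (INR k * h)) by (unfold q; ring). rewrite exp_plus.
  set (X := exp (2 * Q * (INR k * h))) in *.
  assert (1 <= X). { pose proof (exp_ineq1_le (2 * Q * (INR k * h))). pose proof (pos_INR k). assert (0 <= 2 * Q * (INR k * h)) by (apply Rmult_le_pos; [lra|apply Rmult_le_pos; lra]). unfold X. lra. }
  assert (1 + 2 * q <= exp (2 * q)) by apply exp_ineq1_le.
  set (c := 3 * (1 + C1)) in *. assert (0 < c) by (unfold c; lra).
  assert ((1 + 2 * q) * (eu + ep) <= exp (2 * q) * (c * h * (INR k * h) * X)) by nra.
  assert (c * h ^ 2 * 1 <= c * h ^ 2 * (exp (2 * q) * X)).
  { apply Rmult_le_compat_l; [apply Rmult_le_pos; [lra|apply pow2_ge_0]|]. nra. }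
  lra.
Qed.

(** The rounded flow maps the lattice points of the first box injectively into those of the second
    one, enlarged by $1$; the numbers of points times $h^4$ approximate the areas. *)
Lemma lattice_count : h <= (c2 - c1) / 4 -> h <= y0 / 4 -> h <= 1 -> 3 * (1 + C1) * h * (r1 - r0) * exp (2 * Q * (r1 - r0)) <= 1 ->
  (c2 - c1) / 2 * y0 <= (2 * a + 3) * (2 * b + 3).
Proof.
intros. pose proof h_pos. pose proof INR_m.
assert (0 < eta <= h) by (unfold eta; simpl; nra).
assert (Emh : INR m * h = r1 - r0) by (unfold h; field; lra).
assert (Erm : rk m = r0) by (unfold rk; rewrite Emh; ring).
assert (cnv : forall x y z, x / eta <= z <= y / eta <-> x <= z * eta <= y).
{ intros. split; intros [w1 w2]; split.
  - apply Rle_div_l in w1; lra. - apply Rle_div_r in w2; lra. - apply Rle_div_l; lra. - apply Rle_div_r; lra. }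
assert (mn : forall x y, x <= y -> x / eta <= y / eta).
{ intros. apply Rmult_le_compat_r; auto. left. apply Rinv_0_lt_compat. lra. }
destruct (integers_between (c1 / eta) (c2 / eta)) as (l1 & N1 & I1 & [L1 _]); [apply mn; lra|].
destruct (integers_between (0 / eta) (y0 / eta)) as (l2 & N2 & I2 & [L2 _]); [apply mn; lra|].
destruct (integers_between (- (a + 1) / eta) ((a + 1) / eta)) as (l3 & N3 & I3 & [_ L3]); [apply mn; lra|].
destruct (integers_between (- (b + 1) / eta) ((b + 1) / eta)) as (l4 & N4 & I4 & [_ L4]); [apply mn; lra|].
assert (Hincl : incl (map (lattice_run m) (list_prod l1 l2)) (list_prod l3 l4)).
{ intros z Hz. apply in_map_iff in Hz. destruct Hz as ([i j] & <- & Hz). apply in_prod_iff in Hz. destruct Hz as [z1 z2].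
  apply I1, cnv in z1. apply I2, cnv in z2.
  destruct (Hsol (IZR i * eta) (IZR j * eta) z1 z2) as (u & p & Hf & q1 & q2).
  pose proof (scheme_error u p i j Hf m (Nat.le_refl m)) as Er. rewrite Erm, Emh in Er.
  destruct (lattice_run m (i, j)) as [i' j']. simpl fst in Er. simpl snd in Er.
  pose proof (Rabs_pos (IZR i' * eta - u r0)). pose proof (Rabs_pos (IZR j' * eta - p r0)).
  assert (w1 : Rabs (IZR i' * eta - u r0) <= 1) by lra. assert (w2 : Rabs (IZR j' * eta - p r0) <= 1) by lra.
  apply Rabs_le_between in w1, w2, q1, q2. apply in_prod_iff. split; [apply I3, cnv|apply I4, cnv]; lra. }
assert (Hlen := NoDup_incl_length (Injective_map_NoDup (lattice_run_inj m) (NoDup_product _ _ _ _ N1 N2)) Hincl).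
rewrite length_map, !length_prod in Hlen. apply le_INR in Hlen. rewrite !mult_INR in Hlen.
set (n1 := INR (length l1)) in *. set (n2 := INR (length l2)) in *. set (n3 := INR (length l3)) in *. set (n4 := INR (length l4)) in *.
assert (c2 - c1 - eta <= n1 * eta). { apply (Rmult_le_compat_r eta) in L1; [|lra]. replace ((c2 / eta - c1 / eta - 1) * eta) with (c2 - c1 - eta) in L1 by (field; lra). auto. }
assert (y0 - eta <= n2 * eta). { apply (Rmult_le_compat_r eta) in L2; [|lra]. replace ((y0 / eta - 0 / eta - 1) * eta) with (y0 - eta) in L2 by (field; lra). auto. }
assert (n3 * eta <= 2 * a + 3). { apply (Rmult_le_compat_r eta) in L3; [|lra]. replace (((a + 1) / eta - - (a + 1) / eta + 1) * eta) with (2 * a + 2 + eta) in L3 by (field; lra). lra. }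
assert (n4 * eta <= 2 * b + 3). { apply (Rmult_le_compat_r eta) in L4; [|lra]. replace (((b + 1) / eta - - (b + 1) / eta + 1) * eta) with (2 * b + 2 + eta) in L4 by (field; lra). lra. }
assert (0 <= n3) by apply pos_INR. assert (0 <= n4) by apply pos_INR.
assert (n3 * eta * (n4 * eta) <= (2 * a + 3) * (2 * b + 3)) by (apply Rmult_le_compat; try lra; apply Rmult_le_pos; lra).
nra.
Qed.
End Scheme.

(* The flow preserves area in the coordinates (u, p), so a large box cannot be carried into a small one. *)
Lemma area_bound : (c2 - c1) / 2 * y0 <= (2 * a + 3) * (2 * b + 3).
Proof.
set (Q := G * (1 + L)). set (C1 := G * G * L * M). set (c := 3 * (1 + C1) * (r1 - r0) * exp (2 * Q * (r1 - r0))).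
assert (0 < Q) by (unfold Q; apply Rmult_lt_0_compat; lra).
assert (0 <= C1) by (unfold C1; repeat apply Rmult_le_pos; lra).
assert (0 < c) by (unfold c; repeat apply Rmult_lt_0_compat; try lra; apply exp_pos).
set (h0 := Rmin (Rmin (/ Q) (/ c)) (Rmin 1 (Rmin ((c2 - c1) / 4) (y0 / 4)))).
assert (Hh0 : 0 < h0). { repeat apply Rmin_glb_lt; try lra; apply Rinv_0_lt_compat; auto. }
assert (h0 <= / Q /\ h0 <= / c /\ h0 <= 1 /\ h0 <= (c2 - c1) / 4 /\ h0 <= y0 / 4).
{ repeat split.
  - eapply Rle_trans; [apply Rmin_l|apply Rmin_l].
  - eapply Rle_trans; [apply Rmin_l|apply Rmin_r].
  - eapply Rle_trans; [apply Rmin_r|apply Rmin_l].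
  - eapply Rle_trans; [apply Rmin_r|]. eapply Rle_trans; [apply Rmin_r|apply Rmin_l].
  - eapply Rle_trans; [apply Rmin_r|]. eapply Rle_trans; [apply Rmin_r|apply Rmin_r]. }
destruct (INR_archimed h0 (r1 - r0) Hh0) as [m Hm].
assert (Hm0 : (0 < m)%nat). { destruct m; [simpl in Hm; lra|lia]. }
assert (0 < INR m) by nra.
assert ((r1 - r0) / INR m <= h0) by (apply Rle_div_l; lra).
apply (lattice_count m Hm0); try lra; fold Q C1.
- apply Rle_trans with (Q * / Q); [apply Rmult_le_compat_l; lra|right; field; lra].
- apply Rle_trans with (c * / c); [|right; field; lra].
  replace (3 * (1 + C1) * ((r1 - r0) / INR m) * (r1 - r0) * exp (2 * Q * (r1 - r0))) with (c * ((r1 - r0) / INR m)) by (unfold c; ring).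
  nra.
Qed.
End Lattice.

(** * Odd loops meet the lobe *)

Section Crossing.
Variables (n : nat) (g : R -> R) (L R0 : R).
Hypothesis Hn : (1 <= n)%nat.
Hypothesis HR0 : 0 < R0.
Hypothesis HL0 : 0 <= L.
Hypothesis HL : forall x y, Rabs (g x - g y) <= L * Rabs (x - y).
Hypothesis Hgo : forall x, g (- x) = - g x.

(* The damping coefficient is frozen before R0, so that the flow is defined for all times. *)
Definition gsol (u v : R -> R) := forall r : R, is_derive u r (v r) /\ is_derive v r (- (nu n / Rmax r R0) * v r - g (u r)).

Lemma g_0 : g 0 = 0.
Proof. pose proof (Hgo 0). rewrite Ropp_0 in H. lra. Qed.

Lemma coef_bound r : 0 <= nu n / Rmax r R0 <= nu n / R0.
Proof.
pose proof (Rmax_r r R0). pose proof (nu_ge n Hn). split; [apply Rdiv_le_0_compat; lra|].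
 apply Rmult_le_compat_l; [lra|]. apply Rinv_le_contravar; lra.
Qed.

Lemma gsol_exists t x y : exists u v, gsol u v /\ u t = x /\ v t = y.
Proof.
destruct (picard (fun r => nu n / Rmax r R0) g (nu n / R0) L) with (r0 := t) (u0 := x) (v0 := y) as (u & v & h1 & h2 & h3); auto.
- intros. apply (continuous_mult (fun _ => nu n) (fun r => / Rmax r R0)); [apply continuous_const|].
  apply (continuous_comp (fun r => Rmax r R0) Rinv).
  + apply (Lipschitz_continuous _ 1). intros. mm.
  + apply (continuous_Rinv (Rmax r R0)). pose proof (Rmax_r r R0). lra.
- intros. pose proof (coef_bound r). rewrite Rabs_pos_eq; lra.
- exists u, v. auto.
Qed.

Lemma gsol_opp u v : gsol u v -> gsol (fun r => - u r) (fun r => - v r).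
Proof.
intros H r. destruct (H r) as [h1 h2]. split; [apply dopp; auto|]. eapply dval; [apply dopp, h2|]. rewrite Hgo. ring.
Qed.

Lemma gsol_const x : g x = 0 -> gsol (fun _ => x) (fun _ => 0).
Proof. intros. split; [apply dconst|]. eapply dval; [apply dconst|]. lra. Qed.

Lemma gsol_cont u v r : gsol u v -> continuous u r /\ continuous v r.
Proof. intros. destruct (H r). split; eapply is_derive_cont; eauto. Qed.

Definition Kg := 1 + 2 * (nu n / R0) + L.

Lemma gsol_dist u v u' v' s t : gsol u v -> gsol u' v' ->
  (u t - u' t) ^ 2 + (v t - v' t) ^ 2 <= ((u s - u' s) ^ 2 + (v s - v' s) ^ 2) * exp (Kg * Rabs (t - s)).
Proof.
intros H H'.
pose (dD := fun r => 2 * (u r - u' r) * (v r - v' r) + 2 * (v r - v' r) * (- (nu n / Rmax r R0) * (v r - v' r) - (g (u r) - g (u' r)))).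
assert (forall r : R, is_derive (fun r => (u r - u' r) ^ 2 + (v r - v' r) ^ 2) r (dD r)).
{ intros. destruct (H r). destruct (H' r). eapply dval; [der|]. unfold dD. simpl. ring. }
assert (HK : forall r, Rabs (dD r) <= Kg * ((u r - u' r) ^ 2 + (v r - v' r) ^ 2)).
{ intros. set (x := u r - u' r). set (y := v r - v' r). pose proof (coef_bound r). set (al := nu n / Rmax r R0) in *.
  pose proof (HL (u r) (u' r)). unfold dD. fold x y al. set (d := g (u r) - g (u' r)) in *.
  assert (T1 : Rabs (2 * x * y) <= x ^ 2 + y ^ 2).
  { pose proof (pow2_ge_0 (x - y)). pose proof (pow2_ge_0 (x + y)). apply Rabs_le. nra. }
  assert (T2 : Rabs (2 * y * d) <= L * (x ^ 2 + y ^ 2)).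
  { rewrite Rabs_mult. apply Rle_trans with (Rabs (2 * y) * (L * Rabs x)); [apply Rmult_le_compat_l; auto; apply Rabs_pos|].
    replace (Rabs (2 * y) * (L * Rabs x)) with (L * Rabs (2 * x * y)) by (rewrite !Rabs_mult; ring). nra. }
  assert (0 <= 2 * al * y ^ 2 <= 2 * (nu n / R0) * (x ^ 2 + y ^ 2)) by nra.
  apply Rabs_le_between in T1, T2. replace (2 * x * y + 2 * y * (- al * y - d)) with (2 * x * y - 2 * al * y ^ 2 - 2 * y * d) by ring.
  unfold Kg. apply Rabs_le. lra. }
destruct (Rle_lt_dec s t) as [l|l].
- rewrite (Rabs_pos_eq (t - s)) by lra. apply (gronwall (fun r => (u r - u' r) ^ 2 + (v r - v' r) ^ 2) dD Kg s t l); auto.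
  + intros. eapply is_derive_cont. auto.
  + intros. specialize (HK x). apply Rabs_le_between in HK. lra.
- rewrite (Rabs_left (t - s)) by lra. replace (- (t - s)) with (s - t) by ring.
  apply (gronwall_rev (fun r => (u r - u' r) ^ 2 + (v r - v' r) ^ 2) dD Kg t s); auto; try lra.
  + intros. eapply is_derive_cont. auto.
  + intros. specialize (HK x). apply Rabs_le_between in HK. lra.
Qed.

Lemma gsol_uniq u v u' v' s t : gsol u v -> gsol u' v' -> u s = u' s -> v s = v' s -> u t = u' t /\ v t = v' t.
Proof.
intros H H' e1 e2. pose proof (gsol_dist u v u' v' s t H H') as Q. rewrite e1, e2, !Rminus_diag in Q.
replace (0 ^ 2 + 0 ^ 2) with 0 in Q by ring. rewrite Rmult_0_l in Q.
pose proof (pow2_ge_0 (u t - u' t)). pose proof (pow2_ge_0 (v t - v' t)).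
  nra.
Qed.

Variable Z : R.
Hypothesis HZ : R0 < Z.

Lemma gsol_bound : exists C, 0 < C /\ forall u v s t N, gsol u v -> R0 <= s <= Z -> R0 <= t <= Z -> 0 <= N -> Rabs (u s) <= N -> Rabs (v s) <= N ->
  Rabs (u t) <= C * N /\ Rabs (v t) <= C * N.
Proof.
set (X := exp (Kg * (Z - R0))). assert (HX : 0 < X) by apply exp_pos.
assert (HK : 0 <= Kg). { unfold Kg. pose proof (coef_bound 0). lra. }
exists (2 * X + 1). split; [lra|]. intros.
pose proof (gsol_dist u v _ _ s t H (gsol_const 0 g_0)) as Q. rewrite !Rminus_0_r in Q.
assert (exp (Kg * Rabs (t - s)) <= X).
{ apply Rnot_lt_le. intros Hl. apply exp_lt_inv in Hl. assert (Rabs (t - s) <= Z - R0) by (apply Rabs_le; lra).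
  nra. }
assert (S1 : (u s) ^ 2 <= N ^ 2) by (rewrite <- (pow2_abs (u s)); apply pow_incr; split; [apply Rabs_pos|auto]).
assert (S2 : (v s) ^ 2 <= N ^ 2) by (rewrite <- (pow2_abs (v s)); apply pow_incr; split; [apply Rabs_pos|auto]).
assert (u t ^ 2 + v t ^ 2 <= 2 * N ^ 2 * X) by nra.
assert (B : forall w, w ^ 2 <= 2 * N ^ 2 * X -> Rabs w <= (2 * X + 1) * N).
{ intros. apply Rnot_lt_le. intros Hl.
  assert (((2 * X + 1) * N) ^ 2 < Rabs w ^ 2) by (assert (0 <= (2 * X + 1) * N) by (apply Rmult_le_pos; lra); set (aa := (2 * X + 1) * N) in *; nra).
  rewrite pow2_abs in *.
  nra. }
pose proof (pow2_ge_0 (u t)). pose proof (pow2_ge_0 (v t)). split; apply B; lra.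
Qed.

Lemma gsol_lip u v M t t' : gsol u v -> (forall r, R0 <= r <= Z -> Rabs (u r) <= M /\ Rabs (v r) <= M) -> R0 <= t <= Z -> R0 <= t' <= Z ->
  Rabs (u t' - u t) <= Kg * M * Rabs (t' - t) /\ Rabs (v t' - v t) <= Kg * M * Rabs (t' - t).
Proof.
intros H HM.
assert (0 <= M). { destruct (HM R0 LRA). pose proof (Rabs_pos (u R0)). lra. }
assert (K : forall t t', R0 <= t <= t' -> t' <= Z -> Rabs (u t' - u t) <= Kg * M * (t' - t) /\ Rabs (v t' - v t) <= Kg * M * (t' - t)).
{ intros. split.
  - apply (mvt_bound u v); try lra; intros x Hx; [apply H|apply (gsol_cont u v x H)|]. destruct (HM x LRA).
    pose proof (coef_bound x). assert (1 * M <= Kg * M) by (apply Rmult_le_compat_r; unfold Kg; lra). lra.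
  - apply (mvt_bound v (fun r => - (nu n / Rmax r R0) * v r - g (u r))); try lra; intros x Hx; [apply H|apply (gsol_cont u v x H)|].
    destruct (HM x LRA). pose proof (coef_bound x). pose proof (HL (u x) 0) as q4. rewrite g_0, !Rminus_0_r in q4.
    assert (Rabs (- (nu n / Rmax x R0) * v x) <= nu n / R0 * M).
    { rewrite Rabs_mult, Rabs_Ropp, (Rabs_pos_eq (nu n / Rmax x R0)) by lra. nra. }
     eapply Rle_trans; [apply Rabs_triang|]. rewrite Rabs_Ropp. unfold Kg.
    nra. }
intros. destruct (Rle_lt_dec t t') as [l|l].
- rewrite (Rabs_pos_eq (t' - t)) by lra. apply K; lra.
- rewrite (Rabs_left (t' - t)) by lra. rewrite (Rabs_minus_sym (u t')), (Rabs_minus_sym (v t')). replace (- (t' - t)) with (t - t') by ring. apply K; lra.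
Qed.

Variables (gx gy : R -> R) (s0 s1 A B x1 x2 yb : R) (Q : R -> R -> Prop).
Hypothesis Hs01 : s0 < s1.
Hypothesis Cgx : forall s : R, continuous gx s.
Hypothesis Cgy : forall s : R, continuous gy s.
Hypothesis Bgx : forall s, s0 <= s <= s1 -> Rabs (gx s) <= A.
Hypothesis Bgy : forall s, s0 <= s <= s1 -> Rabs (gy s) <= B.
Hypothesis Hodd : gx s1 = - gx s0 /\ gy s1 = - gy s0.
Hypothesis Hx12 : 0 < x1 < x2.
Hypothesis Hyb : 0 < yb.
Hypothesis HQ1 : forall x y, x1 <= x <= x2 -> 0 <= y <= yb -> Q x y.
Hypothesis HQ2 : forall x, 0 <= x <= x2 -> Q x 0.
Hypothesis Harea : (2 * A + 3) * (2 * (R0 ^ n * B) + 3) < (x2 - x1) / 2 * (Z ^ n * yb).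

Lemma box_nonneg : 0 <= A /\ 0 <= B.
Proof.
pose proof (Bgx s0 LRA). pose proof (Bgy s0 LRA). pose proof (Rabs_pos (gx s0)). pose proof (Rabs_pos (gy s0)). lra.
Qed.

(** Otherwise the box $[x_1,x_2]\times[0,Z^ny_b]$ in the coordinates $(u,r^nu')$ would flow back
    into $[-A,A]\times[-R_0^nB,R_0^nB]$, against [Harea]. *)
Lemma backward_escape : exists x y u v, x1 <= x <= x2 /\ 0 <= y <= yb /\ gsol u v /\ u Z = x /\ v Z = y /\ (A < Rabs (u R0) \/ B < Rabs (v R0)).
Proof.
destruct box_nonneg as [HA0 HB0].
apply NNPP. intros HN. assert (RN : 0 < R0 ^ n) by (apply pow_lt; auto). assert (ZN : 0 < Z ^ n) by (apply pow_lt; lra).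
destruct gsol_bound as (C & HC & Cb). set (N := x2 + yb). assert (HNp : 0 < N) by (unfold N; lra).
assert (Pw : forall s, R0 <= s <= Z -> R0 ^ n <= s ^ n <= Z ^ n) by (intros s Hs; split; apply pow_incr; lra).
set (G := / R0 ^ n + Z ^ n). assert (HG1 : 0 < / R0 ^ n) by (apply Rinv_0_lt_compat; auto).
assert (Cont : forall x : R, continuous (fun s => / (Rmax s R0) ^ n) x).
{ intros. pose proof (Rmax_r x R0). apply (continuous_comp (fun s => Rmax s R0 ^ n) Rinv).
  - apply (continuous_comp (fun s => Rmax s R0) (fun s => s ^ n)); [apply (Lipschitz_continuous _ 1); intros z w; mm|eapply is_derive_cont; der].
  - apply (continuous_Rinv (Rmax x R0 ^ n)). apply Rgt_not_eq, pow_lt. lra. }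
assert (AB : (x2 - x1) / 2 * (Z ^ n * yb) <= (2 * A + 3) * (2 * (R0 ^ n * B) + 3)); [|lra].
apply (area_bound (fun s => / s ^ n) (fun s => s ^ n) (rint (fun s => / (Rmax s R0) ^ n) R0) (fun s => s ^ S n / INR (S n)) g R0 Z G L ((1 + Z ^ n) * (C * N))); auto.
- unfold G. lra.
- apply Rmult_le_pos; [lra|apply Rmult_le_pos; lra].
- nra.
- intros s Hs. split.
  + apply (dval _ _ (/ (Rmax s R0) ^ n)); [apply (drint (fun s => / Rmax s R0 ^ n)); auto|rewrite Rmax_left by lra; auto].
  + destruct (Pw s Hs). assert (/ s ^ n <= / R0 ^ n) by (apply Rinv_le_contravar; lra).
    assert (0 < / s ^ n) by (apply Rinv_0_lt_compat; lra). unfold G. lra.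
- intros s Hs. split.
  + unfold Rdiv. assert (INR (S n) <> 0) by (apply not_0_INR; lia). eapply dval; [der|]. cbv beta. simpl pred. field. auto.
  + destruct (Pw s Hs). unfold G. lra.
- apply g_0.
- lra.
- nra.
- intros x y Hx Hy. destruct (gsol_exists Z x (y / Z ^ n)) as (u & v & H & e1 & e2).
  assert (0 <= y / Z ^ n <= yb). { split; [apply Rdiv_le_0_compat; lra|apply Rle_div_l; lra]. }
  exists u, (fun s => s ^ n * v s). split; [|].
  + split; auto. split; [rewrite e2; field; lra|]. intros s Hs. destruct (H s). destruct (Pw s Hs).
    assert (Rabs (u s) <= C * N /\ Rabs (v s) <= C * N).
    { apply (Cb u v Z); auto; try lra; [rewrite e1|rewrite e2]; rewrite Rabs_pos_eq; unfold N; lra. }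
    assert (0 <= C * N) by nra.
    split; [|split; [|split]].
    * apply (dval _ _ (v s)); auto. field. lra.
    * destruct (H s) as [_ d3]. rewrite Rmax_left in d3 by lra. eapply dval; [der|]. unfold nu.
      replace (s ^ n) with (s ^ (S (pred n))) by (f_equal; lia). simpl. field. lra.
    * nra.
    * rewrite Rabs_mult, (Rabs_pos_eq (s ^ n)) by lra. nra.
  + apply NNPP. intros HN'. apply HN. exists x, (y / Z ^ n), u, v. split; auto. split; auto. split; auto. split; auto. split; auto.
    destruct (Rle_lt_dec (Rabs (u R0)) A) as [q1|q1]; auto. destruct (Rle_lt_dec (Rabs (v R0)) B) as [q2|q2]; auto.
    exfalso. apply HN'. split; auto. rewrite Rabs_mult, (Rabs_pos_eq (R0 ^ n)) by lra. nra.
Qed.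

Lemma root_ext hx hy kx ky : (forall s, hx s = kx s) -> (forall s, hy s = ky s) -> root s0 s1 hx hy -> root s0 s1 kx ky.
Proof.
intros e1 e2 (X & Y & h1 & h2 & h3 & h4). exists X, Y. split; auto. split; auto. split; auto. intros. rewrite <- e1, <- e2. auto.
Qed.

(* If no image of the odd loop met [Q] or [-Q] at time Z, then Gamma^2 - q^2 would never vanish while q moves from far away, at time R0,
   along a backward orbit into [Q], at time Z, and then inside [Q] to 0; the closed square root would survive, contradicting oddness. *)
Lemma crossing : exists s u v, s0 <= s <= s1 /\ gsol u v /\ u R0 = gx s /\ v R0 = gy s /\ (Q (u Z) (v Z) \/ Q (- u Z) (- v Z)).
Proof.
apply NNPP. intros HN. destruct box_nonneg.
set (cs := clip s0 s1). assert (Hcs : forall s, s0 <= cs s <= s1) by (intros s; apply clip_range; auto).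
assert (idem : forall s, s0 <= s <= s1 -> cs s = s). { intros. unfold cs, clip. rewrite Rmin_right, Rmax_right; lra. }
destruct (choose2 _ _ _ (fun s u v => gsol u v /\ u R0 = gx (cs s) /\ v R0 = gy (cs s))) as (u & v & Huv).
{ intros. apply (gsol_exists R0). }
assert (NQ : forall s, ~ Q (u s Z) (v s Z) /\ ~ Q (- u s Z) (- v s Z)).
{ intros. destruct (Huv s) as (q1 & q2 & q3). split; intros h; apply HN; exists (cs s), (u s), (v s); auto 6. }
assert (forall s t, u (cs s) t = u s t /\ v (cs s) t = v s t).
{ intros. destruct (Huv s) as (q1 & q2 & q3). destruct (Huv (cs s)) as (q4 & q5 & q6). rewrite (idem (cs s)) in q5, q6 by apply Hcs.
  apply (gsol_uniq (u (cs s)) (v (cs s)) (u s) (v s) R0); auto; congruence. }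
assert (Fodd : forall t, u s1 t = - u s0 t /\ v s1 t = - v s0 t).
{ intros. destruct (Huv s0) as (q1 & q2 & q3). destruct (Huv s1) as (q4 & q5 & q6). rewrite idem in q2, q3, q5, q6 by lra. destruct Hodd.
  apply (gsol_uniq (u s1) (v s1) _ _ R0 t q4 (gsol_opp _ _ q1)); congruence. }
assert (forall s : R, continuous cs s) by (intros s; apply (Lipschitz_continuous _ 1); intros x y; unfold cs, clip; mm).
assert (Cgc : forall s : R, continuous (fun s => gx (cs s)) s /\ continuous (fun s => gy (cs s)) s).
{ intros. split; [apply (continuous_comp cs gx)|apply (continuous_comp cs gy)]; auto. }
assert (Fcont : forall t s : R, continuous (fun s => u s t) s /\ continuous (fun s => v s t) s).
{ intros. set (X := exp (Kg * Rabs (t - R0))).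
  assert (W : forall e, 0 < e -> exists d, 0 < d /\ forall s', Rabs (s' - s) < d -> (u s' t - u s t) ^ 2 + (v s' t - v s t) ^ 2 < e ^ 2).
  { intros. destruct (Cgc s).
    destruct (cont_lt_near (fun s' => ((gx (cs s') - gx (cs s)) ^ 2 + (gy (cs s') - gy (cs s)) ^ 2) * X) s (e ^ 2)) as (d & Hd & hd).
    - cnt.
    - nra.
    - exists d. split; auto. intros. destruct (Huv s) as (q1 & q2 & q3). destruct (Huv s') as (q4 & q5 & q6).
      eapply Rle_lt_trans; [apply (gsol_dist (u s') (v s') (u s) (v s) R0 t); auto|]. rewrite q2, q3, q5, q6. auto. }
  assert (sq : forall x e, 0 < e -> x ^ 2 < e ^ 2 -> Rabs x < e) by (intros x e He h; apply Rabs_def1; nra).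
  split; apply eps_continuous; intros e He; destruct (W e He) as (d & Hd & hd); exists d; (split; auto); intros s' Hs'; apply sq; auto;
    specialize (hd s' Hs'); pose proof (pow2_ge_0 (u s' t - u s t)); pose proof (pow2_ge_0 (v s' t - v s t)); lra. }
destruct gsol_bound as (C & HC & Cb).
set (M1 := C * (A + B)). assert (0 <= M1) by (apply Rmult_le_pos; lra).
assert (Fb : forall s t, R0 <= t <= Z -> Rabs (u s t) <= M1 /\ Rabs (v s t) <= M1).
{ intros. destruct (Huv s) as (q1 & q2 & q3). pose proof (Bgx (cs s) (Hcs s)). pose proof (Bgy (cs s) (Hcs s)).
  apply (Cb (u s) (v s) R0); auto; try lra; [rewrite q2|rewrite q3]; lra. }
destruct backward_escape as (x & y & p & q & Hx & Hy & Hpq & ex & ey & Hesc).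
set (xq := p R0) in *. set (yq := q R0) in *. set (M2 := Rabs xq + Rabs yq).
pose proof (Rabs_pos xq). pose proof (Rabs_pos yq).
assert (0 < M2) by (unfold M2; lra).
set (N := xq ^ 2 + yq ^ 2).
assert (0 < N).
{ unfold N. rewrite <- (pow2_abs xq), <- (pow2_abs yq). nra. }
(* Chosen so that $\lambda q$ lies outside a circle that contains the loop, where [far_root]
   applies. *)
set (lam := 1 + (A ^ 2 + B ^ 2 + 1) / N).
assert (0 <= A ^ 2 + B ^ 2) by nra.
assert (1 <= lam). { unfold lam. assert (0 <= (A ^ 2 + B ^ 2 + 1) / N) by (apply Rdiv_le_0_compat; lra). lra. }
assert (A ^ 2 + B ^ 2 + 1 <= lam * N). { unfold lam. replace ((1 + (A ^ 2 + B ^ 2 + 1) / N) * N) with (N + (A ^ 2 + B ^ 2 + 1)) by (field; lra). lra. }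
assert (root_far : root s0 s1 (fun s => u s R0 ^ 2 - v s R0 ^ 2 - ((lam * xq) ^ 2 - (lam * yq) ^ 2)) (fun s => 2 * u s R0 * v s R0 - 2 * (lam * xq) * (lam * yq))).
{ apply (far_root s0 s1 (fun s => u s R0) (fun s => v s R0)); try (intros s; apply Fcont); try apply Fodd.
  intros. destruct (Huv s) as (_ & -> & ->). pose proof (Bgx (cs s) (Hcs s)) as b1. pose proof (Bgy (cs s) (Hcs s)) as b2.
  pose proof (pow_incr _ _ 2 (conj (Rabs_pos _) b1)) as b3. pose proof (pow_incr _ _ 2 (conj (Rabs_pos _) b2)) as b4. rewrite pow2_abs in b3, b4.
  replace ((lam * xq) ^ 2 + (lam * yq) ^ 2) with (lam * (lam * N)) by (unfold N; ring).
  nra. }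
(* The point moves on its ray from $\lambda q$ to $q$; it stays outside the box $[-A,A]\times[-B,B]$
   that contains the loop. *)
unshelve epose proof (proj2 (root_homotopy s0 s1 Hs01 (fun s _ => u s R0) (fun s _ => v s R0) (fun t => t * xq) (fun t => t * yq) 1 lam M2 (A + B + lam * M2) _ _ _ _ _ _ _ _ _) root_far) as root_far'; cbv beta.
{ auto. } { lra. }
{ nra. }
{ auto. }
{ auto. }
{ intros. rewrite !Rminus_diag, Rabs_R0. assert (0 <= M2 * Rabs (t' - t)) by (apply Rmult_le_pos; [lra|apply Rabs_pos]).
     split; auto. split; auto. pose proof (Rabs_pos (t' - t)). replace (t' * xq - t * xq) with ((t' - t) * xq) by ring. replace (t' * yq - t * yq) with ((t' - t) * yq) by ring.
     rewrite !Rabs_mult, !(Rmult_comm (Rabs (t' - t))). split; apply Rmult_le_compat_r; unfold M2; lra. }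
{ intros. destruct (Huv s) as (_ & -> & ->). pose proof (Bgx (cs s) (Hcs s)). pose proof (Bgy (cs s) (Hcs s)).
     assert (0 <= lam * M2) by nra. rewrite !Rabs_mult, (Rabs_pos_eq t) by lra.
     assert (t * Rabs xq <= lam * M2) by (apply Rmult_le_compat; unfold M2; lra). assert (t * Rabs yq <= lam * M2) by (apply Rmult_le_compat; unfold M2; lra). lra. }
{ intros. destruct (Huv s) as (_ & e1 & e2). rewrite e1, e2. pose proof (Bgx (cs s) (Hcs s)). pose proof (Bgy (cs s) (Hcs s)).
     assert (A < Rabs (t * xq) \/ B < Rabs (t * yq)). { rewrite !Rabs_mult, (Rabs_pos_eq t) by lra. nra. }
     split; intros [z1 z2]; rewrite z1, z2, ?Rabs_Ropp in *; lra. }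
{ auto. }
assert (root_R0 : root s0 s1 (fun s => u s R0 ^ 2 - v s R0 ^ 2 - (p R0 ^ 2 - q R0 ^ 2)) (fun s => 2 * u s R0 * v s R0 - 2 * p R0 * q R0)).
{ revert root_far'. apply root_ext; intros s; fold xq yq; ring. }
set (M3 := C * (x2 + yb)). assert (0 <= M3) by (apply Rmult_le_pos; lra).
assert (Fq : forall t, R0 <= t <= Z -> Rabs (p t) <= M3 /\ Rabs (q t) <= M3).
{ intros. apply (Cb p q Z); auto; try lra; [rewrite ex|rewrite ey]; rewrite Rabs_pos_eq; lra. }
assert (0 <= Kg). { unfold Kg. pose proof (coef_bound 0). lra. }
(* Loop and point move together under the flow; a meeting at some time would persist until [Z] and
   give a crossing. *)
unshelve epose proof (proj1 (root_homotopy s0 s1 Hs01 u v p q R0 Z (Kg * (M1 + M3)) (M1 + M3) _ _ _ _ _ _ _ _ _) root_R0) as root_Z; cbv beta.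
{ lra. }
{ nra. }
{ lra. }
{ auto. }
{ auto. }
{ intros s t t' Ht Ht'. destruct (Huv s) as (q1 & _). destruct (gsol_lip (u s) (v s) M1 t t' q1 (Fb s) Ht Ht').
     destruct (gsol_lip p q M3 t t' Hpq Fq Ht Ht'). pose proof (Rabs_pos (t' - t)).
     assert (Kg * M1 * Rabs (t' - t) <= Kg * (M1 + M3) * Rabs (t' - t)) by (apply Rmult_le_compat_r; auto; apply Rmult_le_compat_l; lra).
     assert (Kg * M3 * Rabs (t' - t) <= Kg * (M1 + M3) * Rabs (t' - t)) by (apply Rmult_le_compat_r; auto; apply Rmult_le_compat_l; lra).
     lra. }
{ intros s t Ht. destruct (Fb s t Ht). destruct (Fq t Ht). lra. }
{ intros. destruct (Huv s) as (q1 & _). destruct (NQ s) as [n1 n2]. split; intros [z1 z2].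
     - destruct (gsol_uniq (u s) (v s) p q t Z q1 Hpq z1 z2) as [w1 w2]. apply n1. rewrite w1, w2, ex, ey. auto.
     - destruct (gsol_uniq (u s) (v s) _ _ t Z q1 (gsol_opp _ _ Hpq) z1 z2) as [w1 w2]. apply n2. rewrite w1, w2, ex, ey, !Ropp_involutive. auto. }
{ auto. }
set (M4 := x2 + yb).
assert (Hc1 : forall s t : R, 0 <= t <= 1 -> Rabs (u s Z) <= M1 + M4 /\ Rabs (v s Z) <= M1 + M4).
{ intros. destruct (Fb s Z LRA). unfold M4. lra. }
assert (lin : forall c t t' : R, 0 <= c <= M4 -> Rabs (t' * c - t * c) <= M4 * Rabs (t' - t)).
{ intros. replace (t' * c - t * c) with (c * (t' - t)) by ring. rewrite Rabs_mult, (Rabs_pos_eq c) by lra. apply Rmult_le_compat_r; [apply Rabs_pos|lra]. }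
assert (lin2 : forall c t : R, 0 <= c <= M4 -> 0 <= t <= 1 -> Rabs (t * c) <= M1 + M4).
{ intros. rewrite Rabs_mult, !Rabs_pos_eq by lra. nra. }
assert (root_1 : root s0 s1 (fun s => u s Z ^ 2 - v s Z ^ 2 - ((0 * 0 + x) ^ 2 - (1 * y) ^ 2)) (fun s => 2 * u s Z * v s Z - 2 * (0 * 0 + x) * (1 * y))).
{ revert root_Z. apply root_ext; intros s; rewrite ex, ey; ring. }
(* At time [Z] the point moves inside [Q]: first vertically to the axis, afterwards along the axis
   to $0$. *)
unshelve epose proof (proj2 (root_homotopy s0 s1 Hs01 (fun s _ => u s Z) (fun s _ => v s Z) (fun _ => 0 * 0 + x) (fun t => t * y) 0 1 M4 (M1 + M4) _ _ _ _ _ _ _ _ _) root_1) as root_1'; cbv beta.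
{ lra. } { unfold M4; lra. } { unfold M4; lra. } { auto. }
{ auto. }
{ intros. rewrite !Rminus_diag, Rabs_R0. assert (0 <= M4 * Rabs (t' - t)) by (apply Rmult_le_pos; [unfold M4; lra|apply Rabs_pos]).
     repeat split; auto. apply lin. unfold M4. lra. }
{ intros s t Ht. destruct (Hc1 s t Ht). split; auto. split; auto. split; [rewrite Rabs_pos_eq; unfold M4; lra|apply lin2; unfold M4; lra]. }
{ intros. destruct (NQ s) as [n1 n2]. assert (Q x (t * y)) by (apply HQ1; [lra|nra]).
     split; intros [z1 z2]; [apply n1|apply n2]; rewrite z1, z2, ?Ropp_involutive, Rmult_0_l, Rplus_0_l; auto. }
{ auto. }
assert (root_2 : root s0 s1 (fun s => u s Z ^ 2 - v s Z ^ 2 - ((1 * x) ^ 2 - 0 ^ 2)) (fun s => 2 * u s Z * v s Z - 2 * (1 * x) * 0)).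
{ revert root_1'. apply root_ext; intros s; ring. }
unshelve epose proof (proj2 (root_homotopy s0 s1 Hs01 (fun s _ => u s Z) (fun s _ => v s Z) (fun t => t * x) (fun _ => 0) 0 1 M4 (M1 + M4) _ _ _ _ _ _ _ _ _) root_2) as root_2'; cbv beta.
{ lra. } { unfold M4; lra. } { unfold M4; lra. } { auto. }
{ auto. }
{ intros. rewrite !Rminus_diag, Rabs_R0. assert (0 <= M4 * Rabs (t' - t)) by (apply Rmult_le_pos; [unfold M4; lra|apply Rabs_pos]).
     repeat split; auto. apply lin. unfold M4. lra. }
{ intros s t Ht. destruct (Hc1 s t Ht). split; auto. split; auto. split; [apply lin2; unfold M4; lra|rewrite Rabs_R0; unfold M4; lra]. }
{ intros. destruct (NQ s) as [n1 n2]. assert (Q (t * x) 0) by (apply HQ2; nra).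
     split; intros [z1 z2]; [apply n1|apply n2]; rewrite z1, z2, ?Ropp_involutive, ?Ropp_0; auto. }
{ auto. }
apply (odd_no_root s0 s1 Hs01 (fun s => u s Z) (fun s => v s Z)); try (intros s; apply Fcont); try apply Fodd.
- intros s [z1 z2]. destruct (NQ s) as [n1 _]. apply n1. rewrite z1, z2. apply HQ2. lra.
- revert root_2'. apply root_ext; intros s; ring.
Qed.
End Crossing.

(** * A shooting value with finitely many sign changes *)

Lemma ulim_continuous (h : R -> R) (x : R) : (forall t : nat -> R, ulim t x -> ulim (fun k => h (t k)) (h x)) -> continuous h x.
Proof.
intros. apply eps_continuous. intros e He. apply NNPP. intros Hno.
destruct (choose1 _ _ (fun (k : nat) t => Rabs (t - x) < 1 * / (INR k + 1) /\ ~ Rabs (h t - h x) < e)) as [t Ht].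
{ intros. apply NNPP. intros Hn'. apply Hno. exists (1 * / (INR k + 1)). split; [apply (xis_pos 1 k); lra|].
  intros. apply NNPP. intros HQ. apply Hn'. exists y. auto. }
assert (Lt : ulim t x).
{ intros e' Hep. apply (Uf_mono _ _ (ulim_lt _ _ e' (xis_lim 1) Hep)). intros k hk. unfold xis in hk. destruct (Ht k). lra. }
apply (Uf_out _ _ (H t Lt e He)). intros k. apply Ht.
Qed.

Lemma alt_dead u R1 m : (forall x, R1 <= x -> u x = 0) -> forall s lo hi, alt u s m lo hi -> alt u s m lo R1.
Proof.
intros H. induction m as [|m IH]; intros s lo hi Ha; [simpl; auto|]. destruct Ha as (r & Hr & Hsr & Ha).
exists r. destruct (Rle_lt_dec R1 r) as [l|l]; [rewrite H in Hsr by auto; lra|]. split; [lra|]. split; auto. apply (IH _ _ _ Ha).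
Qed.

Section Lobe.
Context {P : problem} {LL : landscape}.
Notation n := (@n P).
Notation f := (@f P).
Notation F := (pot f).
Notation U := (@U P).
Notation V := (@V P).
Notation E := (@orbit_energy P).
Notation dl := (@dl P).
Notation d0 := (@d0 P LL).
Notation gM := (@gM P LL).
Notation b := (@b P LL).

(** With energy at most $0$ a zero of $u$ has zero velocity and freezes the solution, so there is no
    sign change after time [r]. *)
Lemma lobe_finite al r : adm al -> 0 <= r -> Rabs (U al r) <= d0 -> E al r <= 0 -> T al /\ exists m, ~ W m al.
Proof.
intros H Hr HU HE. pose proof L_order as Lo. destruct L_g1 as (_ & Lg & _). split; [exists r; split; auto; split; lra|].
assert (Dead : forall t, r <= t -> U al t = 0 -> V al t = 0).
{ intros t Ht H0. pose proof (E_decr al r t H LRA) as Q. unfold orbit_energy at 1, energy in Q. rewrite H0, F_0 in Q. nra. }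
destruct (classic (exists t, r <= t /\ U al t = 0)) as [(t & Ht & H0)|Hno].
- destruct (finite_W al t H) as [m Hm]. exists m. intros [hi Hw]. apply Hm. apply (alt_dead _ t m) in Hw; auto.
  intros. apply (U_frozen al t x H LRA H0 (Dead t Ht H0)).
- destruct (finite_W al (r + 1) H) as [m Hm]. exists m. intros Hw. apply Hm. apply W_after; auto; try lra.
  intros. apply const_sign; auto.
  + intros. apply U_cont; auto; lra.
  + intros s Hs E0. apply Hno. exists s. lra.
Qed.

Lemma gM_pos : 0 < gM.
Proof. pose proof L_order. pose proof Hdl. lra. Qed.

Section Approximation.
Variables (c xi R0 : R).
Hypothesis HR0 : 0 < R0.
Hypothesis Hc : gM < c.
Hypothesis Hxi : 0 < xi <= gM.
Notation g := (gl f c xi).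

Lemma g_lip : exists L, 0 <= L /\ forall x y, Rabs (g x - g y) <= L * Rabs (x - y).
Proof. apply gl_lip; [lra|apply Hfc|]. intros. apply Hfl. lra. Qed.

Lemma g_cont (x : R) : continuous g x.
Proof. destruct g_lip as (L & _ & HL). apply (Lipschitz_continuous _ L); auto. Qed.

Lemma g_odd x : g (- x) = - g x.
Proof. apply gl_odd. lra. Qed.

Lemma g_eq x : xi <= x <= c -> g x = f x.
Proof. intros. rewrite gl_out, fc_id; auto using Hfo; try lra; rewrite Rabs_pos_eq; lra. Qed.

Lemma gsol_ode u v : gsol n g R0 u v -> ode n g R0 u v.
Proof. intros H r Hr. destruct (H r) as [h1 h2]. rewrite Rmax_left in h2 by lra. auto. Qed.

Lemma genergy_decr u v r : gsol n g R0 u v -> R0 <= r -> energy g u v r <= energy g u v R0.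
Proof.
intros. destruct (gsol_cont n g R0 u v R0 H). apply (energy_decr n Hn g R0); auto using g_cont, gsol_ode; lra.
Qed.

(** Beyond $\xi$ the two potentials differ by a constant, so barriers there are the same for both
    equations. *)
Lemma gpot_shift x y : xi <= x <= y -> y <= c -> pot g y - F y = pot g x - F x.
Proof.
intros. apply Rminus_diag_uniq. assert (Q : Rabs ((pot g y - F y) - (pot g x - F x)) <= 0 * (y - x)).
{ apply (mvt_bound (fun z => pot g z - F z) (fun z => g z - f z)); try lra.
  - intros. apply dminus; [apply pot_derive; apply g_cont|apply dF].
  - intros. apply (continuous_minus (pot g) F); [|apply F_cont]. eapply is_derive_cont. apply pot_derive. apply g_cont.
  - intros. rewrite g_eq, Rminus_diag, Rabs_R0; lra. }
rewrite Rmult_0_l in Q. apply Rabs_le_between in Q. lra.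
Qed.

Lemma gpot_close h x : (forall z, Rabs (g z - fc f c z) <= h) -> 0 <= x <= c -> Rabs (pot g x - F x) <= h * c.
Proof.
intros Hh Hx. pose proof (Rabs_pos (g 0 - fc f c 0)). pose proof (Hh 0).
replace (pot g x - F x) with ((pot g x - F x) - (pot g 0 - F 0)) by (rewrite pot_0, F_0; ring).
apply Rle_trans with (h * (x - 0)); [|apply Rmult_le_compat_l; lra].
apply (mvt_bound (fun z => pot g z - F z) (fun z => g z - f z)); try lra.
- intros. apply dminus; [apply pot_derive; apply g_cont|apply dF].
- intros. apply (continuous_minus (pot g) F); [|apply F_cont]. eapply is_derive_cont. apply pot_derive. apply g_cont.
- intros z Hz. specialize (Hh z). rewrite fc_id in Hh by (rewrite Rabs_pos_eq; lra). auto.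
Qed.

(** To return to $-\gamma_M$ the solution would have to keep all its energy and arrive at rest; for
    the Lipschitz equation only the constant solution does that. *)
Lemma stays_left u v r : gsol n g R0 u v -> - c <= u R0 < - gM -> v R0 ^ 2 / 2 + F (u R0) <= F gM -> R0 <= r -> u r < - gM.
Proof.
intros H Hu HE Hr. apply Rnot_le_lt. intros Hle. destruct L_gM.
destruct (first_above u R0 r (- gM)) as (t & Ht & Et & _); try lra.
{ intros. apply (gsol_cont n g R0 u v x H). }
pose proof (genergy_decr u v t H LRA) as Q. unfold energy in Q. rewrite Et in Q.
rewrite (pot_even g g_cont g_odd) in Q.
rewrite <- (pot_abs g g_cont g_odd (u R0)), Rabs_left in Q by lra. rewrite <- (F_even (u R0)) in HE.
pose proof (gpot_shift gM (- u R0) LRA LRA).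
assert (Vt : v t = 0) by nra.
destruct g_lip as (L & HL0 & HL).
assert (g0 : g (- gM) = 0) by (rewrite g_odd, g_eq; lra).
destruct (gsol_uniq n g L R0 Hn HR0 HL0 HL u v _ _ t R0 H (gsol_const n g R0 _ g0) Et Vt). lra.
Qed.

Lemma confined u v r : gsol n g R0 u v -> Rabs (u R0) < c -> energy g u v R0 < pot g c -> R0 <= r -> Rabs (u r) < c.
Proof.
intros. apply Rnot_le_lt. intros Hle.
destruct (first_above (fun t => Rabs (u t)) R0 r c) as (t & Ht & Et & _); try lra.
{ intros. apply (continuous_comp u Rabs); [apply (gsol_cont n g R0 u v x H)|apply (continuous_Rabs (u x))]. }
pose proof (genergy_decr u v t H LRA) as Q. unfold energy at 1 in Q.
rewrite <- (pot_abs g g_cont g_odd (u t)), Et in Q. nra.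
Qed.

Lemma confined_velocity u v B r : (forall y, 0 <= y <= c -> Rabs (f y) <= B) -> gsol n g R0 u v -> Rabs (u R0) < c ->
  energy g u v R0 < pot g c -> R0 <= r -> Rabs (v r) <= 4 * B * c + 1 /\ Rabs (g (u r)) <= B.
Proof.
intros HB H Hu HE Hr. pose proof (confined u v r H Hu HE Hr) as Hur.
assert (gB : forall x, Rabs x <= c -> Rabs (g x) <= B) by (intros x Hx; apply gl_bound; auto; lra).
split; [|apply gB; lra].
assert (0 <= B). { pose proof (HB 0 LRA). pose proof (Rabs_pos (f 0)). lra. }
assert (pB : forall x, 0 <= x <= c -> Rabs (pot g x) <= B * c).
{ intros. replace (pot g x) with (pot g x - pot g 0) by (rewrite pot_0; ring).
  apply Rle_trans with (B * (x - 0)); [|apply Rmult_le_compat_l; lra]. apply (mvt_bound (pot g) g); try lra.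
  - intros. apply pot_derive. apply g_cont.
  - intros. eapply is_derive_cont. apply pot_derive. apply g_cont.
  - intros. apply gB. rewrite Rabs_pos_eq; lra. }
pose proof (genergy_decr u v r H Hr) as Q. unfold energy at 1 in Q. rewrite <- (pot_abs g g_cont g_odd (u r)) in Q.
pose proof (pB (Rabs (u r)) (conj (Rabs_pos _) (Rlt_le _ _ Hur))) as q1. pose proof (pB c LRA) as q2.
apply Rabs_le_between in q1, q2. apply le_of_sq; [apply Rabs_pos|]. rewrite pow2_abs. lra.
Qed.
End Approximation.

(** If no solution entered the lobe, there would be no double zeros, and phase points would depend
    continuously on the initial value. The crossing is found for Lipschitz approximations of $f$,
    whose flow is global and invertible, and passes to the limit. *)
Lemma lobe_shooting : far_oscillation -> exists al r, b < al /\ top al /\ 0 <= r /\ Rabs (U al r) <= d0 /\ E al r <= 0.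
Proof.
intros Hfar. apply NNPP. intros HN. pose proof L_order. pose proof Hdl. pose proof gM_pos.
assert (HA : forall al r, b < al -> top al -> 0 <= r -> Rabs (U al r) <= d0 -> 0 < E al r).
{ intros. apply Rnot_le_lt. intros h5. apply HN. exists al, r. auto. }
assert (Hlive : forall al r, b < al -> top al -> 0 <= r -> U al r <> 0 \/ V al r <> 0).
{ intros al r h1 h2 h3. apply NNPP. intros h. apply not_or_and in h. destruct h as [w1 w2]. apply NNPP in w1. apply NNPP in w2.
  pose proof (HA al r h1 h2 h3) as Q. rewrite w1, Rabs_R0 in Q. unfold orbit_energy, energy in Q. rewrite w1, F_0 in Q. nra. }
destruct (trapped_pair Hfar Hlive) as (a1 & a2 & R0 & Ha & Hta & HR0 & p1 & p2 & p3 & p4).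
assert (Adm : forall al, a1 <= al <= a2 -> b < al /\ top al /\ adm al).
{ intros. assert (top al) by (apply (top_lt _ a2); auto; lra). split; [lra|]. split; auto. apply adm_out; auto; lra. }
assert (Hcx : exists c, a2 < c /\ top c).
{ unfold top in *. destruct gs as [g| |]; simpl in *.
  - exists ((a2 + g) / 2). lra.
  - exists (a2 + 1). lra.
  - tauto. }
destruct Hcx as (c & Hc & Htc).
set (ua := U a1 R0) in *. set (va := V a1 R0). set (ub := U a2 R0) in *. set (vb := V a2 R0).
set (cA := clip a1 a2). set (c01 := clip 0 1).
assert (forall s : R, continuous cA s) by (intros s; apply (Lipschitz_continuous _ 1); intros x y; unfold cA, clip; mm).
assert (Cc01 : forall s : R, continuous c01 s) by (intros s; apply (Lipschitz_continuous _ 1); intros x y; unfold c01, clip; mm).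
assert (RcA : forall s, a1 <= cA s <= a2) by (intros s; apply clip_range; lra).
assert (Rc01 : forall s, 0 <= c01 s <= 1) by (intros s; apply clip_range; lra).
assert (cA_in : forall s, a1 <= s <= a2 -> cA s = s) by (intros s Hs; unfold cA, clip; rewrite Rmin_right, Rmax_right; lra).
assert (cA_hi : forall s, a2 <= s -> cA s = a2) by (intros s Hs; unfold cA, clip; rewrite Rmin_left, Rmax_right; lra).
assert (c01_lo : forall s, s <= 0 -> c01 s = 0) by (intros s Hs; unfold c01, clip; rewrite Rmin_right, Rmax_left; lra).
assert (c01_hi : forall s, 1 <= s -> c01 s = 1) by (intros s Hs; unfold c01, clip; rewrite Rmin_left, Rmax_right; lra).
(* After the phase points for $[a_1,a_2]$ come three segments from $(u_b,v_b)$ to $-(u_a,v_a)$: the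
   velocity goes to $0$, the position moves, and the velocity goes to its final value. *)
set (gx := fun s => U (cA s) R0 + c01 (s - a2 - 1) * (- ua - ub)).
set (gy := fun s => V (cA s) R0 - c01 (s - a2) * vb - c01 (s - a2 - 2) * va).
assert (CUV : forall s : R, continuous (fun s => U (cA s) R0) s /\ continuous (fun s => V (cA s) R0) s).
{ intros.
  assert (Q : forall t, ulim t s -> ulim (fun k => U (cA (t k)) R0) (U (cA s) R0) /\ ulim (fun k => V (cA (t k)) R0) (V (cA s) R0)).
  { intros. apply (U_cd (fun k => cA (t k)) (cA s) a2); try lra.
    - intros. apply Adm, RcA.
    - intros. apply RcA.
    - apply (ulim_comp cA); auto.
    - apply Adm, RcA.
    - apply Hlive; try lra; apply Adm, RcA. }
  split; apply ulim_continuous; intros t Lt; apply (Q t Lt). }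
assert (forall d s : R, continuous (fun s => c01 (s - d)) s).
{ intros. apply (continuous_comp (fun s => s - d) c01); [cnt|apply Cc01]. }
assert (forall s : R, continuous gx s).
{ intros. unfold gx. destruct (CUV s). cnt. apply (continuous_ext (fun s => c01 (s - (a2 + 1)))); [intros x; f_equal; ring|]. auto. }
assert (forall s : R, continuous gy s).
{ intros. unfold gy. destruct (CUV s). cnt. apply (continuous_ext (fun s => c01 (s - (a2 + 2)))); [intros x; f_equal; ring|]. auto. }
assert (gxA : forall s, a1 <= s <= a2 -> gx s = U s R0 /\ gy s = V s R0).
{ intros. unfold gx, gy. rewrite cA_in, !c01_lo by lra. lra. }
(* The added segments stay to the left of $-\gamma_M$ with energy at most $F(\gamma_M)$, so by
   [stays_left] the crossing does not come from them. *)
assert (Hclose : forall s, a2 <= s <= a2 + 3 -> - c <= gx s < - gM /\ gy s ^ 2 / 2 + F (gx s) <= F gM).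
{ assert (Hin : forall al, a1 <= al <= a2 -> E al R0 < F gM -> Rabs (U al R0) <= b).
  { intros al Hal HE. destruct (Adm al Hal) as (_ & ta & ad). apply Rnot_lt_le. intros Hlt. destruct L_b.
    pose proof (U_bound al R0 ad LRA). assert (F b < F (Rabs (U al R0))).
    { apply F_incr_out; [lra|]. apply (top_lt _ al); auto. }
    rewrite F_abs in *. pose proof (F_le_E al R0). lra. }
  pose proof (Hin a1 LRA p2) as i1. pose proof (Hin a2 LRA p4) as i2. fold ua in i1. fold ub in i2.
  apply Rabs_le_between in i1, i2. destruct L_b as [_ Lb].
  assert (FL : forall x, - b <= x <= 0 -> F x <= F gM) by (intros x Hx; rewrite <- F_even; apply Lb; lra).
  assert (va ^ 2 / 2 + F (- ua) < F gM) by (rewrite F_even; exact p2).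
  assert (vb ^ 2 / 2 + F ub < F gM) by auto.
  assert (Hsc : forall k v, 0 <= k <= 1 -> (k * v) ^ 2 <= v ^ 2).
  { intros. replace ((k * v) ^ 2) with (k ^ 2 * v ^ 2) by ring. assert (k ^ 2 <= 1) by nra. nra. }
  intros. unfold gx, gy. rewrite cA_hi by lra. fold ub vb. pose proof (Rc01 (s - a2 - 1)). pose proof (Rc01 (s - a2)). pose proof (Rc01 (s - a2 - 2)) as r3.
  destruct (Rle_lt_dec s (a2 + 1)) as [l|l]; [|destruct (Rle_lt_dec s (a2 + 2)) as [l2|l2]].
  - rewrite (c01_lo (s - a2 - 1)), (c01_lo (s - a2 - 2)) by lra. rewrite !Rmult_0_l, Rplus_0_r, Rminus_0_r.
    nra.
  - rewrite (c01_hi (s - a2)), (c01_lo (s - a2 - 2)) by lra. set (k := c01 (s - a2 - 1)) in *.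
    replace (vb - 1 * vb - 0 * va) with 0 by ring. assert (- b <= ub + k * (- ua - ub) < - gM).
    { replace (ub + k * (- ua - ub)) with ((1 - k) * ub + k * - ua) by ring.
      assert ((1 - k) * ub <= (1 - k) * - gM) by nra. assert (k * - ua <= k * - gM) by nra.
      nra. }
    split; [lra|]. pose proof (FL (ub + k * (- ua - ub)) LRA). lra.
  - rewrite (c01_hi (s - a2)), (c01_hi (s - a2 - 1)) by lra. set (k := c01 (s - a2 - 2)) in *.
    replace (vb - 1 * vb - k * va) with (- (k * va)) by ring. replace (ub + 1 * (- ua - ub)) with (- ua) by ring.
    split; [lra|]. replace ((- (k * va)) ^ 2) with ((k * va) ^ 2) by ring. pose proof (Hsc k va r3). lra. }
assert (gx (a2 + 3) = - gx a1 /\ gy (a2 + 3) = - gy a1).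
{ destruct (gxA a1 LRA) as [-> ->]. fold ua va. unfold gx, gy. rewrite cA_hi, !c01_hi by lra. fold ub vb. lra. }
destruct (bounded_on gx a1 (a2 + 3) LRA ltac:(auto)) as (A & HA0 & BA).
destruct (bounded_on gy a1 (a2 + 3) LRA ltac:(auto)) as (B & HB0 & BB).
(* A box inside the lobe: on $[\delta/4,\delta/2]$ the potential is at most $F(x_m)<0$, which leaves
   room for velocities up to [yb]. *)
destruct (max_attained F (dl / 4) (dl / 2) LRA ltac:(intros; apply F_cont)) as (xm & Hxm & Hmax).
assert (F xm < 0) by (apply HFneg; lra).
set (yb := Rmin 1 (- F xm)). assert (0 < yb) by (unfold yb; apply Rmin_glb_lt; lra).
assert (yb <= 1) by apply Rmin_l. assert (yb <= - F xm) by apply Rmin_r.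
set (Q := fun x y => 0 <= x <= dl / 2 /\ y ^ 2 / 2 + F x <= 0).
assert (forall x y, dl / 4 <= x <= dl / 2 -> 0 <= y <= yb -> Q x y).
{ intros x y Hx Hy. split; [lra|]. specialize (Hmax x Hx). nra. }
assert (forall x, 0 <= x <= dl / 2 -> Q x 0).
{ intros. split; auto. assert (F x <= 0) by (apply L_neg; lra). lra. }
(* In the coordinates $(u,r^nu')$ the height of the box is multiplied by $Z^n$, so a late time makes
   its area as large as needed. *)
assert (HZx : exists Z, R0 < Z /\ (2 * A + 3) * (2 * (R0 ^ n * B) + 3) < (dl / 2 - dl / 4) / 2 * (Z ^ n * yb)).
{ set (K := (2 * A + 3) * (2 * (R0 ^ n * B) + 3)). set (k := (dl / 2 - dl / 4) / 2 * yb). assert (0 < k) by (unfold k; apply Rmult_lt_0_compat; lra).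
  assert (0 <= K). { clearbody k. assert (0 <= R0 ^ n * B) by (apply Rmult_le_pos; [apply pow_le|]; lra). apply Rmult_le_pos; lra. }
  assert (0 <= K / k) by (apply Rdiv_le_0_compat; lra).
  exists (R0 + 1 + K / k). split; [lra|]. set (Z := R0 + 1 + K / k) in *.
  assert (Z <= Z ^ n). { rewrite <- (pow_1 Z) at 1. apply Rle_pow; [unfold Z; lra|apply Hn]. }
  replace ((dl / 2 - dl / 4) / 2 * (Z ^ n * yb)) with (k * Z ^ n) by (unfold k; ring).
  apply Rlt_le_trans with (k * Z); [|apply Rmult_le_compat_l; lra]. unfold Z. replace (k * (R0 + 1 + K / k)) with (k * (R0 + 1) + K) by (field; lra). nra. }
destruct HZx as (Z & HZ & Harea).
pose (xi := xis gM). assert (Hxi : forall k, 0 < xi k <= gM) by (intros k; apply xis_pos; auto).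
destruct (choose1 _ _ (fun (k : nat) (s : R * ((R -> R) * (R -> R))) => let al := fst s in let u := fst (snd s) in let v := snd (snd s) in
   a1 <= al <= a2 /\ gsol n (gl f c (xi k)) R0 u v /\ u R0 = U al R0 /\ v R0 = V al R0 /\ Rabs (u Z) <= dl / 2 /\ v Z ^ 2 / 2 + F (u Z) <= 0)) as [w Hw].
{ intros. destruct (g_lip c (xi k) LRA (Hxi k)) as (L & HL0 & HL).
  destruct (crossing n (gl f c (xi k)) L R0 Hn HR0 HL0 HL (g_odd c (xi k) LRA (Hxi k)) Z HZ gx gy a1 (a2 + 3) A B (dl / 4) (dl / 2) yb Q) as (s & u & v & Hs & Hsol & eu & ev & HQ); auto; try lra.
  assert (s <= a2).
  { apply Rnot_lt_le. intros Hlt. destruct (Hclose s LRA) as [h1 h2]. rewrite <- eu, <- ev in *.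
    pose proof (stays_left c (xi k) R0 HR0 LRA (Hxi k) u v Z Hsol h1 h2 LRA). destruct HQ as [[h _]|[h _]]; lra. }
  destruct (gxA s LRA). exists (s, (u, v)). simpl. rewrite eu, ev. split; [lra|]. split; auto. split; auto. split; auto.
  destruct HQ as [[h1 h2]|[h1 h2]].
  - split; [rewrite Rabs_pos_eq; lra|lra].
  - rewrite F_even in h2. replace ((- v Z) ^ 2) with (v Z ^ 2) in h2 by ring. split; [|lra]. rewrite <- Rabs_Ropp, Rabs_pos_eq; lra. }
set (al := fun k => fst (w k)) in *. set (us := fun k => fst (snd (w k))). set (vs := fun k => snd (snd (w k))).
assert (Hal : forall k, a1 <= al k <= a2) by (intros k; apply Hw).
assert (Hgs : forall k, gsol n (gl f c (xi k)) R0 (us k) (vs k)) by (intros k; apply Hw).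
assert (Iu : forall k, us k R0 = U (al k) R0) by (intros k; apply Hw).
assert (Iv : forall k, vs k R0 = V (al k) R0) by (intros k; apply Hw).
assert (forall k, Rabs (us k Z) <= dl / 2) by (intros k; apply Hw).
assert (forall k, vs k Z ^ 2 / 2 + F (us k Z) <= 0) by (intros k; apply Hw).
clearbody al us vs.
destruct (ulim_exists al a2) as [a La].
{ apply Uf_all. intros k. specialize (Hal k). rewrite Rabs_pos_eq; lra. }
assert (Haa : a1 <= a <= a2).
{ split; [apply (ulim_le (fun _ => a1) al)|apply (ulim_le al (fun _ => a2))]; auto using ulim_const; apply Uf_all; intros k; apply Hal. }
destruct (Adm a Haa) as (ba & ta & ada).
destruct (U_cd al a a2 R0 ltac:(intros k; apply Adm, Hal) ltac:(intros k; apply Hal) La ada LRA ltac:(apply Hlive; auto; lra)).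
assert (F a2 < F c) by (apply F_incr_out; auto; lra).
destruct (bounded_on f 0 c LRA ltac:(intros; apply Hfc)) as (Bf & HBf & hBf).
(* With this approximation error the modified potential still confines the orbits to $|u|<c$, where
   the limit equation is the original one. *)
set (h := (F c - F a2) / (4 * c)). assert (Hh : 0 < h) by (apply Rdiv_lt_0_compat; lra).
assert (h * c = (F c - F a2) / 4) by (unfold h; field; lra).
assert (Happ : forall h, 0 < h -> Uf (fun k => forall x, Rabs (gl f c (xi k) x - fc f c x) <= h)).
{ apply gl_approx; auto using Hfc, Hfo, xis_lim. intros. specialize (Hxi k). lra. apply xis_lim. }
assert (Hconf : Uf (fun k => Rabs (us k R0) < c /\ energy (gl f c (xi k)) (us k) (vs k) R0 < pot (gl f c (xi k)) c)).
{ apply (Uf_mono _ _ (Happ h Hh)). intros k Hk. destruct (Adm (al k) (Hal k)) as (bk & tk & adk). specialize (Hal k).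
  pose proof (U_bound (al k) R0 adk LRA). rewrite Iu. split; [lra|]. unfold energy. rewrite Iu, Iv.
  set (gk := gl f c (xi k)) in *.
  rewrite <- (pot_abs gk (g_cont c (xi k) LRA (Hxi k)) (g_odd c (xi k) LRA (Hxi k))).
  pose proof (gpot_close c (xi k) LRA (Hxi k) h (Rabs (U (al k) R0)) Hk ltac:(split; [apply Rabs_pos|lra])) as q1.
  pose proof (gpot_close c (xi k) LRA (Hxi k) h c Hk LRA) as q2. fold gk in q1, q2.
  apply Rabs_le_between in q1, q2. rewrite F_abs in q1.
  pose proof (E_decr (al k) 0 R0 adk LRA) as q3. rewrite E_0 in q3 by auto. unfold orbit_energy, energy in q3.
  assert (F (al k) <= F a2). { destruct (Req_dec (al k) a2) as [->|]; [lra|]. left. apply F_incr_out; auto. lra. }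
  lra. }
destruct (compactness n (fun k => gl f c (xi k)) (fc f c) us vs (fun _ => R0) (fun k => U (al k) R0) (fun k => V (al k) R0) R0 (U a R0) (V a R0)) as (wu & wv & Ho & w1 & w2 & w3 & w4 & Lw); auto using ulim_const; try lra.
{ intros. apply gsol_ode; auto. }
{ intros. apply (gsol_cont _ _ _ _ _ _ (Hgs k)). } { intros. apply (gsol_cont _ _ _ _ _ _ (Hgs k)). }
{ intros. apply fc_cont, Hfc. }
{ intros. set (Kv := 4 * Bf * c + 1). pose proof (nu_ge n Hn).
  assert (0 <= Kv). { unfold Kv. nra. }
  assert (0 <= nu n / R0 * Kv). { apply Rmult_le_pos; auto. apply Rdiv_le_0_compat; lra. }
  exists (nu n / R0 * Kv + Kv + Bf). apply (Uf_mono _ _ Hconf). intros k [h1 h2] r Hr.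
  destruct (confined_velocity c (xi k) R0 HR0 LRA (Hxi k) (us k) (vs k) Bf r hBf (Hgs k) h1 h2 LRA) as [q1 q2]. fold Kv in q1.
  split; [lra|]. eapply Rle_trans; [apply Rabs_triang|].
  assert (Rabs (nu n / r * vs k r) <= nu n / R0 * Kv); [|lra].
  rewrite Rabs_mult, (Rabs_pos_eq (nu n / r)) by (apply Rdiv_le_0_compat; lra).
  apply Rmult_le_compat; auto using Rabs_pos; [apply Rdiv_le_0_compat; lra|].
   apply Rmult_le_compat_l; [lra|]. apply Rinv_le_contravar; lra. }
{ intros c0 h' Hh'. apply (Uf_mono _ _ (Happ h' Hh')). auto. }
assert (ode n f R0 wu wv).
{ intros r Hr. destruct (Ho r Hr) as [d1 d2]. split; auto. rewrite fc_id in d2; auto.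
  apply (ulim_abs_le (fun k => us k r)); [apply Lw; auto|]. apply (Uf_mono _ _ Hconf). intros k [h1 h2]. left.
  apply (confined c (xi k) R0 HR0 LRA (Hxi k) (us k) (vs k) r (Hgs k) h1 h2). lra. }
destruct (uniq R0 Z (U a) (V a) wu wv) with (r := Z) as [z1 z2]; auto; try lra.
{ intros r Hr. apply U_ode; auto. lra. } { apply U_cont; auto; lra. } { apply V_cont; auto; lra. }
{ intros. apply Hlive; auto. lra. }
destruct (Lw Z HZ).
assert (Hend : Rabs (U a Z) <= d0) by (rewrite z1; apply Rle_trans with (dl / 2); [|lra]; apply (ulim_abs_le (fun k => us k Z)); auto; apply Uf_all; auto).
pose proof (HA a Z ba ta LRA Hend) as Hpos. unfold orbit_energy, energy in Hpos. rewrite z1, z2 in Hpos.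
assert (wv Z ^ 2 / 2 + F (wu Z) <= 0); [|lra].
apply (ulim_le (fun k => vs k Z ^ 2 / 2 + F (us k Z)) (fun _ => 0)); auto using ulim_const; [|apply Uf_all; auto].
apply (ulim_plus (fun k => vs k Z ^ 2 / 2) (fun k => F (us k Z))).
- apply (ulim_comp (fun y => y ^ 2 / 2)); auto. unfold Rdiv. eapply is_derive_cont. der.
- apply (ulim_comp F); auto. apply F_cont.
Qed.

Lemma finite_shooting : far_oscillation -> exists x0 m, b < x0 /\ top x0 /\ T x0 /\ ~ W m x0.
Proof.
intros. destruct (lobe_shooting H) as (al & r & h1 & h2 & h3 & h4 & h5).
destruct (lobe_finite al r (adm_out al (Rlt_le _ _ h1) h2) h3 h4 h5) as (HT & m & Hm). exists al, m. auto.
Qed.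
End Lobe.

(** * Conclusion *)

Section Data.
Variables (N : nat) (f : R -> R) (gst : Rbar) (delta gM bt : R).
Hypothesis HN : (2 <= N)%nat.
Hypothesis HA1 : cond_A1 gst f.
Hypothesis HA2 : cond_A2 gst f delta.
Hypothesis HA3 : cond_A3 gst f delta.
Hypothesis HA4 : cond_A4 gst f delta.
Hypothesis HA5 : cond_A5 N gst f.
Hypothesis HgM : is_gammaM gst f gM.
Hypothesis Hbeta : is_beta gst f gM bt.

(** Extends $f$ beyond $[-\gamma_*,\gamma_*]$ by its boundary values, which keeps it odd, continuous
    and locally Lipschitz off $0$; the solutions found stay inside. *)
Definition clamp x := match gst with Finite g => cl g x | _ => x end.
Definition fe x := f (clamp x).
Notation F := (pot fe).
Notation tp x := (Rbar_lt (Finite x) gst).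

Lemma gs_cases : (exists g, gst = Finite g /\ 0 < g) \/ gst = p_infty.
Proof.
destruct HA1 as (h & _). destruct gst as [g| |]; simpl in h; [left; exists g; auto|auto|tauto].
Qed.

Lemma clamp_dom x : in_dom gst (clamp x).
Proof.
unfold in_dom, clamp. destruct gs_cases as [(g & -> & Hg)| ->]; simpl; auto. apply cl_bound. lra.
Qed.

Lemma clamp_id x : in_dom gst x -> clamp x = x.
Proof.
unfold in_dom, clamp. destruct gs_cases as [(g & -> & Hg)| ->]; simpl; auto. apply cl_id.
Qed.

Lemma clamp_lip x y : Rabs (clamp x - clamp y) <= Rabs (x - y).
Proof. unfold clamp. destruct gst; try lra. apply cl_lip. Qed.

Lemma clamp_odd x : clamp (- x) = - clamp x.
Proof. unfold clamp. destruct gs_cases as [(g & -> & Hg)| ->]; auto. apply cl_odd. lra. Qed.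

Lemma clamp_nonzero x : x <> 0 -> clamp x <> 0.
Proof.
unfold clamp. destruct gs_cases as [(g & -> & Hg)| ->]; auto. intros Hx h. apply Hx. revert h. unfold cl, Rmax, Rmin.
destruct (Rle_dec g x); destruct (Rle_dec _ _); lra.
Qed.

Lemma fe_eq x : in_dom gst x -> fe x = f x.
Proof. intros. unfold fe. rewrite clamp_id; auto. Qed.

Lemma dom_le x y : Rabs x <= Rabs y -> in_dom gst y -> in_dom gst x.
Proof. intros. apply Rbar_le_trans with (Finite (Rabs y)); auto. Qed.

Lemma top_dom x : 0 <= x -> tp x -> in_dom gst x.
Proof. intros. unfold in_dom. rewrite Rabs_pos_eq by auto. apply Rbar_lt_le; auto. Qed.

Lemma tp_le x y : x <= y -> tp y -> tp x.
Proof. intros. apply Rbar_le_lt_trans with (Finite y); auto. Qed.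

Lemma fe_cont (x : R) : continuous fe x.
Proof.
destruct HA1 as (_ & h & _). apply eps_continuous. intros e He. destruct (h (clamp x) (clamp_dom x) e He) as (d & Hd & hd).
exists d. split; auto. intros. apply hd; [apply clamp_dom|]. eapply Rle_lt_trans; [apply clamp_lip|auto].
Qed.

Lemma fe_odd x : fe (- x) = - fe x.
Proof. destruct HA1 as (_ & _ & h & _). unfold fe. rewrite clamp_odd. apply h, clamp_dom. Qed.

Lemma fe_lip x : x <> 0 -> loc_lip fe x.
Proof.
intros Hx. destruct HA1 as (_ & _ & _ & _ & h). destruct (h (clamp x) (clamp_dom x) (clamp_nonzero x Hx)) as (e & L & He & hL).
exists e, (Rmax L 0). split; auto. intros.
eapply Rle_trans; [apply hL; try apply clamp_dom; (eapply Rle_lt_trans; [apply clamp_lip|auto])|].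
apply Rle_trans with (Rmax L 0 * Rabs (clamp y - clamp z)); [apply Rmult_le_compat_r; [apply Rabs_pos|apply Rmax_l]|].
apply Rmult_le_compat_l; [apply Rmax_r|apply clamp_lip].
Qed.

Lemma pot_fe x : in_dom gst x -> F x = Fp f x.
Proof.
intros. apply RInt_ext. intros t Ht. apply fe_eq. apply (dom_le t x); auto.
revert Ht. unfold Rmin, Rmax. destruct (Rle_dec 0 x); intros Ht.
- rewrite !Rabs_pos_eq; lra.
- rewrite !Rabs_left1; lra.
Qed.

Lemma dFe (x : R) : is_derive F x (fe x).
Proof. apply pot_derive, fe_cont. Qed.

Lemma Fe_cont (x : R) : continuous F x.
Proof. eapply is_derive_cont. apply dFe. Qed.

Lemma delta_top : 0 < delta /\ tp delta.
Proof.
destruct HA2 as (h & _). destruct HA3 as (g & h1 & h2 & _). split; auto. apply (tp_le _ g); auto. lra.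
Qed.

Lemma Fe_neg x : 0 < x < delta -> F x < 0.
Proof.
intros. destruct delta_top. rewrite pot_fe by (apply top_dom; [lra|apply (tp_le _ delta); auto; lra]).
apply HA2. rewrite Rabs_pos_eq; lra.
Qed.

Definition data_problem : problem :=
  @Build_problem (pred N) (Nat.le_succ_le_pred 1 N HN) fe fe_cont fe_odd fe_lip delta (proj1 delta_top) Fe_neg.

(** Local maxima of the extended potential without a domain condition; these agree with [LMpt]
    because such a point is interior. *)
Definition top_max x := 0 < x /\ tp x /\ exists e, 0 < e /\ forall t, Rabs (t - x) < e -> F t <= F x.

Lemma top_room x : tp x -> exists y, x < y /\ tp y.
Proof.
intros. destruct gs_cases as [(g & -> & Hg)| ->]; simpl in *.
- exists ((x + g) / 2). lra.
- exists (x + 1). lra.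
Qed.

Lemma top_max_LMpt x : top_max x <-> LMpt gst f x.
Proof.
split.
- intros (h1 & h2 & e & He & he). split; auto. split; auto. exists e. split; auto. intros.
  rewrite <- !pot_fe; auto. apply top_dom; auto; lra.
- intros (h1 & h2 & e & He & he). split; auto. split; auto. destruct (top_room x h2) as (y & Hy & ty).
  exists (Rmin e (Rmin x (y - x))). split; [repeat apply Rmin_glb_lt; lra|]. intros t Ht.
  assert (Rabs (t - x) < e) by (eapply Rlt_le_trans; [exact Ht|apply Rmin_l]).
  assert (A2 : Rabs (t - x) < x) by (eapply Rlt_le_trans; [exact Ht|eapply Rle_trans; [apply Rmin_r|apply Rmin_l]]).
  assert (A3 : Rabs (t - x) < y - x) by (eapply Rlt_le_trans; [exact Ht|eapply Rle_trans; [apply Rmin_r|apply Rmin_r]]).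
  apply Rabs_def2 in A2, A3.
  assert (in_dom gst t) by (apply top_dom; [lra|apply (tp_le _ y); auto; lra]).
  rewrite !pot_fe; auto. apply top_dom; auto; lra.
Qed.

Lemma interior_max p q m : 0 <= p < m -> m < q -> tp q -> (forall x, p <= x <= q -> F x <= F m) -> top_max m.
Proof.
intros H1 H2 Ht Hm. split; [lra|]. split; [apply (tp_le _ q); auto; lra|].
exists (Rmin (m - p) (q - m)). split; [apply Rmin_glb_lt; lra|]. intros t Htm.
pose proof (Rmin_l (m - p) (q - m)). pose proof (Rmin_r (m - p) (q - m)). apply Rabs_def2 in Htm. apply Hm. lra.
Qed.

Lemma top_max_crit x : top_max x -> fe x = 0.
Proof.
intros (h1 & h2 & e & He & he). apply (int_max F (x - e / 2) (x + e / 2) x); [lra|apply dFe|].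
intros. apply he. apply Rabs_def1; lra.
Qed.

(** The maximum over $[p,q]$ is interior unless it is attained at [q]; in that case [x] has the same
    value. *)
Lemma max_below p q x : 0 <= p < q -> tp q -> p < x < q -> F p < F x -> F q <= F x -> exists m, p < m < q /\ top_max m /\ F x <= F m.
Proof.
intros. destruct (max_attained F p q LRA ltac:(intros; apply Fe_cont)) as (m & Hm & Hmax).
pose proof (Hmax x LRA). assert (m <> p) by (intros ->; lra).
destruct (Req_dec m q) as [->|].
- exists x. split; auto. split; [|lra]. apply (interior_max p q); auto; try lra. intros y Hy. specialize (Hmax y Hy). lra.
- exists m. split; [lrn|]. split; auto. apply (interior_max p q); auto; lrn.
Qed.

Lemma rising p q : 0 <= p < q -> tp q -> (forall m, p < m < q -> ~ top_max m) -> (forall x, p < x <= q -> F p < F x) ->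
  forall x y, p <= x < y -> y <= q -> F x < F y.
Proof.
intros H1 Ht Hno Hp x y Hx Hy. apply Rnot_le_lt. intros Hle. destruct (Req_dec x p) as [->|Hxp]; [pose proof (Hp y LRA); lra|].
destruct (max_below p y x) as (m & Hm & HM & _); try lra; [apply (tp_le _ q); auto|apply Hp; lrn|]. apply (Hno m); auto. lra.
Qed.

(** $f\ge0$ where $F$ rises, and by $(A_4)$ a zero of $f$ there would be a sign change. *)
Lemma rising_pos p q : delta <= p -> p < q -> tp q -> (forall x y, p <= x < y -> y <= q -> F x < F y) -> forall x, p < x < q -> 0 < fe x.
Proof.
intros Hd Hpq Ht Hr x Hx. pose proof delta_top.
assert (Hge : forall z, p < z < q -> 0 <= fe z).
{ intros. apply Rnot_lt_le. intros Hlt. destruct (derive_neg_right F z (fe z) (dFe z) Hlt) as (d & Hd' & h & _).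
  destruct (right_point z q d) as (y & ? & ?); try lrn. specialize (h y LRA). pose proof (Hr z y LRA LRA). lra. }
pose proof (Hge x Hx). destruct (Req_dec (fe x) 0) as [E0|]; [|lrn]. exfalso.
assert (tx : tp x) by (apply (tp_le _ q); auto; lra).
destruct HA4 as [_ h4]. destruct (h4 x LRA tx) as (e & He & he).
{ rewrite <- fe_eq; auto. apply top_dom; auto; lra. }
assert (fz : forall z, p < z < q -> 0 <= f z).
{ intros. rewrite <- fe_eq; [apply Hge; auto|]. apply top_dom; [lra|apply (tp_le _ q); auto; lra]. }
destruct he as [[_ h2]|[h1 _]].
- pose (y := Rmin ((x + q) / 2) (x + e / 2)). assert (x < y) by (unfold y; apply Rmin_glb_lt; lra).
  assert (y <= (x + q) / 2) by apply Rmin_l. assert (y <= x + e / 2) by apply Rmin_r.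
  specialize (h2 y LRA). specialize (fz y LRA). lra.
- pose (y := Rmax ((x + p) / 2) (x - e / 2)). assert (y < x) by (unfold y; apply Rmax_lub_lt; lra).
  assert ((x + p) / 2 <= y) by apply Rmax_l. assert (x - e / 2 <= y) by apply Rmax_r.
  specialize (h1 y LRA). specialize (fz y LRA). lra.
Qed.

Lemma F_delta : F delta <= 0.
Proof.
pose proof delta_top. apply Rnot_lt_le. intros Hlt. destruct (cont_gt_near F delta 0 (Fe_cont delta) Hlt) as (d & Hd & h).
pose (y := Rmax (delta / 2) (delta - d / 2)). assert (y < delta) by (unfold y; apply Rmax_lub_lt; lra).
assert (delta / 2 <= y) by apply Rmax_l. assert (delta - d / 2 <= y) by apply Rmax_r.
specialize (h y ltac:(apply Rabs_def1; lra)). pose proof (Fe_neg y LRA). lra.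
Qed.

(** By $(A_2)$ the value $F(x)$ is below the value or limit of $F$ at $\gamma_*$, so it is exceeded
    near $\gamma_*$. *)
Lemma F_higher x : 0 <= x -> tp x -> exists z, x < z /\ tp z /\ F x < F z.
Proof.
intros H0 Ht. destruct HA2 as (_ & _ & h). destruct gs_cases as [(g & Eg & Hg)|Eg].
- assert (E1 : F g = Fp f g) by (apply pot_fe; unfold in_dom; rewrite Eg; simpl; rewrite Rabs_pos_eq; lra).
  assert (E2 : F x = Fp f x) by (apply pot_fe, top_dom; auto).
  rewrite Eg in h, Ht. simpl in Ht. pose proof (h x LRA) as Q. rewrite <- E1, <- E2 in Q.
  destruct (cont_gt_near F g (F x) (Fe_cont g) Q) as (d & Hd & hd).
  pose (z := Rmax ((x + g) / 2) (g - d / 2)). assert (z < g) by (unfold z; apply Rmax_lub_lt; lra).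
  assert ((x + g) / 2 <= z) by apply Rmax_l. assert (g - d / 2 <= z) by apply Rmax_r.
  exists z. rewrite Eg. split; [lra|]. split; auto. apply hd. apply Rabs_def1; lra.
- assert (Eq : forall y, F y = Fp f y) by (intros y; apply pot_fe; unfold in_dom; rewrite Eg; simpl; auto).
  rewrite Eg in h. destruct h as [[l Hl] hlt]. apply NNPP. intros HNo.
  pose proof (is_lim_unique _ _ _ Hl) as El. rewrite El in hlt.
  assert (Hle : Rbar_le l (Finite (Fp f x))); [|apply Rbar_le_not_lt in Hle; auto].
  apply (is_lim_le_loc (Fp f) (fun _ => Fp f x) p_infty l (Finite (Fp f x))); auto; [|apply is_lim_const].
  exists x. intros y Hy. rewrite <- !Eq. apply Rnot_lt_le. intros Hlt2. apply HNo. exists y. rewrite Eg. simpl. auto.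
Qed.

Lemma structure : exists d0 g1, (delta <= d0 /\ d0 < g1 /\ g1 <= gM /\ gM < bt) /\ F d0 = 0 /\ (forall x, 0 <= x <= d0 -> F x <= 0) /\
  (forall x, d0 < x < g1 -> 0 < fe x) /\ (fe g1 = 0 /\ 0 < F g1 /\ forall x, 0 <= x < g1 -> F x < F g1) /\
  (fe gM = 0 /\ forall x, 0 <= x < gM -> F x < F gM) /\ (exists e, 0 < e /\ forall x, gM < x < gM + e -> F x < F gM) /\
  (F bt = F gM /\ forall x, 0 <= x <= bt -> F x <= F gM) /\ (forall x, bt <= x -> tp x -> 0 < fe x) /\
  (exists l : list R, forall x, delta < x -> tp x -> fe x = 0 -> In x l).
Proof.
pose proof delta_top. pose proof F_delta. pose proof (pot_0 fe).
destruct HgM as (g & M & HM & EgM & (G1 & G2 & G3) & Gs & Gl). destruct Hbeta as (B1 & B2 & B3 & B4).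
assert (LMt : forall x, LMpt gst f x -> top_max x /\ in_dom gst x).
{ intros x Hx. split; [apply top_max_LMpt; auto|]. destruct Hx as (h1 & h2 & _). apply top_dom; auto; lra. }
destruct (LMt _ G1) as [T1 D1]. assert (P1 : 0 < F (g 1%nat)) by (rewrite pot_fe; auto).
assert (forall x, 0 <= x < g 1%nat -> F x < F (g 1%nat)).
{ intros. apply Rnot_le_lt. intros Hle. assert (x <> 0) by (intros ->; lra).
  destruct (max_below 0 (g 1%nat) x) as (m & Hm & HMm & Hv); try lra; [apply T1|].
  assert (g 1%nat <= m); [|lra]. apply G3; [apply top_max_LMpt; auto|]. rewrite <- pot_fe; [lra|]. apply LMt, top_max_LMpt; auto. }
(* Each $\gamma_i$ is a strict record of $F$: a value at least as large before it would produce an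
   earlier local maximum above $F(\gamma_{i-1})$, against the choice of $\gamma_i$. *)
assert (Ind : forall i, (1 <= i <= M)%nat -> top_max (g i) /\ g 1%nat <= g i /\ forall x, 0 <= x < g i -> F x < F (g i)).
{ induction i as [|i IH]; intros Hi; [lia|]. destruct (Nat.eq_dec i 0) as [->|Hi0]; [split; auto; split; auto|].
  destruct (IH ltac:(lia)) as (I1 & I2 & I3). destruct (Gs (S i) ltac:(lia)) as (h1 & h2 & h3 & h4).
  replace (S i - 1)%nat with i in * by lia. destruct (LMt _ h1) as [T2 D2].
  assert (in_dom gst (g i)) by (apply LMt, top_max_LMpt; auto). rewrite <- !pot_fe in h3 by auto.
  split; auto. split; [lra|]. intros. apply Rnot_le_lt. intros Hle.
  destruct (Rlt_le_dec x (g i)) as [l|l]; [pose proof (I3 x LRA); lra|]. assert (x <> g i) by (intros ->; lra).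
  assert (0 < g i) by apply I1.
  destruct (max_below (g i) (g (S i)) x) as (m & Hm & HMm & Hv); try lra; [apply T2|].
  assert (LMpt gst f m) by (apply top_max_LMpt; auto).
  assert (g (S i) <= m); [|lra]. apply h4; auto; [lra|]. rewrite <- !pot_fe; auto; [lra|apply LMt; auto]. }
destruct (Ind M ltac:(lia)) as (TM & L1M & LowM). rewrite EgM in *.
assert (0 < gM) by apply TM.
assert (in_dom gst gM) by (apply LMt, top_max_LMpt; auto).
assert (in_dom gst bt) by (apply top_dom; auto; lra).
assert (FB : F bt = F gM) by (rewrite !pot_fe; auto).
assert (delta < g 1%nat).
{ apply Rnot_le_lt. intros Hle. destruct (Req_dec (g 1%nat) delta) as [e|]; [rewrite e in P1; lra|].
  pose proof (Fe_neg (g 1%nat) ltac:(destruct T1; lrn)). lra. }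
assert (After : forall x, top_max x -> gM < x -> F x <= F gM).
{ intros. assert (LMpt gst f x) by (apply top_max_LMpt; auto). rewrite !pot_fe; auto. apply LMt; auto. }
assert (Mid : forall x, 0 <= x <= bt -> F x <= F gM).
{ intros. destruct (Rlt_le_dec x gM) as [l|l]; [pose proof (LowM x LRA); lra|].
  apply Rnot_lt_le. intros Hlt. assert (x <> gM) by (intros ->; lra). assert (x <> bt) by (intros ->; lra).
  destruct (max_below gM bt x) as (m & Hm & HMm & Hv); auto; try lra; [idtac]. pose proof (After m HMm LRA). lra. }
(* Otherwise $F$ would return to the level $F(\gamma_M)$ beyond [bt], since [F_higher] makes it rise
   again; but [bt] is the last such point. *)
assert (Above : forall x, bt < x -> tp x -> F gM < F x).
{ intros. apply Rnot_le_lt. intros Hle.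
  assert (exists z, x <= z /\ tp z /\ F gM <= F z) as (z & z4 & z5 & z6).
  {
    destruct (max_attained F bt x LRA ltac:(intros; apply Fe_cont)) as (m & Hm & Hmax).
    destruct (F_higher m LRA ltac:(apply (tp_le _ x); auto; lra)) as (z & q1 & q2 & q3).
    exists z. pose proof (Hmax bt LRA). split; [|split; auto; lra]. apply Rnot_lt_le. intros Hlt. pose proof (Hmax z LRA). lra. }
  destruct (ivt_up F x z (F gM)) as (y & Hy & Ey); try lra; [intros; apply Fe_cont|].
  assert (tp y) by (apply (tp_le _ z); auto; lra).
  assert (y <= bt); [|lra]. apply B4; auto; [lra|]. rewrite <- !pot_fe; auto. apply top_dom; auto; lra. }
assert (Rise : forall x y, bt <= x < y -> tp y -> F x < F y).
{ intros. apply (rising bt y); try lra; auto.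
  - intros m Hm HMm. pose proof (After m HMm LRA). pose proof (Above m LRA ltac:(apply HMm)). lra.
  - intros. rewrite FB. apply Above; [lra|apply (tp_le _ y); auto; lra]. }
assert (Pos : forall x, bt < x -> tp x -> 0 < fe x).
{ intros x Hx tx. destruct (top_room x tx) as (y & Hy & ty).
  apply (rising_pos bt y); auto; try lra. intros. apply Rise; auto. apply (tp_le _ y); auto. }
destruct (last_at F delta (g 1%nat) 0) as (d0 & Hd & Ed & Hpos); try lra; [intros; apply Fe_cont|].
exists d0, (g 1%nat). split; [lra|]. split; auto. split.
{ intros. apply Rnot_lt_le. intros Hlt. assert (x <> 0) by (intros ->; lra). assert (x <> d0) by (intros ->; lra).
  destruct (max_below 0 d0 x) as (m & Hm & HMm & Hv); try lra; [apply (tp_le _ (g 1%nat)); [lra|apply T1]|].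
  assert (g 1%nat <= m); [|lra]. apply G3; [apply top_max_LMpt; auto|]. rewrite <- pot_fe; [lra|]. apply LMt, top_max_LMpt; auto. }
split.
{ apply (rising_pos d0 (g 1%nat)); try lra; [apply T1|]. apply rising; try lra; [apply T1| |].
  - intros m Hm HMm. assert (g 1%nat <= m); [|lra]. apply G3; [apply top_max_LMpt; auto|].
    rewrite <- pot_fe; [apply Hpos; lra|]. apply LMt, top_max_LMpt; auto.
  - intros. rewrite Ed. auto. }
split; [split; [apply top_max_crit; auto|auto]|]. split; [split; [apply top_max_crit; auto|auto]|]. split.
{ destruct HA4 as [_ h4]. destruct (h4 gM LRA ltac:(apply TM)) as (e & He & he).
  { rewrite <- fe_eq; auto. apply top_max_crit; auto. }
  destruct TM as (_ & tM & e2 & He2 & hM). pose (e0 := Rmin (Rmin e e2) (bt - gM)).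
  assert (0 < e0) by (unfold e0; repeat apply Rmin_glb_lt; lra).
  assert (e0 <= e) by (unfold e0; eapply Rle_trans; [apply Rmin_l|apply Rmin_l]).
  assert (e0 <= e2) by (unfold e0; eapply Rle_trans; [apply Rmin_l|apply Rmin_r]).
  assert (e0 <= bt - gM) by apply Rmin_r.
  assert (feq : forall x, gM < x < gM + e0 -> fe x = f x) by (intros x Hx; apply fe_eq, top_dom; [lra|apply (tp_le _ bt); auto; lra]).
  exists e0. split; auto. intros. destruct he as [[_ h2]|[_ h2]].
  - cut (- F gM < - F x); [lra|]. apply (mono_lt (fun y => - F y) (fun y => - fe y)); try lra.
    + intros. apply dopp, dFe.
    + intros. apply (continuous_opp F). apply Fe_cont.
    + intros y Hy. rewrite feq by lra. specialize (h2 y LRA). lra.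
  - exfalso. pose proof (hM x ltac:(apply Rabs_def1; lra)). assert (F gM < F x); [|lra].
    apply (mono_lt F fe); try lra.
    + intros. apply dFe.
    + intros. apply Fe_cont.
    + intros. rewrite feq by lra. apply h2. lra. }
split; [auto|]. split.
(* At [bt] itself $f=0$ would be a sign change by $(A_4)$: either $f<0$ just after it, against
   [Pos], or $f<0$ just before it, against [Mid]. *)
{ intros x Hx tx. destruct (Req_dec bt x) as [<-|]; [|apply Pos; auto; lrn].
  assert (0 <= fe bt).
  { apply Rnot_lt_le. intros Hlt. destruct (derive_neg_right F bt (fe bt) (dFe bt) Hlt) as (d & Hd' & h & _).
    destruct (top_room bt tx) as (y & Hy & ty). destruct (right_point bt y d) as (z & ? & ?); try lrn.
    specialize (h z LRA). pose proof (Rise bt z LRA ltac:(apply (tp_le _ y); auto; lra)). lra. }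
  destruct (Req_dec (fe bt) 0) as [E0|]; [|lrn]. exfalso.
  destruct HA4 as [_ h4]. destruct (h4 bt LRA tx) as (e & He & he); [rewrite <- fe_eq; auto|].
  destruct (top_room bt tx) as (y & Hy & ty). destruct he as [[_ h2]|[h1 _]].
  - destruct (right_point bt y e) as (z & ? & ?); try lrn. assert (tz : tp z) by (apply (tp_le _ y); auto; lra).
    specialize (h2 z LRA). pose proof (Pos z LRA tz) as Q. rewrite fe_eq in Q; [lra|]. apply top_dom; auto; lra.
  - destruct (left_point gM bt e) as (z & ? & ?); try lrn. assert (F bt < F z); [|pose proof (Mid z LRA); lra].
    cut (- F z < - F bt); [lra|]. apply (mono_lt (fun y => - F y) (fun y => - fe y)); try lra.
    + intros. apply dopp, dFe.
    + intros. apply (continuous_opp F). apply Fe_cont.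
    + intros w Hw. rewrite fe_eq by (apply top_dom; [lra|apply (tp_le _ bt); auto; lra]). specialize (h1 w LRA). lra. }
destruct HA4 as [[l Hl] _]. exists l. intros. apply Hl; auto. rewrite <- fe_eq; auto. apply top_dom; auto; lra.
Qed.

Existing Instance data_problem.

Lemma data_landscape : exists LL : landscape, @gs data_problem LL = gst /\ @b data_problem LL = bt.
Proof.
destruct structure as (d0 & g1 & h1 & h2 & h3 & h4 & h5 & h6 & h7 & h8 & h9 & h10).
unshelve eexists (@Build_landscape data_problem gst d0 g1 gM bt _ _ _ _ _ _ _ _ _ _ _); auto. apply Hbeta.
Qed.

Lemma N_nu : INR N = nu (pred N) + 1.
Proof. replace N with (S (pred N)) at 1 by lia. apply S_INR. Qed.

Lemma data_far (LL : landscape) : @gs data_problem LL = gst -> far_oscillation.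
Proof.
intros Egs. pose proof HA5 as h5. destruct gs_cases as [(g & Eg & Hg)|Eg].
- apply (far_finite g); [rewrite Egs; auto|]. rewrite fe_eq; [|unfold in_dom; rewrite Eg; simpl; rewrite Rabs_pos_eq; lra].
  rewrite Eg in h5. auto.
- apply far_infinite; [rewrite Egs; auto|]. rewrite Eg in h5. destruct h5 as (th & Hth & H). exists th. split; auto. intros.
  destruct (H M) as [S0 HS]. exists S0. intros s s1 s2 q1 q2 q3. specialize (HS s s1 s2 q1 q2 q3).
  assert (forall x, in_dom gst x) by (intros x; unfold in_dom; rewrite Eg; simpl; auto).
  unfold Qf, Qp in *. simpl. rewrite !fe_eq, pot_fe by auto. rewrite N_nu in HS.
  lra.
Qed.

Lemma bound_state_radial a : adm a -> tp a -> tends (U a) 0 -> radial_sol N gst f (U a).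
Proof.
intros H Ht Hl. assert (Hap : 0 < a) by apply H. split; [|split; [|split]].
- intros. apply (dom_le _ a); [rewrite (Rabs_pos_eq a) by lra; apply U_bound; auto|]. apply top_dom; auto. lra.
- intros r Hr. assert (Hloc : locally r (fun t => V a t = Derive (U a) t)).
  { exists (mkposreal r Hr). intros t Ht'. assert (0 < t). { apply Rabs_def2 in Ht'. unfold minus, plus, opp in Ht'. simpl in Ht'. lra. }
    symmetry. apply is_derive_unique. apply U_derive; auto. }
  pose proof (V_derive a r H Hr) as DV. pose proof (is_derive_ext_loc _ _ _ _ Hloc DV) as DD.
  split; [exists (V a r); apply U_derive; auto|]. split; [eexists; exact DD|].
  rewrite (is_derive_unique _ _ _ DD), (is_derive_unique _ _ _ (U_derive a r H Hr)). rewrite N_nu. simpl.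
  rewrite fe_eq; [field; lra|]. apply (dom_le _ a); [rewrite (Rabs_pos_eq a) by lra; apply U_bound; auto; lra|]. apply top_dom; auto. lra.
- destruct (f_bound fe fe_cont a) as (B & HB & hB). intros Q [e He].
  (* The estimate $|u'|\le Br$ makes the difference quotient at $0$ of order $h$. *)
  assert (Hb : forall h, 0 < h -> Rabs ((U a h - U a 0) / h) <= B * h).
  { intros. assert (Rabs (U a h - U a 0) <= B * h * (h - 0)).
    { apply (mvt_bound (U a) (V a)); try lra.
      - intros. apply U_derive; auto; lra.
      - intros. apply U_cont; auto; lra.
      - intros. apply Rle_trans with (B * x); [|apply Rmult_le_compat_l; lra].
        apply (velocity_bound (pred N) (Nat.le_succ_le_pred 1 N HN) fe 0 (U a) (V a)); try lra.
        + exact (U_ode a H).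
        + apply V_cont; auto; lra.
        + apply V_0; auto.
        + intros. apply hB. apply U_bound; auto; lra. }
    unfold Rdiv. rewrite Rabs_mult, Rabs_inv, (Rabs_pos_eq h) by lra. apply Rmult_le_reg_r with h; auto.
    rewrite Rmult_assoc, Rinv_l, Rmult_1_r by lra. lra. }
  assert (Hd : 0 < e / B) by (apply Rdiv_lt_0_compat; auto; apply cond_pos).
  exists (mkposreal _ Hd). intros h Hh Hh0. apply He. unfold ball. simpl. unfold AbsRing_ball, abs, minus, plus, opp. simpl.
  rewrite Ropp_0, Rplus_0_r. eapply Rle_lt_trans; [apply Hb; auto|].
  assert (h < e / B). { apply Rabs_def2 in Hh. unfold minus, plus, opp in Hh. simpl in Hh. lra. }
  apply Rlt_div_r in H0; auto. lra.
- intros Q [e He]. destruct (Hl e ltac:(apply cond_pos)) as [R0 HR]. exists R0. intros. apply He.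
      apply HR. lra.
Qed.

Lemma two_bound_states : exists k0 : nat, forall k : nat, (k0 <= k)%nat ->
    exists u1 u2 : R -> R,
      (exists r, 0 <= r /\ u1 r <> u2 r) /\
      forall u, (u = u1 \/ u = u2) ->
        radial_sol N gst f u /\ bt < u 0 /\ Rbar_lt (Finite (u 0)) gst /\
        n_sign_changes u k.
Proof.
destruct data_landscape as (LL & Egs & Eb). pose proof (data_far LL Egs) as Hfar.
(* [m] serves as [k0]: the solution of [x0] has fewer than [m] sign changes, hence fewer than [k]
   for every [k] from [m] on. *)
destruct (finite_shooting Hfar) as (x0 & m & h1 & h2 & h3 & h4). exists m. intros.
destruct (two_solutions k x0 h1 h2 h3) as (a1 & a2 & q1 & q2 & q3 & q4 & q5).
- intros Hw. apply h4. apply (W_le m k); auto.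
- apply Hfar.
- rewrite Eb in *. unfold top in *. rewrite Egs in *.
  destruct (q5 a1 (or_introl eq_refl)) as (ad1 & _). destruct (q5 a2 (or_intror eq_refl)) as (ad2 & _).
  exists (U a1), (U a2). split; [exists 0; split; [lra|]; rewrite !U_0 by auto; lra|].
  assert (Res : forall a, (a = a1 \/ a = a2) -> bt < a -> tp a -> radial_sol N gst f (U a) /\ bt < U a 0 /\ tp (U a 0) /\ n_sign_changes (U a) k).
  { intros a Ha hb ht. destruct (q5 a Ha) as (ad & w1 & w2 & w3). rewrite U_0 by auto. split; [apply bound_state_radial; auto|]. split; auto. split; auto.
    apply W_sign_changes; auto. }
  intros u [-> | ->]; apply Res; auto; try lra. apply (tp_le _ a2); auto; lra.
Qed.
End Data.

Theorem theorem3p1 (N : nat) (f : R -> R) (gs : Rbar) (delta gM b : R) :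
  (2 <= N)%nat ->
  cond_A1 gs f -> cond_A2 gs f delta -> cond_A3 gs f delta -> cond_A4 gs f delta -> cond_A5 N gs f ->
  is_gammaM gs f gM -> is_beta gs f gM b ->
  exists k0 : nat, forall k : nat, (k0 <= k)%nat ->
    exists u1 u2 : R -> R,
      (exists r, 0 <= r /\ u1 r <> u2 r) /\
      forall u, (u = u1 \/ u = u2) ->
        radial_sol N gs f u /\ b < u 0 /\ Rbar_lt (Finite (u 0)) gs /\
        n_sign_changes u k.
Proof. intros. apply (two_bound_states N f gs delta gM b); assumption. Qed.
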